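(* Let $\mathcal L$ be a linear net in a planar domain and let $\mathcal N$ be its bisector net. The following conditions are equivalent: 1. the net $\mathcal L$ forms a hexagonal 3-web with one of the foliations of $\mathcal N$; 2. the net $\mathcal N$ is conformally flat. Moreover, if these conditions hold, then - the rank of the 4-web formed by $\mathcal N$ and $\mathcal L$ is maximal (i.e. equal to $3$); - the rank quartic of this 4-web splits into 4 concurrent lines forming a harmonic quadruplet; - the lines of $\mathcal L$ are either tangent to some smooth conic $Q$ or form 2 pencils; - the leaves of the net $\mathcal N$ are arcs of some confocal family of conics that includes $Q$, if $Q$ is not a circle; - if $Q$ is a circle, then the net $\mathcal N$ is formed by coordinate lines of a polar coordinate system, $Q$ being one of these lines.
   Context: All considerations are local: webs and foliations are defined on a small planar open set. A net is a pair of transversal foliations by curves. A linear net is a net all of whose leaves are (segments of) straight lines. The bisector net of a linear net $\mathcal L$ is the orthogonal net formed by the integral curves of the two direction fields that bisect the angles between the two lines of $\mathcal L$ at each point. An orthogonal net is conformally flat if there exist local isothermal (conformal) coordinates $(u,v)$ such that its leaves are the coordinate lines $u=\mathrm{const}$ and $v=\mathrm{const}$, i.e. the net is locally conformally equivalent to the net of coordinate lines of a Cartesian coordinate system. A $d$-web is a $d$-tuple of pairwise transversal foliations $\mathcal F_1,\dots,\mathcal F_d$. Abelian relation: a $d$-tuple $(\omega_1,\dots,\omega_d)$ of differential 1-forms such that (i) the leaves of $\mathcal F_i$ are solutions of $\omega_i=0$ (the choice $\omega_i\equiv0$ is allowed), (ii) $d\omega_i=0$ for all $i$, (iii) $\sum_i\omega_i=0$.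 The dimension of the vector space of Abelian relations is the rank of the web; it is at most $\frac12(d-1)(d-2)$. A 3-web is hexagonal if and only if its rank is $1$. For 4-webs the maximal rank is $3$. Rank quartic: a planar 4-web of maximal rank is locally diffeomorphic, by a diffeomorphism unique up to projective transformations, to the web formed by the tangent lines to an algebraic curve $C$ of class 4 (components of $C$ may degenerate to points, the corresponding foliations being pencils of lines). The dual curve $C^*$, of degree 4 and possibly reducible, is determined up to projective equivalence and is called the rank quartic. Explicitly: choose a first integral $s_i$ of each $\mathcal F_i$ and write a basis of the Abelian relations as $\sum_{i=1}^4 x_i^{\alpha}(s_i)\,ds_i=0$, $\alpha=1,2,3$; then the points $[x_i^1(s_i):x_i^2(s_i):x_i^3(s_i)]\in\mathbb P^2$, $i=1,\dots,4$, trace four arcs of the rank quartic. Four concurrent lines form a harmonic quadruplet if, suitably split into two pairs, their cross-ratio is $-1$. Confocal family of conics: all conics with the same two foci; for a parabola the ideal point of its axis serves as the second focus, so the confocal family consists of the parabolas with the same focus and the same axis. The coordinate lines of a polar coordinate system are the concentric circles and the lines through their common center.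
   Formalization: If the lines of L form two pencils of parallel lines, the leaves of N are two orthogonal families of parallel lines, which lie in no confocal family of conics; there the formal statement says instead that N is formed by Cartesian coordinate lines. *)

(* Defs.v *)
(* Stdlib real numbers and Coquelicot. *)
From Stdlib Require Import Reals List.
From Coquelicot Require Import Coquelicot.
Open Scope R_scope.

(** * Plane sets and smooth functions *)

Definition plane_set := R -> R -> Prop.

Definition same_set (A B : plane_set) : Prop := forall x y, A x y <-> B x y.

Definition open_disc (x0 y0 r : R) : plane_set :=
  fun x y => (x - x0) ^ 2 + (y - y0) ^ 2 < r ^ 2.

Definition open_set (D : plane_set) : Prop :=
  forall x y, D x y -> locally_2d D x y.

Definition connected_set (D : plane_set) : Prop :=
  forall A B : plane_set, open_set A -> open_set B ->
    (forall x y, D x y -> A x y \/ B x y) ->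
    (forall x y, D x y -> A x y -> ~ B x y) ->
    (exists x y, D x y /\ A x y) ->
    forall x y, D x y -> A x y.

Definition planar_domain (D : plane_set) : Prop :=
  (exists x y, D x y) /\ open_set D /\ connected_set D.

(* C^oo: on an open set, [ex_diff_n f n] at every point is exactly C^n. *)
Definition smooth_on (D : plane_set) (f : R -> R -> R) : Prop :=
  forall n x y, D x y -> ex_diff_n f n x y.

Definition dx (f : R -> R -> R) (x y : R) : R := Derive (fun t => f t y) x.
Definition dy (f : R -> R -> R) (x y : R) : R := Derive (fun t => f x t) y.

(* \sum_{i < n} f i *)
Definition sum_lt (n : nat) (f : nat -> R) : R :=
  fold_right Rplus 0 (map f (seq 0 n)).

(** * Foliations *)

(* [F x y vx vy]: the vector (vx, vy) is tangent at (x, y) to the leaf of F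
   through (x, y); the zero vector is always counted as tangent. *)
Definition line_field := R -> R -> R -> R -> Prop.

Definition first_integral (V : plane_set) (F : line_field)
    (s : R -> R -> R) : Prop :=
  smooth_on V s /\
  forall x y, V x y ->
    (dx s x y, dy s x y) <> (0, 0) /\
    forall vx vy, F x y vx vy <-> dx s x y * vx + dy s x y * vy = 0.

(* Foliations are given by local submersions, so that no orientability or
   global first integral is assumed. *)
Definition foliation (D : plane_set) (F : line_field) : Prop :=
  forall x0 y0, D x0 y0 -> exists r s, 0 < r /\
    (forall x y, open_disc x0 y0 r x y -> D x y) /\
    first_integral (open_disc x0 y0 r) F s.

Definition transversal (D : plane_set) (F G : line_field) : Prop :=
  forall x y vx vy, D x y -> F x y vx vy -> G x y vx vy -> vx = 0 /\ vy = 0.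

(* An open arc of a leaf, regularly parametrized by the interval ]a, b[. *)
Definition leaf_arc (D : plane_set) (F : line_field) (a b : R)
    (gx gy : R -> R) : Prop :=
  a < b /\
  forall t, a < t < b ->
    D (gx t) (gy t) /\ ex_derive gx t /\ ex_derive gy t /\
    (Derive gx t, Derive gy t) <> (0, 0) /\
    F (gx t) (gy t) (Derive gx t) (Derive gy t).

(* Every leaf of F is an arc of some curve of the family. *)
Definition leaves_in (D : plane_set) (F : line_field)
    (family : plane_set -> Prop) : Prop :=
  forall a b gx gy, leaf_arc D F a b gx gy ->
    exists C, family C /\ forall t, a < t < b -> C (gx t) (gy t).

(** * Webs, Abelian relations and rank *)

(* A d-web is given by the foliations W 0, ..., W (d-1). *)
Definition web (D : plane_set) (d : nat) (W : nat -> line_field) : Prop :=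
  (forall i, (i < d)%nat -> foliation D (W i)) /\
  (forall i j, (i < j < d)%nat -> transversal D (W i) (W j)).

Definition web2 (F G : line_field) (i : nat) : line_field :=
  match i with O => F | _ => G end.
Definition web3 (F G H : line_field) (i : nat) : line_field :=
  match i with O => F | S O => G | _ => H end.
Definition web4 (F G H K : line_field) (i : nat) : line_field :=
  match i with O => F | S O => G | S (S O) => H | _ => K end.

(* The pair (a, b) is the 1-form a dx + b dy. *)
Definition form := ((R -> R -> R) * (R -> R -> R))%type.

Definition abelian_relation (V : plane_set) (d : nat) (W : nat -> line_field)
    (w : nat -> form) : Prop :=
  (forall i, (i < d)%nat ->
     smooth_on V (fst (w i)) /\ smooth_on V (snd (w i)) /\
     forall x y, V x y ->
       (forall vx vy, W i x y vx vy ->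
          fst (w i) x y * vx + snd (w i) x y * vy = 0) /\
       dx (snd (w i)) x y - dy (fst (w i)) x y = 0) /\
  (forall x y, V x y ->
     sum_lt d (fun i => fst (w i) x y) = 0 /\
     sum_lt d (fun i => snd (w i) x y) = 0).

(* B 0, ..., B (n-1) is a basis of the space of Abelian relations on V
   (forms being identified when they agree on V). *)
Definition abelian_basis (V : plane_set) (d : nat) (W : nat -> line_field)
    (n : nat) (B : nat -> nat -> form) : Prop :=
  (forall k, (k < n)%nat -> abelian_relation V d W (B k)) /\
  (forall c : nat -> R,
     (forall i x y, (i < d)%nat -> V x y ->
        sum_lt n (fun k => c k * fst (B k i) x y) = 0 /\
        sum_lt n (fun k => c k * snd (B k i) x y) = 0) ->
     forall k, (k < n)%nat -> c k = 0) /\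
  (forall w, abelian_relation V d W w ->
     exists c : nat -> R, forall i x y, (i < d)%nat -> V x y ->
       fst (w i) x y = sum_lt n (fun k => c k * fst (B k i) x y) /\
       snd (w i) x y = sum_lt n (fun k => c k * snd (B k i) x y)).

(* The rank is a local notion, since Abelian relations may have monodromy:
   it is n when, around every point, the Abelian relations on each
   sufficiently small disc form a space of dimension n. *)
Definition web_rank (D : plane_set) (d : nat) (W : nat -> line_field)
    (n : nat) : Prop :=
  forall x0 y0, D x0 y0 ->
    at_right 0 (fun r => exists B, abelian_basis (open_disc x0 y0 r) d W n B).

(* Hexagonality of a 3-web, expressed by the maximality of its rank. *)
Definition hexagonal (D : plane_set) (W : nat -> line_field) : Prop :=
  web D 3 W /\ web_rank D 3 W 1.

(** * Nets *)

Definition net (D : plane_set) (F G : line_field) : Prop := web D 2 (web2 F G).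

Definition line (a b c : R) : plane_set := fun x y => a * x + b * y + c = 0.

Definition straight_line (C : plane_set) : Prop :=
  exists a b c, (a, b) <> (0, 0) /\ same_set C (line a b c).

Definition linear_net (D : plane_set) (F G : line_field) : Prop :=
  net D F G /\ leaves_in D F straight_line /\ leaves_in D G straight_line.

(* With e and f unit vectors spanning the two lines, the bisectors are spanned
   by e + f and e - f. *)
Definition bisector_net (D : plane_set) (L1 L2 N1 N2 : line_field) : Prop :=
  net D N1 N2 /\
  forall x y, D x y -> exists ex ey fx fy,
    ex ^ 2 + ey ^ 2 = 1 /\ L1 x y ex ey /\
    fx ^ 2 + fy ^ 2 = 1 /\ L2 x y fx fy /\
    (forall vx vy, N1 x y vx vy <->
       exists k, vx = k * (ex + fx) /\ vy = k * (ey + fy)) /\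
    (forall vx vy, N2 x y vx vy <->
       exists k, vx = k * (ex - fx) /\ vy = k * (ey - fy)).

(* (u, v) is an injective chart in which the Euclidean metric is a positive
   multiple of du^2 + dv^2, i.e. du^2 + dv^2 is one of dx^2 + dy^2. *)
Definition isothermal (V : plane_set) (u v : R -> R -> R) : Prop :=
  smooth_on V u /\ smooth_on V v /\
  (forall x y x' y', V x y -> V x' y' ->
     u x y = u x' y' -> v x y = v x' y' -> x = x' /\ y = y') /\
  (forall x y, V x y ->
     dx u x y ^ 2 + dx v x y ^ 2 = dy u x y ^ 2 + dy v x y ^ 2 /\
     dx u x y * dy u x y + dx v x y * dy v x y = 0 /\
     0 < dx u x y ^ 2 + dx v x y ^ 2).

Definition conformally_flat (D : plane_set) (N1 N2 : line_field) : Prop :=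
  forall x0 y0, D x0 y0 -> exists r u v, 0 < r /\
    (forall x y, open_disc x0 y0 r x y -> D x y) /\
    isothermal (open_disc x0 y0 r) u v /\
    first_integral (open_disc x0 y0 r) N1 u /\
    first_integral (open_disc x0 y0 r) N2 v.

(** * The rank quartic *)

Definition quartic_form (P : R -> R -> R -> R) : Prop :=
  (exists c : nat -> nat -> R, forall X Y Z,
     P X Y Z = sum_lt 5 (fun i => sum_lt (5 - i) (fun j =>
                 c i j * X ^ i * Y ^ j * Z ^ (4 - i - j)))) /\
  (exists X Y Z, P X Y Z <> 0).

(* P = 0 is the rank quartic, in the projective coordinates given by some basis
   x_i^k(s_i) ds_i (k = 0, 1, 2) of the Abelian relations on V.  For (x, y) in V
   the four points below are collinear, so some lines meet each arc exactly once
   and the four arcs together determine the quartic. *)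
Definition rank_quartic (V : plane_set) (W : nat -> line_field)
    (P : R -> R -> R -> R) : Prop :=
  quartic_form P /\
  exists (s : nat -> R -> R -> R) (xi : nat -> nat -> R -> R),
    (forall i, (i < 4)%nat -> first_integral V (W i) (s i)) /\
    abelian_basis V 4 W 3 (fun k i =>
      ((fun x y => xi k i (s i x y) * dx (s i) x y),
       (fun x y => xi k i (s i x y) * dy (s i) x y))) /\
    (forall i x y, (i < 4)%nat -> V x y ->
       P (xi 0%nat i (s i x y)) (xi 1%nat i (s i x y)) (xi 2%nat i (s i x y))
       = 0).

(* A linear form on R^3, i.e. homogeneous coordinates of a projective line. *)
Definition covector := (R * R * R)%type.

Definition ev (l : covector) (X Y Z : R) : R :=
  let '(a, b, c) := l in a * X + b * Y + c * Z.

(* In the pencil k l1 + m l2, with coordinate m / k, the lines l1, l2 have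
   coordinates 0 and oo, so the cross-ratio (l1, l2; l3, l4) is the quotient of
   the coordinates of l3 and l4. *)
Definition cross_ratio (l1 l2 l3 l4 : covector) (rho : R) : Prop :=
  exists k3 m3 k4 m4, k3 <> 0 /\ m3 <> 0 /\ k4 <> 0 /\ m4 <> 0 /\
    (forall X Y Z, ev l3 X Y Z = k3 * ev l1 X Y Z + m3 * ev l2 X Y Z) /\
    (forall X Y Z, ev l4 X Y Z = k4 * ev l1 X Y Z + m4 * ev l2 X Y Z) /\
    rho = (m3 / k3) / (m4 / k4).

Definition distinct_lines (l l' : covector) : Prop :=
  forall k m, (forall X Y Z, k * ev l X Y Z + m * ev l' X Y Z = 0) ->
    k = 0 /\ m = 0.

Definition four_harmonic_lines (P : R -> R -> R -> R) : Prop :=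
  exists l1 l2 l3 l4 : covector,
    (forall X Y Z, P X Y Z =
       ev l1 X Y Z * ev l2 X Y Z * ev l3 X Y Z * ev l4 X Y Z) /\
    distinct_lines l1 l2 /\ distinct_lines l1 l3 /\ distinct_lines l1 l4 /\
    distinct_lines l2 l3 /\ distinct_lines l2 l4 /\ distinct_lines l3 l4 /\
    (exists X Y Z, (X, Y, Z) <> (0, 0, 0) /\
       ev l1 X Y Z = 0 /\ ev l2 X Y Z = 0 /\
       ev l3 X Y Z = 0 /\ ev l4 X Y Z = 0) /\
    cross_ratio l1 l2 l3 l4 (-1).

(** * Conics *)

(* The symmetric matrix (qa qb qd; qb qc qe; qd qe qf). *)
Record conic := Conic { qa : R; qb : R; qc : R; qd : R; qe : R; qf : R }.

Definition conic_locus (Q : conic) : plane_set := fun x y =>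
  qa Q * x ^ 2 + 2 * qb Q * x * y + qc Q * y ^ 2
  + 2 * qd Q * x + 2 * qe Q * y + qf Q = 0.

Definition smooth_conic (Q : conic) : Prop :=
  qa Q * (qc Q * qf Q - qe Q ^ 2) - qb Q * (qb Q * qf Q - qd Q * qe Q)
  + qd Q * (qb Q * qe Q - qc Q * qd Q) <> 0.

(* Tangency is projective: [X : Y : Z] is the point of contact and may be at
   infinity, so that asymptotes count as tangents. *)
Definition tangent_line (Q : conic) (C : plane_set) : Prop :=
  exists X Y Z,
    let a := qa Q * X + qb Q * Y + qd Q * Z in
    let b := qb Q * X + qc Q * Y + qe Q * Z in
    let c := qd Q * X + qe Q * Y + qf Q * Z in
    a * X + b * Y + c * Z = 0 /\ (a, b) <> (0, 0) /\ same_set C (line a b c).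

(* The pencil of lines through the projective point [X : Y : Z]. *)
Definition pencil (X Y Z : R) (C : plane_set) : Prop :=
  exists a b c, a * X + b * Y + c * Z = 0 /\
    (a, b) <> (0, 0) /\ same_set C (line a b c).

Definition concentric_circle (x0 y0 : R) (C : plane_set) : Prop :=
  exists r, 0 < r /\
    same_set C (fun x y => (x - x0) ^ 2 + (y - y0) ^ 2 = r ^ 2).

Definition is_circle (C : plane_set) : Prop :=
  exists x0 y0, concentric_circle x0 y0 C.

Definition polar_net (D : plane_set) (N1 N2 : line_field) (x0 y0 : R) : Prop :=
  (leaves_in D N1 (concentric_circle x0 y0) /\
   leaves_in D N2 (pencil x0 y0 1)) \/
  (leaves_in D N2 (concentric_circle x0 y0) /\
   leaves_in D N1 (pencil x0 y0 1)).

Definition cartesian_net (D : plane_set) (N1 N2 : line_field) : Prop :=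
  exists ux uy, (ux, uy) <> (0, 0) /\
    leaves_in D N1 (pencil ux uy 0) /\ leaves_in D N2 (pencil (- uy) ux 0).

Definition dist2 (x y x' y' : R) : R := sqrt ((x - x') ^ 2 + (y - y') ^ 2).

(* Ellipses and hyperbolas with foci (x1, y1), (x2, y2).  The extreme values of
   k give the degenerate members (the segments of the focal axis and the
   perpendicular bisector), which occur as leaves of confocal nets. *)
Definition central_confocal (x1 y1 x2 y2 : R) (C : plane_set) : Prop :=
  (exists k, dist2 x1 y1 x2 y2 <= k /\
     same_set C (fun x y => dist2 x y x1 y1 + dist2 x y x2 y2 = k)) \/
  (exists k, 0 <= k <= dist2 x1 y1 x2 y2 /\
     same_set C (fun x y => Rabs (dist2 x y x1 y1 - dist2 x y x2 y2) = k)).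

(* Parabolas with focus (x1, y1) and axis parallel to the unit vector (ux, uy),
   opening in either direction; the right-hand sides are signed distances to
   the directrix, and k = 0 gives the two half-lines of the axis. *)
Definition parabolic_confocal (x1 y1 ux uy : R) (C : plane_set) : Prop :=
  exists k, 0 <= k /\
    (same_set C (fun x y =>
       dist2 x y x1 y1 = k + ((x - x1) * ux + (y - y1) * uy)) \/
     same_set C (fun x y =>
       dist2 x y x1 y1 = k - ((x - x1) * ux + (y - y1) * uy))).

Inductive confocal_family : (plane_set -> Prop) -> Prop :=
| confocal_central x1 y1 x2 y2 :
    (x1, y1) <> (x2, y2) -> confocal_family (central_confocal x1 y1 x2 y2)
| confocal_parabolic x1 y1 ux uy :
    ux ^ 2 + uy ^ 2 = 1 -> confocal_family (parabolic_confocal x1 y1 ux uy).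

(* Main.v *)
Require Import Defs.
From Stdlib Require Import Reals Lra Lia Psatz Nsatz List Rgeom.
From Coquelicot Require Import Coquelicot.
(* Rtopology also has an [open_set]. *)
Import Defs.
Open Scope R_scope.

(** Let a, b be the direction angles of the two lines of L at a point.  As the
    lines are straight, grad a = A n1 and grad b = C n2 for the unit normals n1,
    n2, and A satisfies a Riccati equation along its own line, so does C.  Both
    3-webs (L1, L2, N_i) have the same Blaschke curvature, and it vanishes if and
    only if a + b is harmonic, that is, if and only if the angle (a + b) / 2 of N1
    is the argument of a holomorphic function: this is conformal flatness.

    If the curvature vanishes, the leaves of L1, L2, N1, N2 are the level lines of
    p, q, p + q, p - q for suitable p and q, and all the Abelian relations are
    combinations of d(p + q) = dp + dq, d(p - q) = dp - dq and
    (p + q) d(p + q) + (p - q) d(p - q) = 2 p dp + 2 q dq.  Thus the rank is 3 and,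
    in the coordinates given by this basis, the rank quartic is
    Y Z (Y - Z) (Y + Z) = 0.

    Moreover exp(i (a + b)) is a positive multiple of a holomorphic function G
    whose second derivative turns out to be real, hence constant: G is a quadratic
    polynomial with real leading coefficient, and its roots are the foci.  The
    signed distances from the foci to a line of L have a product which depends on
    the line only and, by symmetry with respect to the bisectors, is the same for
    both lines through a point, hence is constant.  If it vanishes the lines form
    two pencils, otherwise they are tangent to a conic with these foci.  The
    reflection property gives the leaves of N. *)

(** * Smooth functions of two variables *)

(** With e1, e2 the unit vectors of L as complex numbers, the field A e1 + C e2 controls everything.
    Turned by a right angle it is the gradient of a + b, so a + b is harmonic exactly when the field
    itself has a local potential kap, and then G = exp (kap + i (a + b)). Its derivative is exp kap
    (A e2 + C e1). Along e1 the vector e1 is constant and A satisfies its Riccati equation, which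
    makes the derivative of G' in that direction a real multiple of e1: this is why G'' is real.
    Isothermal coordinates are the two parts of a primitive of G^(-1/2). The obstacle is that
    angles, unit vectors and signs exist only locally: D may have holes, and the bisector net fixes
    its unit vectors only point by point. Computations are therefore made on discs with cosines and
    sines, where every identity is polynomial, and only relations insensitive to signs are carried
    over the connected domain: G up to a real factor, squares of tangent vectors up to a positive
    factor, the product of the focal distances. *)

Lemma sum_squares_zero (a b : R) : a ^ 2 + b ^ 2 = 0 -> a = 0 /\ b = 0.
Proof. intros H. split; nra. Qed.

Lemma Rabs_lt_of_sum_squares (a b d : R) : 0 < d -> a ^ 2 + b ^ 2 < d ^ 2 -> Rabs a < d.
Proof.
  intros Hd H. pose proof (pow2_ge_0 b). apply Rabs_def1.
  - destruct (Rlt_or_le a d); [assumption|nra].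
  - destruct (Rlt_or_le (- d) a); [assumption|nra].
Qed.

Lemma locally_2d_disc (P : R -> R -> Prop) (x y : R) :
  locally_2d P x y -> exists r, 0 < r /\ forall u v, open_disc x y r u v -> P u v.
Proof.
  intros [d H]. exists d. split; [apply cond_pos|].
  intros u v Huv. unfold open_disc in Huv. pose proof (cond_pos d) as Hd.
  apply H.
  - apply Rabs_lt_of_sum_squares with (v - y); assumption.
  - apply Rabs_lt_of_sum_squares with (u - x); [assumption|lra].
Qed.

Lemma disc_locally_2d (P : R -> R -> Prop) (x y r : R) :
  0 < r -> (forall u v, open_disc x y r u v -> P u v) -> locally_2d P x y.
Proof.
  intros Hr H. assert (Hr2 : 0 < r / 2) by lra. exists (mkposreal _ Hr2). simpl.
  intros u v Hu Hv. apply H. unfold open_disc.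
  apply Rabs_def2 in Hu. apply Rabs_def2 in Hv. nra.
Qed.

Lemma open_disc_center (x y r : R) : 0 < r -> open_disc x y r x y.
Proof. intros H. unfold open_disc. nra. Qed.

Lemma open_disc_mono (x y r r' : R) :
  0 < r <= r' -> forall u v, open_disc x y r u v -> open_disc x y r' u v.
Proof. unfold open_disc. intros H u v. nra. Qed.

Lemma continuity_2d_pt_pos (f : R -> R -> R) (x y : R) :
  continuity_2d_pt f x y -> 0 < f x y -> locally_2d (fun u v => 0 < f u v) x y.
Proof.
  intros H Hp. destruct (H (mkposreal _ Hp)) as [d Hd]. exists d.
  intros u v Hu Hv. specialize (Hd u v Hu Hv). simpl in Hd.
  apply Rabs_def2 in Hd. lra.
Qed.

Ltac cont2d :=
  repeat first
    [ assumption
    | apply continuity_2d_pt_const | apply continuity_2d_pt_id1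
    | apply continuity_2d_pt_id2 | apply continuity_2d_pt_plus
    | apply continuity_2d_pt_minus | apply continuity_2d_pt_mult
    | apply continuity_2d_pt_opp ].

Lemma open_disc_open (x0 y0 r : R) : open_set (open_disc x0 y0 r).
Proof.
  intros x y H. unfold open_disc in *.
  assert (C : continuity_2d_pt (fun u v =>
     r * r - ((u - x0) * (u - x0) + (v - y0) * (v - y0))) x y) by cont2d.
  apply continuity_2d_pt_pos in C; [|nra].
  destruct C as [d Hd]. exists d. intros u v Hu Hv. specialize (Hd u v Hu Hv). nra.
Qed.

Lemma open_set_disc (V : plane_set) (x y : R) : open_set V -> V x y ->
  exists r, 0 < r /\ forall u v, open_disc x y r u v -> V u v.
Proof. intros H HV. apply locally_2d_disc. now apply H. Qed.

Lemma discs_and (P Q : R -> R -> Prop) (x y : R) :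
  (exists r, 0 < r /\ forall u v, open_disc x y r u v -> P u v) ->
  (exists r, 0 < r /\ forall u v, open_disc x y r u v -> Q u v) ->
  exists r, 0 < r /\ forall u v, open_disc x y r u v -> P u v /\ Q u v.
Proof.
  intros (r & Hr & H) (s & Hs & K). exists (Rmin r s).
  pose proof (Rmin_l r s). pose proof (Rmin_r r s).
  assert (0 < Rmin r s) by (apply Rmin_glb_lt; assumption).
  split; [assumption|]. intros u v Huv.
  split; [apply H | apply K]; (eapply open_disc_mono; [|exact Huv]; lra).
Qed.

(** This carries local information over the whole domain: the points of D where [P] holds and those
    where it fails form two disjoint sets covering D, and both are open because [P] is all or
    nothing on small discs. *)
Lemma connected_const (D : plane_set) (P : R -> R -> Prop) :
  planar_domain D ->
  (forall x y, D x y -> exists r, 0 < r /\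
     forall u v u' v', open_disc x y r u v -> open_disc x y r u' v' ->
       D u v -> D u' v' -> P u v -> P u' v') ->
  forall x0 y0 x y, D x0 y0 -> P x0 y0 -> D x y -> P x y.
Proof.
  intros (_ & HO & HC) H x0 y0 x y H0 P0 Hxy.
  assert (K : D x y /\ P x y); [|tauto].
  (* Openness is proved once, for any [Q] that passes between two points whenever [P] is equivalent
     at them, and then used for [P] and for its negation. *)
  assert (HH : forall Q : R -> R -> Prop,
    (forall u v u' v', (P u v -> P u' v') -> (P u' v' -> P u v) ->
       Q u v -> Q u' v') -> open_set (fun u v => D u v /\ Q u v)).
  { intros Q HQ u v [Du Qu]. destruct (H u v Du) as (r & Hr & Hd).
    apply locally_2d_and; [now apply HO|].
    apply locally_2d_impl with (fun a b => D a b); [|now apply HO].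
    apply (disc_locally_2d _ u v r Hr). intros a b Hab Da.
    pose proof (open_disc_center u v r Hr). apply (HQ u v); eauto. }
  refine (HC (fun u v => D u v /\ P u v) (fun u v => D u v /\ ~ P u v) _ _ _ _ _ x y Hxy).
  - apply (HH P); auto.
  - apply (HH (fun u v => ~ P u v)); auto.
  - intros u v Du. destruct (Classical_Prop.classic (P u v)); tauto.
  - tauto.
  - exists x0, y0; tauto.
Qed.

(** Partial derivatives are carried as explicit functions rather than as [dx] and [dy], so that each
    of them is a formula open to algebra. *)
Definition grad_on (V : plane_set) (f fx fy : R -> R -> R) : Prop :=
  forall x y, V x y ->
    is_derive (fun t => f t y) x (fx x y) /\ is_derive (fun t => f x t) y (fy x y).

Lemma grad_on_dx (V : plane_set) f fx fy :
  grad_on V f fx fy -> forall x y, V x y -> dx f x y = fx x y /\ dy f x y = fy x y.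
Proof.
  intros H x y HV. destruct (H x y HV) as [A B].
  split; apply is_derive_unique; assumption.
Qed.

Lemma grad_on_ext (V : plane_set) f fx fy gx gy :
  (forall x y, V x y -> fx x y = gx x y /\ fy x y = gy x y) ->
  grad_on V f fx fy -> grad_on V f gx gy.
Proof.
  intros E H x y HV. destruct (E x y HV) as [<- <-]. now apply H.
Qed.

(** The classical criterion in its economical form: both partial derivatives exist, and one of them
    is continuous at the point. *)
Lemma grad_on_differentiable (V : plane_set) f fx fy x y :
  open_set V -> grad_on V f fx fy -> V x y -> continuity_2d_pt fx x y ->
  differentiable_pt_lim f x y (fx x y) (fy x y).
Proof.
  intros HO HG HV HC. apply filterdiff_differentiable_pt_lim.
  refine (is_derive_filterdiff f x y fx (fy x y) _ _ _).
  - destruct (HO x y HV) as [d Hd]. exists d. intros [u v] [Hu Hv]. simpl in *.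
    apply HG. apply Hd; assumption.
  - now apply HG.
  - now apply continuity_2d_pt_filterlim.
Qed.

Lemma grad_on_continuity (V : plane_set) f fx fy x y :
  open_set V -> grad_on V f fx fy -> V x y -> continuity_2d_pt fx x y ->
  continuity_2d_pt f x y.
Proof.
  intros HO HG HV HC. apply differentiable_continuity_pt.
  exists (fx x y), (fy x y). now apply (grad_on_differentiable V).
Qed.

(** One order of [smooth_on] at a time, so that closure properties can be proved by induction on the
    order. *)
Definition Cn_on (V : plane_set) (n : nat) (f : R -> R -> R) : Prop :=
  forall x y, V x y -> ex_diff_n f n x y.

Lemma ex_diff_n_continuity f n x y : ex_diff_n f n x y -> continuity_2d_pt f x y.
Proof. destruct n; intros [H _]; assumption. Qed.

(** The induction step of every closure property. Openness enters because [ex_diff_n] speaks of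
    [Derive] in a neighbourhood, and this agrees with the candidate gradient inside [V] only. *)
Lemma Cn_on_S (V : plane_set) n f fx fy :
  open_set V -> grad_on V f fx fy -> Cn_on V n fx -> Cn_on V n fy -> Cn_on V (S n) f.
Proof.
  intros HO HG Hx Hy x y HV. split; [|split; [|split; [|split]]].
  - apply (grad_on_continuity V f fx fy); auto.
    eapply ex_diff_n_continuity, Hx, HV.
  - exists (fx x y). exact (proj1 (HG x y HV)).
  - exists (fy x y). exact (proj2 (HG x y HV)).
  - apply ex_diff_n_ext_loc with fx; [|now apply Hx].
    destruct (HO x y HV) as [d Hd]. exists d. intros u v Hu Hv.
    symmetry. now apply (grad_on_dx V f fx fy HG u v (Hd u v Hu Hv)).
  - apply ex_diff_n_ext_loc with fy; [|now apply Hy].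
    destruct (HO x y HV) as [d Hd]. exists d. intros u v Hu Hv.
    symmetry. now apply (grad_on_dx V f fx fy HG u v (Hd u v Hu Hv)).
Qed.

Lemma Cn_on_weak (V : plane_set) n f : Cn_on V (S n) f -> Cn_on V n f.
Proof. intros H x y HV. apply (ex_diff_n_m (S n)); auto. Qed.

Lemma Cn_on_grad (V : plane_set) n f : Cn_on V (S n) f ->
  grad_on V f (dx f) (dy f) /\ Cn_on V n (dx f) /\ Cn_on V n (dy f).
Proof.
  intros H. split; [|split]; intros x y HV; destruct (H x y HV) as (_ & A & B & C & D);
    [split; now apply Derive_correct| exact C | exact D].
Qed.

Lemma Cn_on_const (V : plane_set) n c : Cn_on V n (fun _ _ => c).
Proof.
  revert c; induction n; intros c x y HV; simpl.
  - split; [apply continuity_2d_pt_const | trivial].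
  - split; [apply continuity_2d_pt_const|].
    split; [apply ex_derive_const|]. split; [apply ex_derive_const|].
    split; (apply ex_diff_n_ext_loc with (fun _ _ => 0); [|now apply IHn]);
      apply locally_2d_forall; intros; symmetry; apply Derive_const.
Qed.

Lemma Cn_on_id1 (V : plane_set) n : open_set V -> Cn_on V n (fun x _ => x).
Proof.
  intros HO. destruct n; [intros x y _; split; [apply continuity_2d_pt_id1|trivial]|].
  apply (Cn_on_S V n _ (fun _ _ => 1) (fun _ _ => 0)); auto using Cn_on_const.
  intros x y _. split; [apply @is_derive_id | apply @is_derive_const].
Qed.

Lemma Cn_on_id2 (V : plane_set) n : open_set V -> Cn_on V n (fun _ y => y).
Proof.
  intros HO. destruct n; [intros x y _; split; [apply continuity_2d_pt_id2|trivial]|].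
  apply (Cn_on_S V n _ (fun _ _ => 0) (fun _ _ => 1)); auto using Cn_on_const.
  intros x y _. split; [apply @is_derive_const | apply @is_derive_id].
Qed.

(** * Rules of differentiation *)

Lemma is_derive_Rconst (c x : R) : is_derive (fun _ => c) x 0.
Proof. exact (is_derive_const c x). Qed.

Lemma is_derive_Rid (x : R) : is_derive (fun t => t) x 1.
Proof. exact (is_derive_id x). Qed.

Lemma is_derive_Rmult (f g : R -> R) (x a b : R) :
  is_derive f x a -> is_derive g x b ->
  is_derive (fun t => f t * g t) x (a * g x + f x * b).
Proof. intros. apply (is_derive_mult f g); auto. intros; apply Rmult_comm. Qed.

Lemma is_derive_Rplus (f g : R -> R) (x a b : R) :
  is_derive f x a -> is_derive g x b -> is_derive (fun t => f t + g t) x (a + b).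
Proof. intros. now apply (is_derive_plus f g). Qed.

Lemma is_derive_Rminus (f g : R -> R) (x a b : R) :
  is_derive f x a -> is_derive g x b -> is_derive (fun t => f t - g t) x (a - b).
Proof. intros. now apply (is_derive_minus f g). Qed.

Lemma is_derive_Ropp (f : R -> R) (x a : R) :
  is_derive f x a -> is_derive (fun t => - f t) x (- a).
Proof. intros. now apply (is_derive_opp f). Qed.

Lemma is_derive_Rinv (f : R -> R) (x a : R) :
  is_derive f x a -> f x <> 0 -> is_derive (fun t => / f t) x (- a / f x ^ 2).
Proof. intros. now apply (is_derive_inv f). Qed.

Lemma is_derive_Rpow (f : R -> R) (n : nat) (x a : R) :
  is_derive f x a -> is_derive (fun t => f t ^ n) x (INR n * a * f x ^ pred n).
Proof. intros. now apply (is_derive_pow f). Qed.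

Lemma is_derive_Rexp (f : R -> R) (x a : R) :
  is_derive f x a -> is_derive (fun t => exp (f t)) x (a * exp (f x)).
Proof.
  intros H. apply (is_derive_comp exp f); [|exact H].
  apply is_derive_Reals. apply derivable_pt_lim_exp.
Qed.

Lemma is_derive_Rsqrt (f : R -> R) (x a : R) :
  is_derive f x a -> 0 < f x ->
  is_derive (fun t => sqrt (f t)) x (a / (2 * sqrt (f x))).
Proof. intros. now apply (is_derive_sqrt f). Qed.

Lemma is_derive_eq (f : R -> R) (x a b : R) : is_derive f x a -> a = b -> is_derive f x b.
Proof. now intros H <-. Qed.

(** The derivative is an existential variable, filled in from the shape of the function; atoms must
    be differentiated by a hypothesis. [der] then leaves the comparison with the announced
    derivative, besides the conditions of inverses and roots. *)
Ltac der0 :=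
  lazymatch goal with
  | |- is_derive (fun t => t) _ _ => apply is_derive_Rid
  | |- is_derive (fun _ => ?c) _ _ => apply is_derive_Rconst
  | |- is_derive (fun t => @?f t + @?g t) _ _ => apply (is_derive_Rplus f g); der0
  | |- is_derive (fun t => @?f t - @?g t) _ _ => apply (is_derive_Rminus f g); der0
  | |- is_derive (fun t => @?f t * @?g t) _ _ => apply (is_derive_Rmult f g); der0
  | |- is_derive (fun t => @?f t / @?g t) _ _ =>
      apply (is_derive_Rmult f (fun t => / g t)); [der0 | apply (is_derive_Rinv g); [der0 | ]]
  | |- is_derive (fun t => - @?f t) _ _ => apply (is_derive_Ropp f); der0
  | |- is_derive (fun t => / @?f t) _ _ => apply (is_derive_Rinv f); [der0 | ]
  | |- is_derive (fun t => @?f t ^ ?n) _ _ => apply (is_derive_Rpow f n); der0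
  | |- is_derive (fun t => exp (@?f t)) _ _ => apply (is_derive_Rexp f); der0
  | |- is_derive (fun t => sqrt (@?f t)) _ _ => apply (is_derive_Rsqrt f); [der0 | ]
  | |- _ => eassumption
  end.

Ltac der := eapply is_derive_eq; [der0 | cbn [INR Nat.pred]].

(** * Closure properties of the classes of differentiability *)

Lemma Cn_on_plus (V : plane_set) n f g :
  open_set V -> Cn_on V n f -> Cn_on V n g -> Cn_on V n (fun x y => f x y + g x y).
Proof.
  intros HO. revert f g; induction n; intros f g Hf Hg.
  - intros x y HV; split; [|trivial].
    apply continuity_2d_pt_plus; [apply (Hf x y HV)|apply (Hg x y HV)].
  - destruct (Cn_on_grad V n f Hf) as (Gf & Fx & Fy).
    destruct (Cn_on_grad V n g Hg) as (Gg & Gx & Gy).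
    apply (Cn_on_S V n _ (fun x y => dx f x y + dx g x y)
                         (fun x y => dy f x y + dy g x y)); auto.
    intros x y HV. destruct (Gf x y HV). destruct (Gg x y HV).
    split; der; reflexivity.
Qed.

Lemma Cn_on_mult (V : plane_set) n f g :
  open_set V -> Cn_on V n f -> Cn_on V n g -> Cn_on V n (fun x y => f x y * g x y).
Proof.
  intros HO. revert f g; induction n; intros f g Hf Hg.
  - intros x y HV; split; [|trivial].
    apply continuity_2d_pt_mult; [apply (Hf x y HV)|apply (Hg x y HV)].
  - destruct (Cn_on_grad V n f Hf) as (Gf & Fx & Fy).
    destruct (Cn_on_grad V n g Hg) as (Gg & Gx & Gy).
    pose proof (Cn_on_weak V n f Hf). pose proof (Cn_on_weak V n g Hg).
    apply (Cn_on_S V n _ (fun x y => dx f x y * g x y + f x y * dx g x y)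
                         (fun x y => dy f x y * g x y + f x y * dy g x y));
      auto using Cn_on_plus.
    intros x y HV. destruct (Gf x y HV). destruct (Gg x y HV).
    split; der; reflexivity.
Qed.

Lemma Cn_on_opp (V : plane_set) n f :
  open_set V -> Cn_on V n f -> Cn_on V n (fun x y => - f x y).
Proof.
  intros HO Hf. pose proof (Cn_on_mult V n (fun _ _ => -1) f HO (Cn_on_const V n _) Hf) as K.
  intros x y HV. apply ex_diff_n_ext_loc with (2 := K x y HV).
  apply locally_2d_forall; intros; ring.
Qed.

Lemma Cn_on_minus (V : plane_set) n f g :
  open_set V -> Cn_on V n f -> Cn_on V n g -> Cn_on V n (fun x y => f x y - g x y).
Proof. intros. apply (Cn_on_plus V n f (fun x y => - g x y)); auto using Cn_on_opp. Qed.

Lemma Cn_on_pow (V : plane_set) n f k :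
  open_set V -> Cn_on V n f -> Cn_on V n (fun x y => f x y ^ k).
Proof.
  intros HO Hf. induction k; simpl; [apply Cn_on_const|].
  now apply Cn_on_mult.
Qed.

Lemma Cn_on_inv (V : plane_set) n f :
  open_set V -> (forall x y, V x y -> f x y <> 0) ->
  Cn_on V n f -> Cn_on V n (fun x y => / f x y).
Proof.
  intros HO H0. induction n; intros Hf.
  - intros x y HV; split; [|trivial].
    apply continuity_2d_pt_inv; [apply (Hf x y HV)|auto].
  - destruct (Cn_on_grad V n f Hf) as (Gf & Fx & Fy).
    pose proof (IHn (Cn_on_weak V n f Hf)) as I.
    apply (Cn_on_S V n _ (fun x y => - dx f x y * (/ f x y * / f x y))
                         (fun x y => - dy f x y * (/ f x y * / f x y)));
      auto using Cn_on_mult, Cn_on_opp.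
    intros x y HV. destruct (Gf x y HV). pose proof (H0 x y HV).
    split; der; auto; field; auto.
Qed.

Lemma Cn_on_div (V : plane_set) n f g :
  open_set V -> (forall x y, V x y -> g x y <> 0) ->
  Cn_on V n f -> Cn_on V n g -> Cn_on V n (fun x y => f x y / g x y).
Proof. intros. apply (Cn_on_mult V n f (fun x y => / g x y)); auto using Cn_on_inv. Qed.

Lemma Cn_on_exp (V : plane_set) n f :
  open_set V -> Cn_on V n f -> Cn_on V n (fun x y => exp (f x y)).
Proof.
  intros HO. induction n; intros Hf.
  - intros x y HV; split; [|trivial].
    apply (continuity_1d_2d_pt_comp exp f); [|apply (Hf x y HV)].
    apply derivable_continuous_pt, derivable_pt_exp.
  - destruct (Cn_on_grad V n f Hf) as (Gf & Fx & Fy).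
    pose proof (IHn (Cn_on_weak V n f Hf)) as I.
    apply (Cn_on_S V n _ (fun x y => dx f x y * exp (f x y))
                         (fun x y => dy f x y * exp (f x y))); auto using Cn_on_mult.
    intros x y HV. destruct (Gf x y HV). split; der; reflexivity.
Qed.

Lemma Cn_on_sqrt (V : plane_set) n f :
  open_set V -> (forall x y, V x y -> 0 < f x y) ->
  Cn_on V n f -> Cn_on V n (fun x y => sqrt (f x y)).
Proof.
  intros HO H0. induction n; intros Hf.
  - intros x y HV; split; [|trivial].
    apply (continuity_1d_2d_pt_comp sqrt f); [|apply (Hf x y HV)].
    apply continuity_pt_sqrt. left; auto.
  - destruct (Cn_on_grad V n f Hf) as (Gf & Fx & Fy).
    pose proof (IHn (Cn_on_weak V n f Hf)) as I.
    assert (S0 : forall x y, V x y -> 2 * sqrt (f x y) <> 0).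
    { intros x y HV. pose proof (sqrt_lt_R0 _ (H0 x y HV)). lra. }
    apply (Cn_on_S V n _ (fun x y => dx f x y / (2 * sqrt (f x y)))
                         (fun x y => dy f x y / (2 * sqrt (f x y))));
      auto using Cn_on_mult, Cn_on_div, Cn_on_const.
    intros x y HV. destruct (Gf x y HV). split; der; auto.
Qed.

Ltac smooth :=
  repeat first
  [ assumption
  | lazymatch goal with
    | |- smooth_on ?V ?h => let m := fresh "m" in intros m; change (Cn_on V m h)
    | |- Cn_on _ _ (fun _ _ => ?c) => apply Cn_on_const
    | |- Cn_on _ _ (fun x y => _ + _) => apply Cn_on_plus
    | |- Cn_on _ _ (fun x y => _ - _) => apply Cn_on_minus
    | |- Cn_on _ _ (fun x y => _ / _) => apply Cn_on_div
    | |- Cn_on _ _ (fun x y => _ * _) => apply Cn_on_mult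
    | |- Cn_on _ _ (fun x y => - _) => apply Cn_on_opp
    | |- Cn_on _ _ (fun x y => / _) => apply Cn_on_inv
    | |- Cn_on _ _ (fun x y => exp _) => apply Cn_on_exp
    | |- Cn_on _ _ (fun x y => sqrt _) => apply Cn_on_sqrt
    | |- Cn_on _ _ (fun x y => _ ^ _) => apply Cn_on_pow
    | |- Cn_on _ _ (fun x y => x) => apply Cn_on_id1
    | |- Cn_on _ _ (fun x y => y) => apply Cn_on_id2
    end
  | match goal with H : smooth_on ?V ?f |- Cn_on ?V ?n _ => exact (H n) end ].

Lemma smooth_on_S (V : plane_set) f fx fy :
  open_set V -> grad_on V f fx fy -> smooth_on V fx -> smooth_on V fy -> smooth_on V f.
Proof. intros HO G X Y n. apply Cn_on_weak. apply (Cn_on_S V n f fx fy); smooth. Qed.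

Lemma smooth_on_grad (V : plane_set) f : smooth_on V f ->
  grad_on V f (dx f) (dy f) /\ smooth_on V (dx f) /\ smooth_on V (dy f).
Proof.
  intros H. split; [exact (proj1 (Cn_on_grad V 0 f (H 1%nat)))|].
  split; intros n; [exact (proj1 (proj2 (Cn_on_grad V n f (H (S n)))))
    | exact (proj2 (proj2 (Cn_on_grad V n f (H (S n)))))].
Qed.

Lemma smooth_on_sub (V W : plane_set) f :
  (forall x y, W x y -> V x y) -> smooth_on V f -> smooth_on W f.
Proof. intros H K n x y HW. apply K; auto. Qed.

Lemma grad_on_sub (V W : plane_set) f fx fy :
  (forall x y, W x y -> V x y) -> grad_on V f fx fy -> grad_on W f fx fy.
Proof. intros H K x y HW. apply K; auto. Qed.

Lemma smooth_on_continuity (V : plane_set) f x y :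
  smooth_on V f -> V x y -> continuity_2d_pt f x y.
Proof. intros H HV. apply (H 0%nat x y HV). Qed.

Lemma smooth_on_differentiable (V : plane_set) f x y :
  open_set V -> smooth_on V f -> V x y ->
  differentiable_pt_lim f x y (dx f x y) (dy f x y).
Proof.
  intros HO H HV. destruct (smooth_on_grad V f H) as (G & X & Y).
  apply (grad_on_differentiable V); auto. now apply (smooth_on_continuity V).
Qed.

Lemma smooth_is_derive_comp (V : plane_set) f fx fy (gx gy : R -> R) t gx' gy' :
  open_set V -> smooth_on V f -> grad_on V f fx fy -> V (gx t) (gy t) ->
  is_derive gx t gx' -> is_derive gy t gy' ->
  is_derive (fun u => f (gx u) (gy u)) t
    (fx (gx t) (gy t) * gx' + fy (gx t) (gy t) * gy').
Proof.
  intros HO H G HV X Y. apply is_derive_Reals.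
  apply (derivable_pt_lim_comp_2d f gx gy); try now apply is_derive_Reals.
  destruct (grad_on_dx V f fx fy G _ _ HV) as [<- <-].
  now apply (smooth_on_differentiable V).
Qed.

(** Schwarz's theorem for announced formulas. The Riccati equation, the curvature conditions and the
    constancy of G'' are all obtained by feeding it explicit second derivatives. *)
Lemma mixed_partials (V : plane_set) f fx fy fxx fxy fyx fyy :
  open_set V -> smooth_on V f -> grad_on V f fx fy ->
  grad_on V fx fxx fxy -> grad_on V fy fyx fyy ->
  forall x y, V x y -> fxy x y = fyx x y.
Proof.
  intros HO H G Gx Gy x y HV.
  destruct (smooth_on_grad V f H) as (G' & X & Y).
  destruct (smooth_on_grad V _ X) as (GX & XX & XY).
  destruct (smooth_on_grad V _ Y) as (GY & YX & YY).
  assert (E : dx (dy f) x y = dy (dx f) x y).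
  { apply Schwarz.
    - destruct (HO x y HV) as [d Hd]. exists d. intros u v Hu Hv.
      specialize (Hd u v Hu Hv).
      destruct (G' u v Hd), (GX u v Hd), (GY u v Hd).
      repeat split; eexists; eassumption.
    - now apply (smooth_on_continuity V (dx (dy f))).
    - now apply (smooth_on_continuity V (dy (dx f))). }
  assert (E1 : dy (dx f) x y = fxy x y).
  { unfold dy at 1. apply is_derive_unique.
    apply is_derive_ext_loc with (fun t => fx x t); [|now apply Gx].
    apply locally_2d_1d_const_x with (x := x) (y := y)
      (P := fun u v => fx u v = dx f u v).
    destruct (HO x y HV) as [d Hd]. exists d. intros u v Hu Hv.
    symmetry. now apply (grad_on_dx V f fx fy G u v (Hd u v Hu Hv)). }
  assert (E2 : dx (dy f) x y = fyx x y).
  { unfold dx at 1. apply is_derive_unique.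
    apply is_derive_ext_loc with (fun t => fy t y); [|now apply Gy].
    apply locally_2d_1d_const_y with (x := x) (y := y)
      (P := fun u v => fy u v = dy f u v).
    destruct (HO x y HV) as [d Hd]. exists d. intros u v Hu Hv.
    symmetry. now apply (grad_on_dx V f fx fy G u v (Hd u v Hu Hv)). }
  congruence.
Qed.

Lemma grad_on_eq (V : plane_set) f g fx fy gx gy :
  open_set V -> grad_on V f fx fy -> grad_on V g gx gy ->
  (forall x y, V x y -> f x y = g x y) ->
  forall x y, V x y -> fx x y = gx x y /\ fy x y = gy x y.
Proof.
  intros HO F G E x y HV.
  destruct (grad_on_dx V f fx fy F x y HV) as [<- <-].
  destruct (grad_on_dx V g gx gy G x y HV) as [<- <-].
  split; apply Derive_ext_loc.
  - apply locally_2d_1d_const_y with (x := x) (y := y) (P := fun u v => f u v = g u v).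
    destruct (HO x y HV) as [d Hd]. exists d. auto.
  - apply locally_2d_1d_const_x with (x := x) (y := y) (P := fun u v => f u v = g u v).
    destruct (HO x y HV) as [d Hd]. exists d. auto.
Qed.

(** * Constancy, and the Poincaré lemma on a disc *)

Lemma is_derive_continuity_pt f x l : is_derive f x l -> continuity_pt f x.
Proof.
  intros H. apply derivable_continuous_pt. exists l. now apply is_derive_Reals.
Qed.

Lemma sq_le_between (a b t : R) :
  Rmin a b <= t <= Rmax a b -> (t - a) ^ 2 <= (b - a) ^ 2.
Proof.
  unfold Rmin, Rmax. destruct (Rle_dec a b); intros [H1 H2].
  - apply pow_incr. lra.
  - replace ((t - a) ^ 2) with ((a - t) ^ 2) by ring.
    replace ((b - a) ^ 2) with ((a - b) ^ 2) by ring. apply pow_incr. lra.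
Qed.

Lemma open_disc_hor (x0 y0 r x y t : R) :
  open_disc x0 y0 r x y -> Rmin x0 x <= t <= Rmax x0 x -> open_disc x0 y0 r t y0.
Proof.
  unfold open_disc. intros H Ht. pose proof (pow2_ge_0 (y - y0)).
  pose proof (sq_le_between x0 x t Ht). nra.
Qed.

Lemma open_disc_ver (x0 y0 r x y t : R) :
  open_disc x0 y0 r x y -> Rmin y0 y <= t <= Rmax y0 y -> open_disc x0 y0 r x t.
Proof.
  unfold open_disc. intros H Ht. pose proof (pow2_ge_0 (x - x0)).
  pose proof (sq_le_between y0 y t Ht). nra.
Qed.

(** The mean value theorem is applied on a horizontal segment from the center and then on a vertical
    one; both stay in the disc. *)
Lemma grad_zero_const (x0 y0 r : R) f :
  grad_on (open_disc x0 y0 r) f (fun _ _ => 0) (fun _ _ => 0) ->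
  forall x y, open_disc x0 y0 r x y -> f x y = f x0 y0.
Proof.
  intros G x y HV.
  destruct (MVT_gen (fun t => f t y0) x0 x (fun _ => 0)) as (c & _ & Hc).
  - intros t Ht. apply (proj1 (G t y0 (open_disc_hor x0 y0 r x y t HV ltac:(lra)))).
  - intros t Ht. apply (is_derive_continuity_pt (fun t => f t y0) t 0).
    exact (proj1 (G t y0 (open_disc_hor x0 y0 r x y t HV Ht))).
  - destruct (MVT_gen (fun t => f x t) y0 y (fun _ => 0)) as (c' & _ & Hc').
    + intros t Ht. apply (proj2 (G x t (open_disc_ver x0 y0 r x y t HV ltac:(lra)))).
    + intros t Ht. apply (is_derive_continuity_pt (fun t => f x t) t 0).
      exact (proj2 (G x t (open_disc_ver x0 y0 r x y t HV Ht))).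
    + simpl in *. lra.
Qed.

Lemma grad_eq_const (x0 y0 r : R) f g fx fy :
  grad_on (open_disc x0 y0 r) f fx fy -> grad_on (open_disc x0 y0 r) g fx fy ->
  forall x y, open_disc x0 y0 r x y -> f x y = g x y + (f x0 y0 - g x0 y0).
Proof.
  intros F G x y HV.
  enough (f x y - g x y = f x0 y0 - g x0 y0) by lra.
  apply (grad_zero_const x0 y0 r (fun u v => f u v - g u v)); [|exact HV].
  intros u v Huv. destruct (F u v Huv), (G u v Huv). split; der; ring.
Qed.

Lemma continuity_2d_pt_slice_x (f : R -> R -> R) x y :
  continuity_2d_pt f x y -> continuous (fun t => f t y) x.
Proof.
  intros H. apply continuity_pt_filterlim.
  intros eps Heps. destruct (H (mkposreal eps Heps)) as [d Hd].
  exists d. split; [apply cond_pos|]. intros t [_ Ht]. simpl in *.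
  apply Hd; [exact Ht|]. rewrite Rminus_diag, Rabs_R0. apply cond_pos.
Qed.

Lemma continuity_2d_pt_slice_y (f : R -> R -> R) x y :
  continuity_2d_pt f x y -> continuous (fun t => f x t) y.
Proof.
  intros H. apply continuity_pt_filterlim.
  intros eps Heps. destruct (H (mkposreal eps Heps)) as [d Hd].
  exists d. split; [apply cond_pos|]. intros t [_ Ht]. simpl in *.
  apply Hd; [|exact Ht]. rewrite Rminus_diag, Rabs_R0. apply cond_pos.
Qed.

(** The potential is the integral along the path from the center that is first horizontal, then
    vertical. Its y-derivative is immediate; for the x-derivative one differentiates under the
    integral sign, and closedness turns the integrand into the y-derivative of [a]. *)
Lemma poincare_disc (x0 y0 r : R) (a b ay bx : R -> R -> R) :
  0 < r ->
  let V := open_disc x0 y0 r in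
  smooth_on V a -> smooth_on V b ->
  (forall x y, V x y -> is_derive (fun t => a x t) y (ay x y)) ->
  (forall x y, V x y -> is_derive (fun t => b t y) x (bx x y)) ->
  (forall x y, V x y -> ay x y = bx x y) ->
  exists f, smooth_on V f /\ grad_on V f a b.
Proof.
  intros Hr V Ha Hb Day Dbx E.
  pose proof (open_disc_open x0 y0 r : open_set V) as HO.
  assert (Ca : forall x y, V x y -> continuity_2d_pt a x y)
    by (intros; now apply (smooth_on_continuity V)).
  assert (Cb : forall x y, V x y -> continuity_2d_pt b x y)
    by (intros; now apply (smooth_on_continuity V)).
  set (f := fun x y => RInt (fun t => a t y0) x0 x + RInt (fun t => b x t) y0 y).
  assert (G : grad_on V f a b).
  { intros x y HV. split.
    - assert (D1 : is_derive (fun u => RInt (fun t => a t y0) x0 u) x (a x y0)).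
      { apply (is_derive_RInt (fun t => a t y0) _ x0).
        - assert (L : locally x (fun u => V u y)) by
            (apply locally_2d_1d_const_y with (x := x) (y := y) (P := V); now apply HO).
          revert L. apply filter_imp. intros u Hu. apply (RInt_correct (V := R_CompleteNormedModule)).
          apply (ex_RInt_continuous (V := R_CompleteNormedModule)). intros t Ht.
          apply (continuity_2d_pt_slice_x a). apply Ca.
          now apply (open_disc_hor x0 y0 r u y t).
        - apply (continuity_2d_pt_slice_x a). apply Ca.
          apply (open_disc_hor x0 y0 r x y x HV).
          split; [apply Rmin_r|apply Rmax_r]. }
      assert (D2 : is_derive (fun u => RInt (fun t => b u t) y0 y) x
                     (RInt (fun t => Derive (fun u => b u t) x) y0 y)).
      { assert (L : locally x (fun u => V u y)) by
            (apply locally_2d_1d_const_y with (x := x) (y := y) (P := V); now apply HO).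
        apply is_derive_RInt_param.
        - revert L. apply filter_imp. intros u Hu t Ht.
          exists (bx u t). apply Dbx. now apply (open_disc_ver x0 y0 r u y t).
        - intros t Ht. apply (smooth_on_continuity V (dx b)).
          + now apply smooth_on_grad.
          + now apply (open_disc_ver x0 y0 r x y t).
        - revert L. apply filter_imp. intros u Hu.
          apply (ex_RInt_continuous (V := R_CompleteNormedModule)). intros t Ht.
          apply (continuity_2d_pt_slice_y b). apply Cb.
          now apply (open_disc_ver x0 y0 r u y t). }
      assert (D3 : RInt (fun t => Derive (fun u => b u t) x) y0 y = a x y - a x y0).
      { rewrite <- (RInt_Derive (fun t => a x t)).
        - apply RInt_ext. intros t Ht.
          assert (HVt : V x t) by (apply (open_disc_ver x0 y0 r x y t HV); lra).
          transitivity (bx x t); [exact (is_derive_unique _ _ _ (Dbx x t HVt))|].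
          rewrite <- (E x t HVt). symmetry. exact (is_derive_unique _ _ _ (Day x t HVt)).
        - intros t Ht. exists (ay x t). apply Day.
          now apply (open_disc_ver x0 y0 r x y t).
        - intros t Ht. apply (continuity_2d_pt_slice_y (dy a)).
          apply (smooth_on_continuity V (dy a)); [now apply smooth_on_grad|].
          now apply (open_disc_ver x0 y0 r x y t). }
      rewrite D3 in D2. unfold f. der. ring.
    - assert (D1 : is_derive (fun u => RInt (fun t => b x t) y0 u) y (b x y)).
      { apply (is_derive_RInt (fun t => b x t) _ y0).
        - assert (L : locally y (fun u => V x u)) by
            (apply locally_2d_1d_const_x with (x := x) (y := y) (P := V); now apply HO).
          revert L. apply filter_imp. intros u Hu. apply (RInt_correct (V := R_CompleteNormedModule)).
          apply (ex_RInt_continuous (V := R_CompleteNormedModule)). intros t Ht.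
          apply (continuity_2d_pt_slice_y b). apply Cb.
          now apply (open_disc_ver x0 y0 r x u t).
        - now apply (continuity_2d_pt_slice_y b), Cb. }
      unfold f. der. ring. }
  exists f. split; [|exact G]. now apply (smooth_on_S V f a b).
Qed.

(** * Straight leaves *)

(** The implicit function theorem. [s] increases in y near the point, so the intermediate value
    theorem gives a root on each vertical line, monotonicity makes it unique and continuous, and
    differentiability of [s] yields the slope. *)
Lemma level_curve_pos (V : plane_set) (s : R -> R -> R) (x0 y0 : R) :
  open_set V -> smooth_on V s -> V x0 y0 -> 0 < dy s x0 y0 ->
  exists eta (Y : R -> R), 0 < eta /\ Y x0 = y0 /\
    forall x, Rabs (x - x0) < eta ->
      V x (Y x) /\ dy s x (Y x) <> 0 /\
      is_derive Y x (- dx s x (Y x) / dy s x (Y x)).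
Proof.
  intros HO Hs H0 Hpos.
  destruct (smooth_on_grad V s Hs) as (G & Sx & Sy).
  assert (L : locally_2d (fun u v => V u v /\ 0 < dy s u v) x0 y0).
  { apply locally_2d_and; [now apply HO|]. apply continuity_2d_pt_pos; [|exact Hpos].
    now apply (smooth_on_continuity V). }
  destruct L as [d Hd]. pose proof (cond_pos d) as dpos.
  assert (inc : forall u v v', Rabs (u - x0) < d -> Rabs (v - y0) < d ->
            Rabs (v' - y0) < d -> v < v' -> s u v < s u v').
  { intros u v v' Hu Hv Hv' Hlt.
    apply Rabs_def2 in Hv. apply Rabs_def2 in Hv'.
    assert (B : forall t, Rmin v v' <= t <= Rmax v v' -> V u t /\ 0 < dy s u t).
    { intros t Ht. rewrite Rmin_left, Rmax_right in Ht by lra.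
      apply Hd; [exact Hu|]. apply Rabs_def1; lra. }
    destruct (MVT_gen (fun t => s u t) v v' (fun t => dy s u t)) as (c & Hc & E).
    - intros t Ht. destruct (B t) as [HV _]; [lra|]. exact (proj2 (G u t HV)).
    - intros t Ht. destruct (B t) as [HV _]; [lra|].
      exact (is_derive_continuity_pt _ _ _ (proj2 (G u t HV))).
    - destruct (B c Hc) as [_ P]. simpl in E. nra. }
  set (rho := d / 2).
  assert (Hrho : 0 < rho < d) by (unfold rho; lra).
  assert (Ax0 : Rabs (x0 - x0) < d) by (rewrite Rminus_diag, Rabs_R0; lra).
  (* This is used at the initial point to bracket the roots, and again at every point of the curve
     to prove its continuity. *)
  assert (between : forall x1 v1 eps, Rabs (x1 - x0) < d -> 0 < eps ->
     Rabs (v1 - y0) <= rho -> eps <= rho / 2 -> 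
     exists eta, 0 < eta /\ forall x, Rabs (x - x1) < eta ->
       s x (v1 - eps) < s x1 v1 < s x (v1 + eps)).
  { intros x1 v1 eps Hx1 Heps Hv1 He.
    apply Rabs_le_between in Hv1.
    assert (D1 : Rabs (v1 - eps - y0) < d) by (apply Rabs_def1; unfold rho in *; lra).
    assert (D2 : Rabs (v1 + eps - y0) < d) by (apply Rabs_def1; unfold rho in *; lra).
    assert (D3 : Rabs (v1 - y0) < d) by (apply Rabs_def1; unfold rho in *; lra).
    assert (I1 : s x1 (v1 - eps) < s x1 v1) by (apply inc; auto; lra).
    assert (I2 : s x1 v1 < s x1 (v1 + eps)) by (apply inc; auto; lra).
    destruct (Hd x1 (v1 - eps) Hx1 D1) as [V1 _].
    destruct (Hd x1 (v1 + eps) Hx1 D2) as [V2 _].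
    assert (P1 : locally_2d (fun u v => 0 < s x1 v1 - s u v) x1 (v1 - eps)).
    { apply continuity_2d_pt_pos; [|lra].
      apply continuity_2d_pt_minus; [apply continuity_2d_pt_const|].
      now apply (smooth_on_continuity V). }
    assert (P2 : locally_2d (fun u v => 0 < s u v - s x1 v1) x1 (v1 + eps)).
    { apply continuity_2d_pt_pos; [|lra].
      apply continuity_2d_pt_minus; [|apply continuity_2d_pt_const].
      now apply (smooth_on_continuity V). }
    destruct P1 as [e1 P1], P2 as [e2 P2].
    exists (Rmin e1 e2). split; [apply Rmin_glb_lt; apply cond_pos|].
    intros x Hx. pose proof (Rmin_l e1 e2). pose proof (Rmin_r e1 e2).
    specialize (P1 x (v1 - eps)). specialize (P2 x (v1 + eps)).
    rewrite Rminus_diag, Rabs_R0 in P1. rewrite Rminus_diag, Rabs_R0 in P2.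
    pose proof (cond_pos e1). pose proof (cond_pos e2).
    split; [assert (0 < s x1 v1 - s x (v1 - eps)) by (apply P1; lra)
           |assert (0 < s x (v1 + eps) - s x1 v1) by (apply P2; lra)]; lra. }
  destruct (between x0 y0 (rho / 2)) as (e0 & He0 & Hb); auto;
    [lra|rewrite Rminus_diag, Rabs_R0; lra|lra|].
  set (eta := Rmin e0 d).
  assert (Heta : 0 < eta /\ eta <= e0 /\ eta <= d).
  { unfold eta. split; [apply Rmin_glb_lt; lra|split; [apply Rmin_l|apply Rmin_r]]. }
  (* The informative existential, with [y0] as default value away from [x0], allows the curve to be
     defined by projection. *)
  assert (HY : forall x, {y | Rabs (x - x0) < eta ->
                  Rabs (y - y0) <= rho / 2 /\ s x y = s x0 y0}).
  { intros x. destruct (Rlt_dec (Rabs (x - x0)) eta) as [Hx|Hx];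
      [|exists y0; intros; contradiction].
    destruct (Ranalysis5.IVT_interv (fun v => s x v - s x0 y0) (y0 - rho / 2) (y0 + rho / 2))
      as (z & Hz & Ez).
    - intros t Ht. destruct (Hd x t) as [HV _]; [lra|apply Rabs_def1; lra|].
      apply (is_derive_continuity_pt _ _ (dy s x t)).
      pose proof (proj2 (G x t HV)). der. ring.
    - lra.
    - destruct (Hb x); lra.
    - destruct (Hb x); lra.
    - exists z. intros _. split; [apply Rabs_le; lra|lra]. }
  set (Y := fun x => proj1_sig (HY x)).
  assert (PY : forall x, Rabs (x - x0) < eta ->
             Rabs (Y x - y0) <= rho / 2 /\ s x (Y x) = s x0 y0).
  { intros x Hx. unfold Y. destruct (HY x) as [y Py]. simpl. now apply Py. }
  assert (CY : forall x1 eps, Rabs (x1 - x0) < eta -> 0 < eps ->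
             exists del, 0 < del /\ forall x, Rabs (x - x1) < del ->
               Rabs (x - x0) < eta /\ Rabs (Y x - Y x1) < eps).
  { intros x1 eps Hx1 Heps. set (ep := Rmin eps (rho / 2)).
    assert (Hep : 0 < ep /\ ep <= eps /\ ep <= rho / 2).
    { unfold ep. split; [apply Rmin_glb_lt; lra|split; [apply Rmin_l|apply Rmin_r]]. }
    destruct (PY x1 Hx1) as [B1 E1].
    destruct (between x1 (Y x1) ep) as (e & He & HB); try lra.
    set (del := Rmin e (eta - Rabs (x1 - x0))).
    assert (Hdel : 0 < del /\ del <= e /\ del <= eta - Rabs (x1 - x0)).
    { unfold del. split; [apply Rmin_glb_lt; lra|split; [apply Rmin_l|apply Rmin_r]]. }
    exists del. split; [lra|]. intros x Hx.
    assert (Hxx : Rabs (x - x0) < eta).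
    { replace (x - x0) with ((x - x1) + (x1 - x0)) by ring.
      eapply Rle_lt_trans; [apply Rabs_triang|]. lra. }
    split; [exact Hxx|].
    destruct (PY x Hxx) as [B E]. destruct (HB x) as [I1 I2]; [lra|].
    apply Rabs_le_between in B. apply Rabs_le_between in B1.
    apply Rlt_le_trans with ep; [|lra].
    apply Rabs_def1.
    - destruct (Rlt_or_le (Y x - Y x1) ep) as [|Hc]; [assumption|].
      destruct (Req_dec (Y x) (Y x1 + ep)) as [Eq|Ne]; [rewrite Eq in E; lra|].
      assert (s x (Y x1 + ep) < s x (Y x)); [|lra].
      apply inc; first [lra | apply Rabs_def1; lra].
    - destruct (Rlt_or_le (- ep) (Y x - Y x1)) as [|Hc]; [assumption|].
      destruct (Req_dec (Y x) (Y x1 - ep)) as [Eq|Ne]; [rewrite Eq in E; lra|].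
      assert (s x (Y x) < s x (Y x1 - ep)); [|lra].
      apply inc; first [lra | apply Rabs_def1; lra]. }
  exists eta, Y. split; [lra|]. split.
  { destruct (PY x0) as [B E]; [rewrite Rminus_diag, Rabs_R0; lra|].
    apply Rabs_le_between in B.
    destruct (Rtotal_order (Y x0) y0) as [Hl|[He|Hl]]; [|exact He|];
      exfalso; [assert (s x0 (Y x0) < s x0 y0)|assert (s x0 y0 < s x0 (Y x0))]; try lra;
      apply inc; first [lra | apply Rabs_def1; lra]. }
  intros x1 Hx1. destruct (PY x1 Hx1) as [B1 E1].
  destruct (Hd x1 (Y x1)) as [HV1 Hp1]; [lra|lra|].
  split; [exact HV1|]. split; [lra|].
  set (sx := dx s x1 (Y x1)) in *. set (sy := dy s x1 (Y x1)) in *.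
  apply is_derive_Reals. intros eps Heps.
  (* The first bound sy / 2 on the error of linearization gives |k| <= M |h| for the increments;
     with it, the second bound eps sy / (2 M) leaves an error of at most eps / 2 in the slope. *)
  set (M := 2 * Rabs sx / sy + 1).
  assert (HM : 1 <= M).
  { unfold M. pose proof (Rabs_pos sx).
    assert (0 <= 2 * Rabs sx / sy); [|lra].
    apply Rmult_le_pos; [lra|]. left; now apply Rinv_0_lt_compat. }
  assert (He0' : 0 < Rmin (sy / 2) (eps * sy / (2 * M))).
  { apply Rmin_glb_lt; [lra|]. apply Rdiv_lt_0_compat; nra. }
  pose proof (smooth_on_differentiable V s x1 (Y x1) HO Hs HV1) as DF.
  destruct (DF (mkposreal _ He0')) as [d1 Hd1]. simpl in Hd1.
  fold sx in Hd1. fold sy in Hd1.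
  set (ep := Rmin (sy / 2) (eps * sy / (2 * M))) in *.
  assert (Hep1 : ep <= sy / 2) by apply Rmin_l.
  assert (Hep2 : ep <= eps * sy / (2 * M)) by apply Rmin_r.
  destruct (CY x1 d1 Hx1 (cond_pos d1)) as (del & Hdel & Cdel).
  assert (Hdd : 0 < Rmin del d1) by (apply Rmin_glb_lt; [lra|apply cond_pos]).
  exists (mkposreal _ Hdd). simpl. intros h Hh0 Hh.
  pose proof (Rmin_l del d1). pose proof (Rmin_r del d1).
  destruct (Cdel (x1 + h)) as [Hx2 HY2]; [replace (x1 + h - x1) with h by ring; lra|].
  destruct (PY _ Hx2) as [_ E2].
  specialize (Hd1 (x1 + h) (Y (x1 + h))).
  replace (x1 + h - x1) with h in Hd1 by ring.
  set (k := Y (x1 + h) - Y x1) in *.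
  assert (I : Rabs (sx * h + sy * k) <= ep * Rmax (Rabs h) (Rabs k)).
  { rewrite E2, E1 in Hd1.
    replace (s x0 y0 - s x0 y0 - (sx * h + sy * k)) with (- (sx * h + sy * k)) in Hd1 by ring.
    rewrite Rabs_Ropp in Hd1. apply Hd1; lra. }
  assert (hpos : 0 < Rabs h) by now apply Rabs_pos_lt.
  assert (Ik : Rabs k <= M * Rabs h).
  { assert (T : sy * Rabs k <= Rabs sx * Rabs h + Rabs (sx * h + sy * k)).
    { replace (sy * Rabs k) with (Rabs (sy * k))
        by (rewrite Rabs_mult, (Rabs_pos_eq sy); lra).
      rewrite <- Rabs_mult. replace (sy * k) with (- (sx * h) + (sx * h + sy * k)) at 1 by ring.
      eapply Rle_trans; [apply Rabs_triang|]. rewrite Rabs_Ropp. lra. }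
    assert (T2 : Rmax (Rabs h) (Rabs k) <= Rabs h + Rabs k).
    { pose proof (Rabs_pos k). apply Rmax_lub; lra. }
    pose proof (Rabs_pos k).
    assert (T3 : ep * Rmax (Rabs h) (Rabs k) <= sy / 2 * (Rabs h + Rabs k)).
    { apply Rmult_le_compat; try lra. eapply Rle_trans; [|apply Rmax_l]. lra. }
    assert (T4 : sy * (M * Rabs h) = 2 * Rabs sx * Rabs h + sy * Rabs h)
      by (unfold M; field; lra).
    nra. }
  replace (k / h - - sx / sy) with ((sx * h + sy * k) / (h * sy))
    by (field; split; [lra|exact Hh0]).
  unfold Rdiv. rewrite Rabs_mult, Rabs_inv, Rabs_mult, (Rabs_pos_eq sy) by lra.
  apply Rmult_lt_reg_r with (Rabs h * sy); [nra|].
  rewrite Rmult_assoc, Rinv_l by nra. rewrite Rmult_1_r.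
  assert (T5 : Rmax (Rabs h) (Rabs k) <= M * Rabs h) by (apply Rmax_lub; nra).
  assert (T6 : ep * Rmax (Rabs h) (Rabs k) <= eps * sy / (2 * M) * (M * Rabs h)).
  { apply Rmult_le_compat; try lra. eapply Rle_trans; [|apply Rmax_l]. lra. }
  replace (eps * sy / (2 * M) * (M * Rabs h)) with (eps * sy * Rabs h / 2) in T6
    by (field; lra).
  assert (0 < eps * (Rabs h * sy)) by (apply Rmult_lt_0_compat; nra).
  nra.
Qed.

Lemma grad_on_opp (V : plane_set) f fx fy :
  grad_on V f fx fy ->
  grad_on V (fun x y => - f x y) (fun x y => - fx x y) (fun x y => - fy x y).
Proof. intros G x y HV. destruct (G x y HV). split; der; reflexivity. Qed.

Lemma level_curve (V : plane_set) (s : R -> R -> R) (x0 y0 : R) :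
  open_set V -> smooth_on V s -> V x0 y0 -> dy s x0 y0 <> 0 ->
  exists eta (Y : R -> R), 0 < eta /\ Y x0 = y0 /\
    forall x, Rabs (x - x0) < eta ->
      V x (Y x) /\ dy s x (Y x) <> 0 /\
      is_derive Y x (- dx s x (Y x) / dy s x (Y x)).
Proof.
  intros HO Hs H0 Hn.
  destruct (Rlt_or_le 0 (dy s x0 y0)) as [P|P]; [now apply level_curve_pos|].
  destruct (smooth_on_grad V s Hs) as (G & _ & _).
  pose proof (grad_on_dx V _ _ _ (grad_on_opp V s _ _ G)) as E. cbv beta in E.
  assert (Sm : smooth_on V (fun x y => - s x y)) by smooth.
  assert (Pos : 0 < dy (fun x y => - s x y) x0 y0) by (rewrite (proj2 (E x0 y0 H0)); lra).
  destruct (level_curve_pos V _ x0 y0 HO Sm H0 Pos) as (eta & Y & He & HY & H).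
  exists eta, Y. split; [lra|]. split; [exact HY|]. intros x Hx.
  destruct (H x Hx) as (A & B & C). destruct (E x (Y x) A) as [E1 E2].
  rewrite E2 in B. rewrite E1, E2 in C.
  split; [exact A|]. split; [lra|]. eapply is_derive_eq; [exact C|]. field. lra.
Qed.

Lemma open_set_swap (V : plane_set) : open_set V -> open_set (fun x y => V y x).
Proof. intros HO x y HV. destruct (HO y x HV) as [d Hd]. exists d. auto. Qed.

Lemma Cn_on_swap (V : plane_set) n f :
  open_set V -> Cn_on V n f -> Cn_on (fun x y => V y x) n (fun x y => f y x).
Proof.
  intros HO. revert f; induction n; intros f Hf.
  - intros x y HV. split; [|trivial]. destruct (Hf y x HV) as [C _].
    intros eps. destruct (C eps) as [d Hd]. exists d. auto.
  - destruct (Cn_on_grad V n f Hf) as (G & X & Y).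
    apply (Cn_on_S _ n _ (fun x y => dy f y x) (fun x y => dx f y x));
      auto using open_set_swap.
    intros x y HV. destruct (G y x HV). split; assumption.
Qed.

(* A leaf through the point is needed to exploit the straightness of leaves: it
   is a level curve of a first integral, a graph over one of the two axes. *)
Lemma straight_leaves_direction (D V : plane_set) (L : line_field) s c sn cx cy sx sy :
  open_set V -> (forall x y, V x y -> D x y) -> leaves_in D L straight_line ->
  first_integral V L s -> smooth_on V c -> smooth_on V sn ->
  grad_on V c cx cy -> grad_on V sn sx sy ->
  (forall x y, V x y -> c x y ^ 2 + sn x y ^ 2 = 1) ->
  (forall x y vx vy, V x y -> (L x y vx vy <-> c x y * vy - sn x y * vx = 0)) ->
  forall x y, V x y ->
    c x y * (c x y * sx x y - sn x y * cx x y)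
    + sn x y * (c x y * sy x y - sn x y * cy x y) = 0.
Proof.
  intros HO HVD HL [Hs HF] Hc Hsn Gc Gs HU HS x0 y0 H0.
  (* The computation is made for any regular parametrization of the leaf, since the graph may have
     to be taken over either axis. *)
  assert (key : forall (gx gy : R -> R) t0 eta, 0 < eta ->
    gx t0 = x0 -> gy t0 = y0 ->
    (forall t, Rabs (t - t0) < eta -> V (gx t) (gy t) /\
       exists gx' gy' : R, is_derive gx t gx' /\ is_derive gy t gy' /\
         (gx', gy') <> (0, 0) /\ L (gx t) (gy t) gx' gy') ->
    c x0 y0 * (c x0 y0 * sx x0 y0 - sn x0 y0 * cx x0 y0)
    + sn x0 y0 * (c x0 y0 * sy x0 y0 - sn x0 y0 * cy x0 y0) = 0).
  { intros gx gy t0 eta He Ex Ey Hg.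
    destruct (HL (t0 - eta) (t0 + eta) gx gy) as (Cv & (a & b & k & Hab & Hline) & HC).
    { split; [lra|]. intros t Ht.
      destruct (Hg t) as (HV & gx' & gy' & Dx & Dy & Hn & HLt); [apply Rabs_def1; lra|].
      rewrite (is_derive_unique _ _ _ Dx : Derive gx t = gx').
      rewrite (is_derive_unique _ _ _ Dy : Derive gy t = gy').
      split; [auto|]. split; [eexists; eassumption|].
      split; [eexists; eassumption|]. split; assumption. }
    assert (HC' : forall t, Rabs (t - t0) < eta -> a * gx t + b * gy t + k = 0).
    { intros t Ht. apply Rabs_def2 in Ht. apply Hline. apply HC. lra. }
    assert (loc : forall t, Rabs (t - t0) < eta ->
              locally t (fun u => Rabs (u - t0) < eta)).
    { intros t Ht. assert (Hp : 0 < eta - Rabs (t - t0)) by lra.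
      exists (mkposreal _ Hp). intros u Hu.
      change (Rabs (u - t) < eta - Rabs (t - t0)) in Hu.
      replace (u - t0) with ((u - t) + (t - t0)) by ring.
      eapply Rle_lt_trans; [apply Rabs_triang|]. lra. }
    assert (HT : forall t, Rabs (t - t0) < eta ->
              a * c (gx t) (gy t) + b * sn (gx t) (gy t) = 0).
    { intros t Ht. destruct (Hg t Ht) as (HV & gx' & gy' & Dx & Dy & Hn & HLt).
      assert (E : a * gx' + b * gy' = 0).
      { assert (D0 : is_derive (fun u => a * gx u + b * gy u + k) t (a * gx' + b * gy'))
          by (der; ring).
        apply is_derive_unique in D0. rewrite <- D0.
        rewrite (Derive_ext_loc _ (fun _ => 0)); [apply Derive_const|].
        generalize (loc t Ht). apply filter_imp. exact HC'. }
      apply HS in HLt; [|exact HV]. pose proof (HU _ _ HV) as U.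
      set (cc := c (gx t) (gy t)) in *. set (ss := sn (gx t) (gy t)) in *.
      assert (E1 : gx' * (a * cc + b * ss) = 0).
      { replace (gx' * (a * cc + b * ss)) with
          (cc * (a * gx' + b * gy') - b * (cc * gy' - ss * gx')) by ring.
        rewrite E, HLt. ring. }
      assert (E2 : gy' * (a * cc + b * ss) = 0).
      { replace (gy' * (a * cc + b * ss)) with
          (ss * (a * gx' + b * gy') + a * (cc * gy' - ss * gx')) by ring.
        rewrite E, HLt. ring. }
      destruct (Rmult_integral _ _ E1) as [Z1|]; [|assumption].
      destruct (Rmult_integral _ _ E2) as [Z2|]; [|assumption].
      exfalso. apply Hn. now rewrite Z1, Z2. }
    assert (Ht0 : Rabs (t0 - t0) < eta) by (rewrite Rminus_diag, Rabs_R0; lra).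
    destruct (Hg t0 Ht0) as (HV & gx' & gy' & Dx & Dy & Hn & HLt).
    pose proof (smooth_is_derive_comp V c cx cy gx gy t0 gx' gy' HO Hc Gc HV Dx Dy) as D1.
    pose proof (smooth_is_derive_comp V sn sx sy gx gy t0 gx' gy' HO Hsn Gs HV Dx Dy) as D2.
    rewrite Ex, Ey in *.
    (* Derivative along the leaf of the relation between the constant normal (a, b) and the
       direction (c, sn): the direction does not turn. *)
    assert (D0 : a * (cx x0 y0 * gx' + cy x0 y0 * gy')
                 + b * (sx x0 y0 * gx' + sy x0 y0 * gy') = 0).
    { assert (D3 : is_derive (fun u => a * c (gx u) (gy u) + b * sn (gx u) (gy u)) t0
         (a * (cx x0 y0 * gx' + cy x0 y0 * gy')
                 + b * (sx x0 y0 * gx' + sy x0 y0 * gy'))) by (der; ring).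
      apply is_derive_unique in D3. rewrite <- D3.
      rewrite (Derive_ext_loc _ (fun _ => 0)); [apply Derive_const|].
      generalize (loc t0 Ht0). apply filter_imp. exact HT. }
    pose proof (HT t0 Ht0) as T0. rewrite Ex, Ey in T0.
    apply HS in HLt; [|exact HV]. pose proof (HU x0 y0 HV) as U.
    clear - D0 T0 HLt U Hn Hab.
    set (cc := c x0 y0) in *. set (ss := sn x0 y0) in *.
    set (cx0 := cx x0 y0) in *. set (cy0 := cy x0 y0) in *.
    set (sx0 := sx x0 y0) in *. set (sy0 := sy x0 y0) in *.
    (* (gx', gy') = m (cc, ss) and (a, b) = l (- ss, cc) *)
    set (m := cc * gx' + ss * gy'). set (l := cc * b - ss * a).
    assert (Em1 : gx' = m * cc).
    { unfold m. replace ((cc * gx' + ss * gy') * cc) with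
       (gx' * (cc ^ 2 + ss ^ 2) + ss * (cc * gy' - ss * gx')) by ring.
      rewrite U, HLt. ring. }
    assert (Em2 : gy' = m * ss).
    { unfold m. replace ((cc * gx' + ss * gy') * ss) with
       (gy' * (cc ^ 2 + ss ^ 2) - cc * (cc * gy' - ss * gx')) by ring.
      rewrite U, HLt. ring. }
    assert (El1 : a = - l * ss).
    { unfold l. replace (- (cc * b - ss * a) * ss) with
       (a * (cc ^ 2 + ss ^ 2) - cc * (a * cc + b * ss)) by ring.
      rewrite U, T0. ring. }
    assert (El2 : b = l * cc).
    { unfold l. replace ((cc * b - ss * a) * cc) with
       (b * (cc ^ 2 + ss ^ 2) - ss * (a * cc + b * ss)) by ring.
      rewrite U, T0. ring. }
    clearbody m l.
    assert (m <> 0) by (intros ->; apply Hn; f_equal; lra).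
    assert (l <> 0) by (intros ->; apply Hab; f_equal; lra).
    apply Rmult_eq_reg_l with (m * l); [|now apply Rmult_integral_contrapositive_currified].
    rewrite Rmult_0_r. rewrite <- D0. rewrite Em1, Em2, El1, El2. ring. }
  destruct (HF x0 y0 H0) as [Hn _].
  destruct (Req_dec (dy s x0 y0) 0) as [Zy|Ny].
  - assert (Nx : dx s x0 y0 <> 0) by (intros Zx; apply Hn; now rewrite Zx, Zy).
    destruct (level_curve (fun x y => V y x) (fun x y => s y x) y0 x0)
      as (eta & Y & He & EY & H); auto using open_set_swap.
    { intros n. now apply (Cn_on_swap V n s HO (Hs n)). }
    apply (key Y (fun t => t) y0 eta); auto.
    intros t Ht. destruct (H t Ht) as (A & B & E). split; [exact A|].
    unfold dx, dy in B, E. fold (dx s (Y t) t) in B, E. fold (dy s (Y t) t) in E.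
    eexists; eexists; split; [exact E|]. split; [apply is_derive_Rid|].
    split; [intros F; inversion F; lra|].
    apply HF; [exact A|]. field. exact B.
  - destruct (level_curve V s x0 y0) as (eta & Y & He & EY & H); auto.
    apply (key (fun t => t) Y x0 eta); auto.
    intros t Ht. destruct (H t Ht) as (A & B & E). split; [exact A|].
    eexists; eexists; split; [apply is_derive_Rid|]. split; [exact E|].
    split; [intros F; inversion F; lra|].
    apply HF; [exact A|]. field. exact B.
Qed.

(** * Unit frames *)

(** Only equations between reals are kept for [nsatz], and powers are unfolded into products; facts
    such as nonvanishing have to be used separately. *)
Ltac nsz :=
  repeat match goal with
    | H : ?P |- _ => lazymatch P with @eq R _ _ => fail | _ => clear H end
    end;
  cbn [pow] in *; nsatz.

(* (c, s) = (cos a, sin a) is a unit field tangent to L; since the leaves are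
   straight, grad a = A (- s, c). *)
Record line_frame (V : plane_set) (L : line_field) (c s A : R -> R -> R) : Prop := {
  lf_c : smooth_on V c;
  lf_s : smooth_on V s;
  lf_A : smooth_on V A;
  lf_unit : forall x y, V x y -> c x y ^ 2 + s x y ^ 2 = 1;
  lf_span : forall x y vx vy, V x y ->
    (L x y vx vy <-> c x y * vy - s x y * vx = 0);
  lf_gc : grad_on V c (fun x y => s x y ^ 2 * A x y)
                      (fun x y => - (c x y * s x y * A x y));
  lf_gs : grad_on V s (fun x y => - (c x y * s x y * A x y))
                      (fun x y => c x y ^ 2 * A x y) }.

Arguments lf_c {V L c s A}.
Arguments lf_s {V L c s A}.
Arguments lf_unit {V L c s A}.
Arguments lf_span {V L c s A}.
Arguments lf_gc {V L c s A}.
Arguments lf_gs {V L c s A}.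

Lemma line_frame_sub (V W : plane_set) L c s A :
  (forall x y, W x y -> V x y) -> line_frame V L c s A -> line_frame W L c s A.
Proof.
  intros H []. constructor; eauto using smooth_on_sub, grad_on_sub.
Qed.

Lemma line_frame_opp (V : plane_set) L c s A :
  open_set V -> line_frame V L c s A ->
  line_frame V L (fun x y => - c x y) (fun x y => - s x y) (fun x y => - A x y).
Proof.
  intros HO []. constructor; try smooth.
  - intros x y HV. pose proof (lf_unit0 x y HV). nra.
  - intros x y vx vy HV. rewrite (lf_span0 x y vx vy HV). split; intros; lra.
  - intros x y HV. destruct (lf_gc0 x y HV). split; der; ring.
  - intros x y HV. destruct (lf_gs0 x y HV). split; der; ring.
Qed.

(** The unit tangent is the normalized gradient of a first integral turned by a right angle.
    Constant length leaves only the derivative of the direction angle, and straightness removes its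
    component along the line. *)
Lemma linear_foliation_frame (D : plane_set) (L : line_field) x0 y0 :
  foliation D L -> leaves_in D L straight_line -> D x0 y0 ->
  exists r c s A, 0 < r /\ (forall x y, open_disc x0 y0 r x y -> D x y) /\
    line_frame (open_disc x0 y0 r) L c s A.
Proof.
  intros HF HL H0. destruct (HF x0 y0 H0) as (r & f & Hr & HD & Hs & HI).
  set (V := open_disc x0 y0 r) in *.
  pose proof (open_disc_open x0 y0 r : open_set V) as HO.
  destruct (smooth_on_grad V f Hs) as (G & Fx & Fy).
  set (n := fun x y => sqrt (dx f x y ^ 2 + dy f x y ^ 2)).
  assert (npos : forall x y, V x y -> 0 < dx f x y ^ 2 + dy f x y ^ 2).
  { intros x y HV. destruct (HI x y HV) as [Hn _].
    destruct (Req_dec (dx f x y) 0) as [E|E].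
    - destruct (Req_dec (dy f x y) 0) as [E'|E'].
      + exfalso. apply Hn. now rewrite E, E'.
      + pose proof (pow2_gt_0 _ E'). pose proof (pow2_ge_0 (dx f x y)). lra.
    - pose proof (pow2_gt_0 _ E). pose proof (pow2_ge_0 (dy f x y)). lra. }
  assert (n0 : forall x y, V x y -> n x y <> 0).
  { intros x y HV. pose proof (sqrt_lt_R0 _ (npos x y HV)). unfold n. lra. }
  assert (n2 : forall x y, V x y -> n x y ^ 2 = dx f x y ^ 2 + dy f x y ^ 2).
  { intros x y HV. unfold n. apply pow2_sqrt. pose proof (npos x y HV). lra. }
  assert (Sn : smooth_on V n) by (unfold n; smooth).
  set (c := fun x y => - dy f x y / n x y). set (s := fun x y => dx f x y / n x y).
  assert (Sc : smooth_on V c) by (unfold c; smooth).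
  assert (Ss : smooth_on V s) by (unfold s; smooth).
  assert (U : forall x y, V x y -> c x y ^ 2 + s x y ^ 2 = 1).
  { intros x y HV. unfold c, s. pose proof (n0 x y HV). pose proof (n2 x y HV) as E.
    apply Rmult_eq_reg_r with (n x y ^ 2); [|now apply pow_nonzero].
    rewrite E at 2. field. assumption. }
  assert (Sp : forall x y vx vy, V x y ->
    (L x y vx vy <-> c x y * vy - s x y * vx = 0)).
  { intros x y vx vy HV. destruct (HI x y HV) as [_ K]. rewrite K.
    unfold c, s. pose proof (n0 x y HV) as N.
    replace (- dy f x y / n x y * vy - dx f x y / n x y * vx)
      with (- (dx f x y * vx + dy f x y * vy) / n x y) by (field; exact N).
    split; intros E.
    - rewrite E. field. exact N.
    - apply Rmult_integral in E. destruct E as [E|E]; [lra|].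
      exfalso. now apply (Rinv_neq_0_compat _ N). }
  clearbody c s.
  destruct (smooth_on_grad V c Sc) as (Gc & Cx & Cy).
  destruct (smooth_on_grad V s Ss) as (Gs & Sx & Sy).
  pose proof (straight_leaves_direction D V L f c s _ _ _ _ HO HD HL (conj Hs HI)
                Sc Ss Gc Gs U Sp) as St.
  assert (GU : forall x y, V x y ->
     2 * c x y * dx c x y + 2 * s x y * dx s x y = 0 /\
     2 * c x y * dy c x y + 2 * s x y * dy s x y = 0).
  { apply (grad_on_eq V (fun x y => c x y ^ 2 + s x y ^ 2) (fun _ _ => 1)
       (fun x y => 2 * c x y * dx c x y + 2 * s x y * dx s x y)
       (fun x y => 2 * c x y * dy c x y + 2 * s x y * dy s x y)
       (fun _ _ => 0) (fun _ _ => 0)); auto.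
    - intros x y HV. destruct (Gc x y HV), (Gs x y HV). split; der; ring.
    - intros x y HV. split; apply is_derive_Rconst. }
  (* [A] is c ds - s dc, the differential of the direction angle, evaluated on the unit normal (- s,
     c). *)
  exists r, c, s,
    (fun x y => - s x y * (c x y * dx s x y - s x y * dx c x y)
              + c x y * (c x y * dy s x y - s x y * dy c x y)).
  split; [exact Hr|]. split; [exact HD|].
  constructor; auto; try smooth.
  - refine (grad_on_ext V c _ _ _ _ _ Gc). intros x y HV.
    pose proof (St x y HV). pose proof (U x y HV). destruct (GU x y HV).
    cbv beta. split; nsz.
  - refine (grad_on_ext V s _ _ _ _ _ Gs). intros x y HV.
    pose proof (St x y HV). pose proof (U x y HV). destruct (GU x y HV).
    cbv beta. split; nsz.
Qed.

(** Integrability of the gradient formulas for c and s. Geometrically, where A does not vanish, 1 /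
    A is the signed distance along the line from its contact point with the envelope, and it grows
    with unit speed. *)
Lemma line_frame_A (V : plane_set) L c s A :
  open_set V -> line_frame V L c s A ->
  forall x y, V x y -> c x y * dx A x y + s x y * dy A x y = - A x y ^ 2.
Proof.
  intros HO [Sc Ss SA U _ Gc Gs]. intros x y HV.
  destruct (smooth_on_grad V A SA) as (GA & _ & _).
  pose proof (mixed_partials V c _ _
    (fun x y => 2 * s x y * - (c x y * s x y * A x y) * A x y + s x y ^ 2 * dx A x y)
    (fun x y => 2 * s x y * (c x y ^ 2 * A x y) * A x y + s x y ^ 2 * dy A x y)
    (fun x y => - ((s x y ^ 2 * A x y * s x y + c x y * - (c x y * s x y * A x y)) * A x y
                   + c x y * s x y * dx A x y))
    (fun x y => - ((- (c x y * s x y * A x y) * s x y + c x y * (c x y ^ 2 * A x y)) * A x y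
                   + c x y * s x y * dy A x y)) HO Sc Gc) as M1.
  pose proof (mixed_partials V s _ _
    (fun x y => - ((s x y ^ 2 * A x y * s x y + c x y * - (c x y * s x y * A x y)) * A x y
                   + c x y * s x y * dx A x y))
    (fun x y => - ((- (c x y * s x y * A x y) * s x y + c x y * (c x y ^ 2 * A x y)) * A x y
                   + c x y * s x y * dy A x y))
    (fun x y => 2 * c x y * (s x y ^ 2 * A x y) * A x y + c x y ^ 2 * dx A x y)
    (fun x y => 2 * c x y * - (c x y * s x y * A x y) * A x y + c x y ^ 2 * dy A x y)
     HO Ss Gs) as M2.
  assert (D : forall u v, V u v ->
    (is_derive (fun t => c t v) u (s u v ^ 2 * A u v) /\
     is_derive (fun t => c u t) v (- (c u v * s u v * A u v))) /\
    (is_derive (fun t => s t v) u (- (c u v * s u v * A u v)) /\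
     is_derive (fun t => s u t) v (c u v ^ 2 * A u v)) /\
    (is_derive (fun t => A t v) u (dx A u v) /\ is_derive (fun t => A u t) v (dy A u v)))
    by (intros; split; [|split]; auto).
  specialize (M1 ltac:(intros u v Hu; destruct (D u v Hu) as ((?&?)&(?&?)&(?&?)); split; der; ring)
    ltac:(intros u v Hu; destruct (D u v Hu) as ((?&?)&(?&?)&(?&?)); split; der; ring) x y HV).
  specialize (M2 ltac:(intros u v Hu; destruct (D u v Hu) as ((?&?)&(?&?)&(?&?)); split; der; ring)
    ltac:(intros u v Hu; destruct (D u v Hu) as ((?&?)&(?&?)&(?&?)); split; der; ring) x y HV).
  pose proof (U x y HV). cbv beta in *. nsz.
Qed.

Record frame (V : plane_set) (L1 L2 N1 N2 : line_field) (c1 s1 A c2 s2 C : R -> R -> R) : Prop := {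
  fr_1 : line_frame V L1 c1 s1 A;
  fr_2 : line_frame V L2 c2 s2 C;
  fr_S : forall x y, V x y -> c1 x y * s2 x y - s1 x y * c2 x y <> 0;
  fr_N1 : forall x y vx vy, V x y ->
    (N1 x y vx vy <-> (c1 x y + c2 x y) * vy - (s1 x y + s2 x y) * vx = 0);
  fr_N2 : forall x y vx vy, V x y ->
    (N2 x y vx vy <-> (c1 x y - c2 x y) * vy - (s1 x y - s2 x y) * vx = 0) }.

Arguments fr_1 {V L1 L2 N1 N2 c1 s1 A c2 s2 C}.
Arguments fr_2 {V L1 L2 N1 N2 c1 s1 A c2 s2 C}.
Arguments fr_S {V L1 L2 N1 N2 c1 s1 A c2 s2 C}.
Arguments fr_N1 {V L1 L2 N1 N2 c1 s1 A c2 s2 C}.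
Arguments fr_N2 {V L1 L2 N1 N2 c1 s1 A c2 s2 C}.

Lemma frame_sub (V W : plane_set) L1 L2 N1 N2 c1 s1 A c2 s2 C :
  (forall x y, W x y -> V x y) -> frame V L1 L2 N1 N2 c1 s1 A c2 s2 C ->
  frame W L1 L2 N1 N2 c1 s1 A c2 s2 C.
Proof. intros H []. constructor; eauto using line_frame_sub. Qed.

Lemma span_multiple (a b vx vy : R) : (a, b) <> (0, 0) ->
  ((exists k, vx = k * a /\ vy = k * b) <-> a * vy - b * vx = 0).
Proof.
  intros Hab. split.
  - intros (k & -> & ->). ring.
  - intros E. assert (P : a ^ 2 + b ^ 2 <> 0).
    { intros Z. apply Hab. f_equal; nra. }
    exists ((a * vx + b * vy) / (a ^ 2 + b ^ 2)).
    split; apply Rmult_eq_reg_r with (a ^ 2 + b ^ 2); try exact P;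
      field_simplify; try exact P; nsz.
Qed.

Lemma unit_parallel (c s ex ey : R) : c ^ 2 + s ^ 2 = 1 -> ex ^ 2 + ey ^ 2 = 1 ->
  c * ey - s * ex = 0 -> (ex = c /\ ey = s) \/ (ex = - c /\ ey = - s).
Proof.
  intros U W E. set (k := c * ex + s * ey).
  assert (E1 : ex = k * c) by (unfold k; nsz).
  assert (E2 : ey = k * s) by (unfold k; nsz).
  assert (K : (k - 1) * (k + 1) = 0) by (unfold k; nsz).
  apply Rmult_integral in K. destruct K as [K|K]; [left|right]; split; nra.
Qed.

(** The unit vectors of [bisector_net] are chosen independently at each point. Compared with smooth
    e1 and e2, the foliation N1 could follow e1 + e2 at some points and e1 - e2 at others; once this
    is excluded near the center, the second case is reduced to the first by changing the sign of
    e2. *)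
Lemma frame_exists (D : plane_set) (L1 L2 N1 N2 : line_field) x0 y0 :
  planar_domain D -> linear_net D L1 L2 -> bisector_net D L1 L2 N1 N2 -> D x0 y0 ->
  exists r c1 s1 A c2 s2 C, 0 < r /\ (forall x y, open_disc x0 y0 r x y -> D x y) /\
    frame (open_disc x0 y0 r) L1 L2 N1 N2 c1 s1 A c2 s2 C.
Proof.
  intros _ [[HF HT] [HL1 HL2]] [[HN HTN] HB] H0.
  pose proof (HF 0%nat ltac:(lia)) as F1. pose proof (HF 1%nat ltac:(lia)) as F2.
  pose proof (HT 0%nat 1%nat ltac:(lia)) as T. pose proof (HTN 0%nat 1%nat ltac:(lia)) as TN.
  pose proof (HN 0%nat ltac:(lia)) as FN. simpl in F1, F2, T, TN, FN.
  destruct (linear_foliation_frame D L1 x0 y0 F1 HL1 H0) as (r1 & c1 & s1 & A & Hr1 & D1 & K1).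
  destruct (linear_foliation_frame D L2 x0 y0 F2 HL2 H0) as (r2 & c2 & s2 & C & Hr2 & D2 & K2).
  destruct (FN x0 y0 H0) as (r3 & f & Hr3 & D3 & Sf & If).
  set (r := Rmin r1 (Rmin r2 r3)).
  assert (Hr : 0 < r) by (unfold r; repeat apply Rmin_glb_lt; assumption).
  assert (R1 : forall x y, open_disc x0 y0 r x y -> open_disc x0 y0 r1 x y)
    by (apply open_disc_mono; split; [exact Hr|apply Rmin_l]).
  assert (R2 : forall x y, open_disc x0 y0 r x y -> open_disc x0 y0 r2 x y).
  { apply open_disc_mono; split; [exact Hr|].
    eapply Rle_trans; [apply Rmin_r|apply Rmin_l]. }
  assert (R3 : forall x y, open_disc x0 y0 r x y -> open_disc x0 y0 r3 x y).
  { apply open_disc_mono; split; [exact Hr|].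
    eapply Rle_trans; [apply Rmin_r|apply Rmin_r]. }
  apply (line_frame_sub _ _ _ _ _ _ R1) in K1. apply (line_frame_sub _ _ _ _ _ _ R2) in K2.
  pose proof (smooth_on_sub _ _ f R3 Sf) as Sf'.
  assert (If' : forall x y, open_disc x0 y0 r x y -> (dx f x y, dy f x y) <> (0, 0) /\
    forall vx vy, N1 x y vx vy <-> dx f x y * vx + dy f x y * vy = 0) by auto.
  assert (DD : forall x y, open_disc x0 y0 r x y -> D x y) by auto.
  clear D1 D2 D3 R1 R2 R3 Sf If. set (V := open_disc x0 y0 r) in *.
  pose proof (open_disc_open x0 y0 r : open_set V) as HO.
  assert (HS : forall x y, V x y -> c1 x y * s2 x y - s1 x y * c2 x y <> 0).
  { intros x y HV E. destruct (T x y (c1 x y) (s1 x y) (DD x y HV)) as [Z1 Z2].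
    - apply (lf_span K1 _ _ _ _ HV). ring.
    - apply (lf_span K2 _ _ _ _ HV). lra.
    - pose proof (lf_unit K1 _ _ HV) as U. rewrite Z1, Z2 in U. lra. }
  assert (HP : forall x y, V x y ->
    ((forall vx vy, N1 x y vx vy <-> (c1 x y + c2 x y) * vy - (s1 x y + s2 x y) * vx = 0) /\
     (forall vx vy, N2 x y vx vy <-> (c1 x y - c2 x y) * vy - (s1 x y - s2 x y) * vx = 0)) \/
    ((forall vx vy, N1 x y vx vy <-> (c1 x y - c2 x y) * vy - (s1 x y - s2 x y) * vx = 0) /\
     (forall vx vy, N2 x y vx vy <-> (c1 x y + c2 x y) * vy - (s1 x y + s2 x y) * vx = 0))).
  { intros x y HV. destruct (HB x y (DD x y HV)) as (ex & ey & fx & fy & Ue & Le & Uf & Lf & B1 & B2).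
    apply (lf_span K1 _ _ _ _ HV) in Le. apply (lf_span K2 _ _ _ _ HV) in Lf.
    pose proof (lf_unit K1 _ _ HV) as U1. pose proof (lf_unit K2 _ _ HV) as U2.
    pose proof (HS x y HV) as SS.
    assert (P1 : (c1 x y + c2 x y, s1 x y + s2 x y) <> (0, 0)).
    { intros E. injection E as E1 E2. apply SS.
      replace (c2 x y) with (- c1 x y) by lra. replace (s2 x y) with (- s1 x y) by lra. ring. }
    assert (P2 : (c1 x y - c2 x y, s1 x y - s2 x y) <> (0, 0)).
    { intros E. injection E as E1 E2. apply SS.
      replace (c2 x y) with (c1 x y) by lra. replace (s2 x y) with (s1 x y) by lra. ring. }
    pose proof (fun vx vy => span_multiple _ _ vx vy P1) as Q1.
    pose proof (fun vx vy => span_multiple _ _ vx vy P2) as Q2.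
    destruct (unit_parallel _ _ _ _ U1 Ue Le) as [[-> ->]|[-> ->]];
    destruct (unit_parallel _ _ _ _ U2 Uf Lf) as [[-> ->]|[-> ->]]; [left|right|right|left];
    (split; intros vx vy; first [rewrite B1|rewrite B2]; first [rewrite <- Q1|rewrite <- Q2];
     split; intros (k & E1 & E2);
     solve [ exists k; lra | exists (- k); lra ]). }
  (* continuity of N1 selects one of the two cases on a smaller disc *)
  assert (SG : smooth_on V (dx f) /\ smooth_on V (dy f)) by (now apply smooth_on_grad).
  destruct SG as [Sfx Sfy].
  pose proof (lf_c K1) as Sc1. pose proof (lf_s K1) as Ss1.
  pose proof (lf_c K2) as Sc2. pose proof (lf_s K2) as Ss2.
  assert (Sp : smooth_on V (fun x y => dx f x y * (c1 x y + c2 x y) + dy f x y * (s1 x y + s2 x y)))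
    by smooth.
  assert (Sm : smooth_on V (fun x y => dx f x y * (c1 x y - c2 x y) + dy f x y * (s1 x y - s2 x y)))
    by smooth.
  pose proof (open_disc_center x0 y0 r Hr : V x0 y0) as V0.
  assert (loc : forall g, smooth_on V g -> g x0 y0 <> 0 -> exists q, 0 < q /\
     forall u v, open_disc x0 y0 q u v -> V u v /\ g u v <> 0).
  { intros g Sg g0. apply locally_2d_disc. apply locally_2d_and; [now apply HO|].
    apply continuity_2d_pt_neq_0; [now apply (smooth_on_continuity V)|exact g0]. }
  (* If the first integral of N1 had zero derivative along both e1 + e2 and e1 - e2, its gradient
     would vanish, since these two vectors span the plane. *)
  assert (excl : forall x y, V x y ->
     dx f x y * (c1 x y + c2 x y) + dy f x y * (s1 x y + s2 x y) = 0 ->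
     dx f x y * (c1 x y - c2 x y) + dy f x y * (s1 x y - s2 x y) = 0 -> False).
  { intros x y HV E1 E2. destruct (If' x y HV) as [Hn _]. apply Hn.
    pose proof (HS x y HV) as SS.
    assert (X : dx f x y * (c1 x y * s2 x y - s1 x y * c2 x y) = 0) by nsz.
    assert (Y : dy f x y * (c1 x y * s2 x y - s1 x y * c2 x y) = 0) by nsz.
    apply Rmult_integral in X. apply Rmult_integral in Y.
    f_equal; tauto. }
  destruct (HP x0 y0 V0) as [[P1 P2]|[P1 P2]].
  - destruct (loc _ Sm) as (q & Hq & HW).
    { intros E. apply (excl x0 y0 V0); [|exact E].
      apply (proj2 (If' x0 y0 V0)). apply P1. ring. }
    exists q, c1, s1, A, c2, s2, C. split; [exact Hq|].
    split; [intros x y Hxy; now apply DD, HW|].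
    assert (WV : forall u v, open_disc x0 y0 q u v -> V u v) by (intros; now apply HW).
    assert (HP' : forall x y, open_disc x0 y0 q x y ->
     (forall vx vy, N1 x y vx vy <-> (c1 x y + c2 x y) * vy - (s1 x y + s2 x y) * vx = 0) /\
     (forall vx vy, N2 x y vx vy <-> (c1 x y - c2 x y) * vy - (s1 x y - s2 x y) * vx = 0)).
    { intros x y Hxy. destruct (HW x y Hxy) as [HV Hn].
      destruct (HP x y HV) as [K|[K _]]; [exact K|]. exfalso. apply Hn.
      apply (proj2 (If' x y HV)). apply K. ring. }
    constructor; eauto using line_frame_sub; intros; now apply HP'.
  - destruct (loc _ Sp) as (q & Hq & HW).
    { intros E. apply (excl x0 y0 V0); [exact E|].
      apply (proj2 (If' x0 y0 V0)). apply P1. ring. }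
    exists q, c1, s1, A, (fun x y => - c2 x y), (fun x y => - s2 x y), (fun x y => - C x y).
    split; [exact Hq|].
    split; [intros x y Hxy; now apply DD, HW|].
    assert (WV : forall u v, open_disc x0 y0 q u v -> V u v) by (intros; now apply HW).
    assert (HP' : forall x y, open_disc x0 y0 q x y ->
     (forall vx vy, N1 x y vx vy <-> (c1 x y - c2 x y) * vy - (s1 x y - s2 x y) * vx = 0) /\
     (forall vx vy, N2 x y vx vy <-> (c1 x y + c2 x y) * vy - (s1 x y + s2 x y) * vx = 0)).
    { intros x y Hxy. destruct (HW x y Hxy) as [HV Hn].
      destruct (HP x y HV) as [[K _]|K]; [|exact K]. exfalso. apply Hn.
      apply (proj2 (If' x y HV)). apply K. ring. }
    constructor.
    + eauto using line_frame_sub.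
    + apply line_frame_opp; [apply open_disc_open|]. eauto using line_frame_sub.
    + intros x y Hxy. pose proof (HS x y (WV x y Hxy)). lra.
    + intros x y vx vy Hxy. rewrite (proj1 (HP' x y Hxy)). split; intros; lra.
    + intros x y vx vy Hxy. rewrite (proj2 (HP' x y Hxy)). split; intros; lra.
Qed.

(** * Conformal flatness and the curvature of the web *)

(* Vanishing of the Blaschke curvature of the 3-webs (L1, L2, N1) and
   (L1, L2, N2), and also harmonicity of the sum of the direction angles. *)
Definition web_curvature (c1 s1 A c2 s2 C : R -> R -> R) (x y : R) : R :=
  c2 x y * dx A x y + s2 x y * dy A x y - (c1 x y * dx C x y + s1 x y * dy C x y)
  + (c1 x y * c2 x y + s1 x y * s2 x y) * (A x y ^ 2 - C x y ^ 2).

Lemma frame_facts {V : plane_set} {L1 L2 N1 N2 c1 s1 A c2 s2 C} :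
  open_set V -> frame V L1 L2 N1 N2 c1 s1 A c2 s2 C ->
  forall x y, V x y ->
  (c1 x y ^ 2 + s1 x y ^ 2 = 1 /\ c2 x y ^ 2 + s2 x y ^ 2 = 1 /\
   c1 x y * s2 x y - s1 x y * c2 x y <> 0 /\
   c1 x y * dx A x y + s1 x y * dy A x y = - A x y ^ 2 /\
   c2 x y * dx C x y + s2 x y * dy C x y = - C x y ^ 2) /\
  ((is_derive (fun t => c1 t y) x (s1 x y ^ 2 * A x y) /\
    is_derive (fun t => c1 x t) y (- (c1 x y * s1 x y * A x y))) /\
   (is_derive (fun t => s1 t y) x (- (c1 x y * s1 x y * A x y)) /\
    is_derive (fun t => s1 x t) y (c1 x y ^ 2 * A x y)) /\
   (is_derive (fun t => A t y) x (dx A x y) /\ is_derive (fun t => A x t) y (dy A x y))) /\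
  ((is_derive (fun t => c2 t y) x (s2 x y ^ 2 * C x y) /\
    is_derive (fun t => c2 x t) y (- (c2 x y * s2 x y * C x y))) /\
   (is_derive (fun t => s2 t y) x (- (c2 x y * s2 x y * C x y)) /\
    is_derive (fun t => s2 x t) y (c2 x y ^ 2 * C x y)) /\
   (is_derive (fun t => C t y) x (dx C x y) /\ is_derive (fun t => C x t) y (dy C x y))).
Proof.
  intros HO [K1 K2 HS _ _] x y HV.
  pose proof (line_frame_A V _ _ _ _ HO K1 x y HV).
  pose proof (line_frame_A V _ _ _ _ HO K2 x y HV).
  destruct K1 as [? ? SA U1 _ Gc1 Gs1]. destruct K2 as [? ? SC U2 _ Gc2 Gs2].
  destruct (smooth_on_grad V A SA) as (GA & _ & _).
  destruct (smooth_on_grad V C SC) as (GC & _ & _).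
  exact (conj (conj (U1 x y HV) (conj (U2 x y HV) (conj (HS x y HV) (conj H H0))))
    (conj (conj (Gc1 x y HV) (conj (Gs1 x y HV) (GA x y HV)))
          (conj (Gc2 x y HV) (conj (Gs2 x y HV) (GC x y HV))))).
Qed.

Lemma frame_smooth {V : plane_set} {L1 L2 N1 N2 c1 s1 A c2 s2 C} :
  frame V L1 L2 N1 N2 c1 s1 A c2 s2 C ->
  (smooth_on V c1 /\ smooth_on V s1 /\ smooth_on V A /\ smooth_on V c2 /\
   smooth_on V s2 /\ smooth_on V C) /\
  (smooth_on V (dx A) /\ smooth_on V (dy A) /\ smooth_on V (dx C) /\ smooth_on V (dy C)).
Proof.
  intros [[] [] _ _ _]. repeat split; try assumption; now apply smooth_on_grad.
Qed.

Ltac at_point F HO x y HV :=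
  let U1 := fresh "U1" in let U2 := fresh "U2" in let S0 := fresh "S0" in
  let RA := fresh "RA" in let RC := fresh "RC" in
  destruct (frame_facts HO F x y HV)
    as ((U1 & U2 & S0 & RA & RC) & ((? & ?) & (? & ?) & (? & ?)) &
        ((? & ?) & (? & ?) & (? & ?))).

(** For complex e = c + i s, e' = c' + i s' of modulus 1 and f = e + e', one has e e' = f^2 / |f|^2
    and f e = e^2 + e e'. The two equations are the imaginary part and, up to sign, the real part of
    f^2 + |f|^2 e^2 = |f|^2 f e. *)
Lemma unit_bisector_identities (c s c' s' : R) :
  c ^ 2 + s ^ 2 = 1 -> c' ^ 2 + s' ^ 2 = 1 ->
  let m := c + c' in let n := s + s' in
  2 * (m * n + c * s * (m ^ 2 + n ^ 2)) = (n * c + m * s) * (m ^ 2 + n ^ 2) /\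
  2 * (n ^ 2 * s ^ 2 - m ^ 2 * c ^ 2) = (n * s - m * c) * (m ^ 2 + n ^ 2).
Proof.
  intros U U' m n.
  assert (M : m ^ 2 + n ^ 2 = 2 * (n * s + m * c)) by (unfold m, n; nsz).
  rewrite M. split; [|ring].
  unfold m, n. nsz.
Qed.
(** Here (- l n, l m) is the gradient of a harmonic u and p, q stand for u_xx, u_xy; the premises
    are the derivatives of the equation saying that u is constant along e1 + e2. For F = u_x - i u_y
    the conclusion reads F' = - (1/2) F (A conj e1 + C conj e2). *)
Lemma bisector_normal_gradient (c1 s1 A c2 s2 C p q l : R) :
  c1 ^ 2 + s1 ^ 2 = 1 -> c2 ^ 2 + s2 ^ 2 = 1 ->
  let m := c1 + c2 in let n := s1 + s2 in
  m ^ 2 + n ^ 2 <> 0 ->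
  p * m + (- l * n) * (s1 ^ 2 * A + s2 ^ 2 * C) + q * n
    + (l * m) * (- (c1 * s1 * A) - (c2 * s2 * C)) = 0 ->
  q * m + (- l * n) * (- (c1 * s1 * A) - (c2 * s2 * C)) + - p * n
    + (l * m) * (c1 ^ 2 * A + c2 ^ 2 * C) = 0 ->
  p = - (1 / 2) * (- l * n * (A * c1 + C * c2) - l * m * (A * s1 + C * s2)) /\
  q = - (1 / 2) * (- l * n * (A * s1 + C * s2) + l * m * (A * c1 + C * c2)).
Proof.
  intros U1 U2 m n P X1 X2.
  destruct (unit_bisector_identities c1 s1 c2 s2 U1 U2) as [I1 I2].
  destruct (unit_bisector_identities c2 s2 c1 s1 U2 U1) as [J1 J2].
  rewrite (Rplus_comm c2 c1), (Rplus_comm s2 s1) in J1, J2.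
  fold m n in I1, I2, J1, J2. set (M := m ^ 2 + n ^ 2) in *.
  assert (Ep : 2 * (p * M) = l * A * (2 * (m * n * (c1 ^ 2 + s1 ^ 2) + c1 * s1 * M))
                     + l * C * (2 * (m * n * (c2 ^ 2 + s2 ^ 2) + c2 * s2 * M))).
  { apply Rminus_diag_uniq.
    match type of X1 with ?L1 = _ => match type of X2 with ?L2 = _ =>
      transitivity (2 * m * L1 - 2 * n * L2); [unfold M; ring | rewrite X1, X2; ring] end end. }
  assert (Eq : 2 * (q * M) = l * A * (2 * (n ^ 2 * s1 ^ 2 - m ^ 2 * c1 ^ 2))
                     + l * C * (2 * (n ^ 2 * s2 ^ 2 - m ^ 2 * c2 ^ 2))).
  { apply Rminus_diag_uniq.
    match type of X1 with ?L1 = _ => match type of X2 with ?L2 = _ =>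
      transitivity (2 * n * L1 + 2 * m * L2); [unfold M; ring | rewrite X1, X2; ring] end end. }
  rewrite U1, U2, !Rmult_1_r, I1, J1 in Ep. rewrite I2, J2 in Eq.
  split; apply Rmult_eq_reg_r with (2 * M); try lra.
Qed.

(** An isothermal u is harmonic and its gradient is normal to N1, so that u_x - i u_y is holomorphic
    with argument - (a + b) / 2 up to a constant. This expresses its second derivatives through the
    first ones, and Schwarz's theorem for u_x and u_y gives the harmonicity of a + b. *)
Lemma flat_curvature (D V : plane_set) L1 L2 N1 N2 c1 s1 A c2 s2 C x y :
  open_set V -> frame V L1 L2 N1 N2 c1 s1 A c2 s2 C ->
  conformally_flat D N1 N2 -> D x y -> V x y ->
  web_curvature c1 s1 A c2 s2 C x y = 0.
Proof.
  intros HOV FV HC HD HV.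
  destruct (HC x y HD) as (r & u & v & Hr & _ & (Su & Sv & _ & HI) & [_ Fu] & [_ Fv]).
  set (W0 := open_disc x y r) in *.
  pose proof (open_disc_open x y r : open_set W0) as HO0.
  destruct (smooth_on_grad _ _ Su) as (Gu & Sux & Suy).
  destruct (smooth_on_grad _ _ Sv) as (Gv & Svx & Svy).
  set (J := fun a b => dx u a b * dy v a b - dy u a b * dx v a b).
  assert (SJ : smooth_on W0 J) by (unfold J; smooth).
  assert (NJ : forall a b, W0 a b ->
     J a b <> 0 /\
     dx v a b * (dx u a b ^ 2 + dx v a b ^ 2) = - J a b * dy u a b /\
     dy v a b * (dx u a b ^ 2 + dx v a b ^ 2) = J a b * dx u a b /\
     J a b ^ 2 = (dx u a b ^ 2 + dx v a b ^ 2) ^ 2).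
  { intros a b Hab. destruct (HI a b Hab) as (E1 & E2 & E3). unfold J.
    assert (E4 : (dx u a b * dy v a b - dy u a b * dx v a b) ^ 2
                 = (dx u a b ^ 2 + dx v a b ^ 2) ^ 2) by nsz.
    split; [|split; [|split]]; try nsz.
    intros Z. rewrite Z in E4. nra. }
  pose proof (open_disc_center x y r Hr : W0 x y) as H0.
  (* The chart may reverse the orientation. [sigma] is the sign of its Jacobian, kept on a smaller
     disc, and u, sigma v satisfy the Cauchy-Riemann equations there. *)
  assert (sg : exists sigma, sigma ^ 2 = 1 /\ 0 < sigma * J x y).
  { destruct (NJ x y H0) as [N _]. destruct (Rtotal_order (J x y) 0) as [L|[L|L]];
      [exists (-1)|contradiction|exists 1]; lra. }
  destruct sg as (sigma & Hs2 & Hsp).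
  assert (LW : locally_2d (fun a b => (W0 a b /\ V a b) /\ 0 < sigma * J a b) x y).
  { apply locally_2d_and; [apply locally_2d_and; [now apply HO0|now apply HOV]|].
    apply (continuity_2d_pt_pos (fun a b => sigma * J a b)); [|exact Hsp].
    apply continuity_2d_pt_mult; [apply continuity_2d_pt_const|].
    now apply (smooth_on_continuity W0). }
  apply locally_2d_disc in LW. destruct LW as (q & Hq & HW).
  set (W := open_disc x y q) in *.
  pose proof (open_disc_open x y q : open_set W) as HO.
  pose proof (open_disc_center x y q Hq : W x y) as HWx.
  assert (WV : forall a b, W a b -> V a b) by (intros; now apply HW).
  assert (WW : forall a b, W a b -> W0 a b) by (intros; now apply HW).
  assert (CR : forall a b, W a b ->
            dx v a b = - sigma * dy u a b /\ dy v a b = sigma * dx u a b).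
  { intros a b Hab. destruct (HW a b Hab) as [[H1 _] HJ].
    destruct (NJ a b H1) as (N & Ex & Ey & E2). destruct (HI a b H1) as (_ & _ & P).
    assert (EJ : J a b = sigma * (dx u a b ^ 2 + dx v a b ^ 2)).
    { assert (Z : (sigma * J a b - (dx u a b ^ 2 + dx v a b ^ 2)) *
             (sigma * J a b + (dx u a b ^ 2 + dx v a b ^ 2)) = 0) by nsz.
      apply Rmult_integral in Z. destruct Z as [Z|Z]; [|lra]. nsz. }
    rewrite EJ in Ex, Ey.
    split; (eapply Rmult_eq_reg_r; [|apply Rgt_not_eq; exact P]); lra. }
  apply (frame_sub V W _ _ _ _ _ _ _ _ _ _ WV) in FV.
  assert (HE : forall a b, W a b ->
     dx u a b * (c1 a b + c2 a b) + dy u a b * (s1 a b + s2 a b) = 0).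
  { intros a b Hab. apply (proj2 (Fu a b (WW a b Hab))).
    apply (fr_N1 FV); [exact Hab|ring]. }
  apply (smooth_on_sub W0 W _ WW) in Su, Sv, Sux, Suy, Svx, Svy.
  apply (grad_on_sub W0 W _ _ _ WW) in Gu, Gv.
  destruct (smooth_on_grad _ _ Sux) as (Gux & Suxx & Suxy).
  destruct (smooth_on_grad _ _ Suy) as (Guy & Suyx & Suyy).
  assert (nz : forall a b, W a b -> dx u a b ^ 2 + dy u a b ^ 2 <> 0).
  { intros a b Hab Z. destruct (proj1 (Fu a b (WW a b Hab))). f_equal; nra. }
  clear HI Fu Fv NJ SJ Hsp HW J H0 WW WV HC.
  pose proof (mixed_partials W u _ _ _ _ _ _ HO Su Gu Gux Guy) as Mu.
  assert (Gv' : grad_on W v (fun a b => - sigma * dy u a b) (fun a b => sigma * dx u a b)).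
  { refine (grad_on_ext W v _ _ _ _ CR Gv). }
  assert (harm : forall a b, W a b -> dx (dx u) a b + dy (dy u) a b = 0).
  { intros a b Hab.
    pose proof (mixed_partials W v _ _
      (fun a b => - sigma * dx (dy u) a b) (fun a b => - sigma * dy (dy u) a b)
      (fun a b => sigma * dx (dx u) a b) (fun a b => sigma * dy (dx u) a b)
      HO Sv Gv') as M.
    assert (M1 : grad_on W (fun a b => - sigma * dy u a b)
       (fun a b => - sigma * dx (dy u) a b) (fun a b => - sigma * dy (dy u) a b)).
    { intros a' b' Hab'. destruct (Guy a' b' Hab'). split; der; ring. }
    assert (M2 : grad_on W (fun a b => sigma * dx u a b)
       (fun a b => sigma * dx (dx u) a b) (fun a b => sigma * dy (dx u) a b)).
    { intros a' b' Hab'. destruct (Gux a' b' Hab'). split; der; ring. }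
    specialize (M M1 M2 a b Hab). cbv beta in M. nsz. }
  set (Gr := fun a b => A a b * c1 a b + C a b * c2 a b).
  set (Gi := fun a b => A a b * s1 a b + C a b * s2 a b).
  assert (HP : forall a b, W a b ->
    dx (dx u) a b = - (1/2) * (dx u a b * Gr a b - dy u a b * Gi a b) /\
    dy (dx u) a b = - (1/2) * (dx u a b * Gi a b + dy u a b * Gr a b)).
  { intros a b Hab. at_point FV HO a b Hab.
    destruct (grad_on_eq W
      (fun a b => dx u a b * (c1 a b + c2 a b) + dy u a b * (s1 a b + s2 a b)) (fun _ _ => 0)
      (fun a b => dx (dx u) a b * (c1 a b + c2 a b)
         + dx u a b * (s1 a b ^ 2 * A a b + s2 a b ^ 2 * C a b)
         + dx (dy u) a b * (s1 a b + s2 a b)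
         + dy u a b * (- (c1 a b * s1 a b * A a b) - (c2 a b * s2 a b * C a b)))
      (fun a b => dy (dx u) a b * (c1 a b + c2 a b)
         + dx u a b * (- (c1 a b * s1 a b * A a b) - (c2 a b * s2 a b * C a b))
         + dy (dy u) a b * (s1 a b + s2 a b)
         + dy u a b * (c1 a b ^ 2 * A a b + c2 a b ^ 2 * C a b))
      (fun _ _ => 0) (fun _ _ => 0) HO) with (x := a) (y := b) as [X1 X2]; auto.
    - intros a' b' Hab'. at_point FV HO a' b' Hab'.
      destruct (Gux a' b' Hab'), (Guy a' b' Hab'). split; der; ring.
    - intros a' b' Hab'. split; apply is_derive_Rconst.
    - pose proof (harm a b Hab) as h1. pose proof (Mu a b Hab) as h2.
      pose proof (HE a b Hab) as h3. cbv beta in X1, X2. rewrite <- h2 in X1.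
      replace (dy (dy u) a b) with (- dx (dx u) a b) in X2 by lra.
      unfold Gr, Gi.
      assert (P : (c1 a b + c2 a b) ^ 2 + (s1 a b + s2 a b) ^ 2 <> 0).
      { intros Z. apply S0. replace (c2 a b) with (- c1 a b) by nra.
        replace (s2 a b) with (- s1 a b) by nra. ring. }
      clear - X1 X2 h3 U1 U2 P.
      set (m := c1 a b + c2 a b) in *. set (n := s1 a b + s2 a b) in *.
      assert (L : exists l, dx u a b = - l * n /\ dy u a b = l * m).
      { exists ((dy u a b * m - dx u a b * n) / (m ^ 2 + n ^ 2)).
        split; apply Rmult_eq_reg_r with (m ^ 2 + n ^ 2); try exact P;
          field_simplify; try exact P; nsz. }
      destruct L as (l & L1 & L2). rewrite L1, L2 in X1, X2 |- *.
      apply (bisector_normal_gradient _ _ _ _ _ _ _ _ l U1 U2 P); fold m n; lra. }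
  set (P := fun a b => - (1/2) * (dx u a b * Gr a b - dy u a b * Gi a b)).
  set (Q := fun a b => - (1/2) * (dx u a b * Gi a b + dy u a b * Gr a b)).
  set (Grx := fun a b => dx A a b * c1 a b + A a b * (s1 a b ^ 2 * A a b)
                         + dx C a b * c2 a b + C a b * (s2 a b ^ 2 * C a b)).
  set (Gry := fun a b => dy A a b * c1 a b - A a b * (c1 a b * s1 a b * A a b)
                         + dy C a b * c2 a b - C a b * (c2 a b * s2 a b * C a b)).
  set (Gix := fun a b => dx A a b * s1 a b - A a b * (c1 a b * s1 a b * A a b)
                         + dx C a b * s2 a b - C a b * (c2 a b * s2 a b * C a b)).
  set (Giy := fun a b => dy A a b * s1 a b + A a b * (c1 a b ^ 2 * A a b)
                         + dy C a b * s2 a b + C a b * (c2 a b ^ 2 * C a b)).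
  set (Px := fun a b => - (1/2) * (dx (dx u) a b * Gr a b + dx u a b * Grx a b
                                   - dx (dy u) a b * Gi a b - dy u a b * Gix a b)).
  set (Py := fun a b => - (1/2) * (dy (dx u) a b * Gr a b + dx u a b * Gry a b
                                   - dy (dy u) a b * Gi a b - dy u a b * Giy a b)).
  set (Qx := fun a b => - (1/2) * (dx (dx u) a b * Gi a b + dx u a b * Gix a b
                                   + dx (dy u) a b * Gr a b + dy u a b * Grx a b)).
  set (Qy := fun a b => - (1/2) * (dy (dx u) a b * Gi a b + dx u a b * Giy a b
                                   + dy (dy u) a b * Gr a b + dy u a b * Gry a b)).
  assert (GA : grad_on W (dx u) P Q) by exact (grad_on_ext W _ _ _ _ _ HP Gux).
  assert (GB : grad_on W (dy u) Q (fun a b => - P a b)).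
  { refine (grad_on_ext W _ _ _ _ _ _ Guy). intros a b Hab.
    destruct (HP a b Hab) as [h1 h2]. pose proof (harm a b Hab). pose proof (Mu a b Hab).
    unfold P, Q. split; lra. }
  assert (GP : grad_on W P Px Py).
  { intros a b Hab. at_point FV HO a b Hab. destruct (Gux a b Hab), (Guy a b Hab).
    unfold P, Px, Py, Grx, Gry, Gix, Giy, Gr, Gi. split; der; ring. }
  assert (GQ : grad_on W Q Qx Qy).
  { intros a b Hab. at_point FV HO a b Hab. destruct (Gux a b Hab), (Guy a b Hab).
    unfold Q, Qx, Qy, Grx, Gry, Gix, Giy, Gr, Gi. split; der; ring. }
  pose proof (mixed_partials W (dx u) _ _ _ _ _ _ HO Sux GA GP GQ x y HWx) as M1.
  pose proof (mixed_partials W (dy u) _ _ _ _ _ _ HO Suy GB GQ (grad_on_opp W _ _ _ GP) x y HWx) as M2.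
  unfold Px, Py, Qx, Qy, Grx, Gry, Gix, Giy in M1, M2. clear GP GQ GA GB Px Py Qx Qy Grx Gry Gix Giy P Q.
  cbv beta in M1, M2. 
  destruct (HP x y HWx) as [h1 h2]. pose proof (harm x y HWx) as h3.
  pose proof (Mu x y HWx) as h4. pose proof (nz x y HWx) as h5.
  at_point FV HO x y HWx.
  unfold web_curvature.
  replace (dy (dy u) x y) with (- dx (dx u) x y) in * by lra.
  rewrite <- h4 in *. rewrite h1, h2 in M1, M2. unfold Gr, Gi in *.
  clear - M1 M2 h5 U1 U2 RA RC.
  set (a := dx u x y) in *. set (b := dy u x y) in *. clearbody a b.
  (* [X] is the Laplacian of a + b. The combination of the two integrability conditions with weights
     u_x and u_y yields |grad u|^2 X. *)
  set (X := c1 x y * dy A x y - s1 x y * dx A x y + (c2 x y * dy C x y - s2 x y * dx C x y)).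
  assert (HX : X = 0).
  { apply Rmult_eq_reg_l with (a ^ 2 + b ^ 2); [|exact h5]. rewrite Rmult_0_r.
    match type of M1 with ?P1 = ?Q1 => match type of M2 with ?P2 = ?Q2 =>
      transitivity (- 2 * a * (P1 - Q1) - 2 * b * (P2 - Q2));
      [unfold X; field | rewrite M1, M2; ring] end end. }
  clear M1 M2 h5. unfold X in HX. nsz.
Qed.

(** The Riccati equations give the derivative of A along e1 and of C along e2. Resolving e2 along e1
    and n1, and e1 along e2 and n2, leaves the normal derivatives of A and C; n1 and n2 have zero
    divergence, so the sum of these is the Laplacian of a + b. *)
Lemma web_curvature_rot (V : plane_set) L1 L2 N1 N2 c1 s1 A c2 s2 C x y :
  open_set V -> frame V L1 L2 N1 N2 c1 s1 A c2 s2 C -> V x y ->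
  web_curvature c1 s1 A c2 s2 C x y =
  (c1 x y * s2 x y - s1 x y * c2 x y) *
  (c1 x y * dy A x y - s1 x y * dx A x y + (c2 x y * dy C x y - s2 x y * dx C x y)).
Proof. intros HO F HV. at_point F HO x y HV. unfold web_curvature. nsz. Qed.

(** The direction angle of (bm, bn) is (a + b) / 2, whence the halves. The derivatives are found
    without an angle function, from the unit length and from the parallelism with e1 + e2. *)
Lemma frame_bisector (V : plane_set) L1 L2 N1 N2 c1 s1 A c2 s2 C :
  open_set V -> frame V L1 L2 N1 N2 c1 s1 A c2 s2 C ->
  exists w bm bn, smooth_on V bm /\ smooth_on V bn /\
    (forall x y, V x y -> 0 < w x y /\ bm x y ^ 2 + bn x y ^ 2 = 1 /\
       c1 x y + c2 x y = w x y * bm x y /\ s1 x y + s2 x y = w x y * bn x y) /\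
    grad_on V bm
      (fun x y => bn x y * (A x y * s1 x y + C x y * s2 x y) / 2)
      (fun x y => - (bn x y * (A x y * c1 x y + C x y * c2 x y) / 2)) /\
    grad_on V bn
      (fun x y => - (bm x y * (A x y * s1 x y + C x y * s2 x y) / 2))
      (fun x y => bm x y * (A x y * c1 x y + C x y * c2 x y) / 2).
Proof.
  intros HO F. destruct (frame_smooth F) as ((Sc1 & Ss1 & SA & Sc2 & Ss2 & SC) & _).
  set (M := fun x y => (c1 x y + c2 x y) ^ 2 + (s1 x y + s2 x y) ^ 2).
  assert (MP : forall x y, V x y -> 0 < M x y).
  { intros x y HV. at_point F HO x y HV. unfold M.
    pose proof (pow2_ge_0 (c1 x y + c2 x y)). pose proof (pow2_ge_0 (s1 x y + s2 x y)).
    destruct (Rle_lt_or_eq_dec 0 ((c1 x y + c2 x y) ^ 2 + (s1 x y + s2 x y) ^ 2)); [lra|assumption|].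
    exfalso. apply S0. replace (c2 x y) with (- c1 x y) by nra.
    replace (s2 x y) with (- s1 x y) by nra. ring. }
  set (w := fun x y => sqrt (M x y)).
  assert (SM : smooth_on V M) by (unfold M; smooth).
  assert (Sw : smooth_on V w) by (unfold w; smooth).
  assert (wP : forall x y, V x y -> 0 < w x y) by (intros; now apply sqrt_lt_R0, MP).
  assert (w2 : forall x y, V x y -> w x y ^ 2 = M x y)
    by (intros x y HV; apply pow2_sqrt; left; now apply MP).
  assert (w0 : forall x y, V x y -> w x y <> 0) by (intros x y HV; pose proof (wP x y HV); lra).
  clearbody w.
  set (bm := fun x y => (c1 x y + c2 x y) / w x y). set (bn := fun x y => (s1 x y + s2 x y) / w x y).
  assert (Sm : smooth_on V bm) by (unfold bm; smooth).
  assert (Sn : smooth_on V bn) by (unfold bn; smooth).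
  assert (Em : forall x y, V x y -> c1 x y + c2 x y = w x y * bm x y)
    by (intros x y HV; unfold bm; field; auto).
  assert (En : forall x y, V x y -> s1 x y + s2 x y = w x y * bn x y)
    by (intros x y HV; unfold bn; field; auto).
  clearbody bm bn.
  assert (Ub : forall x y, V x y -> bm x y ^ 2 + bn x y ^ 2 = 1).
  { intros x y HV. apply Rmult_eq_reg_l with (w x y ^ 2); [|apply pow_nonzero; auto].
    rewrite Rmult_1_r. rewrite (w2 x y HV) at 2. unfold M. rewrite (Em x y HV), (En x y HV). ring. }
  exists w, bm, bn. split; [exact Sm|]. split; [exact Sn|]. split; [auto|].
  destruct (smooth_on_grad V bm Sm) as (Gm & _). destruct (smooth_on_grad V bn Sn) as (Gn & _).
  assert (K : forall x y, V x y ->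
    (dx bm x y = bn x y * (A x y * s1 x y + C x y * s2 x y) / 2 /\
     dy bm x y = - (bn x y * (A x y * c1 x y + C x y * c2 x y) / 2)) /\
    (dx bn x y = - (bm x y * (A x y * s1 x y + C x y * s2 x y) / 2) /\
     dy bn x y = bm x y * (A x y * c1 x y + C x y * c2 x y) / 2)).
  { intros x y HV.
    destruct (grad_on_eq V (fun x y => bm x y ^ 2 + bn x y ^ 2) (fun _ _ => 1)
      (fun x y => 2 * (bm x y * dx bm x y + bn x y * dx bn x y))
      (fun x y => 2 * (bm x y * dy bm x y + bn x y * dy bn x y))
      (fun _ _ => 0) (fun _ _ => 0) HO) with (x := x) (y := y) as [X1 X2]; auto.
    { intros a b Hab. destruct (Gm a b Hab), (Gn a b Hab). split; der; ring. }
    { intros a b Hab. split; apply is_derive_Rconst. }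
    destruct (grad_on_eq V
      (fun x y => bm x y * (s1 x y + s2 x y) - bn x y * (c1 x y + c2 x y)) (fun _ _ => 0)
      (fun x y => dx bm x y * (s1 x y + s2 x y)
         + bm x y * (- (c1 x y * s1 x y * A x y) - c2 x y * s2 x y * C x y)
         - dx bn x y * (c1 x y + c2 x y)
         - bn x y * (s1 x y ^ 2 * A x y + s2 x y ^ 2 * C x y))
      (fun x y => dy bm x y * (s1 x y + s2 x y)
         + bm x y * (c1 x y ^ 2 * A x y + c2 x y ^ 2 * C x y)
         - dy bn x y * (c1 x y + c2 x y)
         - bn x y * (- (c1 x y * s1 x y * A x y) - c2 x y * s2 x y * C x y))
      (fun _ _ => 0) (fun _ _ => 0) HO) with (x := x) (y := y) as [Y1 Y2]; auto.
    { intros a b Hab. at_point F HO a b Hab. destruct (Gm a b Hab), (Gn a b Hab).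
      split; der; ring. }
    { intros a b Hab. split; apply is_derive_Rconst. }
    { intros a b Hab. rewrite (Em a b Hab), (En a b Hab). ring. }
    cbv beta in X1, X2, Y1, Y2. at_point F HO x y HV.
    pose proof (Ub x y HV) as U. pose proof (Em x y HV) as m1. pose proof (En x y HV) as n1.
    pose proof (w0 x y HV) as W0.
    assert (T : forall p q, 2 * (bm x y * p + bn x y * q) = 0 ->
        p = - bn x y * (bm x y * q - bn x y * p) /\ q = bm x y * (bm x y * q - bn x y * p)).
    { intros p q E. split; nsz. }
    destruct (T _ _ X1) as [Tx1 Tx2]. destruct (T _ _ X2) as [Ty1 Ty2].
    set (tx := bm x y * dx bn x y - bn x y * dx bm x y) in *.
    set (ty := bm x y * dy bn x y - bn x y * dy bm x y) in *.
    (* The two unit vectors are mirror images in the bisector, so each of them projects onto it with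
       half the length of their sum. *)
    assert (I : forall c s c' s' v, c ^ 2 + s ^ 2 = 1 -> c' ^ 2 + s' ^ 2 = 1 ->
       bm x y ^ 2 + bn x y ^ 2 = 1 -> c + c' = v * bm x y -> s + s' = v * bn x y -> v <> 0 ->
       2 * (bm x y * c + bn x y * s) = v).
    { intros c s c' s' v e1 e2 e3 e4 e5 e6. apply Rmult_eq_reg_l with v; [|exact e6]. 
      replace (v * (2 * (bm x y * c + bn x y * s)))
        with (2 * (v * bm x y * c + v * bn x y * s)) by ring.
      rewrite <- e4, <- e5. nsz. }
    pose proof (I _ _ _ _ _ U1 U2 U m1 n1 W0) as I1.
    assert (m2 : c2 x y + c1 x y = w x y * bm x y) by lra.
    assert (n2 : s2 x y + s1 x y = w x y * bn x y) by lra.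
    pose proof (I _ _ _ _ _ U2 U1 U m2 n2 W0) as I2. clear I T m2 n2.
    rewrite Tx1, Tx2, m1, n1 in Y1. rewrite Ty1, Ty2, m1, n1 in Y2.
    assert (Vx : tx = - (A x y * s1 x y + C x y * s2 x y) / 2).
    { apply Rmult_eq_reg_l with (w x y); [|exact W0].
      transitivity (- (A x y * s1 x y * (bm x y * c1 x y + bn x y * s1 x y)
                       + C x y * s2 x y * (bm x y * c2 x y + bn x y * s2 x y))).
      - clear - Y1 U. nsz.
      - replace (bm x y * c1 x y + bn x y * s1 x y) with (w x y / 2) by lra.
        replace (bm x y * c2 x y + bn x y * s2 x y) with (w x y / 2) by lra. field. }
    assert (Vy : ty = (A x y * c1 x y + C x y * c2 x y) / 2).
    { apply Rmult_eq_reg_l with (w x y); [|exact W0].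
      transitivity ((A x y * c1 x y * (bm x y * c1 x y + bn x y * s1 x y)
                       + C x y * c2 x y * (bm x y * c2 x y + bn x y * s2 x y))).
      - clear - Y2 U. nsz.
      - replace (bm x y * c1 x y + bn x y * s1 x y) with (w x y / 2) by lra.
        replace (bm x y * c2 x y + bn x y * s2 x y) with (w x y / 2) by lra. field. }
    rewrite Tx1, Tx2, Ty1, Ty2, Vx, Vy. repeat split; field. }
  split; (refine (grad_on_ext V _ _ _ _ _ _ _); [|eassumption]); intros x y HV; now apply K.
Qed.

(** As 3 / 4 exceeds cos 45°, both vectors deviate from the third by less than 45°. Numerically, the
    product of the cosines exceeds 9/16, whereas that of the sines is below 7/16 in absolute
    value. *)
Lemma unit_acute (a b a' b' a0 b0 : R) :
  a ^ 2 + b ^ 2 = 1 -> a' ^ 2 + b' ^ 2 = 1 -> a0 ^ 2 + b0 ^ 2 = 1 ->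
  3 / 4 < a * a0 + b * b0 -> 3 / 4 < a' * a0 + b' * b0 -> 0 < a * a' + b * b'.
Proof.
  intros U U' U0 P P'.
  set (p := a * a0 + b * b0) in *. set (p' := a' * a0 + b' * b0) in *.
  set (q := a * b0 - b * a0). set (q' := a' * b0 - b' * a0).
  assert (E : a * a' + b * b' = p * p' + q * q') by (unfold p, p', q, q'; nsz).
  assert (Q : p ^ 2 + q ^ 2 = 1) by (unfold p, q; nsz).
  assert (Q' : p' ^ 2 + q' ^ 2 = 1) by (unfold p', q'; nsz).
  rewrite E. clearbody p p' q q'. clear E U U' U0.
  assert (9/16 < p * p') by nra.
  assert (- (q * q') <= (q ^ 2 + q' ^ 2) / 2) by (pose proof (pow2_ge_0 (q + q')); nra).
  nra.
Qed.

(** The chord lies in the disc because the squared distance to the center is convex along it. This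
    serves the injectivity of the isothermal chart. *)
Lemma segment_rolle (x0 y0 r : R) f fx fy x y x' y' :
  let V := open_disc x0 y0 r in
  0 < r -> smooth_on V f -> grad_on V f fx fy -> V x y -> V x' y' -> f x y = f x' y' ->
  exists a b, V a b /\ fx a b * (x' - x) + fy a b * (y' - y) = 0.
Proof.
  intros V Hr Sf G HV HV' E.
  pose proof (open_disc_open x0 y0 r : open_set V) as HO.
  set (gx := fun t => x + t * (x' - x)). set (gy := fun t => y + t * (y' - y)).
  assert (HG : forall t, 0 <= t <= 1 -> V (gx t) (gy t)).
  { intros t Ht. unfold V, open_disc, gx, gy in *.
    set (a := x - x0) in *. set (b := y - y0) in *. set (a' := x' - x0) in *. set (b' := y' - y0) in *.
    replace (x + t * (x' - x) - x0) with ((1 - t) * a + t * a') by (unfold a, a'; ring).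
    replace (y + t * (y' - y) - y0) with ((1 - t) * b + t * b') by (unfold b, b'; ring).
    assert (K : ((1 - t) * a + t * a') ^ 2 + ((1 - t) * b + t * b') ^ 2
       <= (1 - t) * (a ^ 2 + b ^ 2) + t * (a' ^ 2 + b' ^ 2)).
    { assert (0 <= t * (1 - t) * ((a - a') ^ 2 + (b - b') ^ 2)).
      { apply Rmult_le_pos; [nra|]. pose proof (pow2_ge_0 (a - a')). pose proof (pow2_ge_0 (b - b')). lra. }
      nra. }
    destruct (Rle_lt_or_eq_dec 0 t) as [Hl|Hl]; [lra| |]; nra. }
  assert (DG : forall t, 0 <= t <= 1 -> is_derive (fun u => f (gx u) (gy u)) t
      (fx (gx t) (gy t) * (x' - x) + fy (gx t) (gy t) * (y' - y))).
  { intros t Ht. apply (smooth_is_derive_comp V); auto; unfold gx, gy; der; ring. }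
  destruct (MVT_gen (fun u => f (gx u) (gy u)) 0 1
     (fun t => fx (gx t) (gy t) * (x' - x) + fy (gx t) (gy t) * (y' - y))) as (c & Hc & Ec).
  - intros t Ht. rewrite Rmin_left, Rmax_right in Ht by lra. apply DG. lra.
  - intros t Ht. rewrite Rmin_left, Rmax_right in Ht by lra.
    eapply is_derive_continuity_pt. apply DG. lra.
  - rewrite Rmin_left, Rmax_right in Hc by lra. exists (gx c), (gy c). split; [auto|].
    cbv beta in Ec.
    replace (gx 1) with x' in Ec by (unfold gx; ring).
    replace (gy 1) with y' in Ec by (unfold gy; ring).
    replace (gx 0) with x in Ec by (unfold gx; ring).
    replace (gy 0) with y in Ec by (unfold gy; ring).
    lra.
Qed.

(** In complex terms v + i u is a primitive of exp (- (kap + i (a + b)) / 2), where the gradient of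
    [kap] is conjugate to that of a + b. *)
Lemma curvature_zero_flat (x0 y0 r : R) L1 L2 N1 N2 c1 s1 A c2 s2 C :
  let V := open_disc x0 y0 r in
  0 < r -> frame V L1 L2 N1 N2 c1 s1 A c2 s2 C ->
  (forall x y, V x y -> web_curvature c1 s1 A c2 s2 C x y = 0) ->
  exists q u v, 0 < q <= r /\
    isothermal (open_disc x0 y0 q) u v /\
    first_integral (open_disc x0 y0 q) N1 u /\ first_integral (open_disc x0 y0 q) N2 v.
Proof.
  intros V Hr F HC.
  pose proof (open_disc_open x0 y0 r : open_set V) as HO.
  destruct (frame_smooth F) as ((Sc1 & Ss1 & SA & Sc2 & Ss2 & SC) & _).
  destruct (frame_bisector V _ _ _ _ _ _ _ _ _ _ HO F) as (w & bm & bn & Sm & Sn & HB & Gm & Gn).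
  set (Gr := fun x y => A x y * c1 x y + C x y * c2 x y) in *.
  set (Gi := fun x y => A x y * s1 x y + C x y * s2 x y) in *.
  destruct (poincare_disc x0 y0 r Gr Gi
    (fun x y => dy A x y * c1 x y - A x y * (c1 x y * s1 x y * A x y)
                     + dy C x y * c2 x y - C x y * (c2 x y * s2 x y * C x y))
    (fun x y => dx A x y * s1 x y - A x y * (c1 x y * s1 x y * A x y)
                     + dx C x y * s2 x y - C x y * (c2 x y * s2 x y * C x y)))
    as (kap & Sk & Gk); try assumption.
  { unfold Gr; smooth. }
  { unfold Gi; smooth. }
  { intros x y HV. at_point F HO x y HV. unfold Gr. der. ring. }
  { intros x y HV. at_point F HO x y HV. unfold Gi. der. ring. }
  { intros x y HV. pose proof (HC x y HV) as E.
    rewrite (web_curvature_rot V _ _ _ _ _ _ _ _ _ _ x y HO F HV) in E.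
    pose proof (fr_S F x y HV) as S0.
    apply Rmult_integral in E. destruct E as [E|E]; [contradiction|]. lra. }
  (* The modulus of G^(-1/2); its argument is already provided by (bm, - bn). *)
  set (E := fun x y => exp (- (1 / 2) * kap x y)).
  assert (SE : smooth_on V E) by (unfold E; smooth).
  assert (GE : grad_on V E (fun x y => - (Gr x y / 2) * E x y) (fun x y => - (Gi x y / 2) * E x y)).
  { intros x y HV. destruct (Gk x y HV). unfold E. split; der; field. }
  assert (EP : forall x y, 0 < E x y) by (intros; apply exp_pos).
  clearbody E. clear Gk Sk kap.
  destruct (poincare_disc x0 y0 r (fun x y => - (E x y * bn x y)) (fun x y => E x y * bm x y)
    (fun x y => - (- (Gi x y / 2) * E x y * bn x y + E x y * (bm x y * Gr x y / 2)))
    (fun x y => - (Gr x y / 2) * E x y * bm x y + E x y * (bn x y * Gi x y / 2)))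
    as (u & Su & Gu); try assumption; try smooth.
  { intros x y HV. destruct (GE x y HV), (Gm x y HV), (Gn x y HV). der. unfold Gr. ring. }
  { intros x y HV. destruct (GE x y HV), (Gm x y HV), (Gn x y HV). der. unfold Gi. ring. }
  { intros x y HV. field. }
  destruct (poincare_disc x0 y0 r (fun x y => E x y * bm x y) (fun x y => E x y * bn x y)
    (fun x y => - (Gi x y / 2) * E x y * bm x y + E x y * - (bn x y * Gr x y / 2))
    (fun x y => - (Gr x y / 2) * E x y * bn x y + E x y * - (bm x y * Gi x y / 2)))
    as (v & Sv & Gv); try assumption; try smooth.
  { intros x y HV. destruct (GE x y HV), (Gm x y HV), (Gn x y HV). der. unfold Gr. ring. }
  { intros x y HV. destruct (GE x y HV), (Gm x y HV), (Gn x y HV). der. unfold Gi. ring. }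
  { intros x y HV. field. }
  pose proof (open_disc_center x0 y0 r Hr : V x0 y0) as V0.
  (* On the smaller disc the bisector direction turns by less than 45° from its value at the center,
     which will give injectivity. *)
  assert (LW : locally_2d (fun x y => V x y /\
      0 < bm x y * bm x0 y0 + bn x y * bn x0 y0 - 3 / 4) x0 y0).
  { apply locally_2d_and; [now apply HO|].
    apply (continuity_2d_pt_pos (fun x y => bm x y * bm x0 y0 + bn x y * bn x0 y0 - 3 / 4)).
    - cont2d; now apply (smooth_on_continuity V).
    - pose proof (HB x0 y0 V0). nra. }
  apply locally_2d_disc in LW. destruct LW as (q0 & Hq0 & HW0).
  set (q := Rmin q0 r).
  assert (Hq : 0 < q <= r) by (split; [apply Rmin_glb_lt; assumption|apply Rmin_r]).
  assert (HW : forall x y, open_disc x0 y0 q x y -> V x y /\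
      0 < bm x y * bm x0 y0 + bn x y * bn x0 y0 - 3 / 4).
  { intros x y Hxy. apply HW0. revert Hxy. apply open_disc_mono. split; [apply Hq|apply Rmin_l]. }
  exists q, u, v. split; [exact Hq|]. set (W := open_disc x0 y0 q) in *.
  assert (WV : forall x y, W x y -> V x y) by (intros; now apply HW).
  pose proof (grad_on_dx V _ _ _ Gu) as Du. pose proof (grad_on_dx V _ _ _ Gv) as Dv.
  cbv beta in Du, Dv.
  split; [|split].
  - split; [now apply (smooth_on_sub V)|]. split; [now apply (smooth_on_sub V)|]. split.
    + intros x y x' y' HV HV' Eu Ev.
      destruct (segment_rolle x0 y0 q u _ _ x y x' y' (proj1 Hq) (smooth_on_sub _ _ _ WV Su)
                  (grad_on_sub _ _ _ _ _ WV Gu) HV HV' Eu) as (a & b & Hab & K1).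
      destruct (segment_rolle x0 y0 q v _ _ x y x' y' (proj1 Hq) (smooth_on_sub _ _ _ WV Sv)
                  (grad_on_sub _ _ _ _ _ WV Gv) HV HV' Ev) as (a' & b' & Hab' & K2).
      destruct (HW _ _ Hab) as [Va Pa]. destruct (HW _ _ Hab') as [Va' Pa'].
      destruct (HB _ _ Va) as (_ & Ua & _). destruct (HB _ _ Va') as (_ & Ua' & _).
      destruct (HB _ _ V0) as (_ & U0 & _).
      (* Equal values of u and of v at two points would make the chord parallel to the bisector at
         one of its points and orthogonal to the bisector at another, although the two bisector
         directions form an acute angle. *)
      assert (PP : 0 < bm a b * bm a' b' + bn a b * bn a' b').
      { apply (unit_acute _ _ _ _ _ _ Ua Ua' U0); lra. }
      pose proof (EP a b) as P1. pose proof (EP a' b') as P2.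
      assert (T1 : - bn a b * (x' - x) + bm a b * (y' - y) = 0).
      { apply Rmult_eq_reg_l with (E a b); lra. }
      assert (T2 : bm a' b' * (x' - x) + bn a' b' * (y' - y) = 0).
      { apply Rmult_eq_reg_l with (E a' b'); lra. }
      assert (X : (x' - x) * (bm a b * bm a' b' + bn a b * bn a' b') = 0).
      { transitivity (bm a b * (bm a' b' * (x' - x) + bn a' b' * (y' - y))
           - bn a' b' * (- bn a b * (x' - x) + bm a b * (y' - y))); [ring|].
        rewrite T1, T2. ring. }
      assert (Y : (y' - y) * (bm a b * bm a' b' + bn a b * bn a' b') = 0).
      { transitivity (bn a b * (bm a' b' * (x' - x) + bn a' b' * (y' - y))
           + bm a' b' * (- bn a b * (x' - x) + bm a b * (y' - y))); [ring|].
        rewrite T1, T2. ring. }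
      apply Rmult_integral in X. apply Rmult_integral in Y.
      destruct X, Y; split; lra.
    + intros x y Hxy. destruct (Du x y (WV x y Hxy)) as [-> ->].
      destruct (Dv x y (WV x y Hxy)) as [-> ->].
      destruct (HB _ _ (WV x y Hxy)) as (_ & U & _). pose proof (EP x y).
      assert (0 < E x y ^ 2) by (apply pow_lt; assumption).
      split; [|split]; [ring|ring|].
      replace ((- (E x y * bn x y)) ^ 2 + (E x y * bm x y) ^ 2)
        with (E x y ^ 2 * (bm x y ^ 2 + bn x y ^ 2)) by ring. rewrite U. lra.
  - split; [now apply (smooth_on_sub V)|].
    intros x y Hxy. destruct (Du x y (WV x y Hxy)) as [-> ->].
    destruct (HB _ _ (WV x y Hxy)) as (wP & U & Em & En). pose proof (EP x y). split.
    + intros Z. injection Z as Z1 Z2. assert (bn x y = 0) by nra. assert (bm x y = 0) by nra. nra.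
    + intros vx vy. rewrite (fr_N1 F _ _ vx vy (WV x y Hxy)), Em, En.
      replace (w x y * bm x y * vy - w x y * bn x y * vx)
        with (w x y * (bm x y * vy - bn x y * vx)) by ring.
      replace (- (E x y * bn x y) * vx + E x y * bm x y * vy)
        with (E x y * (bm x y * vy - bn x y * vx)) by ring.
      split; intros Z; apply Rmult_integral in Z; destruct Z as [Z|Z]; try lra; rewrite Z; ring.
  - split; [now apply (smooth_on_sub V)|].
    intros x y Hxy. destruct (Dv x y (WV x y Hxy)) as [-> ->].
    destruct (HB _ _ (WV x y Hxy)) as (wP & U & Em & En). pose proof (EP x y). split.
    + intros Z. injection Z as Z1 Z2. assert (bn x y = 0) by nra. assert (bm x y = 0) by nra. nra.
    + intros vx vy. rewrite (fr_N2 F _ _ vx vy (WV x y Hxy)).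
      at_point F HO x y (WV x y Hxy).
      (* e1 - e2 is orthogonal to e1 + e2 *)
      assert (Z0 : (c1 x y - c2 x y) * bm x y + (s1 x y - s2 x y) * bn x y = 0).
      { apply Rmult_eq_reg_l with (w x y); [|lra]. rewrite Rmult_0_r.
        transitivity ((c1 x y - c2 x y) * (w x y * bm x y) + (s1 x y - s2 x y) * (w x y * bn x y)); [ring|].
        rewrite <- Em, <- En. clear Em En. nsz. }
      set (l := - (c1 x y - c2 x y) * bn x y + (s1 x y - s2 x y) * bm x y).
      assert (l1 : c1 x y - c2 x y = - l * bn x y) by (unfold l; nsz).
      assert (l2 : s1 x y - s2 x y = l * bm x y) by (unfold l; nsz).
      assert (l0 : l <> 0).
      { intros Z. rewrite Z in l1, l2. apply S0. replace (c2 x y) with (c1 x y) by lra.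
        replace (s2 x y) with (s1 x y) by lra. ring. }
      rewrite l1, l2.
      replace (- l * bn x y * vy - l * bm x y * vx)
        with (- l * (bm x y * vx + bn x y * vy)) by ring.
      replace (E x y * bm x y * vx + E x y * bn x y * vy)
        with (E x y * (bm x y * vx + bn x y * vy)) by ring.
      split; intros Z; apply Rmult_integral in Z; destruct Z as [Z|Z]; try lra; rewrite Z; ring.
Qed.

(** * Hexagonality and Abelian relations *)

(** The hypotheses say that phi n1 and phi n2 are closed, n_i = (- s_i, c_i). As e1 and e2 have
    divergences A and C, this prescribes the derivatives of phi along e1 and e2, hence its
    gradient. *)
Lemma closed_pair_grad (V : plane_set) L1 L2 N1 N2 c1 s1 A c2 s2 C phi :
  open_set V -> frame V L1 L2 N1 N2 c1 s1 A c2 s2 C -> smooth_on V phi ->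
  (forall x y, V x y -> dx (fun x y => phi x y * c1 x y) x y
                        + dy (fun x y => phi x y * s1 x y) x y = 0) ->
  (forall x y, V x y -> dx (fun x y => phi x y * c2 x y) x y
                        + dy (fun x y => phi x y * s2 x y) x y = 0) ->
  grad_on V phi
    (fun x y => - (phi x y * (A x y * s2 x y - C x y * s1 x y)
                   / (c1 x y * s2 x y - s1 x y * c2 x y)))
    (fun x y => phi x y * (A x y * c2 x y - C x y * c1 x y)
                / (c1 x y * s2 x y - s1 x y * c2 x y)).
Proof.
  intros HO F Sp H1 H2. destruct (smooth_on_grad V phi Sp) as (G & _).
  refine (grad_on_ext V _ _ _ _ _ _ G). intros x y HV.
  specialize (H1 x y HV). specialize (H2 x y HV). at_point F HO x y HV.
  destruct (G x y HV).
  assert (E1 : dx (fun x y => phi x y * c1 x y) x y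
     = dx phi x y * c1 x y + phi x y * (s1 x y ^ 2 * A x y))
    by (apply is_derive_unique; der; ring).
  assert (E2 : dy (fun x y => phi x y * s1 x y) x y
     = dy phi x y * s1 x y + phi x y * (c1 x y ^ 2 * A x y))
    by (apply is_derive_unique; der; ring).
  assert (E3 : dx (fun x y => phi x y * c2 x y) x y
     = dx phi x y * c2 x y + phi x y * (s2 x y ^ 2 * C x y))
    by (apply is_derive_unique; der; ring).
  assert (E4 : dy (fun x y => phi x y * s2 x y) x y
     = dy phi x y * s2 x y + phi x y * (c2 x y ^ 2 * C x y))
    by (apply is_derive_unique; der; ring).
  rewrite E1, E2 in H1. rewrite E3, E4 in H2.
  assert (T1 : dx phi x y * c1 x y + dy phi x y * s1 x y = - phi x y * A x y).
  { assert (phi x y * A x y * (c1 x y ^ 2 + s1 x y ^ 2) = phi x y * A x y)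
      by (rewrite U1; ring). lra. }
  assert (T2 : dx phi x y * c2 x y + dy phi x y * s2 x y = - phi x y * C x y).
  { assert (phi x y * C x y * (c2 x y ^ 2 + s2 x y ^ 2) = phi x y * C x y)
      by (rewrite U2; ring). lra. }
  split; (eapply Rmult_eq_reg_r; [|exact S0]); field_simplify; try exact S0; nsz.
Qed.

(** The curvature is the obstruction to integrating the logarithmic gradient of phi. Since phi may
    vanish, Schwarz's theorem is applied to phi itself, and the factor phi remains in the
    conclusion. *)
Lemma closed_pair_curvature (V : plane_set) L1 L2 N1 N2 c1 s1 A c2 s2 C phi :
  open_set V -> frame V L1 L2 N1 N2 c1 s1 A c2 s2 C -> smooth_on V phi ->
  (forall x y, V x y -> dx (fun x y => phi x y * c1 x y) x y
                        + dy (fun x y => phi x y * s1 x y) x y = 0) ->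
  (forall x y, V x y -> dx (fun x y => phi x y * c2 x y) x y
                        + dy (fun x y => phi x y * s2 x y) x y = 0) ->
  forall x y, V x y -> phi x y * web_curvature c1 s1 A c2 s2 C x y = 0.
Proof.
  intros HO F Sp H1 H2 x y HV.
  pose proof (closed_pair_grad V _ _ _ _ _ _ _ _ _ _ phi HO F Sp H1 H2) as G.
  set (S := fun x y => c1 x y * s2 x y - s1 x y * c2 x y).
  set (K := fun x y => c1 x y * c2 x y + s1 x y * s2 x y).
  set (g := fun x y => A x y * s2 x y - C x y * s1 x y).
  set (h := fun x y => A x y * c2 x y - C x y * c1 x y).
  set (Sx := fun x y => K x y * (A x y * s1 x y - C x y * s2 x y)).
  set (Sy := fun x y => K x y * (C x y * c2 x y - A x y * c1 x y)).
  change (grad_on V phi (fun x y => - (phi x y * g x y / S x y))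
            (fun x y => phi x y * h x y / S x y)) in G.
  set (gx := fun x y => dx A x y * s2 x y - A x y * (c2 x y * s2 x y * C x y)
                        - (dx C x y * s1 x y - C x y * (c1 x y * s1 x y * A x y))).
  set (gy := fun x y => dy A x y * s2 x y + A x y * (c2 x y ^ 2 * C x y)
                        - (dy C x y * s1 x y + C x y * (c1 x y ^ 2 * A x y))).
  set (hx := fun x y => dx A x y * c2 x y + A x y * (s2 x y ^ 2 * C x y)
                        - (dx C x y * c1 x y + C x y * (s1 x y ^ 2 * A x y))).
  set (hy := fun x y => dy A x y * c2 x y - A x y * (c2 x y * s2 x y * C x y)
                        - (dy C x y * c1 x y - C x y * (c1 x y * s1 x y * A x y))).
  assert (GS : grad_on V S Sx Sy).
  { intros a b Hab. at_point F HO a b Hab. unfold S, Sx, Sy, K.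
    split; der; [clear - U1 U2|clear - U1 U2]; nsz. }
  assert (Gg : grad_on V g gx gy).
  { intros a b Hab. at_point F HO a b Hab. unfold g, gx, gy. split; der; ring. }
  assert (Gh : grad_on V h hx hy).
  { intros a b Hab. at_point F HO a b Hab. unfold h, hx, hy. split; der; ring. }
  assert (HS : forall a b, V a b -> S a b <> 0) by apply F.
  pose proof (mixed_partials V phi _ _
    (fun x y => - ((- (phi x y * g x y / S x y) * g x y + phi x y * gx x y) / S x y
               - phi x y * g x y * Sx x y / S x y ^ 2))
    (fun x y => - ((phi x y * h x y / S x y * g x y + phi x y * gy x y) / S x y
               - phi x y * g x y * Sy x y / S x y ^ 2))
    (fun x y => (- (phi x y * g x y / S x y) * h x y + phi x y * hx x y) / S x y
               - phi x y * h x y * Sx x y / S x y ^ 2)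
    (fun x y => (phi x y * h x y / S x y * h x y + phi x y * hy x y) / S x y
               - phi x y * h x y * Sy x y / S x y ^ 2)
    HO Sp G) as M.
  assert (M1 : grad_on V (fun x y => - (phi x y * g x y / S x y))
    (fun x y => - ((- (phi x y * g x y / S x y) * g x y + phi x y * gx x y) / S x y
               - phi x y * g x y * Sx x y / S x y ^ 2))
    (fun x y => - ((phi x y * h x y / S x y * g x y + phi x y * gy x y) / S x y
               - phi x y * g x y * Sy x y / S x y ^ 2))).
  { intros a b Hab. destruct (G a b Hab), (Gg a b Hab), (GS a b Hab). pose proof (HS a b Hab).
    split; der; auto; field; auto. }
  assert (M2 : grad_on V (fun x y => phi x y * h x y / S x y)
    (fun x y => (- (phi x y * g x y / S x y) * h x y + phi x y * hx x y) / S x y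
               - phi x y * h x y * Sx x y / S x y ^ 2)
    (fun x y => (phi x y * h x y / S x y * h x y + phi x y * hy x y) / S x y
               - phi x y * h x y * Sy x y / S x y ^ 2)).
  { intros a b Hab. destruct (G a b Hab), (Gh a b Hab), (GS a b Hab). pose proof (HS a b Hab).
    split; der; auto; field; auto. }
  specialize (M M1 M2 x y HV). cbv beta in M. pose proof (HS x y HV) as S0'.
  assert (E : phi x y * (gy x y * S x y - g x y * Sy x y + hx x y * S x y - h x y * Sx x y) = 0).
  { apply Rmult_eq_reg_r with (/ S x y ^ 2); [|apply Rinv_neq_0_compat, pow_nonzero; exact S0'].
    rewrite Rmult_0_l.
    match type of M with ?P = ?Q => transitivity (Q - P); [field; exact S0'|rewrite M; ring] end. }
  at_point F HO x y HV.
  assert (I : gy x y * S x y - g x y * Sy x y + hx x y * S x y - h x y * Sx x y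
              = S x y * web_curvature c1 s1 A c2 s2 C x y).
  { transitivity (S x y * (gy x y + hx x y) - (g x y * Sy x y + h x y * Sx x y)); [ring|].
    assert (I1 : gy x y + hx x y = c2 x y * dx A x y + s2 x y * dy A x y
              - (c1 x y * dx C x y + s1 x y * dy C x y)).
    { unfold gy, hx. clear - U1 U2. nsz. }
    rewrite I1. unfold web_curvature, g, h, Sx, Sy, K, S. ring. }
  rewrite I in E.
  apply Rmult_eq_reg_l with (S x y); [|exact S0']. lra.
Qed.

(** Without curvature the logarithm of a common integrating factor phi exists, and phi n1 = dp, phi
    n2 = dq. The normals of e1 + e2 and e1 - e2 are n1 + n2 and n1 - n2, so the same phi integrates
    all four foliations. *)
Lemma curvature_zero_parallel (x0 y0 r : R) L1 L2 N1 N2 c1 s1 A c2 s2 C :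
  let V := open_disc x0 y0 r in
  0 < r -> frame V L1 L2 N1 N2 c1 s1 A c2 s2 C ->
  (forall x y, V x y -> web_curvature c1 s1 A c2 s2 C x y = 0) ->
  exists p q, 
    first_integral V L1 p /\ first_integral V L2 q /\
    first_integral V N1 (fun x y => p x y + 1 * q x y) /\
    first_integral V N2 (fun x y => p x y + - 1 * q x y) /\
    (forall x y, V x y -> dx p x y * dy q x y - dy p x y * dx q x y <> 0).
Proof.
  intros V Hr F HC.
  pose proof (open_disc_open x0 y0 r : open_set V) as HO.
  destruct (frame_smooth F) as ((Sc1 & Ss1 & SA & Sc2 & Ss2 & SC) & _).
  set (S := fun x y => c1 x y * s2 x y - s1 x y * c2 x y).
  set (K := fun x y => c1 x y * c2 x y + s1 x y * s2 x y).
  set (g := fun x y => A x y * s2 x y - C x y * s1 x y).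
  set (h := fun x y => A x y * c2 x y - C x y * c1 x y).
  set (Sx := fun x y => K x y * (A x y * s1 x y - C x y * s2 x y)).
  set (Sy := fun x y => K x y * (C x y * c2 x y - A x y * c1 x y)).
  set (gy := fun x y => dy A x y * s2 x y + A x y * (c2 x y ^ 2 * C x y)
                        - (dy C x y * s1 x y + C x y * (c1 x y ^ 2 * A x y))).
  set (hx := fun x y => dx A x y * c2 x y + A x y * (s2 x y ^ 2 * C x y)
                        - (dx C x y * c1 x y + C x y * (s1 x y ^ 2 * A x y))).
  assert (HS : forall a b, V a b -> S a b <> 0) by apply F.
  assert (GS : grad_on V S Sx Sy).
  { intros a b Hab. at_point F HO a b Hab. unfold S, Sx, Sy, K.
    split; der; [clear - U1 U2|clear - U1 U2]; nsz. }
  destruct (poincare_disc x0 y0 r (fun x y => - (g x y / S x y)) (fun x y => h x y / S x y)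
     (fun x y => - (gy x y / S x y - g x y * Sy x y / S x y ^ 2))
     (fun x y => hx x y / S x y - h x y * Sx x y / S x y ^ 2)) as (eta & Se & Ge); try assumption.
  { unfold g, S; smooth; exact HS. }
  { unfold h, S; smooth; exact HS. }
  { intros a b Hab. assert (is_derive (fun t => g a t) b (gy a b)).
    { at_point F HO a b Hab. unfold g, gy. der; ring. }
    destruct (GS a b Hab). pose proof (HS a b Hab). der; auto. field; auto. }
  { intros a b Hab. assert (is_derive (fun t => h t b) a (hx a b)).
    { at_point F HO a b Hab. unfold h, hx. der; ring. }
    destruct (GS a b Hab). pose proof (HS a b Hab). der; auto. field; auto. }
  { intros x y HV. pose proof (HC x y HV) as E. at_point F HO x y HV. pose proof (HS x y HV) as S0'.
    assert (I : gy x y * S x y - g x y * Sy x y + hx x y * S x y - h x y * Sx x y = 0).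
    { transitivity (S x y * web_curvature c1 s1 A c2 s2 C x y); [|rewrite E; ring].
      transitivity (S x y * (gy x y + hx x y) - (g x y * Sy x y + h x y * Sx x y)); [ring|].
      assert (I1 : gy x y + hx x y = c2 x y * dx A x y + s2 x y * dy A x y
                - (c1 x y * dx C x y + s1 x y * dy C x y)).
      { unfold gy, hx. clear - U1 U2. nsz. }
      rewrite I1. unfold web_curvature, g, h, Sx, Sy, K, S. ring. }
    apply Rminus_diag_uniq.
    transitivity (- (gy x y * S x y - g x y * Sy x y + hx x y * S x y - h x y * Sx x y)
       / S x y ^ 2); [field; exact S0'|]. rewrite I. field. exact S0'. }
  set (phi := fun x y => exp (eta x y)).
  assert (Sp : smooth_on V phi) by (unfold phi; smooth).
  assert (Pp : forall x y, 0 < phi x y) by (intros; apply exp_pos).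
  assert (Gp : grad_on V phi (fun x y => - (g x y / S x y) * phi x y)
                 (fun x y => h x y / S x y * phi x y)).
  { intros x y HV. destruct (Ge x y HV). unfold phi. split; der; ring. }
  clearbody phi. clear Ge Se eta.
  assert (D : forall x y, V x y ->
     (- (g x y / S x y) * phi x y) * c1 x y + h x y / S x y * phi x y * s1 x y
       = - A x y * phi x y /\
     (- (g x y / S x y) * phi x y) * c2 x y + h x y / S x y * phi x y * s2 x y
       = - C x y * phi x y).
  { intros x y HV. pose proof (HS x y HV) as S0'.
    split; apply Rmult_eq_reg_r with (S x y); try exact S0'; 
      field_simplify; try exact S0'; unfold g, h, S; ring. }
  destruct (poincare_disc x0 y0 r (fun x y => - (phi x y * s1 x y)) (fun x y => phi x y * c1 x y)
     (fun x y => - (h x y / S x y * phi x y * s1 x y + phi x y * (c1 x y ^ 2 * A x y)))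
     (fun x y => - (g x y / S x y) * phi x y * c1 x y + phi x y * (s1 x y ^ 2 * A x y)))
     as (p & Sp' & Gp'); try assumption; try smooth.
  { intros x y HV. destruct (Gp x y HV). at_point F HO x y HV. der. ring. }
  { intros x y HV. destruct (Gp x y HV). at_point F HO x y HV. der. ring. }
  { intros x y HV. destruct (D x y HV) as [E1 _]. at_point F HO x y HV.
    assert (phi x y * (c1 x y ^ 2 * A x y) + phi x y * (s1 x y ^ 2 * A x y) = A x y * phi x y).
    { transitivity (A x y * phi x y * (c1 x y ^ 2 + s1 x y ^ 2)); [ring|rewrite U1; ring]. }
    lra. }
  destruct (poincare_disc x0 y0 r (fun x y => - (phi x y * s2 x y)) (fun x y => phi x y * c2 x y)
     (fun x y => - (h x y / S x y * phi x y * s2 x y + phi x y * (c2 x y ^ 2 * C x y)))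
     (fun x y => - (g x y / S x y) * phi x y * c2 x y + phi x y * (s2 x y ^ 2 * C x y)))
     as (q & Sq & Gq); try assumption; try smooth.
  { intros x y HV. destruct (Gp x y HV). at_point F HO x y HV. der. ring. }
  { intros x y HV. destruct (Gp x y HV). at_point F HO x y HV. der. ring. }
  { intros x y HV. destruct (D x y HV) as [_ E1]. at_point F HO x y HV.
    assert (phi x y * (c2 x y ^ 2 * C x y) + phi x y * (s2 x y ^ 2 * C x y) = C x y * phi x y).
    { transitivity (C x y * phi x y * (c2 x y ^ 2 + s2 x y ^ 2)); [ring|rewrite U2; ring]. }
    lra. }
  exists p, q.
  assert (Dp : forall x y, V x y -> dx p x y = - (phi x y * s1 x y) /\ dy p x y = phi x y * c1 x y)
    by exact (grad_on_dx V _ _ _ Gp').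
  assert (Dq : forall x y, V x y -> dx q x y = - (phi x y * s2 x y) /\ dy q x y = phi x y * c2 x y)
    by exact (grad_on_dx V _ _ _ Gq).
  assert (Ds : forall k x y, V x y ->
     dx (fun x y => p x y + k * q x y) x y = - (phi x y * (s1 x y + k * s2 x y)) /\
     dy (fun x y => p x y + k * q x y) x y = phi x y * (c1 x y + k * c2 x y)).
  { intros k x y HV. destruct (Gp' x y HV), (Gq x y HV).
    split; apply is_derive_unique; der; ring. }
  assert (FI : forall (N : line_field) f a b, smooth_on V f ->
     (forall x y, V x y -> dx f x y = - (phi x y * b x y) /\ dy f x y = phi x y * a x y) ->
     (forall x y, V x y -> (a x y, b x y) <> (0, 0)) ->
     (forall x y vx vy, V x y -> (N x y vx vy <-> a x y * vy - b x y * vx = 0)) ->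
     first_integral V N f).
  { intros N f a b Sf Df Hab HN. split; [exact Sf|]. intros x y HV.
    destruct (Df x y HV) as [-> ->]. pose proof (Pp x y). split.
    - intros Z. injection Z as Z1 Z2. apply (Hab x y HV).
      f_equal; apply Rmult_eq_reg_l with (phi x y); lra.
    - intros vx vy. rewrite (HN x y vx vy HV).
      replace (- (phi x y * b x y) * vx + phi x y * a x y * vy)
        with (phi x y * (a x y * vy - b x y * vx)) by ring.
      split; intros Z; [rewrite Z; ring|]. apply Rmult_eq_reg_l with (phi x y); lra. }
  destruct F as [K1 K2 HS' HN1 HN2].
  split; [|split; [|split; [|split]]].
  - apply (FI L1 p c1 s1); auto; [|apply K1].
    intros x y HV Z. injection Z as Z1 Z2. apply (HS' x y HV). rewrite Z1, Z2. ring.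
  - apply (FI L2 q c2 s2); auto; [|apply K2].
    intros x y HV Z. injection Z as Z1 Z2. apply (HS' x y HV). rewrite Z1, Z2. ring.
  - apply (FI N1 _ (fun x y => c1 x y + 1 * c2 x y) (fun x y => s1 x y + 1 * s2 x y)); [smooth|auto| |].
    + intros x y HV Z. injection Z as Z1 Z2. apply (HS' x y HV).
      replace (c1 x y) with (- c2 x y) by lra. replace (s1 x y) with (- s2 x y) by lra. ring.
    + intros x y vx vy HV. rewrite !Rmult_1_l. now apply HN1.
  - apply (FI N2 _ (fun x y => c1 x y + -1 * c2 x y) (fun x y => s1 x y + -1 * s2 x y)); [smooth|auto| |].
    + intros x y HV Z. injection Z as Z1 Z2. apply (HS' x y HV).
      replace (c1 x y) with (c2 x y) by lra. replace (s1 x y) with (s2 x y) by lra. ring.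
    + intros x y vx vy HV. rewrite (HN2 x y vx vy HV). split; intros; lra.
  - intros x y HV. destruct (Dp x y HV) as [-> ->]. destruct (Dq x y HV) as [-> ->].
    pose proof (HS' x y HV) as N. pose proof (Pp x y).
    replace (- (phi x y * s1 x y) * (phi x y * c2 x y) - phi x y * c1 x y * - (phi x y * s2 x y))
      with (phi x y * phi x y * (c1 x y * s2 x y - s1 x y * c2 x y)) by ring.
    intros Z. apply Rmult_integral in Z. destruct Z as [Z|Z]; [nra|contradiction].
Qed.

(** Closedness of f ds means that the differential of f is proportional to ds. This form of the
    condition is used throughout for Abelian relations. *)
Lemma form_factor (V : plane_set) (F : line_field) s a b :
  open_set V -> first_integral V F s -> smooth_on V a -> smooth_on V b ->
  (forall x y vx vy, V x y -> F x y vx vy -> a x y * vx + b x y * vy = 0) ->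
  (forall x y, V x y -> dx b x y - dy a x y = 0) ->
  exists f, smooth_on V f /\
    (forall x y, V x y -> a x y = f x y * dx s x y /\ b x y = f x y * dy s x y) /\
    (forall x y, V x y -> dx f x y * dy s x y - dy f x y * dx s x y = 0).
Proof.
  intros HO [Ss HF] Sa Sb HA Hcl.
  destruct (smooth_on_grad V s Ss) as (Gs & Sx & Sy).
  assert (nz : forall x y, V x y -> dx s x y ^ 2 + dy s x y ^ 2 <> 0).
  { intros x y HV Z. destruct (HF x y HV) as [N _]. apply N. f_equal; nra. }
  set (f := fun x y => (a x y * dx s x y + b x y * dy s x y) / (dx s x y ^ 2 + dy s x y ^ 2)).
  assert (Sf : smooth_on V f) by (unfold f; smooth; exact nz).
  assert (E : forall x y, V x y -> a x y = f x y * dx s x y /\ b x y = f x y * dy s x y).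
  { intros x y HV. pose proof (nz x y HV) as N.
    assert (K : a x y * dy s x y = b x y * dx s x y).
    { assert (a x y * (- dy s x y) + b x y * dx s x y = 0); [|lra].
      apply HA; [exact HV|]. apply HF; [exact HV|]. ring. }
    unfold f. split; apply Rmult_eq_reg_r with (dx s x y ^ 2 + dy s x y ^ 2); try exact N;
      field_simplify; try exact N; nsz. }
  clearbody f. exists f. split; [exact Sf|]. split; [exact E|].
  destruct (smooth_on_grad V f Sf) as (Gf & _).
  destruct (smooth_on_grad V (dx s) Sx) as (Gsx & _).
  destruct (smooth_on_grad V (dy s) Sy) as (Gsy & _).
  destruct (smooth_on_grad V a Sa) as (Ga & _).
  destruct (smooth_on_grad V b Sb) as (Gb & _).
  pose proof (mixed_partials V s _ _ _ _ _ _ HO Ss Gs Gsx Gsy) as M.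
  intros x y HV.
  destruct (grad_on_eq V a (fun x y => f x y * dx s x y) _ _
    (fun x y => dx f x y * dx s x y + f x y * dx (dx s) x y)
    (fun x y => dy f x y * dx s x y + f x y * dy (dx s) x y) HO Ga) with (x := x) (y := y)
    as [_ E1]; auto.
  { intros u v Huv. destruct (Gf u v Huv), (Gsx u v Huv). split; der; ring. }
  { intros u v Huv. now apply E. }
  destruct (grad_on_eq V b (fun x y => f x y * dy s x y) _ _
    (fun x y => dx f x y * dy s x y + f x y * dx (dy s) x y)
    (fun x y => dy f x y * dy s x y + f x y * dy (dy s) x y) HO Gb) with (x := x) (y := y)
    as [E2 _]; auto.
  { intros u v Huv. destruct (Gf u v Huv), (Gsy u v Huv). split; der; ring. }
  { intros u v Huv. now apply E. }
  cbv beta in E1, E2. specialize (Hcl x y HV). rewrite E1, E2, (M x y HV) in Hcl. lra.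
Qed.

(** * Abelian relations of webs with parallel first integrals *)

Lemma sum_lt_1 (f : nat -> R) : sum_lt 1 f = f 0%nat.
Proof. unfold sum_lt; simpl; ring. Qed.

Lemma sum_lt_3 (f : nat -> R) : sum_lt 3 f = f 0%nat + f 1%nat + f 2%nat.
Proof. unfold sum_lt; simpl; ring. Qed.

Lemma sum_lt_4 (f : nat -> R) : sum_lt 4 f = f 0%nat + f 1%nat + f 2%nat + f 3%nat.
Proof. unfold sum_lt; simpl; ring. Qed.

Lemma first_integral_sub (V W : plane_set) F s :
  (forall x y, W x y -> V x y) -> first_integral V F s -> first_integral W F s.
Proof. intros H [S K]. split; [now apply (smooth_on_sub V)|auto]. Qed.

Lemma dx_combination (V : plane_set) p q k : smooth_on V p -> smooth_on V q ->
  forall x y, V x y ->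
  dx (fun x y => p x y + k * q x y) x y = dx p x y + k * dx q x y /\
  dy (fun x y => p x y + k * q x y) x y = dy p x y + k * dy q x y.
Proof.
  intros Sp Sq x y HV. destruct (smooth_on_grad V p Sp) as (Gp & _).
  destruct (smooth_on_grad V q Sq) as (Gq & _).
  destruct (Gp x y HV), (Gq x y HV). split; apply is_derive_unique; der; ring.
Qed.

Lemma jacobian_independent (px py qx qy a b : R) :
  px * qy - py * qx <> 0 -> a * px + b * qx = 0 -> a * py + b * qy = 0 -> a = 0 /\ b = 0.
Proof.
  intros J E1 E2. split; apply Rmult_eq_reg_r with (px * qy - py * qx); try exact J; rewrite Rmult_0_l.
  - transitivity ((a * px + b * qx) * qy - (a * py + b * qy) * qx); [ring|rewrite E1, E2; ring].
  - transitivity ((a * py + b * qy) * px - (a * px + b * qx) * py); [ring|rewrite E1, E2; ring].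
Qed.

Lemma parallel_multiple (a b sx sy : R) : (sx, sy) <> (0, 0) -> a * sy - b * sx = 0 ->
  exists u, a = u * sx /\ b = u * sy.
Proof.
  intros N E. assert (N' : sx ^ 2 + sy ^ 2 <> 0) by (intros Z; apply N; f_equal; nra).
  exists ((a * sx + b * sy) / (sx ^ 2 + sy ^ 2)).
  split; apply Rmult_eq_reg_r with (sx ^ 2 + sy ^ 2); try exact N'; field_simplify; try exact N'; nsz.
Qed.

Lemma closed_gradient (V : plane_set) p : open_set V -> smooth_on V p ->
  forall x y, V x y -> dx (dy p) x y - dy (dx p) x y = 0.
Proof.
  intros HO Sp x y HV. destruct (smooth_on_grad V p Sp) as (G & Sx & Sy).
  destruct (smooth_on_grad V _ Sx) as (Gx & _). destruct (smooth_on_grad V _ Sy) as (Gy & _).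
  rewrite (mixed_partials V p _ _ _ _ _ _ HO Sp G Gx Gy x y HV). ring.
Qed.

Lemma closed_function_form (V : plane_set) f s :
  open_set V -> smooth_on V f -> smooth_on V s ->
  (forall x y, V x y -> dx f x y * dy s x y - dy f x y * dx s x y = 0) ->
  forall x y, V x y ->
    dx (fun x y => f x y * dy s x y) x y - dy (fun x y => f x y * dx s x y) x y = 0.
Proof.
  intros HO Sf Ss E x y HV. destruct (smooth_on_grad V f Sf) as (Gf & _).
  destruct (smooth_on_grad V s Ss) as (_ & Sx & Sy).
  destruct (smooth_on_grad V _ Sx) as (Gx & _). destruct (smooth_on_grad V _ Sy) as (Gy & _).
  pose proof (closed_gradient V s HO Ss x y HV) as C.
  destruct (Gf x y HV), (Gx x y HV), (Gy x y HV).
  assert (E1 : dx (fun x y => f x y * dy s x y) x y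
     = dx f x y * dy s x y + f x y * dx (dy s) x y) by (apply is_derive_unique; der; ring).
  assert (E2 : dy (fun x y => f x y * dx s x y) x y
     = dy f x y * dx s x y + f x y * dy (dx s) x y) by (apply is_derive_unique; der; ring).
  rewrite E1, E2. specialize (E x y HV). nra.
Qed.

(** Independence of dp and dq reduces a relation to the single function f2. Closedness of its first
    two forms makes df2 proportional to both dp and dq, hence zero. *)
Lemma parallel_3web_basis (x0 y0 r : R) (F G N : line_field) p q k :
  let V := open_disc x0 y0 r in
  0 < r -> k <> 0 -> first_integral V F p -> first_integral V G q ->
  first_integral V N (fun x y => p x y + k * q x y) ->
  (forall x y, V x y -> dx p x y * dy q x y - dy p x y * dx q x y <> 0) ->
  exists B, abelian_basis V 3 (web3 F G N) 1 B.
Proof.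
  intros V Hr Hk FP FQ FN J.
  pose proof (open_disc_open x0 y0 r : open_set V) as HO.
  pose proof (open_disc_center x0 y0 r Hr : V x0 y0) as V0.
  pose proof (proj1 FP) as Sp. pose proof (proj1 FQ) as Sq.
  destruct (smooth_on_grad V p Sp) as (Gp & Spx & Spy).
  destruct (smooth_on_grad V q Sq) as (Gq & Sqx & Sqy).
  pose proof (dx_combination V p q k Sp Sq) as Ds.
  set (s := fun x y => p x y + k * q x y) in *.
  assert (Ss : smooth_on V s) by apply FN.
  destruct (smooth_on_grad V s Ss) as (Gs & Ssx & Ssy).
  exists (fun _ i => match i with
     | 0%nat => (dx p, dy p)
     | 1%nat => ((fun x y => k * dx q x y), (fun x y => k * dy q x y))
     | _ => ((fun x y => - dx s x y), (fun x y => - dy s x y)) end).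
  split; [|split].
  - intros _ _. split.
    + intros [|[|i]] Hi; cbn [fst snd web3].
      * split; [exact Spx|]. split; [exact Spy|]. intros x y HV. split.
        -- intros vx vy Hv. now apply (proj2 FP x y HV).
        -- now apply (closed_gradient V).
      * split; [smooth|]. split; [smooth|]. intros x y HV. split.
        -- intros vx vy Hv. apply (proj2 FQ x y HV) in Hv.
           transitivity (k * (dx q x y * vx + dy q x y * vy)); [ring|rewrite Hv; ring].
        -- apply (closed_function_form V (fun _ _ => k) q); auto; [smooth|].
           intros u v Huv. unfold dx at 1, dy at 2. rewrite !Derive_const. ring.
      * split; [smooth|]. split; [smooth|]. intros x y HV. split.
        -- intros vx vy Hv. destruct i; apply (proj2 FN x y HV) in Hv; lra.
        -- pose proof (closed_function_form V (fun _ _ => - 1) s) as K.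
           assert (K1 : dx (fun x y => - dy s x y) x y = dx (fun x y => -1 * dy s x y) x y).
           { unfold dx. apply Derive_ext. intros. ring. }
           assert (K2 : dy (fun x y => - dx s x y) x y = dy (fun x y => -1 * dx s x y) x y).
           { unfold dy. apply Derive_ext. intros. ring. }
           rewrite K1, K2. apply K; auto; [smooth|].
           intros u v Huv. unfold dx at 1, dy at 2. rewrite !Derive_const. ring.
    + intros x y HV. destruct (Ds x y HV) as [E1 E2]. rewrite !sum_lt_3. cbn [fst snd].
      rewrite E1, E2. split; ring.
  - intros c Hc j Hj. assert (j = 0)%nat by lia. subst j.
    destruct (Hc 0%nat x0 y0 ltac:(lia) V0) as [E1 E2]. rewrite sum_lt_1 in E1, E2.
    cbn [fst snd] in E1, E2. destruct (Rmult_integral _ _ E1) as [Z1|Z1]; [assumption|].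
    destruct (Rmult_integral _ _ E2) as [Z2|Z2]; [assumption|].
    exfalso. apply (J x0 y0 V0). rewrite Z1, Z2. ring.
  - intros w [Hw Hsum].
    destruct (Hw 0%nat ltac:(lia)) as (Sa0 & Sb0 & H0).
    destruct (Hw 1%nat ltac:(lia)) as (Sa1 & Sb1 & H1).
    destruct (Hw 2%nat ltac:(lia)) as (Sa2 & Sb2 & H2). cbn [web3] in *.
    destruct (form_factor V F p _ _ HO FP Sa0 Sb0) as (f0 & Sf0 & E0 & C0);
      [intros x y vx vy HV; now apply H0|intros x y HV; now apply H0|].
    destruct (form_factor V G q _ _ HO FQ Sa1 Sb1) as (f1 & Sf1 & E1 & C1);
      [intros x y vx vy HV; now apply H1|intros x y HV; now apply H1|].
    destruct (form_factor V N s _ _ HO FN Sa2 Sb2) as (f2 & Sf2 & E2 & C2);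
      [intros x y vx vy HV; now apply H2|intros x y HV; now apply H2|].
    assert (R : forall x y, V x y -> f0 x y = - f2 x y /\ f1 x y = - k * f2 x y).
    { intros x y HV. destruct (Hsum x y HV) as [X Y]. rewrite sum_lt_3 in X, Y.
      destruct (E0 x y HV) as [a0 b0]. destruct (E1 x y HV) as [a1 b1].
      destruct (E2 x y HV) as [a2 b2]. destruct (Ds x y HV) as [d1 d2].
      rewrite a0, a1, a2, d1 in X. rewrite b0, b1, b2, d2 in Y.
      destruct (jacobian_independent _ _ _ _ (f0 x y + f2 x y) (f1 x y + k * f2 x y) (J x y HV));
        lra. }
    destruct (smooth_on_grad V f2 Sf2) as (Gf2 & _).
    destruct (smooth_on_grad V f0 Sf0) as (Gf0 & _).
    destruct (smooth_on_grad V f1 Sf1) as (Gf1 & _).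
    assert (Z : grad_on V f2 (fun _ _ => 0) (fun _ _ => 0)).
    { refine (grad_on_ext V _ _ _ _ _ _ Gf2). intros x y HV.
      destruct (grad_on_eq V f0 (fun x y => - f2 x y) _ _ _ _ HO Gf0 (grad_on_opp V _ _ _ Gf2)
        (fun x y HV => proj1 (R x y HV)) x y HV) as [X0 Y0].
      assert (Gk : grad_on V (fun x y => - k * f2 x y) (fun x y => - k * dx f2 x y) (fun x y => - k * dy f2 x y)).
      { intros u v Huv. destruct (Gf2 u v Huv). split; der; ring. }
      destruct (grad_on_eq V f1 (fun x y => - k * f2 x y) _ _ _ _ HO Gf1 Gk
        (fun x y HV => proj2 (R x y HV)) x y HV) as [X1 Y1].
      specialize (C0 x y HV). specialize (C1 x y HV). rewrite X0, Y0 in C0. rewrite X1, Y1 in C1.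
      apply (jacobian_independent (dy p x y) (dy q x y) (- dx p x y) (- dx q x y)).
      - intros Z. apply (J x y HV). lra.
      - lra.
      - apply Rmult_eq_reg_l with k; [|exact Hk]. lra. }
    exists (fun _ => - f2 x0 y0). intros i x y Hi HV. rewrite !sum_lt_1. cbv beta.
    pose proof (grad_zero_const x0 y0 r f2 Z x y HV) as CC.
    destruct (R x y HV) as [R0 R1]. rewrite CC in R0, R1.
    destruct i as [|[|[|i]]]; [| | |lia]; cbn [fst snd].
    + destruct (E0 x y HV) as [-> ->]. rewrite R0. split; ring.
    + destruct (E1 x y HV) as [-> ->]. rewrite R1. split; ring.
    + destruct (E2 x y HV) as [-> ->]. rewrite CC. split; ring.
Qed.

(** The order is that of [web4 N1 N2 L1 L2], and the factors 1 and - 1 are written out so that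
    [dx_combination] covers both bisector foliations. *)
Definition parallel_first_integrals (p q : R -> R -> R) (i : nat) : R -> R -> R :=
  match i with
  | 0%nat => fun x y => p x y + 1 * q x y
  | 1%nat => fun x y => p x y + - 1 * q x y
  | 2%nat => p
  | _ => q
  end.

(* The coefficients of (p + q) d(p + q) + (p - q) d(p - q) = 2 p dp + 2 q dq,
   d(p + q) = dp + dq and d(p - q) = dp - dq. *)
Definition parallel_coefficients (k i : nat) (t : R) : R :=
  match k, i with
  | 0%nat, 0%nat => t | 0%nat, 1%nat => t | 0%nat, _ => - 2 * t
  | 1%nat, 0%nat => 1 | 1%nat, 1%nat => 0 | 1%nat, _ => - 1
  | _, 0%nat => 0 | _, 1%nat => 1 | _, 2%nat => - 1 | _, _ => 1
  end.

Definition parallel_relations (p q : R -> R -> R) (k i : nat) : form :=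
  ((fun x y => parallel_coefficients k i (parallel_first_integrals p q i x y)
               * dx (parallel_first_integrals p q i) x y),
   (fun x y => parallel_coefficients k i (parallel_first_integrals p q i x y)
               * dy (parallel_first_integrals p q i) x y)).

(** Comparing coefficients of dp and dq, a relation is determined by its factors f0 and f1 on N1 and
    N2. These turn out to be affine in p + q and in p - q, with a common slope: three constants,
    which are the coordinates in the basis. *)
Lemma parallel_4web_basis (x0 y0 r : R) (W : nat -> line_field) p q :
  let V := open_disc x0 y0 r in
  0 < r -> (forall i, (i < 4)%nat -> first_integral V (W i) (parallel_first_integrals p q i)) ->
  (forall x y, V x y -> dx p x y * dy q x y - dy p x y * dx q x y <> 0) ->
  abelian_basis V 4 W 3 (parallel_relations p q).
Proof.
  intros V Hr FI J.
  pose proof (open_disc_open x0 y0 r : open_set V) as HO.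
  pose proof (open_disc_center x0 y0 r Hr : V x0 y0) as V0.
  pose proof (FI 0%nat ltac:(lia)) as F0. pose proof (FI 1%nat ltac:(lia)) as F1.
  pose proof (FI 2%nat ltac:(lia)) as F2. pose proof (FI 3%nat ltac:(lia)) as F3.
  cbn [parallel_first_integrals] in F0, F1, F2, F3.
  pose proof (proj1 F2) as Sp. pose proof (proj1 F3) as Sq.
  destruct (smooth_on_grad V p Sp) as (Gp & Spx & Spy).
  destruct (smooth_on_grad V q Sq) as (Gq & Sqx & Sqy).
  pose proof (dx_combination V p q 1 Sp Sq) as D0.
  pose proof (dx_combination V p q (-1) Sp Sq) as D1.
  assert (coef : forall k i, smooth_on V
      (fun x y => parallel_coefficients k i (parallel_first_integrals p q i x y)) /\
      forall x y, V x y ->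
        dx (fun x y => parallel_coefficients k i (parallel_first_integrals p q i x y)) x y
          * dy (parallel_first_integrals p q i) x y
        - dy (fun x y => parallel_coefficients k i (parallel_first_integrals p q i x y)) x y
          * dx (parallel_first_integrals p q i) x y = 0).
  { assert (T : forall c s, smooth_on V s ->
       smooth_on V (fun x y => c * s x y) /\
       forall x y, V x y -> dx (fun x y => c * s x y) x y * dy s x y
                          - dy (fun x y => c * s x y) x y * dx s x y = 0).
    { intros c s Ss. split; [smooth|]. intros x y HV.
      destruct (smooth_on_grad V s Ss) as (G & _). destruct (G x y HV).
      assert (E1 : dx (fun x y => c * s x y) x y = c * dx s x y)
        by (apply is_derive_unique; der; ring).
      assert (E2 : dy (fun x y => c * s x y) x y = c * dy s x y)
        by (apply is_derive_unique; der; ring).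
      rewrite E1, E2. ring. }
    assert (T1 : forall s, smooth_on V s ->
       smooth_on V (fun x y => s x y) /\
       forall x y, V x y -> dx (fun x y => s x y) x y * dy s x y
                          - dy (fun x y => s x y) x y * dx s x y = 0).
    { intros s Ss. split; [exact Ss|]. intros x y HV.
      change (fun x y => s x y) with s. ring. }
    assert (K : forall (c : R) s, smooth_on V (fun _ _ => c) /\
       forall x y, V x y -> dx (fun _ _ => c) x y * dy s x y
                          - dy (fun _ _ => c) x y * dx s x y = 0).
    { intros c s. split; [smooth|]. intros x y HV. unfold dx at 1, dy at 2.
      rewrite !Derive_const. ring. }
    intros [|[|k]] [|[|[|i]]]; cbn [parallel_coefficients parallel_first_integrals];
      first [apply K | apply T1; first [apply F0 | apply F1] | apply T; assumption]. }
  assert (SF : forall i, (i < 4)%nat -> smooth_on V (parallel_first_integrals p q i))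
    by (intros i Hi; apply (FI i Hi)).
  split; [|split].
  - intros k Hk. split.
    + intros i Hi. unfold parallel_relations. cbn [fst snd].
      destruct (coef k i) as [Sc Cc].
      destruct (smooth_on_grad V _ (SF i Hi)) as (_ & Six & Siy).
      split; [smooth|]. split; [smooth|]. intros x y HV. split.
      * intros vx vy Hv. apply (proj2 (FI i Hi) x y HV) in Hv.
        match goal with |- ?m * ?a * ?b + _ * ?c * ?d = 0 =>
          transitivity (m * (a * b + c * d)); [ring|rewrite Hv; ring] end.
      * apply (closed_function_form V _ _ HO Sc (SF i Hi) Cc x y HV).
    + intros x y HV. destruct (D0 x y HV) as [d0x d0y]. destruct (D1 x y HV) as [d1x d1y].
      rewrite !sum_lt_4. unfold parallel_relations.
      cbn [fst snd parallel_first_integrals]. rewrite d0x, d0y, d1x, d1y.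
      destruct k as [|[|[|k]]]; [| | |lia]; cbn [parallel_coefficients]; split; ring.
  - intros c Hc k Hk.
    destruct (D0 x0 y0 V0) as [d0x d0y]. destruct (D1 x0 y0 V0) as [d1x d1y].
    assert (Q : forall i, (i < 4)%nat -> forall x y, V x y ->
      c 0%nat * parallel_coefficients 0 i (parallel_first_integrals p q i x y)
      + c 1%nat * parallel_coefficients 1 i (parallel_first_integrals p q i x y)
      + c 2%nat * parallel_coefficients 2 i (parallel_first_integrals p q i x y) = 0).
    { intros i Hi x y HV. destruct (Hc i x y Hi HV) as [X Y]. rewrite sum_lt_3 in X, Y.
      unfold parallel_relations in X, Y. cbn [fst snd] in X, Y.
      match goal with |- ?g = 0 => set (t := g) end.
      assert (X' : t * dx (parallel_first_integrals p q i) x y = 0) by (unfold t; lra).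
      assert (Y' : t * dy (parallel_first_integrals p q i) x y = 0) by (unfold t; lra).
      apply Rmult_integral in X'. apply Rmult_integral in Y'.
      destruct X' as [|X']; [assumption|]. destruct Y' as [|Y']; [assumption|].
      exfalso. apply (proj1 (proj2 (FI i Hi) x y HV)). now rewrite X', Y'. }
    (* The component along L1 is - 2 c0 p - c1 - c2; with c0 nonzero it would make [p] constant. *)
    assert (Z0 : c 0%nat = 0).
    { destruct (Req_dec (c 0%nat) 0) as [E|E]; [exact E|]. exfalso.
      assert (Gz : grad_on V p (fun _ _ => 0) (fun _ _ => 0)).
      { assert (Kp : forall x y, V x y -> p x y = p x0 y0).
        { intros x y HV. pose proof (Q 2%nat ltac:(lia) x y HV) as A.
          pose proof (Q 2%nat ltac:(lia) x0 y0 V0) as A0.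
          cbn [parallel_coefficients parallel_first_integrals] in A, A0.
          apply Rmult_eq_reg_l with (c 0%nat); lra. }
        assert (Gc : grad_on V (fun _ _ => p x0 y0) (fun _ _ => 0) (fun _ _ => 0))
          by (intros x y HV; split; apply is_derive_Rconst).
        refine (grad_on_ext V _ _ _ _ _ _ Gp).
        exact (grad_on_eq V p _ _ _ _ _ HO Gp Gc Kp). }
      destruct (grad_on_dx V _ _ _ Gz x0 y0 V0) as [X Y]. apply (J x0 y0 V0). rewrite X, Y. ring. }
    pose proof (Q 0%nat ltac:(lia) x0 y0 V0) as A1. pose proof (Q 1%nat ltac:(lia) x0 y0 V0) as A2.
    cbn [parallel_coefficients] in A1, A2. rewrite Z0 in A1, A2.
    destruct k as [|[|[|k]]]; [| | |lia]; lra.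
  - intros w [Hw Hsum].
    destruct (Hw 0%nat ltac:(lia)) as (Sa0 & Sb0 & H0).
    destruct (Hw 1%nat ltac:(lia)) as (Sa1 & Sb1 & H1).
    destruct (Hw 2%nat ltac:(lia)) as (Sa2 & Sb2 & H2).
    destruct (Hw 3%nat ltac:(lia)) as (Sa3 & Sb3 & H3).
    destruct (form_factor V _ _ _ _ HO F0 Sa0 Sb0) as (f0 & Sf0 & E0 & C0);
      [intros x y vx vy HV; now apply H0|intros x y HV; now apply H0|].
    destruct (form_factor V _ _ _ _ HO F1 Sa1 Sb1) as (f1 & Sf1 & E1 & C1);
      [intros x y vx vy HV; now apply H1|intros x y HV; now apply H1|].
    destruct (form_factor V _ _ _ _ HO F2 Sa2 Sb2) as (f2 & Sf2 & E2 & C2);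
      [intros x y vx vy HV; now apply H2|intros x y HV; now apply H2|].
    destruct (form_factor V _ _ _ _ HO F3 Sa3 Sb3) as (f3 & Sf3 & E3 & C3);
      [intros x y vx vy HV; now apply H3|intros x y HV; now apply H3|].
    assert (R : forall x y, V x y -> f2 x y = - f0 x y + - 1 * f1 x y /\ f3 x y = - f0 x y + 1 * f1 x y).
    { intros x y HV. destruct (Hsum x y HV) as [X Y]. rewrite sum_lt_4 in X, Y.
      destruct (E0 x y HV) as [a0 b0]. destruct (E1 x y HV) as [a1 b1].
      destruct (E2 x y HV) as [a2 b2]. destruct (E3 x y HV) as [a3 b3].
      destruct (D0 x y HV) as [d0x d0y]. destruct (D1 x y HV) as [d1x d1y].
      rewrite a0, a1, a2, a3, d0x, d1x in X. rewrite b0, b1, b2, b3, d0y, d1y in Y.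
      destruct (jacobian_independent _ _ _ _ (f0 x y + f1 x y + f2 x y)
        (f0 x y - f1 x y + f3 x y) (J x y HV)); lra. }
    assert (So : smooth_on V (fun x y => - f0 x y)) by smooth.
    destruct (smooth_on_grad V f0 Sf0) as (Gf0 & Sf0x & Sf0y).
    destruct (smooth_on_grad V f1 Sf1) as (Gf1 & Sf1x & Sf1y).
    destruct (smooth_on_grad V f2 Sf2) as (Gf2 & _).
    destruct (smooth_on_grad V f3 Sf3) as (Gf3 & _).
    assert (Gm : forall k, grad_on V (fun x y => - f0 x y + k * f1 x y)
       (fun x y => - dx f0 x y + k * dx f1 x y) (fun x y => - dy f0 x y + k * dy f1 x y)).
    { intros k u v Huv. destruct (Gf0 u v Huv), (Gf1 u v Huv). split; der; ring. }
    (* df0 = g d(p + q) and df1 = g' d(p - q); closedness of the other two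
       forms gives g = g', hence dg = 0 *)
    destruct (form_factor V _ _ (dx f0) (dy f0) HO F0 Sf0x Sf0y) as (g & Sg & Eg & Cg).
    { intros x y vx vy HV Hv. apply (proj2 F0 x y HV) in Hv.
      destruct (parallel_multiple _ _ _ _ (proj1 (proj2 F0 x y HV)) (C0 x y HV)) as (u & -> & ->).
      match goal with |- ?m * ?a * ?b + _ * ?c * ?d = 0 =>
          transitivity (m * (a * b + c * d)); [ring|rewrite Hv; ring] end. }
    { now apply closed_gradient. }
    destruct (form_factor V _ _ (dx f1) (dy f1) HO F1 Sf1x Sf1y) as (g' & Sg' & Eg' & Cg').
    { intros x y vx vy HV Hv. apply (proj2 F1 x y HV) in Hv.
      destruct (parallel_multiple _ _ _ _ (proj1 (proj2 F1 x y HV)) (C1 x y HV)) as (u & -> & ->).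
      match goal with |- ?m * ?a * ?b + _ * ?c * ?d = 0 =>
          transitivity (m * (a * b + c * d)); [ring|rewrite Hv; ring] end. }
    { now apply closed_gradient. }
    assert (EG : forall x y, V x y -> g x y = g' x y).
    { intros x y HV.
      destruct (grad_on_eq V f2 _ _ _ _ _ HO Gf2 (Gm (-1))
        (fun x y HV => proj1 (R x y HV)) x y HV) as [X2 Y2].
      specialize (C2 x y HV). rewrite X2, Y2 in C2.
      destruct (Eg x y HV) as [u0 v0]. destruct (Eg' x y HV) as [u1 v1].
      destruct (D0 x y HV) as [d0x d0y]. destruct (D1 x y HV) as [d1x d1y].
      rewrite u0, v0, u1, v1, d0x, d0y, d1x, d1y in C2.
      apply Rmult_eq_reg_r with (dx p x y * dy q x y - dy p x y * dx q x y); [|now apply J].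
      lra. }
    destruct (smooth_on_grad V g Sg) as (Gg & _). destruct (smooth_on_grad V g' Sg') as (Gg' & _).
    assert (Z : grad_on V g (fun _ _ => 0) (fun _ _ => 0)).
    { refine (grad_on_ext V _ _ _ _ _ _ Gg). intros x y HV.
      destruct (grad_on_eq V g g' _ _ _ _ HO Gg Gg' EG x y HV) as [X Y].
      specialize (Cg x y HV). specialize (Cg' x y HV). rewrite <- X, <- Y in Cg'.
      destruct (D0 x y HV) as [d0x d0y]. destruct (D1 x y HV) as [d1x d1y].
      rewrite d0x, d0y in Cg. rewrite d1x, d1y in Cg'.
      apply (jacobian_independent (dy p x y) (dy q x y) (- dx p x y) (- dx q x y)).
      - intros Z. apply (J x y HV). lra.
      - lra.
      - lra. }
    pose proof (grad_zero_const x0 y0 r g Z) as CG.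
    set (g0 := g x0 y0) in *.
    assert (P0 : forall x y, V x y -> f0 x y = g0 * (p x y + 1 * q x y)
        + (f0 x0 y0 - g0 * (p x0 y0 + 1 * q x0 y0))).
    { apply (grad_eq_const x0 y0 r f0 (fun x y => g0 * (p x y + 1 * q x y)) (dx f0) (dy f0) Gf0).
      intros x y HV. destruct (Eg x y HV) as [-> ->]. rewrite (CG x y HV).
      destruct (D0 x y HV) as [-> ->]. destruct (Gp x y HV), (Gq x y HV). split; der; ring. }
    assert (P1 : forall x y, V x y -> f1 x y = g0 * (p x y + -1 * q x y)
        + (f1 x0 y0 - g0 * (p x0 y0 + -1 * q x0 y0))).
    { apply (grad_eq_const x0 y0 r f1 (fun x y => g0 * (p x y + -1 * q x y)) (dx f1) (dy f1) Gf1).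
      intros x y HV. destruct (Eg' x y HV) as [-> ->]. rewrite <- (EG x y HV), (CG x y HV).
      destruct (D1 x y HV) as [-> ->]. destruct (Gp x y HV), (Gq x y HV). split; der; ring. }
    set (a := f0 x0 y0 - g0 * (p x0 y0 + 1 * q x0 y0)) in *.
    set (b := f1 x0 y0 - g0 * (p x0 y0 + -1 * q x0 y0)) in *.
    exists (fun k => match k with 0%nat => g0 | 1%nat => a | _ => b end).
    intros i x y Hi HV. rewrite !sum_lt_3. unfold parallel_relations. cbn [fst snd].
    specialize (P0 x y HV). specialize (P1 x y HV). destruct (R x y HV) as [R2 R3].
    rewrite P0, P1 in R2, R3.
    destruct i as [|[|[|[|i]]]]; [| | | |lia];
      cbn [parallel_coefficients parallel_first_integrals].
    + destruct (E0 x y HV) as [-> ->]. rewrite P0. split; ring.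
    + destruct (E1 x y HV) as [-> ->]. rewrite P1. split; ring.
    + destruct (E2 x y HV) as [-> ->]. rewrite R2. split; ring.
    + destruct (E3 x y HV) as [-> ->]. rewrite R3. split; ring.
Qed.

Lemma grad_on_scal (V : plane_set) k f fx fy : grad_on V f fx fy ->
  grad_on V (fun x y => k * f x y) (fun x y => k * fx x y) (fun x y => k * fy x y).
Proof. intros G x y HV. destruct (G x y HV). split; der; ring. Qed.

(* The forms of the relation are phi n1, e phi n2 and the opposite of their sum,
   n1 and n2 being the unit conormals of L1 and L2; so phi n1 and phi n2 are closed. *)
Lemma hexagonal_curvature_at (x0 y0 r : R) L1 L2 N1 N2 c1 s1 A c2 s2 C e N w :
  let V := open_disc x0 y0 r in
  frame V L1 L2 N1 N2 c1 s1 A c2 s2 C -> e ^ 2 = 1 ->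
  (forall x y, V x y -> N x y (c1 x y + e * c2 x y) (s1 x y + e * s2 x y)) ->
  abelian_relation V 3 (web3 L1 L2 N) w ->
  exists phi, (forall x y, V x y -> phi x y * web_curvature c1 s1 A c2 s2 C x y = 0) /\
    forall i x y, (i < 3)%nat -> V x y -> phi x y = 0 -> fst (w i) x y = 0 /\ snd (w i) x y = 0.
Proof.
  intros V F He HN [Hw Hsum].
  pose proof (open_disc_open x0 y0 r : open_set V) as HO.
  destruct (frame_smooth F) as ((Sc1 & Ss1 & SA & Sc2 & Ss2 & SC) & _).
  destruct (Hw 0%nat ltac:(lia)) as (Sa0 & Sb0 & H0).
  destruct (Hw 1%nat ltac:(lia)) as (Sa1 & Sb1 & H1).
  destruct (Hw 2%nat ltac:(lia)) as (Sa2 & Sb2 & H2). cbn [web3] in *.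
  set (phi := fun x y => - s1 x y * fst (w 0%nat) x y + c1 x y * snd (w 0%nat) x y).
  assert (Sp : smooth_on V phi) by (unfold phi; smooth).
  assert (E0 : forall x y, V x y ->
     fst (w 0%nat) x y = - (phi x y * s1 x y) /\ snd (w 0%nat) x y = phi x y * c1 x y).
  { intros x y HV. at_point F HO x y HV.
    assert (K : fst (w 0%nat) x y * c1 x y + snd (w 0%nat) x y * s1 x y = 0).
    { apply (proj1 (H0 x y HV)). apply (lf_span (fr_1 F)); [exact HV|ring]. }
    unfold phi. split; nsz. }
  assert (E1 : forall x y, V x y ->
     fst (w 1%nat) x y = - (e * (phi x y * s2 x y)) /\ snd (w 1%nat) x y = e * (phi x y * c2 x y)).
  { intros x y HV. at_point F HO x y HV.
    assert (K : fst (w 1%nat) x y * c2 x y + snd (w 1%nat) x y * s2 x y = 0).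
    { apply (proj1 (H1 x y HV)). apply (lf_span (fr_2 F)); [exact HV|ring]. }
    pose proof (proj1 (H2 x y HV) _ _ (HN x y HV)) as K2.
    destruct (Hsum x y HV) as [X Y]. rewrite sum_lt_3 in X, Y.
    destruct (E0 x y HV) as [e1 e2]. rewrite e1 in X. rewrite e2 in Y.
    set (f := fst (w 1%nat) x y) in *. set (g := snd (w 1%nat) x y) in *.
    set (psi := - s2 x y * f + c2 x y * g).
    assert (f1 : f = - (psi * s2 x y)) by (unfold psi; nsz).
    assert (f2 : g = psi * c2 x y) by (unfold psi; nsz).
    (* The third form annihilates e1 + e e2; evaluated on this vector it equals (c1 s2 - s1 c2) (psi
       - e phi). *)
    assert (Z : psi = e * phi x y).
    { apply Rmult_eq_reg_l with (c1 x y * s2 x y - s1 x y * c2 x y); [|exact S0].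
      replace (fst (w 2%nat) x y) with (phi x y * s1 x y + psi * s2 x y) in K2 by lra.
      replace (snd (w 2%nat) x y) with (- (phi x y * c1 x y + psi * c2 x y)) in K2 by lra. lra. }
    rewrite f1, f2, Z. split; ring. }
  exists phi. split.
  - apply (closed_pair_curvature V _ _ _ _ _ _ _ _ _ _ phi HO F Sp).
    + intros x y HV. destruct (H0 x y HV) as [_ K].
      destruct (smooth_on_grad V _ Sa0) as (Ga & _). destruct (smooth_on_grad V _ Sb0) as (Gb & _).
      assert (Q1 : smooth_on V (fun x y => phi x y * c1 x y)) by smooth.
      assert (Q2 : smooth_on V (fun x y => - (phi x y * s1 x y))) by smooth.
      assert (Q3 : smooth_on V (fun x y => phi x y * s1 x y)) by smooth.
      destruct (smooth_on_grad V _ Q1) as (G1 & _). destruct (smooth_on_grad V _ Q2) as (G2 & _).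
      destruct (smooth_on_grad V _ Q3) as (G3 & _).
      destruct (grad_on_eq V _ _ _ _ _ _ HO Gb G1 (fun x y HV => proj2 (E0 x y HV)) x y HV) as [X _].
      destruct (grad_on_eq V _ _ _ _ _ _ HO Ga G2 (fun x y HV => proj1 (E0 x y HV)) x y HV) as [_ Y].
      destruct (grad_on_dx V _ _ _ (grad_on_opp V _ _ _ G3) x y HV) as [_ Z].
      cbv beta in Z. rewrite X, Y in K. lra.
    + intros x y HV. destruct (H1 x y HV) as [_ K].
      destruct (smooth_on_grad V _ Sa1) as (Ga & _). destruct (smooth_on_grad V _ Sb1) as (Gb & _).
      assert (Q1 : smooth_on V (fun x y => phi x y * c2 x y)) by smooth.
      assert (Q3 : smooth_on V (fun x y => phi x y * s2 x y)) by smooth.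
      destruct (smooth_on_grad V _ Q1) as (G1 & _).
      destruct (smooth_on_grad V _ Q3) as (G3 & _).
      pose proof (grad_on_scal V e _ _ _ G1) as G1'.
      pose proof (grad_on_opp V _ _ _ (grad_on_scal V e _ _ _ G3)) as G3'.
      destruct (grad_on_eq V _ _ _ _ _ _ HO Gb G1' (fun x y HV => proj2 (E1 x y HV)) x y HV) as [X _].
      destruct (grad_on_eq V _ _ _ _ _ _ HO Ga G3' (fun x y HV => proj1 (E1 x y HV)) x y HV) as [_ Y].
      cbv beta in X, Y. rewrite X, Y in K.
      assert (e <> 0) by (intros Z; rewrite Z in He; lra).
      apply Rmult_eq_reg_l with e; [lra|assumption].
  - intros i x y Hi HV Z. destruct (E0 x y HV) as [e1 e2]. destruct (E1 x y HV) as [e3 e4].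
    destruct (Hsum x y HV) as [X Y]. rewrite sum_lt_3 in X, Y.
    rewrite Z in *.
    destruct i as [|[|[|i]]]; [| | |lia]; split; lra.
Qed.

(** * The rank quartic *)

Definition quartic_sum (c : nat -> nat -> R) (X Y Z : R) : R :=
  sum_lt 5 (fun i => sum_lt (5 - i) (fun j => c i j * X ^ i * Y ^ j * Z ^ (4 - i - j))).

(** Unlike [quartic_form] this admits the zero polynomial, and is therefore stable under sums and
    scalar multiples. *)
Definition is_quartic (P : R -> R -> R -> R) : Prop :=
  exists c, forall X Y Z, P X Y Z = quartic_sum c X Y Z.

Lemma quartic_sum_eq c X Y Z : quartic_sum c X Y Z =
  c 4%nat 0%nat * X ^ 4
  + X ^ 3 * (c 3%nat 0%nat * Z + c 3%nat 1%nat * Y)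
  + X ^ 2 * (c 2%nat 0%nat * Z ^ 2 + c 2%nat 1%nat * Y * Z + c 2%nat 2%nat * Y ^ 2)
  + X * (c 1%nat 0%nat * Z ^ 3 + c 1%nat 1%nat * Y * Z ^ 2 + c 1%nat 2%nat * Y ^ 2 * Z
         + c 1%nat 3%nat * Y ^ 3)
  + (c 0%nat 0%nat * Z ^ 4 + c 0%nat 1%nat * Y * Z ^ 3 + c 0%nat 2%nat * Y ^ 2 * Z ^ 2
     + c 0%nat 3%nat * Y ^ 3 * Z + c 0%nat 4%nat * Y ^ 4).
Proof. unfold quartic_sum, sum_lt. cbn -[pow]. cbn [pow]. ring. Qed.

Lemma is_quartic_ext P P' :
  (forall X Y Z, P X Y Z = P' X Y Z) -> is_quartic P -> is_quartic P'.
Proof. intros E (c & H). exists c. intros. now rewrite <- E. Qed.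

Lemma is_quartic_add P P' : is_quartic P -> is_quartic P' ->
  is_quartic (fun X Y Z => P X Y Z + P' X Y Z).
Proof.
  intros (c & H) (c' & H'). exists (fun i j => c i j + c' i j). intros X Y Z.
  rewrite H, H', !quartic_sum_eq. ring.
Qed.

Lemma is_quartic_scal k P : is_quartic P -> is_quartic (fun X Y Z => k * P X Y Z).
Proof.
  intros (c & H). exists (fun i j => k * c i j). intros X Y Z.
  rewrite H, !quartic_sum_eq. ring.
Qed.

Lemma is_quartic_zero : is_quartic (fun _ _ _ => 0).
Proof. exists (fun _ _ => 0). intros. rewrite quartic_sum_eq. ring. Qed.

Lemma is_quartic_sum_list (l : list nat) (f : nat -> R -> R -> R -> R) :
  (forall k, In k l -> is_quartic (f k)) ->
  is_quartic (fun X Y Z => fold_right Rplus 0 (map (fun k => f k X Y Z) l)).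
Proof.
  induction l as [|a l IH]; intros H; simpl; [apply is_quartic_zero|].
  apply (is_quartic_add (f a)); [apply H; now left|].
  apply IH. intros k Hk. apply H. now right.
Qed.

Definition quadratic (a b c d e f : R) (X Y Z : R) : R :=
  a * X ^ 2 + b * X * Y + c * X * Z + d * Y ^ 2 + e * Y * Z + f * Z ^ 2.

Lemma is_quartic_quadratics a b c d e f a' b' c' d' e' f' :
  is_quartic (fun X Y Z => quadratic a b c d e f X Y Z * quadratic a' b' c' d' e' f' X Y Z).
Proof.
  exists (fun i j => match i, j with
    | 4%nat, 0%nat => a * a' | 3%nat, 0%nat => a * c' + c * a' | 3%nat, 1%nat => a * b' + b * a'
    | 2%nat, 0%nat => a * f' + f * a' + c * c'
    | 2%nat, 1%nat => a * e' + e * a' + b * c' + c * b'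
    | 2%nat, 2%nat => a * d' + d * a' + b * b'
    | 1%nat, 0%nat => c * f' + f * c'
    | 1%nat, 1%nat => b * f' + f * b' + c * e' + e * c'
    | 1%nat, 2%nat => b * e' + e * b' + c * d' + d * c'
    | 1%nat, 3%nat => b * d' + d * b'
    | 0%nat, 0%nat => f * f' | 0%nat, 1%nat => e * f' + f * e' | 0%nat, 2%nat => d * f' + f * d' + e * e'
    | 0%nat, 3%nat => d * e' + e * d' | _, _ => d * d' end).
  intros. rewrite quartic_sum_eq. unfold quadratic. ring.
Qed.

(** With a list of factors the degree of the product is a length. *)
Definition linear_product (l : list covector) (X Y Z : R) : R :=
  fold_right (fun u p => ev u X Y Z * p) 1 l.

Lemma linear_product_app l l' X Y Z :
  linear_product (l ++ l') X Y Z = linear_product l X Y Z * linear_product l' X Y Z.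
Proof. induction l as [|a l IH]; simpl; [ring|]. rewrite IH. ring. Qed.

Lemma linear_product_repeat u n X Y Z :
  linear_product (repeat u n) X Y Z = ev u X Y Z ^ n.
Proof. induction n as [|n IH]; simpl; [reflexivity|]. now rewrite IH. Qed.

Lemma is_quartic_linear_product l : length l = 4%nat -> is_quartic (linear_product l).
Proof.
  destruct l as [|[[a1 b1] c1] [|[[a2 b2] c2] [|[[a3 b3] c3] [|[[a4 b4] c4] [|]]]]]; try discriminate.
  intros _.
  apply (is_quartic_ext (fun X Y Z =>
    quadratic (a1 * a2) (a1 * b2 + b1 * a2) (a1 * c2 + c1 * a2) (b1 * b2)
              (b1 * c2 + c1 * b2) (c1 * c2) X Y Z *
    quadratic (a3 * a4) (a3 * b4 + b3 * a4) (a3 * c4 + c3 * a4) (b3 * b4)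
              (b3 * c4 + c3 * b4) (c3 * c4) X Y Z)); [|apply is_quartic_quadratics].
  intros. unfold quadratic, linear_product. simpl. ring.
Qed.

(** Each monomial becomes a product of four linear forms, which is grouped as two quadratic
    forms. *)
Lemma is_quartic_substitution P u v w : is_quartic P ->
  is_quartic (fun X Y Z => P (ev u X Y Z) (ev v X Y Z) (ev w X Y Z)).
Proof.
  intros (c & H).
  apply (is_quartic_ext (fun X Y Z =>
    quartic_sum c (ev u X Y Z) (ev v X Y Z) (ev w X Y Z))); [intros; now rewrite H|].
  unfold quartic_sum, sum_lt.
  apply is_quartic_sum_list with (f := fun i X Y Z =>
    fold_right Rplus 0 (map (fun j => c i j * ev u X Y Z ^ i * ev v X Y Z ^ j
       * ev w X Y Z ^ (4 - i - j)) (seq 0 (5 - i)))).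
  intros i Hi. apply in_seq in Hi.
  apply is_quartic_sum_list with (f := fun j X Y Z =>
    c i j * ev u X Y Z ^ i * ev v X Y Z ^ j * ev w X Y Z ^ (4 - i - j)).
  intros j Hj. apply in_seq in Hj.
  apply (is_quartic_ext (fun X Y Z => c i j *
    linear_product (repeat u i ++ repeat v j ++ repeat w (4 - i - j)) X Y Z)).
  - intros. rewrite !linear_product_app, !linear_product_repeat. ring.
  - apply is_quartic_scal, is_quartic_linear_product.
    rewrite !length_app, !repeat_length. lia.
Qed.

Lemma is_quartic_homogeneous P k X Y Z : is_quartic P ->
  P (k * X) (k * Y) (k * Z) = k ^ 4 * P X Y Z.
Proof. intros (c & H). rewrite !H, !quartic_sum_eq. ring. Qed.

(** The differential of [s] does not vanish, so it can be cancelled in the chain rule; this replaces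
    an argument that the values of [s] fill an interval. *)
Lemma vanish_derivative (V : plane_set) F s (g g' : R -> R) :
  open_set V -> first_integral V F s -> (forall t, is_derive g t (g' t)) ->
  (forall x y, V x y -> g (s x y) = 0) -> forall x y, V x y -> g' (s x y) = 0.
Proof.
  intros HO [Ss HF] Hg H x y HV. destruct (smooth_on_grad V s Ss) as (G & _).
  assert (Gg : grad_on V (fun x y => g (s x y)) (fun x y => dx s x y * g' (s x y))
                 (fun x y => dy s x y * g' (s x y))).
  { intros u v Huv. destruct (G u v Huv) as [G1 G2]. split.
    - exact (is_derive_comp g (fun t => s t v) u _ _ (Hg _) G1).
    - exact (is_derive_comp g (fun t => s u t) v _ _ (Hg _) G2). }
  assert (G0 : grad_on V (fun _ _ => 0) (fun _ _ => 0) (fun _ _ => 0))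
    by (intros u v Huv; split; apply is_derive_Rconst).
  destruct (grad_on_eq V _ _ _ _ _ _ HO Gg G0 H x y HV) as [X Y].
  apply Rmult_integral in X. apply Rmult_integral in Y.
  destruct X as [X|]; [|assumption]. destruct Y as [Y|]; [|assumption].
  exfalso. apply (proj1 (HF x y HV)). now rewrite X, Y.
Qed.

(** Four differentiations isolate the leading coefficient; the other ones follow in turn from the
    lower derivatives. *)
Lemma vanish_coefficients (V : plane_set) F s a0 a1 a2 a3 a4 x y :
  open_set V -> first_integral V F s -> V x y ->
  (forall x y, V x y -> a0 + a1 * s x y + a2 * s x y ^ 2 + a3 * s x y ^ 3 + a4 * s x y ^ 4 = 0) ->
  a0 = 0 /\ a1 = 0 /\ a2 = 0 /\ a3 = 0 /\ a4 = 0.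
Proof.
  intros HO FI HV H0.
  assert (H1 : forall x y, V x y -> a1 + 2 * a2 * s x y + 3 * a3 * s x y ^ 2 + 4 * a4 * s x y ^ 3 = 0).
  { apply (vanish_derivative V F s
      (fun t => a0 + a1 * t + a2 * t ^ 2 + a3 * t ^ 3 + a4 * t ^ 4)
      (fun t => a1 + 2 * a2 * t + 3 * a3 * t ^ 2 + 4 * a4 * t ^ 3) HO FI); [|exact H0].
    intros t. der. ring. }
  assert (H2 : forall x y, V x y -> 2 * a2 + 6 * a3 * s x y + 12 * a4 * s x y ^ 2 = 0).
  { apply (vanish_derivative V F s
      (fun t => a1 + 2 * a2 * t + 3 * a3 * t ^ 2 + 4 * a4 * t ^ 3)
      (fun t => 2 * a2 + 6 * a3 * t + 12 * a4 * t ^ 2) HO FI); [|exact H1].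
    intros t. der. ring. }
  assert (H3 : forall x y, V x y -> 6 * a3 + 24 * a4 * s x y = 0).
  { apply (vanish_derivative V F s
      (fun t => 2 * a2 + 6 * a3 * t + 12 * a4 * t ^ 2)
      (fun t => 6 * a3 + 24 * a4 * t) HO FI); [|exact H2].
    intros t. der. ring. }
  assert (H4 : forall x y, V x y -> 24 * a4 = 0).
  { apply (vanish_derivative V F s (fun t => 6 * a3 + 24 * a4 * t) (fun t => 24 * a4) HO FI); [|exact H3].
    intros t. der. ring. }
  specialize (H0 x y HV). specialize (H1 x y HV). specialize (H2 x y HV).
  specialize (H3 x y HV). specialize (H4 x y HV).
  assert (Z4 : a4 = 0) by lra. subst a4. assert (Z3 : a3 = 0) by lra. subst a3.
  assert (Z2 : a2 = 0) by lra. subst a2. assert (Z1 : a1 = 0) by lra. subst a1.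
  repeat split; lra.
Qed.

(** The four arcs lie on Z = 0, Y = 0, Y = Z and Y = - Z. On each of them [T] is a polynomial in one
    parameter with all coefficients zero, and the resulting linear system leaves one free
    coefficient. *)
Lemma quartic_vanishing_on_lines (V : plane_set) F0 F1 F2 F3 t0 t1 t2 t3 T x0 y0 :
  open_set V -> V x0 y0 ->
  first_integral V F0 t0 -> first_integral V F1 t1 ->
  first_integral V F2 t2 -> first_integral V F3 t3 ->
  is_quartic T ->
  (forall x y, V x y -> T (t0 x y) 1 0 = 0) -> (forall x y, V x y -> T (t1 x y) 0 1 = 0) ->
  (forall x y, V x y -> T (-2 * t2 x y) (-1) (-1) = 0) ->
  (forall x y, V x y -> T (-2 * t3 x y) (-1) 1 = 0) ->
  exists c, forall X Y Z, T X Y Z = c * (Y * Z * (Y - Z) * (Y + Z)).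
Proof.
  intros HO V0 I0 I1 I2 I3 (c & Hc) H0 H1 H2 H3.
  destruct (vanish_coefficients V F0 t0 (c 0%nat 4%nat) (c 1%nat 3%nat) (c 2%nat 2%nat)
    (c 3%nat 1%nat) (c 4%nat 0%nat) x0 y0 HO I0 V0) as (A0 & A1 & A2 & A3 & A4).
  { intros x y HV. rewrite <- (H0 x y HV), Hc, quartic_sum_eq. ring. }
  destruct (vanish_coefficients V F1 t1 (c 0%nat 0%nat) (c 1%nat 0%nat) (c 2%nat 0%nat)
    (c 3%nat 0%nat) (c 4%nat 0%nat) x0 y0 HO I1 V0) as (B0 & B1 & B2 & B3 & B4).
  { intros x y HV. rewrite <- (H1 x y HV), Hc, quartic_sum_eq. ring. }
  destruct (vanish_coefficients V F2 t2
    (c 0%nat 0%nat + c 0%nat 1%nat + c 0%nat 2%nat + c 0%nat 3%nat + c 0%nat 4%nat)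
    (2 * (c 1%nat 0%nat + c 1%nat 1%nat + c 1%nat 2%nat + c 1%nat 3%nat))
    (4 * (c 2%nat 0%nat + c 2%nat 1%nat + c 2%nat 2%nat))
    (8 * (c 3%nat 0%nat + c 3%nat 1%nat)) (16 * c 4%nat 0%nat) x0 y0 HO I2 V0)
    as (C0 & C1 & C2 & C3 & C4).
  { intros x y HV. rewrite <- (H2 x y HV), Hc, quartic_sum_eq. ring. }
  destruct (vanish_coefficients V F3 t3
    (c 0%nat 0%nat - c 0%nat 1%nat + c 0%nat 2%nat - c 0%nat 3%nat + c 0%nat 4%nat)
    (-2 * (c 1%nat 0%nat - c 1%nat 1%nat + c 1%nat 2%nat - c 1%nat 3%nat))
    (4 * (c 2%nat 0%nat - c 2%nat 1%nat + c 2%nat 2%nat))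
    (-8 * (c 3%nat 0%nat - c 3%nat 1%nat)) (16 * c 4%nat 0%nat) x0 y0 HO I3 V0)
    as (E0 & E1 & E2 & E3 & E4).
  { intros x y HV. rewrite <- (H3 x y HV), Hc, quartic_sum_eq. ring. }
  exists (c 0%nat 3%nat). intros X Y Z. rewrite Hc, quartic_sum_eq.
  rewrite A0, A1, A2, A3, A4, B0, B1, B2, B3 in *.
  assert (D1 : c 0%nat 1%nat = - c 0%nat 3%nat) by lra.
  assert (D2 : c 0%nat 2%nat = 0) by lra.
  assert (D3 : c 1%nat 1%nat = 0) by lra.
  assert (D4 : c 1%nat 2%nat = 0) by lra.
  assert (D5 : c 2%nat 1%nat = 0) by lra.
  rewrite D1, D2, D3, D4, D5. ring.
Qed.

(** [m] sends the model coordinates X, Y, Z to those of [P], and [n] undoes it. The four lines are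
    [n 1], [n 2], their difference and their sum; they meet at the image of [1 : 0 : 0]. *)
Lemma harmonic_factorization (P : R -> R -> R -> R) (m n : nat -> covector) c :
  (exists X Y Z, P X Y Z <> 0) ->
  (forall X Y Z, P X Y Z = c * (ev (n 1%nat) X Y Z * ev (n 2%nat) X Y Z
     * (ev (n 1%nat) X Y Z - ev (n 2%nat) X Y Z) * (ev (n 1%nat) X Y Z + ev (n 2%nat) X Y Z))) ->
  (forall X Y Z,
     ev (n 0%nat) (ev (m 0%nat) X Y Z) (ev (m 1%nat) X Y Z) (ev (m 2%nat) X Y Z) = X /\
     ev (n 1%nat) (ev (m 0%nat) X Y Z) (ev (m 1%nat) X Y Z) (ev (m 2%nat) X Y Z) = Y /\
     ev (n 2%nat) (ev (m 0%nat) X Y Z) (ev (m 1%nat) X Y Z) (ev (m 2%nat) X Y Z) = Z) ->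
  four_harmonic_lines P.
Proof.
  intros (X0 & Y0 & Z0 & HP) H HN.
  assert (c0 : c <> 0) by (intros Z; apply HP; rewrite H, Z; ring).
  set (scale := fun k (u : covector) => let '(a, b, d) := u in (k * a, k * b, k * d) : covector).
  set (comb := fun k (u v : covector) => let '(a, b, d) := u in let '(a', b', d') := v in
      (a + k * a', b + k * b', d + k * d') : covector).
  assert (ES : forall k u X Y Z, ev (scale k u) X Y Z = k * ev u X Y Z).
  { intros k [[a b] d] X Y Z. simpl. ring. }
  assert (EC : forall k u v X Y Z, ev (comb k u v) X Y Z = ev u X Y Z + k * ev v X Y Z).
  { intros k [[a b] d] [[a' b'] d'] X Y Z. simpl. ring. }
  clearbody scale comb.
  assert (DL : forall a b a' b' l l', a * b' - b * a' <> 0 ->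
     (forall X Y Z, ev l X Y Z = a * ev (n 1%nat) X Y Z + b * ev (n 2%nat) X Y Z) ->
     (forall X Y Z, ev l' X Y Z = a' * ev (n 1%nat) X Y Z + b' * ev (n 2%nat) X Y Z) ->
     distinct_lines l l').
  { intros a b a' b' l l' D El El' k k' K.
    pose proof (K (ev (m 0%nat) 0 1 0) (ev (m 1%nat) 0 1 0) (ev (m 2%nat) 0 1 0)) as K1.
    pose proof (K (ev (m 0%nat) 0 0 1) (ev (m 1%nat) 0 0 1) (ev (m 2%nat) 0 0 1)) as K2.
    rewrite El, El' in K1, K2.
    destruct (HN 0 1 0) as (_ & A1 & A2). destruct (HN 0 0 1) as (_ & B1 & B2).
    rewrite A1, A2 in K1. rewrite B1, B2 in K2.
    split; apply Rmult_eq_reg_r with (a * b' - b * a'); try exact D; rewrite Rmult_0_l.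
    - transitivity ((k * a + k' * a') * b' - (k * b + k' * b') * a'); [ring|].
      replace (k * a + k' * a') with 0 by lra. replace (k * b + k' * b') with 0 by lra. ring.
    - transitivity (- (k * a + k' * a') * b + (k * b + k' * b') * a); [ring|].
      replace (k * a + k' * a') with 0 by lra. replace (k * b + k' * b') with 0 by lra. ring. }
  exists (scale c (n 1%nat)), (n 2%nat), (comb (-1) (n 1%nat) (n 2%nat)), (comb 1 (n 1%nat) (n 2%nat)).
  assert (F1 : forall X Y Z, ev (scale c (n 1%nat)) X Y Z = c * ev (n 1%nat) X Y Z + 0 * ev (n 2%nat) X Y Z)
    by (intros; rewrite ES; ring).
  assert (F2 : forall X Y Z, ev (n 2%nat) X Y Z = 0 * ev (n 1%nat) X Y Z + 1 * ev (n 2%nat) X Y Z)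
    by (intros; ring).
  assert (F3 : forall X Y Z, ev (comb (-1) (n 1%nat) (n 2%nat)) X Y Z = 1 * ev (n 1%nat) X Y Z + -1 * ev (n 2%nat) X Y Z)
    by (intros; rewrite EC; ring).
  assert (F4 : forall X Y Z, ev (comb 1 (n 1%nat) (n 2%nat)) X Y Z = 1 * ev (n 1%nat) X Y Z + 1 * ev (n 2%nat) X Y Z)
    by (intros; rewrite EC; ring).
  split; [intros; rewrite H, ES, !EC; ring|].
  split; [apply (DL c 0 0 1); auto; lra|]. split; [apply (DL c 0 1 (-1)); auto; lra|].
  split; [apply (DL c 0 1 1); auto; lra|]. split; [apply (DL 0 1 1 (-1)); auto; lra|].
  split; [apply (DL 0 1 1 1); auto; lra|]. split; [apply (DL 1 (-1) 1 1); auto; lra|].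
  split.
  - exists (ev (m 0%nat) 1 0 0), (ev (m 1%nat) 1 0 0), (ev (m 2%nat) 1 0 0).
    destruct (HN 1 0 0) as (A0 & A1 & A2). split.
    + intros E. injection E as E1 E2 E3. rewrite E1, E2, E3 in A0.
      destruct (n 0%nat) as [[a b] d]. simpl in A0. lra.
    + rewrite ES, !EC, A1, A2. repeat split; ring.
  (* The constant c was absorbed by the first line, so its contribution to the third and fourth is 1
     / c; the quotient of the pencil coordinates is - 1. *)
  - exists (/ c), (-1), (/ c), 1.
    assert (/ c <> 0) by now apply Rinv_neq_0_compat.
    repeat split; try lra; try (intros; rewrite EC, ES; field; exact c0).
    field. exact c0.
Qed.

Lemma combination_unique (V : plane_set) d W n B (c c' : nat -> R) :
  abelian_basis V d W n B ->
  (forall i x y, (i < d)%nat -> V x y ->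
     sum_lt n (fun k => c k * fst (B k i) x y) = sum_lt n (fun k => c' k * fst (B k i) x y) /\
     sum_lt n (fun k => c k * snd (B k i) x y) = sum_lt n (fun k => c' k * snd (B k i) x y)) ->
  forall k, (k < n)%nat -> c k = c' k.
Proof.
  intros (_ & Hind & _) H k Hk.
  enough (c k - c' k = 0) by lra.
  apply (Hind (fun k => c k - c' k)); [|exact Hk].
  assert (S : forall (f g h : nat -> R) l, (forall k, h k = f k - g k) ->
     fold_right Rplus 0 (map h l) = fold_right Rplus 0 (map f l) - fold_right Rplus 0 (map g l)).
  { intros f g h l E. induction l as [|a l IH]; simpl; [ring|]. rewrite E, IH. ring. }
  intros i x y Hi HV. destruct (H i x y Hi HV) as [X Y]. unfold sum_lt in *. split.
  - rewrite (S (fun k => c k * fst (B k i) x y) (fun k => c' k * fst (B k i) x y));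
      [lra|intros; ring].
  - rewrite (S (fun k => c k * snd (B k i) x y) (fun k => c' k * snd (B k i) x y));
      [lra|intros; ring].
Qed.

(** The basis underlying [P] and the standard one are related by constant matrices M and N inverse
    to each other. Pulled back by M, [P] vanishes on the standard arcs and is thus known up to a
    factor; N carries its lines back. *)
Lemma parallel_rank_quartic (x0 y0 r : R) (W : nat -> line_field) p q :
  let V := open_disc x0 y0 r in
  0 < r -> (forall i, (i < 4)%nat -> first_integral V (W i) (parallel_first_integrals p q i)) ->
  (forall x y, V x y -> dx p x y * dy q x y - dy p x y * dx q x y <> 0) ->
  (exists P, rank_quartic V W P) /\ (forall P, rank_quartic V W P -> four_harmonic_lines P).
Proof.
  intros V Hr FI J. pose proof (parallel_4web_basis x0 y0 r W p q Hr FI J) as HB. fold V in HB.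
  pose proof (open_disc_open x0 y0 r : open_set V) as HO.
  pose proof (open_disc_center x0 y0 r Hr : V x0 y0) as V0.
  split.
  - exists (fun X Y Z => Y * Z * (Y - Z) * (Y + Z)). split.
    + split.
      * exists (fun i j => match i, j with 0%nat, 3%nat => 1 | 0%nat, 1%nat => - 1 | _, _ => 0 end).
        intros X Y Z.
        change (Y * Z * (Y - Z) * (Y + Z) =
          quartic_sum (fun i j => match i, j with 0%nat, 3%nat => 1 | 0%nat, 1%nat => - 1 | _, _ => 0 end) X Y Z).
        rewrite quartic_sum_eq. ring.
      * exists 0, 2, 1. lra.
    + exists (parallel_first_integrals p q), parallel_coefficients.
      split; [exact FI|]. split; [exact HB|].
      intros i x y Hi _. destruct i as [|[|[|[|i]]]]; [| | | |lia];
        cbn [parallel_coefficients]; ring.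
  - intros P [[HQ HP] (s & xi & Hs & HB' & Hz)].
    set (B := fun k i => ((fun x y => xi k i (s i x y) * dx (s i) x y),
                          (fun x y => xi k i (s i x y) * dy (s i) x y)) : form) in *.
    set (Rl := parallel_relations p q) in *.
    pose proof HB as (RA & _ & RS). pose proof HB' as (BA & _ & BS).
    destruct (RS _ (BA 0%nat ltac:(lia))) as (M0 & HM0).
    destruct (RS _ (BA 1%nat ltac:(lia))) as (M1 & HM1).
    destruct (RS _ (BA 2%nat ltac:(lia))) as (M2 & HM2).
    destruct (BS _ (RA 0%nat ltac:(lia))) as (N0 & HN0).
    destruct (BS _ (RA 1%nat ltac:(lia))) as (N1 & HN1).
    destruct (BS _ (RA 2%nat ltac:(lia))) as (N2 & HN2).
    set (row := fun f : nat -> R => (f 0%nat, f 1%nat, f 2%nat) : covector).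
    (* Stated for two arbitrary systems of relations, because it is used in both directions to prove
       that N M and M N are the identity. *)
    assert (inv : forall (B B' : nat -> nat -> form) (M0 M1 M2 : nat -> R) (N : nat -> R) k,
      abelian_basis V 4 W 3 B ->
      (forall i x y, (i < 4)%nat -> V x y ->
         fst (B' 0%nat i) x y = sum_lt 3 (fun k => M0 k * fst (B k i) x y) /\
         snd (B' 0%nat i) x y = sum_lt 3 (fun k => M0 k * snd (B k i) x y)) ->
      (forall i x y, (i < 4)%nat -> V x y ->
         fst (B' 1%nat i) x y = sum_lt 3 (fun k => M1 k * fst (B k i) x y) /\
         snd (B' 1%nat i) x y = sum_lt 3 (fun k => M1 k * snd (B k i) x y)) ->
      (forall i x y, (i < 4)%nat -> V x y ->
         fst (B' 2%nat i) x y = sum_lt 3 (fun k => M2 k * fst (B k i) x y) /\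
         snd (B' 2%nat i) x y = sum_lt 3 (fun k => M2 k * snd (B k i) x y)) ->
      (forall i x y, (i < 4)%nat -> V x y ->
         fst (B k i) x y = sum_lt 3 (fun j => N j * fst (B' j i) x y) /\
         snd (B k i) x y = sum_lt 3 (fun j => N j * snd (B' j i) x y)) ->
      (k < 3)%nat ->
      forall j, (j < 3)%nat ->
        N 0%nat * M0 j + N 1%nat * M1 j + N 2%nat * M2 j = if Nat.eqb j k then 1 else 0).
    { intros B0 B' m0 m1 m2 nn k HBB h0 h1 h2 hn Hk j Hj.
      apply (combination_unique V 4 W 3 B0
        (fun j => nn 0%nat * m0 j + nn 1%nat * m1 j + nn 2%nat * m2 j)
        (fun j => if Nat.eqb j k then 1 else 0) HBB); [|exact Hj].
      intros i x y Hi HV. destruct (hn i x y Hi HV) as [X Y]. rewrite !sum_lt_3 in *.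
      destruct (h0 i x y Hi HV) as [a0 b0]. destruct (h1 i x y Hi HV) as [a1 b1].
      destruct (h2 i x y Hi HV) as [a2 b2]. rewrite sum_lt_3 in a0, b0, a1, b1, a2, b2.
      rewrite a0, a1, a2 in X. rewrite b0, b1, b2 in Y.
      split; [transitivity (fst (B0 k i) x y); [rewrite X; ring|]
             |transitivity (snd (B0 k i) x y); [rewrite Y; ring|]];
        (destruct k as [|[|[|k]]]; [| | |lia]; cbn [Nat.eqb]; ring). }
    assert (NM : forall k j N, (k < 3)%nat -> (j < 3)%nat -> N = nth k (N0 :: N1 :: N2 :: nil) N0 ->
      N 0%nat * M0 j + N 1%nat * M1 j + N 2%nat * M2 j = if Nat.eqb j k then 1 else 0).
    { intros k j N Hk Hj EN. apply (inv Rl B M0 M1 M2 N k HB HM0 HM1 HM2); auto.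
      destruct k as [|[|[|k]]]; [| | |lia]; simpl in EN; subst N; assumption. }
    assert (MN : forall k j M, (k < 3)%nat -> (j < 3)%nat -> M = nth k (M0 :: M1 :: M2 :: nil) M0 ->
      M 0%nat * N0 j + M 1%nat * N1 j + M 2%nat * N2 j = if Nat.eqb j k then 1 else 0).
    { intros k j M Hk Hj EM. apply (inv B Rl N0 N1 N2 M k HB' HN0 HN1 HN2); auto.
      destruct k as [|[|[|k]]]; [| | |lia]; simpl in EM; subst M; assumption. }
    assert (HT : forall i x y, (i < 4)%nat -> V x y ->
      P (ev (row M0) (parallel_coefficients 0 i (parallel_first_integrals p q i x y))
                     (parallel_coefficients 1 i (parallel_first_integrals p q i x y))
                     (parallel_coefficients 2 i (parallel_first_integrals p q i x y)))
        (ev (row M1) (parallel_coefficients 0 i (parallel_first_integrals p q i x y))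
                     (parallel_coefficients 1 i (parallel_first_integrals p q i x y))
                     (parallel_coefficients 2 i (parallel_first_integrals p q i x y)))
        (ev (row M2) (parallel_coefficients 0 i (parallel_first_integrals p q i x y))
                     (parallel_coefficients 1 i (parallel_first_integrals p q i x y))
                     (parallel_coefficients 2 i (parallel_first_integrals p q i x y))) = 0).
    { intros i x y Hi HV. pose proof (Hz i x y Hi HV) as Z.
      destruct (proj2 (FI i Hi) x y HV) as [Nn Ni]. destruct (proj2 (Hs i Hi) x y HV) as [Nn' Ni'].
      set (sx := dx (parallel_first_integrals p q i) x y) in *.
      set (sy := dy (parallel_first_integrals p q i) x y) in *.
      (* [P] comes with first integrals of its own. Their gradients are proportional to the standard
         ones, and the factor [l] disappears by homogeneity of [P]. *)
      assert (Par : exists l, dx (s i) x y = l * sx /\ dy (s i) x y = l * sy).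
      { apply parallel_multiple; [exact Nn|].
        assert (dx (s i) x y * sy + dy (s i) x y * (- sx) = 0); [|lra].
        apply Ni'. apply Ni. ring. }
      destruct Par as (l & e1 & e2).
      assert (T : forall k M, (forall i x y, (i < 4)%nat -> V x y ->
         fst (B k i) x y = sum_lt 3 (fun m => M m * fst (Rl m i) x y) /\
         snd (B k i) x y = sum_lt 3 (fun m => M m * snd (Rl m i) x y)) ->
         ev (row M) (parallel_coefficients 0 i (parallel_first_integrals p q i x y))
                     (parallel_coefficients 1 i (parallel_first_integrals p q i x y))
                     (parallel_coefficients 2 i (parallel_first_integrals p q i x y))
         = l * xi k i (s i x y)).
      { intros k M HM. destruct (HM i x y Hi HV) as [X Y]. rewrite sum_lt_3 in X, Y.
        unfold B, Rl, parallel_relations in X, Y. cbn [fst snd] in X, Y.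
        fold sx in X. fold sy in Y. rewrite e1 in X. rewrite e2 in Y.
        unfold row, ev.
        match goal with |- ?g = ?h => set (a := g) in *; set (b := h) in * end.
        assert (X' : (a - b) * sx = 0) by (unfold a, b; lra).
        assert (Y' : (a - b) * sy = 0) by (unfold a, b; lra).
        apply Rmult_integral in X'. apply Rmult_integral in Y'.
        destruct X' as [X'|X']; [lra|]. destruct Y' as [Y'|Y']; [lra|].
        exfalso. apply Nn. now rewrite X', Y'. }
      rewrite (T 0%nat M0 HM0), (T 1%nat M1 HM1), (T 2%nat M2 HM2).
      rewrite (is_quartic_homogeneous P); [rewrite Z; ring|exact HQ]. }
    destruct (quartic_vanishing_on_lines V _ _ _ _ _ _ _ _
      (fun X Y Z => P (ev (row M0) X Y Z) (ev (row M1) X Y Z) (ev (row M2) X Y Z)) x0 y0 HO V0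
      (FI 0%nat ltac:(lia)) (FI 1%nat ltac:(lia)) (FI 2%nat ltac:(lia)) (FI 3%nat ltac:(lia))
      (is_quartic_substitution P (row M0) (row M1) (row M2) HQ)) as (c & Hc).
    { intros x y HV. exact (HT 0%nat x y ltac:(lia) HV). }
    { intros x y HV. exact (HT 1%nat x y ltac:(lia) HV). }
    { intros x y HV. exact (HT 2%nat x y ltac:(lia) HV). }
    { intros x y HV. exact (HT 3%nat x y ltac:(lia) HV). }
    cbv beta in Hc.
    assert (EV : forall f X Y Z, ev (row f) X Y Z = f 0%nat * X + f 1%nat * Y + f 2%nat * Z)
      by reflexivity.
    assert (comp : forall (M N0 N1 N2 : nat -> R) k,
      (forall j, (j < 3)%nat -> M 0%nat * N0 j + M 1%nat * N1 j + M 2%nat * N2 j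
                                = if Nat.eqb j k then 1 else 0) ->
      forall X Y Z, ev (row M) (ev (row N0) X Y Z) (ev (row N1) X Y Z) (ev (row N2) X Y Z)
        = (if Nat.eqb 0 k then X else 0) + (if Nat.eqb 1 k then Y else 0)
          + (if Nat.eqb 2 k then Z else 0)).
    { intros M n0 n1 n2 k K X Y Z. rewrite !EV.
      transitivity ((M 0%nat * n0 0%nat + M 1%nat * n1 0%nat + M 2%nat * n2 0%nat) * X
        + (M 0%nat * n0 1%nat + M 1%nat * n1 1%nat + M 2%nat * n2 1%nat) * Y
        + (M 0%nat * n0 2%nat + M 1%nat * n1 2%nat + M 2%nat * n2 2%nat) * Z); [ring|].
      rewrite !K by lia. destruct (Nat.eqb 0 k), (Nat.eqb 1 k), (Nat.eqb 2 k); ring. }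
    apply (harmonic_factorization P
      (fun k => match k with 0%nat => row M0 | 1%nat => row M1 | _ => row M2 end)
      (fun k => match k with 0%nat => row N0 | 1%nat => row N1 | _ => row N2 end) c HP).
    + intros X Y Z. cbv iota beta.
      pose proof (comp M0 N0 N1 N2 0%nat (fun j Hj => MN 0%nat j M0 ltac:(lia) Hj eq_refl) X Y Z) as R0.
      pose proof (comp M1 N0 N1 N2 1%nat (fun j Hj => MN 1%nat j M1 ltac:(lia) Hj eq_refl) X Y Z) as R1.
      pose proof (comp M2 N0 N1 N2 2%nat (fun j Hj => MN 2%nat j M2 ltac:(lia) Hj eq_refl) X Y Z) as R2.
      cbn [Nat.eqb] in R0, R1, R2.
      rewrite <- (Hc (ev (row N0) X Y Z) (ev (row N1) X Y Z) (ev (row N2) X Y Z)), R0, R1, R2. f_equal; ring.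
    + intros X Y Z. cbv iota beta.
      pose proof (comp N0 M0 M1 M2 0%nat (fun j Hj => NM 0%nat j N0 ltac:(lia) Hj eq_refl) X Y Z) as R0.
      pose proof (comp N1 M0 M1 M2 1%nat (fun j Hj => NM 1%nat j N1 ltac:(lia) Hj eq_refl) X Y Z) as R1.
      pose proof (comp N2 M0 M1 M2 2%nat (fun j Hj => NM 2%nat j N2 ltac:(lia) Hj eq_refl) X Y Z) as R2.
      cbn [Nat.eqb] in R0, R1, R2. rewrite R0, R1, R2. repeat split; ring.
Qed.

(** * The foci *)

(* Real and imaginary parts of G(z) = k z^2 + (d + i d') z + (e + i e'), k real. *)
Definition quad_re (k d d' e e' x y : R) : R := k * (x ^ 2 - y ^ 2) + d * x - d' * y + e.
Definition quad_im (k d d' e e' x y : R) : R := k * (2 * x * y) + d * y + d' * x + e'.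

(* G = rho exp(i (a + b)) with rho > 0 and a, b the direction angles is
   holomorphic, and its second derivative is both holomorphic and real. *)
Lemma curvature_zero_quadratic (x0 y0 r : R) L1 L2 N1 N2 c1 s1 A c2 s2 C :
  let V := open_disc x0 y0 r in
  0 < r -> frame V L1 L2 N1 N2 c1 s1 A c2 s2 C ->
  (forall x y, V x y -> web_curvature c1 s1 A c2 s2 C x y = 0) ->
  exists k d d' e e', forall x y, V x y -> exists rho, 0 < rho /\
    quad_re k d d' e e' x y = rho * (c1 x y * c2 x y - s1 x y * s2 x y) /\
    quad_im k d d' e e' x y = rho * (c1 x y * s2 x y + s1 x y * c2 x y).
Proof.
  intros V Hr F HC.
  pose proof (open_disc_open x0 y0 r : open_set V) as HO.
  destruct (frame_smooth F)
    as ((Sc1 & Ss1 & SA & Sc2 & Ss2 & SC) & (SAx & SAy & SCx & SCy)).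
  set (Gr := fun x y => A x y * c1 x y + C x y * c2 x y) in *.
  set (Gi := fun x y => A x y * s1 x y + C x y * s2 x y) in *.
  assert (rot : forall x y, V x y ->
     c1 x y * dy A x y - s1 x y * dx A x y + (c2 x y * dy C x y - s2 x y * dx C x y) = 0).
  { intros x y HV. pose proof (HC x y HV) as E.
    rewrite (web_curvature_rot V _ _ _ _ _ _ _ _ _ _ x y HO F HV) in E.
    pose proof (fr_S F x y HV) as S0.
    apply Rmult_integral in E. destruct E as [E|E]; [contradiction|]. exact E. }
  destruct (poincare_disc x0 y0 r Gr Gi
    (fun x y => dy A x y * c1 x y - A x y * (c1 x y * s1 x y * A x y)
                     + dy C x y * c2 x y - C x y * (c2 x y * s2 x y * C x y))
    (fun x y => dx A x y * s1 x y - A x y * (c1 x y * s1 x y * A x y)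
                     + dx C x y * s2 x y - C x y * (c2 x y * s2 x y * C x y)))
    as (kap & Sk & Gk); try assumption.
  { unfold Gr; smooth. }
  { unfold Gi; smooth. }
  { intros x y HV. at_point F HO x y HV. unfold Gr. der. ring. }
  { intros x y HV. at_point F HO x y HV. unfold Gi. der. ring. }
  { intros x y HV. pose proof (rot x y HV). lra. }
  set (E := fun x y => exp (kap x y)).
  assert (SE : smooth_on V E) by (unfold E; smooth).
  assert (GE : grad_on V E (fun x y => Gr x y * E x y) (fun x y => Gi x y * E x y)).
  { intros x y HV. destruct (Gk x y HV). unfold E. split; der; ring. }
  assert (EP : forall x y, 0 < E x y) by (intros; apply exp_pos).
  clearbody E. clear Gk Sk kap.
  (* [a] + i [b] is G = E e1 e2, and [g1] + i [g2] is G' = E (A e2 + C e1). *)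
  set (g1 := fun x y => E x y * (A x y * c2 x y + C x y * c1 x y)).
  set (g2 := fun x y => E x y * (A x y * s2 x y + C x y * s1 x y)).
  set (a := fun x y => E x y * (c1 x y * c2 x y - s1 x y * s2 x y)).
  set (b := fun x y => E x y * (c1 x y * s2 x y + s1 x y * c2 x y)).
  (* The derivative of G' along e1 is [k2] e1: there A has derivative - A^2, e1 is constant, and the
     turning of e2 contributes another multiple of e1. Hence G'' is the real function [k2]. *)
  set (k2 := fun x y => E x y * (c1 x y * dx C x y + s1 x y * dy C x y + 2 * A x y * C x y
               + C x y ^ 2 * (c1 x y * c2 x y + s1 x y * s2 x y))).
  assert (Sk2 : smooth_on V k2) by (unfold k2; smooth).
  assert (Sg1 : smooth_on V g1) by (unfold g1; smooth).
  assert (Sg2 : smooth_on V g2) by (unfold g2; smooth).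
  assert (Ga : grad_on V a g1 (fun x y => - g2 x y)).
  { intros x y HV. at_point F HO x y HV. destruct (GE x y HV). unfold a, g1, g2.
    split; der; unfold Gr, Gi.
    - transitivity (E x y * (A x y * c2 x y * (c1 x y ^ 2 + s1 x y ^ 2)
         + C x y * c1 x y * (c2 x y ^ 2 + s2 x y ^ 2))); [ring|rewrite U1, U2; ring].
    - transitivity (- (E x y * (A x y * s2 x y * (c1 x y ^ 2 + s1 x y ^ 2)
         + C x y * s1 x y * (c2 x y ^ 2 + s2 x y ^ 2)))); [ring|rewrite U1, U2; ring]. }
  assert (Gb : grad_on V b g2 g1).
  { intros x y HV. at_point F HO x y HV. destruct (GE x y HV). unfold b, g1, g2.
    split; der; unfold Gr, Gi.
    - transitivity (E x y * (A x y * s2 x y * (c1 x y ^ 2 + s1 x y ^ 2)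
         + C x y * s1 x y * (c2 x y ^ 2 + s2 x y ^ 2))); [ring|rewrite U1, U2; ring].
    - transitivity (E x y * (A x y * c2 x y * (c1 x y ^ 2 + s1 x y ^ 2)
         + C x y * c1 x y * (c2 x y ^ 2 + s2 x y ^ 2))); [ring|rewrite U1, U2; ring]. }
  (* The Riccati equations give the components of grad A and grad C along the lines; the normal
     components nA and nC cancel by vanishing of the curvature. *)
  assert (dec : forall x y, V x y -> exists nA nC,
     dx A x y = - A x y ^ 2 * c1 x y - nA * s1 x y /\
     dy A x y = - A x y ^ 2 * s1 x y + nA * c1 x y /\
     dx C x y = - C x y ^ 2 * c2 x y - nC * s2 x y /\
     dy C x y = - C x y ^ 2 * s2 x y + nC * c2 x y /\ nA + nC = 0).
  { intros x y HV. at_point F HO x y HV. pose proof (rot x y HV) as R0.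
    exists (c1 x y * dy A x y - s1 x y * dx A x y), (c2 x y * dy C x y - s2 x y * dx C x y).
    rewrite <- RA, <- RC. repeat split.
    - transitivity (dx A x y * (c1 x y ^ 2 + s1 x y ^ 2)); [rewrite U1|]; ring.
    - transitivity (dy A x y * (c1 x y ^ 2 + s1 x y ^ 2)); [rewrite U1|]; ring.
    - transitivity (dx C x y * (c2 x y ^ 2 + s2 x y ^ 2)); [rewrite U2|]; ring.
    - transitivity (dy C x y * (c2 x y ^ 2 + s2 x y ^ 2)); [rewrite U2|]; ring.
    - exact R0. }
  assert (Gg1 : grad_on V g1 k2 (fun _ _ => 0)).
  { intros x y HV. at_point F HO x y HV. destruct (GE x y HV).
    destruct (dec x y HV) as (nA & nC & e1 & e2 & e3 & e4 & e5). unfold g1, k2, Gr, Gi in *.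
    split; der; rewrite e1, e3 || rewrite e2, e4; rewrite ?e3, ?e4;
      replace nC with (- nA) by lra; clear - U1 U2; nsz. }
  assert (Gg2 : grad_on V g2 (fun _ _ => 0) k2).
  { intros x y HV. at_point F HO x y HV. destruct (GE x y HV).
    destruct (dec x y HV) as (nA & nC & e1 & e2 & e3 & e4 & e5). unfold g2, k2, Gr, Gi in *.
    split; der; rewrite e1, e3 || rewrite e2, e4; rewrite ?e3, ?e4;
      replace nC with (- nA) by lra; clear - U1 U2; nsz. }
  destruct (smooth_on_grad V k2 Sk2) as (Gk2 & _).
  assert (G00 : grad_on V (fun _ _ => 0) (fun _ _ => 0) (fun _ _ => 0))
    by (intros x y _; split; apply is_derive_Rconst).
  assert (Gk0 : grad_on V k2 (fun _ _ => 0) (fun _ _ => 0)).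
  { refine (grad_on_ext V _ _ _ _ _ _ Gk2). intros x y HV. split.
    - symmetry. exact (mixed_partials V g2 _ _ _ _ _ _ HO Sg2 Gg2 G00 Gk2 x y HV).
    - exact (mixed_partials V g1 _ _ _ _ _ _ HO Sg1 Gg1 Gk2 G00 x y HV). }
  pose proof (grad_zero_const x0 y0 r k2 Gk0) as Ck.
  set (k := k2 x0 y0) in *.
  assert (P1 : forall x y, V x y -> g1 x y = k * x + (g1 x0 y0 - k * x0)).
  { apply (grad_eq_const x0 y0 r g1 (fun x y => k * x) (fun _ _ => k) (fun _ _ => 0)).
    - refine (grad_on_ext V _ _ _ _ _ _ Gg1). intros x y HV. split; [now apply Ck|reflexivity].
    - intros x y _. split; der; ring. }
  assert (P2 : forall x y, V x y -> g2 x y = k * y + (g2 x0 y0 - k * y0)).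
  { apply (grad_eq_const x0 y0 r g2 (fun x y => k * y) (fun _ _ => 0) (fun _ _ => k)).
    - refine (grad_on_ext V _ _ _ _ _ _ Gg2). intros x y HV. split; [reflexivity|now apply Ck].
    - intros x y _. split; der; ring. }
  set (d := g1 x0 y0 - k * x0) in *. set (d' := g2 x0 y0 - k * y0) in *.
  assert (P3 : forall x y, V x y -> a x y = quad_re (k / 2) d d' 0 0 x y
      + (a x0 y0 - quad_re (k / 2) d d' 0 0 x0 y0)).
  { apply (grad_eq_const x0 y0 r a (quad_re (k / 2) d d' 0 0)
       (fun x y => k * x + d) (fun x y => - (k * y + d'))).
    - refine (grad_on_ext V _ _ _ _ _ _ Ga). intros x y HV. rewrite (P1 x y HV), (P2 x y HV). split; ring.
    - intros x y _. unfold quad_re. split; der; field. }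
  assert (P4 : forall x y, V x y -> b x y = quad_im (k / 2) d d' 0 0 x y
      + (b x0 y0 - quad_im (k / 2) d d' 0 0 x0 y0)).
  { apply (grad_eq_const x0 y0 r b (quad_im (k / 2) d d' 0 0)
       (fun x y => k * y + d') (fun x y => k * x + d)).
    - refine (grad_on_ext V _ _ _ _ _ _ Gb). intros x y HV. rewrite (P1 x y HV), (P2 x y HV). split; ring.
    - intros x y _. unfold quad_im. split; der; field. }
  exists (k / 2), d, d', (a x0 y0 - quad_re (k / 2) d d' 0 0 x0 y0),
    (b x0 y0 - quad_im (k / 2) d d' 0 0 x0 y0).
  intros x y HV. exists (E x y). split; [apply EP|]. split.
  - change (E x y * (c1 x y * c2 x y - s1 x y * s2 x y)) with (a x y). rewrite (P3 x y HV).
    unfold quad_re. ring.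
  - change (E x y * (c1 x y * s2 x y + s1 x y * c2 x y)) with (b x y). rewrite (P4 x y HV).
    unfold quad_im. ring.
Qed.

(* With vectors as complex numbers, v w is a real multiple of g <> 0 whenever v is
   tangent to L1 and w to L2. *)
Definition aligned (L1 L2 : line_field) (gre gim x y : R) : Prop :=
  (gre, gim) <> (0, 0) /\
  forall vx vy wx wy, L1 x y vx vy -> L2 x y wx wy ->
    (vx * wx - vy * wy) * gim = (vx * wy + vy * wx) * gre.

Lemma span_unit (c s vx vy : R) : c ^ 2 + s ^ 2 = 1 -> c * vy - s * vx = 0 ->
  exists t, vx = t * c /\ vy = t * s.
Proof.
  intros U E. exists (c * vx + s * vy). split; nsz.
Qed.

Lemma aligned_frame (V : plane_set) L1 L2 N1 N2 c1 s1 A c2 s2 C gre gim x y :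
  frame V L1 L2 N1 N2 c1 s1 A c2 s2 C -> V x y ->
  (aligned L1 L2 gre gim x y <->
   (gre, gim) <> (0, 0) /\
   (c1 x y * c2 x y - s1 x y * s2 x y) * gim = (c1 x y * s2 x y + s1 x y * c2 x y) * gre).
Proof.
  intros [K1 K2 _ _ _] HV.
  pose proof (lf_unit K1 _ _ HV) as U1. pose proof (lf_unit K2 _ _ HV) as U2.
  split; intros [N H]; (split; [exact N|]).
  - apply H.
    + apply (lf_span K1); [exact HV|ring].
    + apply (lf_span K2); [exact HV|ring].
  - intros vx vy wx wy Hv Hw.
    apply (lf_span K1) in Hv; [|exact HV]. apply (lf_span K2) in Hw; [|exact HV].
    destruct (span_unit _ _ _ _ U1 Hv) as (t & -> & ->).
    destruct (span_unit _ _ _ _ U2 Hw) as (t' & -> & ->).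
    transitivity (t * t' * ((c1 x y * c2 x y - s1 x y * s2 x y) * gim)); [ring|].
    rewrite H. ring.
Qed.

Lemma aligned_scal L1 L2 gre gim x y k : k <> 0 ->
  aligned L1 L2 gre gim x y -> aligned L1 L2 (k * gre) (k * gim) x y.
Proof.
  intros Hk [N H]. split.
  - intros E. injection E as E1 E2. apply N.
    f_equal; apply Rmult_eq_reg_l with k; lra.
  - intros vx vy wx wy Hv Hw. specialize (H vx vy wx wy Hv Hw).
    transitivity (k * ((vx * wx - vy * wy) * gim)); [ring|]. rewrite H. ring.
Qed.

Lemma grad_quad_re k d d' e e' (V : plane_set) :
  grad_on V (quad_re k d d' e e') (fun x y => 2 * k * x + d) (fun x y => - (2 * k * y + d')).
Proof. intros x y _. unfold quad_re. split; der; ring. Qed.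

Lemma grad_quad_im k d d' e e' (V : plane_set) :
  grad_on V (quad_im k d d' e e') (fun x y => 2 * k * y + d') (fun x y => 2 * k * x + d).
Proof. intros x y _. unfold quad_im. split; der; ring. Qed.

(** An identity theorem: the coefficients are read off from the values and the derivatives at one
    point. *)
Lemma quad_zero (V : plane_set) k d d' e e' x0 y0 :
  open_set V -> V x0 y0 -> 
  (forall x y, V x y -> quad_re k d d' e e' x y = 0 /\ quad_im k d d' e e' x y = 0) ->
  k = 0 /\ d = 0 /\ d' = 0 /\ e = 0 /\ e' = 0.
Proof.
  intros HO V0 H.
  assert (G0 : grad_on V (fun _ _ => 0) (fun _ _ => 0) (fun _ _ => 0))
    by (intros x y _; split; apply is_derive_Rconst).
  pose proof (grad_on_eq V _ _ _ _ _ _ HO (grad_quad_re k d d' e e' V) G0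
     (fun x y HV => proj1 (H x y HV))) as H1. cbv beta in H1.
  assert (G1 : grad_on V (fun x y => 2 * k * x + d) (fun _ _ => 2 * k) (fun _ _ => 0))
    by (intros x y _; split; der; ring).
  pose proof (grad_on_eq V _ _ _ _ _ _ HO G1 G0 (fun x y HV => proj1 (H1 x y HV)) x0 y0 V0) as [H2 _].
  destruct (H1 x0 y0 V0) as [E1 E2]. destruct (H x0 y0 V0) as [E3 E4]. unfold quad_re, quad_im in E3, E4.
  assert (Zk : k = 0) by lra. subst k.
  assert (Zd : d = 0) by lra. subst d. assert (Zd' : d' = 0) by lra. subst d'.
  repeat split; lra.
Qed.

(** Both polynomials have argument a + b modulo pi, so their quotient is real; being holomorphic, it
    is constant. *)
Lemma aligned_unique (x0 y0 r : R) L1 L2 N1 N2 c1 s1 A c2 s2 C k d d' e e' l f f' h h' :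
  let V := open_disc x0 y0 r in
  0 < r -> frame V L1 L2 N1 N2 c1 s1 A c2 s2 C ->
  (forall x y, V x y -> aligned L1 L2 (quad_re k d d' e e' x y) (quad_im k d d' e e' x y) x y) ->
  (forall x y, V x y -> aligned L1 L2 (quad_re l f f' h h' x y) (quad_im l f f' h h' x y) x y) ->
  exists q, q <> 0 /\ l = q * k /\ f = q * d /\ f' = q * d' /\ h = q * e /\ h' = q * e'.
Proof.
  intros V Hr F HG HG'.
  pose proof (open_disc_open x0 y0 r : open_set V) as HO.
  pose proof (open_disc_center x0 y0 r Hr : V x0 y0) as V0.
  set (a := quad_re k d d' e e') in *. set (b := quad_im k d d' e e') in *.
  set (a' := quad_re l f f' h h') in *. set (b' := quad_im l f f' h h') in *.
  assert (nz : forall x y, V x y -> a x y ^ 2 + b x y ^ 2 <> 0).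
  { intros x y HV Z. destruct (HG x y HV) as [N _]. apply N. f_equal; nra. }
  set (q := fun x y => (a' x y * a x y + b' x y * b x y) / (a x y ^ 2 + b x y ^ 2)).
  assert (Q : forall x y, V x y -> a' x y = q x y * a x y /\ b' x y = q x y * b x y).
  { intros x y HV. pose proof (nz x y HV) as N.
    pose proof (proj1 (aligned_frame V _ _ _ _ _ _ _ _ _ _ _ _ x y F HV) (HG x y HV)) as [_ E].
    pose proof (proj1 (aligned_frame V _ _ _ _ _ _ _ _ _ _ _ _ x y F HV) (HG' x y HV)) as [_ E'].
    at_point F HO x y HV.
    set (u := c1 x y * c2 x y - s1 x y * s2 x y) in *. set (v := c1 x y * s2 x y + s1 x y * c2 x y) in *.
    assert (UV : u ^ 2 + v ^ 2 = 1).
    { unfold u, v. clear - U1 U2. nsz. }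
    assert (X : a' x y * b x y = b' x y * a x y) by (clear - E E' UV; clearbody u v; nsz).
    unfold q. split; apply Rmult_eq_reg_r with (a x y ^ 2 + b x y ^ 2); try exact N;
      field_simplify; try exact N; clear - X; nsz. }
  assert (Ga : grad_on V a (fun x y => 2 * k * x + d) (fun x y => - (2 * k * y + d')))
    by apply grad_quad_re.
  assert (Gb : grad_on V b (fun x y => 2 * k * y + d') (fun x y => 2 * k * x + d))
    by apply grad_quad_im.
  assert (Ga' : grad_on V a' (fun x y => 2 * l * x + f) (fun x y => - (2 * l * y + f')))
    by apply grad_quad_re.
  assert (Gb' : grad_on V b' (fun x y => 2 * l * y + f') (fun x y => 2 * l * x + f))
    by apply grad_quad_im.
  assert (poly : forall k d d' e e', smooth_on V (quad_re k d d' e e') /\ smooth_on V (quad_im k d d' e e')).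
  { intros. unfold quad_re, quad_im. split; smooth. }
  assert (Sq : smooth_on V q).
  { destruct (poly k d d' e e'). destruct (poly l f f' h h').
    unfold q, a, b, a', b' in *. smooth.  }
  destruct (smooth_on_grad V q Sq) as (Gq & _).
  assert (Z : grad_on V q (fun _ _ => 0) (fun _ _ => 0)).
  { refine (grad_on_ext V _ _ _ _ _ _ Gq). intros x y HV.
    assert (P1 : grad_on V (fun x y => q x y * a x y)
      (fun x y => dx q x y * a x y + q x y * (2 * k * x + d))
      (fun x y => dy q x y * a x y + q x y * (- (2 * k * y + d')))).
    { intros u v Huv. destruct (Gq u v Huv), (Ga u v Huv). split; der; ring. }
    assert (P2 : grad_on V (fun x y => q x y * b x y)
      (fun x y => dx q x y * b x y + q x y * (2 * k * y + d'))
      (fun x y => dy q x y * b x y + q x y * (2 * k * x + d))).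
    { intros u v Huv. destruct (Gq u v Huv), (Gb u v Huv). split; der; ring. }
    destruct (grad_on_eq V _ _ _ _ _ _ HO Ga' P1 (fun x y HV => proj1 (Q x y HV)) x y HV) as [X1 X2].
    destruct (grad_on_eq V _ _ _ _ _ _ HO Gb' P2 (fun x y HV => proj2 (Q x y HV)) x y HV) as [X3 X4].
    (* What is left of the Cauchy-Riemann equations of q G after removing those of G. Since G has no
       zero in [V], they force grad q = 0. *)
    assert (Y1 : dx q x y * a x y = dy q x y * b x y) by lra.
    assert (Y2 : dy q x y * a x y = - dx q x y * b x y) by lra.
    pose proof (nz x y HV) as N.
    split; apply Rmult_eq_reg_r with (a x y ^ 2 + b x y ^ 2); try exact N; rewrite Rmult_0_l;
      clear - Y1 Y2; nsz. }
  pose proof (grad_zero_const x0 y0 r q Z) as Cq.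
  set (q0 := q x0 y0) in *.
  destruct (quad_zero V (l - q0 * k) (f - q0 * d) (f' - q0 * d') (h - q0 * e) (h' - q0 * e') x0 y0 HO V0)
    as (E1 & E2 & E3 & E4 & E5).
  { intros x y HV. destruct (Q x y HV) as [X Y]. rewrite (Cq x y HV) in X, Y.
    unfold a, b, a', b', quad_re, quad_im in X, Y. unfold quad_re, quad_im. split; lra. }
  exists q0. split; [|repeat split; lra].
  intros Zq. destruct (HG' x0 y0 V0) as [N _]. apply N.
  destruct (Q x0 y0 V0) as [X Y]. fold a' b'. rewrite X, Y. fold q0. rewrite Zq. f_equal; ring.
Qed.

Lemma quad_scal q k d d' e e' x y :
  quad_re (q * k) (q * d) (q * d') (q * e) (q * e') x y = q * quad_re k d d' e e' x y /\
  quad_im (q * k) (q * d) (q * d') (q * e) (q * e') x y = q * quad_im k d d' e e' x y.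
Proof. unfold quad_re, quad_im. split; ring. Qed.

(** The hinge of the proof: each of the two conditions of the equivalence is shown to amount to it,
    and all further conclusions start from it. *)
Definition locally_frame (D : plane_set) (L1 L2 N1 N2 : line_field) : Prop :=
  forall x0 y0, D x0 y0 -> exists r c1 s1 A c2 s2 C, 0 < r /\
    (forall x y, open_disc x0 y0 r x y -> D x y) /\
    frame (open_disc x0 y0 r) L1 L2 N1 N2 c1 s1 A c2 s2 C /\
    forall x y, open_disc x0 y0 r x y -> web_curvature c1 s1 A c2 s2 C x y = 0.

(** The polynomial of one disc is continued over D. On the common part of two discs the polynomials
    differ by a real factor, which [aligned] does not see. *)
Lemma aligned_global (D : plane_set) (L1 L2 N1 N2 : line_field) :
  planar_domain D -> locally_frame D L1 L2 N1 N2 ->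
  exists k d d' e e', forall x y, D x y ->
    aligned L1 L2 (quad_re k d d' e e' x y) (quad_im k d d' e e' x y) x y.
Proof.
  intros HD HF.
  assert (loc : forall x0 y0, D x0 y0 -> exists r c1 s1 A c2 s2 C k d d' e e', 0 < r /\
    (forall x y, open_disc x0 y0 r x y -> D x y) /\
    frame (open_disc x0 y0 r) L1 L2 N1 N2 c1 s1 A c2 s2 C /\
    forall x y, open_disc x0 y0 r x y ->
      aligned L1 L2 (quad_re k d d' e e' x y) (quad_im k d d' e e' x y) x y).
  { intros x0 y0 H0. destruct (HF x0 y0 H0) as (r & c1 & s1 & A & c2 & s2 & C & Hr & Hd & F & HC).
    destruct (curvature_zero_quadratic x0 y0 r _ _ _ _ _ _ _ _ _ _ Hr F HC)
      as (k & d & d' & e & e' & HG).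
    exists r, c1, s1, A, c2, s2, C, k, d, d', e, e'. split; [exact Hr|]. split; [exact Hd|].
    split; [exact F|]. intros x y HV. apply (aligned_frame _ _ _ _ _ _ _ _ _ _ _ _ _ x y F HV).
    destruct (HG x y HV) as (rho & Hp & E1 & E2).
    at_point F (open_disc_open x0 y0 r) x y HV.
    set (u := c1 x y * c2 x y - s1 x y * s2 x y) in *. set (v := c1 x y * s2 x y + s1 x y * c2 x y) in *.
    assert (UV : u ^ 2 + v ^ 2 = 1) by (unfold u, v; clear - U1 U2; nsz).
    rewrite E1, E2. split; [|ring].
    intros Z. injection Z as Z1 Z2.
    assert (u = 0) by (apply Rmult_eq_reg_l with rho; lra).
    assert (v = 0) by (apply Rmult_eq_reg_l with rho; lra). nra. }
  pose proof HD as ((x0 & y0 & H0) & HO & _).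
  destruct (loc x0 y0 H0) as (r & _ & _ & _ & _ & _ & _ & k & d & d' & e & e' & Hr & Hd & _ & HA).
  exists k, d, d', e, e'. intros x y Hxy.
  (* Alignment is propagated together with a disc around the point, since at a single point it would
     not determine the polynomial. *)
  assert (K : exists rho, 0 < rho /\ forall u v, open_disc x y rho u v ->
     aligned L1 L2 (quad_re k d d' e e' u v) (quad_im k d d' e e' u v) u v).
  { apply (connected_const D (fun x y => exists rho, 0 < rho /\ forall u v, open_disc x y rho u v ->
      aligned L1 L2 (quad_re k d d' e e' u v) (quad_im k d d' e e' u v) u v) HD) with (x0 := x0) (y0 := y0);
      [|assumption|exists r; split; [exact Hr|exact HA]|assumption].
    clear x y Hxy. intros x y Hxy.
    destruct (loc x y Hxy) as (r1 & c1 & s1 & A & c2 & s2 & C & l & f & f' & h & h' & Hr1 & Hd1 & F & HB).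
    exists r1. split; [exact Hr1|]. intros u v u' v' Huv Huv' _ _ (rho & Hrho & HP).
    destruct (discs_and (open_disc x y r1) (open_disc u v rho) u v) as (t & Ht & HT).
    { exact (open_set_disc _ _ _ (open_disc_open x y r1) Huv). }
    { exists rho. split; [exact Hrho|auto]. }
    destruct (aligned_unique u v t L1 L2 N1 N2 c1 s1 A c2 s2 C l f f' h h' k d d' e e' Ht)
      as (q & Hq & E1 & E2 & E3 & E4 & E5).
    { apply (frame_sub (open_disc x y r1)); [|exact F]. intros a b Hab. now apply HT. }
    { intros a b Hab. apply HB. now apply HT. }
    { intros a b Hab. apply HP. now apply HT. }
    destruct (open_set_disc _ _ _ (open_disc_open x y r1) Huv') as (t' & Ht' & HT').
    exists t'. split; [exact Ht'|]. intros a b Hab. rewrite E1, E2, E3, E4, E5.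
    destruct (quad_scal q l f f' h h' a b) as [-> ->]. apply aligned_scal; [exact Hq|]. auto. }
  destruct K as (rho & Hrho & HP). apply HP. now apply open_disc_center.
Qed.

(** * The roots of G *)

Lemma complex_sqrt (p q : R) : exists a b, a ^ 2 - b ^ 2 = p /\ 2 * a * b = q.
Proof.
  set (m := sqrt (p ^ 2 + q ^ 2)).
  assert (M2 : m ^ 2 = p ^ 2 + q ^ 2) by (apply pow2_sqrt; nra).
  assert (M0 : 0 <= m) by apply sqrt_pos.
  assert (M1 : Rabs p <= m).
  { apply Rabs_le_between. split; nra. }
  apply Rabs_le_between in M1.
  set (a := sqrt ((m + p) / 2)). set (b := sqrt ((m - p) / 2)).
  assert (A2 : a ^ 2 = (m + p) / 2) by (apply pow2_sqrt; lra).
  assert (B2 : b ^ 2 = (m - p) / 2) by (apply pow2_sqrt; lra).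
  assert (A0 : 0 <= a) by apply sqrt_pos. assert (B0 : 0 <= b) by apply sqrt_pos.
  assert (AB : (2 * a * b) ^ 2 = q ^ 2).
  { replace ((2 * a * b) ^ 2) with (4 * (a ^ 2 * b ^ 2)) by ring. rewrite A2, B2. nra. }
  assert (AB0 : 0 <= 2 * a * b) by nra.
  destruct (Rle_lt_dec 0 q) as [Hq|Hq].
  - exists a, b. split; [lra|]. nra.
  - exists a, (- b). split; [replace ((- b) ^ 2) with (b ^ 2) by ring; lra|]. nra.
Qed.

(* A focus is a point (X, Y, 1) of the plane or an ideal point (X, Y, 0); it is
   encoded by the linear function Z z - (X + i Y). *)
Definition focal_pair (D : plane_set) (L1 L2 : line_field) (X1 Y1 Z1 X2 Y2 Z2 : R) : Prop :=
  forall x y, D x y ->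
    let a1 := Z1 * x - X1 in let b1 := Z1 * y - Y1 in
    let a2 := Z2 * x - X2 in let b2 := Z2 * y - Y2 in
    aligned L1 L2 (a1 * a2 - b1 * b2) (a1 * b2 + b1 * a2) x y.

(** The cases are the degrees 2, 1, 0 of G. [aligned] tolerates real factors only: in degree 2 one
    may divide by the leading coefficient because it is real. In degree 1 the direction of the
    complex leading coefficient becomes an ideal focus, and in degree 0 a square root of the
    constant gives a double ideal focus. *)
Lemma focal_pair_exists (D : plane_set) (L1 L2 N1 N2 : line_field) :
  planar_domain D -> locally_frame D L1 L2 N1 N2 ->
  (exists X1 Y1 X2 Y2, focal_pair D L1 L2 X1 Y1 1 X2 Y2 1) \/
  (exists X1 Y1 ux uy, ux ^ 2 + uy ^ 2 = 1 /\ focal_pair D L1 L2 X1 Y1 1 ux uy 0) \/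
  (exists ux uy, focal_pair D L1 L2 ux uy 0 ux uy 0).
Proof.
  intros HD HF. destruct (aligned_global D L1 L2 N1 N2 HD HF) as (k & d & d' & e & e' & H).
  destruct (Req_dec k 0) as [Zk|Nk].
  - subst k. right. destruct (Req_dec (d ^ 2 + d' ^ 2) 0) as [Zd|Nd].
    + right. assert (d = 0) by nra. assert (d' = 0) by nra. subst d d'.
      destruct (complex_sqrt e e') as (a & b & E1 & E2). exists a, b.
      intros x y Hxy a1 b1 a2 b2. unfold a1, b1, a2, b2.
      specialize (H x y Hxy). unfold quad_re, quad_im in H.
      replace ((0 * x - a) * (0 * x - a) - (0 * y - b) * (0 * y - b))
        with (0 * (x ^ 2 - y ^ 2) + 0 * x - 0 * y + e) by (rewrite <- E1; ring).
      replace ((0 * x - a) * (0 * y - b) + (0 * y - b) * (0 * x - a))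
        with (0 * (2 * x * y) + 0 * y + 0 * x + e') by (rewrite <- E2; ring).
      exact H.
    + left. set (m := sqrt (d ^ 2 + d' ^ 2)).
      assert (Mp : 0 < m) by (apply sqrt_lt_R0; pose proof (pow2_ge_0 d); pose proof (pow2_ge_0 d'); lra).
      assert (M2 : m ^ 2 = d ^ 2 + d' ^ 2) by (apply pow2_sqrt; pose proof (pow2_ge_0 d); pose proof (pow2_ge_0 d'); lra).
      (* G = d z + e = d (z - z1) with z1 = - e / d *)
      exists (- (e * d + e' * d') / m ^ 2), (- (e' * d - e * d') / m ^ 2), (d / m), (d' / m).
      split.
      { apply Rmult_eq_reg_r with (m ^ 2); [|apply pow_nonzero; lra].
        rewrite M2 at 2. field. lra. }
      intros x y Hxy a1 b1 a2 b2. specialize (H x y Hxy).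
      (* The minus sign comes from the encoding: an ideal focus u contributes the factor 0 z - u = -
         u. *)
      apply (aligned_scal _ _ _ _ _ _ (- / m)) in H; [|apply Ropp_neq_0_compat, Rinv_neq_0_compat; lra].
      unfold quad_re, quad_im in H.
      assert (ER : a1 * a2 - b1 * b2 = - / m * (0 * (x ^ 2 - y ^ 2) + d * x - d' * y + e)).
      { unfold a1, b1, a2, b2. apply Rmult_eq_reg_r with (m * m ^ 2); [|apply Rgt_not_eq; nra].
        transitivity (- (m ^ 2 * (x * d - y * d') + e * (d ^ 2 + d' ^ 2))); [field; lra|].
        rewrite <- M2. field. lra. }
      assert (EI : a1 * b2 + b1 * a2 = - / m * (0 * (2 * x * y) + d * y + d' * x + e')).
      { unfold a1, b1, a2, b2. apply Rmult_eq_reg_r with (m * m ^ 2); [|apply Rgt_not_eq; nra].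
        transitivity (- (m ^ 2 * (y * d + x * d') + e' * (d ^ 2 + d' ^ 2))); [field; lra|].
        rewrite <- M2. field. lra. }
      rewrite ER, EI. exact H.
  - left.
    (* roots of z^2 + (d / k) z + e / k *)
    set (p := d / k). set (p' := d' / k). set (q := e / k). set (q' := e' / k).
    destruct (complex_sqrt (p ^ 2 - p' ^ 2 - 4 * q) (2 * p * p' - 4 * q')) as (a & b & E1 & E2).
    exists ((- p + a) / 2), ((- p' + b) / 2), ((- p - a) / 2), ((- p' - b) / 2).
    intros x y Hxy a1 b1 a2 b2. specialize (H x y Hxy).
    apply (aligned_scal _ _ _ _ _ _ (/ k)) in H; [|now apply Rinv_neq_0_compat].
    unfold quad_re, quad_im in H.
    assert (ER : a1 * a2 - b1 * b2 = / k * (k * (x ^ 2 - y ^ 2) + d * x - d' * y + e)).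
    { transitivity (x ^ 2 - y ^ 2 + p * x - p' * y + q).
      - unfold a1, b1, a2, b2.
        transitivity (x ^ 2 - y ^ 2 + p * x - p' * y + (p ^ 2 - p' ^ 2 - (a ^ 2 - b ^ 2)) / 4); [field|].
        rewrite E1. field.
      - unfold p, p', q. field. exact Nk. }
    assert (EI : a1 * b2 + b1 * a2 = / k * (k * (2 * x * y) + d * y + d' * x + e')).
    { transitivity (2 * x * y + p * y + p' * x + q').
      - unfold a1, b1, a2, b2.
        transitivity (2 * x * y + p * y + p' * x + (2 * p * p' - 2 * a * b) / 4); [field|].
        rewrite E2. field.
      - unfold p, p', q'. field. exact Nk. }
    rewrite ER, EI. exact H.
Qed.

(** * The product of the distances to the foci *)

(** The difference of the two sides factors as the sine of the angle between the lines times the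
    alignment equation. *)
Lemma focal_product_swap (c s c' s' a b a' b' : R) :
  c ^ 2 + s ^ 2 = 1 -> c' ^ 2 + s' ^ 2 = 1 ->
  (c * c' - s * s') * (a * b' + b * a') = (c * s' + s * c') * (a * a' - b * b') ->
  (a * s - b * c) * (a' * s - b' * c) = (a * s' - b * c') * (a' * s' - b' * c').
Proof.
  intros U U' E. apply Rminus_diag_uniq.
  transitivity ((c * s' - s * c') * ((c * c' - s * s') * (a * b' + b * a')
                 - (c * s' + s * c') * (a * a' - b * b'))).
  - clear E. nsz.
  - rewrite E. ring.
Qed.

(* The product of the signed distances from the foci to a line of L is constant:
   it depends only on the line, and the two lines through a point are symmetric
   with respect to the bisectors of the directions of the foci. *)
Lemma focal_product_const (D : plane_set) (L1 L2 N1 N2 : line_field) X1 Y1 Z1 X2 Y2 Z2 :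
  planar_domain D -> locally_frame D L1 L2 N1 N2 ->
  focal_pair D L1 L2 X1 Y1 Z1 X2 Y2 Z2 ->
  exists b, forall x y vx vy, D x y -> (L1 x y vx vy \/ L2 x y vx vy) -> vx ^ 2 + vy ^ 2 = 1 ->
    ((Z1 * x - X1) * vy - (Z1 * y - Y1) * vx) * ((Z2 * x - X2) * vy - (Z2 * y - Y2) * vx) = b.
Proof.
  intros HD HF HP.
  set (f := fun x y vx vy =>
    ((Z1 * x - X1) * vy - (Z1 * y - Y1) * vx) * ((Z2 * x - X2) * vy - (Z2 * y - Y2) * vx)).
  assert (loc : forall x0 y0, D x0 y0 -> exists r b, 0 < r /\
     forall x y vx vy, open_disc x0 y0 r x y -> (L1 x y vx vy \/ L2 x y vx vy) ->
       vx ^ 2 + vy ^ 2 = 1 -> f x y vx vy = b).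
  { intros x0 y0 H0. destruct (HF x0 y0 H0) as (r & c1 & s1 & A & c2 & s2 & C & Hr & Hd & F & _).
    pose proof (open_disc_open x0 y0 r) as HO. set (V := open_disc x0 y0 r) in *.
    destruct (frame_smooth F) as ((Sc1 & Ss1 & SA & Sc2 & Ss2 & SC) & _).
    assert (E : forall x y, V x y -> f x y (c1 x y) (s1 x y) = f x y (c2 x y) (s2 x y)).
    { intros x y HV. pose proof (proj1 (aligned_frame V _ _ _ _ _ _ _ _ _ _ _ _ x y F HV)
         (HP x y (Hd x y HV))) as [_ T]. at_point F HO x y HV.
      unfold f. apply focal_product_swap; assumption. }
    (* As [f] depends on the line only, its gradient is a multiple [h] of the normal of that line.
       The equality of the two products makes it normal to both lines at once, hence zero. *)
    set (h := fun (c s A : R -> R -> R) x y =>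
      (Z1 - A x y * ((Z1 * x - X1) * c x y + (Z1 * y - Y1) * s x y))
        * ((Z2 * x - X2) * s x y - (Z2 * y - Y2) * c x y)
      + ((Z1 * x - X1) * s x y - (Z1 * y - Y1) * c x y)
        * (Z2 - A x y * ((Z2 * x - X2) * c x y + (Z2 * y - Y2) * s x y))).
    assert (G1 : grad_on V (fun x y => f x y (c1 x y) (s1 x y))
       (fun x y => s1 x y * h c1 s1 A x y) (fun x y => - (c1 x y * h c1 s1 A x y))).
    { intros x y HV. at_point F HO x y HV. unfold f, h. split; der; ring. }
    assert (G2 : grad_on V (fun x y => f x y (c2 x y) (s2 x y))
       (fun x y => s2 x y * h c2 s2 C x y) (fun x y => - (c2 x y * h c2 s2 C x y))).
    { intros x y HV. at_point F HO x y HV. unfold f, h. split; der; ring. }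
    assert (G0 : grad_on V (fun x y => f x y (c1 x y) (s1 x y)) (fun _ _ => 0) (fun _ _ => 0)).
    { refine (grad_on_ext V _ _ _ _ _ _ G1). intros x y HV.
      destruct (grad_on_eq V _ _ _ _ _ _ HO G1 G2 E x y HV) as [e1 e2]. cbv beta in e1, e2.
      at_point F HO x y HV.
      assert (Z : h c1 s1 A x y = 0).
      { apply Rmult_eq_reg_r with (c1 x y * s2 x y - s1 x y * c2 x y); [|exact S0].
        transitivity (- s2 x y * (- (c1 x y * h c1 s1 A x y)) - c2 x y * (s1 x y * h c1 s1 A x y)); [ring|].
        rewrite e1, e2. ring. }
      rewrite Z. split; ring. }
    exists r, (f x0 y0 (c1 x0 y0) (s1 x0 y0)). split; [exact Hr|].
    intros x y vx vy HV HL U. at_point F HO x y HV.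
    rewrite <- (grad_zero_const x0 y0 r _ G0 x y HV).
    destruct HL as [HL|HL].
    - apply (lf_span (fr_1 F)) in HL; [|exact HV].
      destruct (unit_parallel _ _ _ _ U1 U HL) as [[-> ->]|[-> ->]]; [reflexivity|unfold f; ring].
    - rewrite (E x y HV).
      apply (lf_span (fr_2 F)) in HL; [|exact HV].
      destruct (unit_parallel _ _ _ _ U2 U HL) as [[-> ->]|[-> ->]]; [reflexivity|unfold f; ring]. }
  pose proof HD as ((x0 & y0 & H0) & _).
  destruct (loc x0 y0 H0) as (r & b & Hr & Hb). exists b.
  intros x y vx vy Hxy. change (((L1 x y vx vy \/ L2 x y vx vy) -> vx ^ 2 + vy ^ 2 = 1 ->
    f x y vx vy = b)). revert vx vy.
  apply (connected_const D (fun x y => forall vx vy, L1 x y vx vy \/ L2 x y vx vy ->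
    vx ^ 2 + vy ^ 2 = 1 -> f x y vx vy = b) HD) with (x0 := x0) (y0 := y0); [|assumption| |assumption].
  - clear x y Hxy. intros x y Hxy. destruct (loc x y Hxy) as (q & b' & Hq & Hb').
    exists q. split; [exact Hq|]. intros u v u' v' Huv Huv' Du Du' P vx vy HL U.
    destruct (HF u v Du) as (r1 & c1 & s1 & A & c2 & s2 & C & Hr1 & Hd1 & F & _).
    pose proof (open_disc_center u v r1 Hr1) as HV.
    at_point F (open_disc_open u v r1) u v HV.
    assert (HL1 : L1 u v (c1 u v) (s1 u v)).
    { apply (lf_span (fr_1 F)); [exact HV|ring]. }
    rewrite (Hb' u' v' vx vy Huv' HL U), <- (Hb' u v (c1 u v) (s1 u v) Huv (or_introl HL1) U1).
    apply P; auto.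
  - intros vx vy HL U. apply Hb; auto. now apply open_disc_center.
Qed.

(** For v = vx + i vy and g = gre + i gim: v^2 is a real multiple of g, with the sign of sigma or
    zero. A square forgets the orientation of v. *)
Definition square_aligned (gre gim sigma vx vy : R) : Prop :=
  2 * vx * vy * gre = (vx ^ 2 - vy ^ 2) * gim /\
  0 <= sigma * ((vx ^ 2 - vy ^ 2) * gre + 2 * vx * vy * gim).

(** (e1 + e2)^2 is a positive multiple of e1 e2 and (e1 - e2)^2 a negative one, while e1 e2 is a
    real multiple of G. Only the sign of this last factor is at stake; it is locally constant and
    has a meaning independent of the frame. *)
Lemma bisector_squares (D : plane_set) (L1 L2 N1 N2 : line_field) X1 Y1 Z1 X2 Y2 Z2 :
  planar_domain D -> locally_frame D L1 L2 N1 N2 ->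
  focal_pair D L1 L2 X1 Y1 Z1 X2 Y2 Z2 ->
  exists sigma, (sigma = 1 \/ sigma = -1) /\ forall x y, D x y ->
    let a1 := Z1 * x - X1 in let b1 := Z1 * y - Y1 in
    let a2 := Z2 * x - X2 in let b2 := Z2 * y - Y2 in
    (forall vx vy, N1 x y vx vy ->
       square_aligned (a1 * a2 - b1 * b2) (a1 * b2 + b1 * a2) sigma vx vy) /\
    (forall vx vy, N2 x y vx vy ->
       square_aligned (a1 * a2 - b1 * b2) (a1 * b2 + b1 * a2) (- sigma) vx vy).
Proof.
  intros HD HF HP.
  set (gre := fun x y => (Z1 * x - X1) * (Z2 * x - X2) - (Z1 * y - Y1) * (Z2 * y - Y2)).
  set (gim := fun x y => (Z1 * x - X1) * (Z2 * y - Y2) + (Z1 * y - Y1) * (Z2 * x - X2)).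
  set (P := fun sigma x y =>
    (forall vx vy, N1 x y vx vy -> square_aligned (gre x y) (gim x y) sigma vx vy) /\
    (forall vx vy, N2 x y vx vy -> square_aligned (gre x y) (gim x y) (- sigma) vx vy)).
  assert (loc : forall x0 y0, D x0 y0 -> exists r tau, 0 < r /\
     continuity_2d_pt tau x0 y0 /\ tau x0 y0 <> 0 /\
     forall x y sigma, open_disc x0 y0 r x y -> sigma = 1 \/ sigma = -1 ->
       (P sigma x y <-> 0 <= sigma * tau x y)).
  { intros x0 y0 H0. destruct (HF x0 y0 H0) as (r & c1 & s1 & A & c2 & s2 & C & Hr & Hd & F & _).
    pose proof (open_disc_open x0 y0 r) as HO. set (V := open_disc x0 y0 r) in *.
    pose proof (open_disc_center x0 y0 r Hr : V x0 y0) as V0.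
    destruct (frame_smooth F) as ((Sc1 & Ss1 & SA & Sc2 & Ss2 & SC) & _).
    (* The real part of e1 e2 conj G. Its sign does not jump, because by alignment it vanishes only
       where G does. *)
    set (tau := fun x y => (c1 x y * c2 x y - s1 x y * s2 x y) * gre x y
                         + (c1 x y * s2 x y + s1 x y * c2 x y) * gim x y).
    exists r, tau. split; [exact Hr|].
    assert (AL : forall x y, V x y -> (gre x y, gim x y) <> (0, 0) /\
       (c1 x y * c2 x y - s1 x y * s2 x y) * gim x y = (c1 x y * s2 x y + s1 x y * c2 x y) * gre x y).
    { intros x y HV. exact (proj1 (aligned_frame V _ _ _ _ _ _ _ _ _ _ _ _ x y F HV) (HP x y (Hd x y HV))). }
    split; [|split].
    - assert (smooth_on V tau) by (unfold tau, gre, gim; smooth).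
      now apply (smooth_on_continuity V).
    - destruct (AL x0 y0 V0) as [N E]. at_point F HO x0 y0 V0. intros Z. apply N.
      set (u := c1 x0 y0 * c2 x0 y0 - s1 x0 y0 * s2 x0 y0) in *.
      set (v := c1 x0 y0 * s2 x0 y0 + s1 x0 y0 * c2 x0 y0) in *.
      assert (UV : u ^ 2 + v ^ 2 = 1) by (unfold u, v; clear - U1 U2; nsz).
      unfold tau in Z. fold u in Z. fold v in Z.
      f_equal; clear - Z E UV; clearbody u v; nsz.
    - intros x y sigma HV Hs. destruct (AL x y HV) as [N E]. at_point F HO x y HV.
      set (K := c1 x y * c2 x y + s1 x y * s2 x y).
      assert (K2 : K ^ 2 + (c1 x y * s2 x y - s1 x y * c2 x y) ^ 2 = 1)
        by (unfold K; clear - U1 U2; nsz).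
      assert (Kb : -1 < K < 1).
      { pose proof (pow2_gt_0 _ S0). split; nra. }
      set (u := c1 x y * c2 x y - s1 x y * s2 x y) in *.
      set (v := c1 x y * s2 x y + s1 x y * c2 x y) in *.
      (* (e1 + e2)^2 = (2 + 2 K) e1 e2 and (e1 - e2)^2 = (2 K - 2) e1 e2 *)
      assert (Q : forall e, e ^ 2 = 1 ->
        (c1 x y + e * c2 x y) ^ 2 - (s1 x y + e * s2 x y) ^ 2 = (2 * e + 2 * K) * u /\
        2 * (c1 x y + e * c2 x y) * (s1 x y + e * s2 x y) = (2 * e + 2 * K) * v).
      { intros e He. unfold K, u, v. clear - U1 U2 He. split; nsz. }
      destruct (Q 1 ltac:(ring)) as [q1 q2]. destruct (Q (-1) ltac:(ring)) as [q3 q4].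
      rewrite !Rmult_1_l in q1, q2.
      assert (R1 : forall t, 2 * (t * (c1 x y + c2 x y)) * (t * (s1 x y + s2 x y)) = t ^ 2 * (2 * 1 + 2 * K) * v
         /\ (t * (c1 x y + c2 x y)) ^ 2 - (t * (s1 x y + s2 x y)) ^ 2 = t ^ 2 * (2 * 1 + 2 * K) * u).
      { intros t. split.
        - transitivity (t ^ 2 * (2 * (c1 x y + c2 x y) * (s1 x y + s2 x y))); [ring|]. rewrite q2. ring.
        - transitivity (t ^ 2 * ((c1 x y + c2 x y) ^ 2 - (s1 x y + s2 x y) ^ 2)); [ring|]. rewrite q1. ring. }
      assert (R2 : forall t, 2 * (t * (c1 x y - c2 x y)) * (t * (s1 x y - s2 x y)) = t ^ 2 * (2 * -1 + 2 * K) * v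
         /\ (t * (c1 x y - c2 x y)) ^ 2 - (t * (s1 x y - s2 x y)) ^ 2 = t ^ 2 * (2 * -1 + 2 * K) * u).
      { intros t. split.
        - transitivity (t ^ 2 * (2 * (c1 x y + -1 * c2 x y) * (s1 x y + -1 * s2 x y))); [ring|]. rewrite q4. ring.
        - transitivity (t ^ 2 * ((c1 x y + -1 * c2 x y) ^ 2 - (s1 x y + -1 * s2 x y) ^ 2)); [ring|]. rewrite q3. ring. }
      assert (M1 : (c1 x y + c2 x y, s1 x y + s2 x y) <> (0, 0)).
      { intros Z. injection Z as Z1' Z2'. apply S0.
        replace (c2 x y) with (- c1 x y) by lra. replace (s2 x y) with (- s1 x y) by lra. ring. }
      assert (M2 : (c1 x y - c2 x y, s1 x y - s2 x y) <> (0, 0)).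
      { intros Z. injection Z as Z1' Z2'. apply S0.
        replace (c2 x y) with (c1 x y) by lra. replace (s2 x y) with (s1 x y) by lra. ring. }
      unfold P, tau. fold u v. split.
      + intros [HN1 _]. destruct (HN1 (c1 x y + c2 x y) (s1 x y + s2 x y)) as [_ Hpos].
        { apply (fr_N1 F); [exact HV|ring]. }
        rewrite q1, q2 in Hpos.
        apply Rmult_le_reg_l with (2 * 1 + 2 * K); [lra|]. lra.
      + intros Hpos. split; intros vx vy Hv.
        * apply (fr_N1 F) in Hv; [|exact HV].
          apply (span_multiple _ _ _ _ M1) in Hv. destruct Hv as (t & -> & ->).
          destruct (R1 t) as [r1 r2]. split.
          -- rewrite r1, r2. transitivity (t ^ 2 * (2 * 1 + 2 * K) * (v * gre x y)); [ring|].
             rewrite <- E. ring.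
          -- rewrite r1, r2.
             replace (sigma * (t ^ 2 * (2 * 1 + 2 * K) * u * gre x y + t ^ 2 * (2 * 1 + 2 * K) * v * gim x y))
               with (t ^ 2 * (2 * 1 + 2 * K) * (sigma * (u * gre x y + v * gim x y))) by ring.
             apply Rmult_le_pos; [|exact Hpos]. apply Rmult_le_pos; [apply pow2_ge_0|lra].
        * apply (fr_N2 F) in Hv; [|exact HV].
          apply (span_multiple _ _ _ _ M2) in Hv. destruct Hv as (t & -> & ->).
          destruct (R2 t) as [r1 r2]. split.
          -- rewrite r1, r2. transitivity (t ^ 2 * (2 * -1 + 2 * K) * (v * gre x y)); [ring|].
             rewrite <- E. ring.
          -- rewrite r1, r2.
             replace (- sigma * (t ^ 2 * (2 * -1 + 2 * K) * u * gre x y + t ^ 2 * (2 * -1 + 2 * K) * v * gim x y))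
               with (t ^ 2 * (2 - 2 * K) * (sigma * (u * gre x y + v * gim x y))) by ring.
             apply Rmult_le_pos; [|exact Hpos]. apply Rmult_le_pos; [apply pow2_ge_0|lra]. }
  assert (sgn : forall x0 y0, D x0 y0 -> exists q s0, (s0 = 1 \/ s0 = -1) /\ 0 < q /\
     forall x y sigma, open_disc x0 y0 q x y -> sigma = 1 \/ sigma = -1 -> (P sigma x y <-> sigma = s0)).
  { intros x0 y0 H0. destruct (loc x0 y0 H0) as (r & tau & Hr & Ct & Nt & HT).
    assert (S : exists s0, (s0 = 1 \/ s0 = -1) /\ 0 < s0 * tau x0 y0).
    { destruct (Rtotal_order (tau x0 y0) 0) as [L|[L|L]]; [exists (-1)|contradiction|exists 1]; split; auto; lra. }
    destruct S as (s0 & Hs0 & Hp).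
    assert (LW : locally_2d (fun x y => 0 < s0 * tau x y) x0 y0).
    { apply (continuity_2d_pt_pos (fun x y => s0 * tau x y)); [|exact Hp].
      apply continuity_2d_pt_mult; [apply continuity_2d_pt_const|exact Ct]. }
    apply locally_2d_disc in LW.
    destruct (discs_and _ (open_disc x0 y0 r) x0 y0 LW) as (q & Hq & HW); [exists r; auto|].
    exists q, s0. split; [exact Hs0|]. split; [exact Hq|].
    intros x y sigma Hxy Hs. destruct (HW x y Hxy) as [Hpos HV].
    rewrite (HT x y sigma HV Hs). destruct Hs0; destruct Hs; subst; split; intros; lra. }
  pose proof HD as ((x0 & y0 & H0) & _).
  destruct (sgn x0 y0 H0) as (q & sigma & Hs & Hq & HS).
  exists sigma. split; [exact Hs|]. intros x y Hxy.
  apply (connected_const D (P sigma) HD) with (x0 := x0) (y0 := y0); [|assumption| |assumption].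
  - intros u v Huv. destruct (sgn u v Huv) as (q' & s0 & Hs0 & Hq' & HS'). exists q'.
    split; [exact Hq'|]. intros a b a' b' Hab Hab' _ _ K.
    apply (HS' a' b' sigma Hab' Hs). now apply (HS' a b sigma Hab Hs).
  - apply (HS x0 y0 sigma); [now apply open_disc_center|exact Hs|reflexivity].
Qed.

(* If v^2 is a multiple of a1 a2 with the sign of sigma, then v makes with the
   directions of a1 and of sigma a2 angles of equal cosine. *)
Lemma reflection_law (a1 b1 a2 b2 sigma vx vy m n : R) :
  sigma = 1 \/ sigma = -1 ->
  square_aligned (a1 * a2 - b1 * b2) (a1 * b2 + b1 * a2) sigma vx vy ->
  0 < m -> 0 < n -> m ^ 2 = a1 ^ 2 + b1 ^ 2 -> n ^ 2 = a2 ^ 2 + b2 ^ 2 ->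
  (vx * a1 + vy * b1) / m = sigma * ((vx * a2 + vy * b2) / n).
Proof.
  intros Hs [E1 E2] Hm Hn M N.
  (* c + i s and c' + i s' are a1 + i b1 and a2 + i b2 times the conjugate of v. By hypothesis their
     product is real with the sign of sigma; the law compares their real parts divided by m and
     n. *)
  set (c := vx * a1 + vy * b1). set (s := vx * b1 - vy * a1).
  set (c' := vx * a2 + vy * b2). set (s' := vx * b2 - vy * a2).
  assert (I : c * s' + c' * s = 0).
  { unfold c, s, c', s'. lra. }
  assert (Re : (vx ^ 2 - vy ^ 2) * (a1 * a2 - b1 * b2) + 2 * vx * vy * (a1 * b2 + b1 * a2) = c * c' - s * s').
  { unfold c, s, c', s'. ring. }
  rewrite Re in E2.
  assert (X1 : (vx ^ 2 + vy ^ 2) * m ^ 2 = c ^ 2 + s ^ 2) by (rewrite M; unfold c, s; ring).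
  assert (X2 : (vx ^ 2 + vy ^ 2) * n ^ 2 = c' ^ 2 + s' ^ 2) by (rewrite N; unfold c', s'; ring).
  assert (P : (c * c') * (c * c' - s * s') = (c * c') ^ 2 + (c' * s) ^ 2).
  { transitivity ((c * c') ^ 2 - (c * s') * (c' * s)); [ring|].
    replace (c * s') with (- (c' * s)) by lra. ring. }
  assert (Sg : 0 <= sigma * (c * c')).
  { destruct (Rle_lt_dec 0 (sigma * (c * c'))) as [|L]; [assumption|]. exfalso.
    pose proof (pow2_ge_0 (c * c')). pose proof (pow2_ge_0 (c' * s)).
    assert (T : (sigma * (c * c')) * (sigma * (c * c' - s * s')) <= 0) by nra.
    replace ((sigma * (c * c')) * (sigma * (c * c' - s * s')))
      with (sigma ^ 2 * ((c * c') * (c * c' - s * s'))) in T by ring.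
    assert (S2 : sigma ^ 2 = 1) by (destruct Hs; subst; ring).
    rewrite S2, P, Rmult_1_l in T. assert (c * c' = 0) by nra. nra. }
  destruct (Req_dec (vx ^ 2 + vy ^ 2) 0) as [Z|Nz].
  { assert (vx = 0) by nra. assert (vy = 0) by nra. unfold c, c'. subst. field. split; lra. }
  assert (SQ : (c * n) ^ 2 = (c' * m) ^ 2).
  { apply Rmult_eq_reg_l with (vx ^ 2 + vy ^ 2); [|exact Nz].
    transitivity (c ^ 2 * ((vx ^ 2 + vy ^ 2) * n ^ 2)); [ring|].
    transitivity (c' ^ 2 * ((vx ^ 2 + vy ^ 2) * m ^ 2)); [|ring].
    rewrite X1, X2. apply Rminus_diag_uniq.
    transitivity ((c * s' + c' * s) * (c * s' - c' * s)); [ring|rewrite I; ring]. }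
  assert (K : c * n = sigma * (c' * m)).
  { assert (T : (c * n - sigma * (c' * m)) * (c * n + sigma * (c' * m)) = 0).
    { transitivity ((c * n) ^ 2 - sigma ^ 2 * (c' * m) ^ 2); [ring|].
      rewrite SQ. destruct Hs; subst; ring. }
    apply Rmult_integral in T. destruct T as [T|T]; [lra|].
    assert (T2 : 0 <= sigma * (c * c') * (m * n)) by (apply Rmult_le_pos; nra).
    assert (T3 : sigma * (c * c') * (m * n) = - (c * n) ^ 2).
    { transitivity ((c * n) * (sigma * (c' * m))); [ring|]. replace (sigma * (c' * m)) with (- (c * n)) by lra. ring. }
    assert (c * n = 0) by nra. lra. }
  apply Rmult_eq_reg_r with (m * n); [|apply Rgt_not_eq; nra].
  transitivity (c * n); [field; lra|]. rewrite K. field. lra.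
Qed.

(** * Leaves *)

Lemma is_derive_zero_const (h : R -> R) a b t t' :
  (forall u, a < u < b -> is_derive h u 0) -> a < t < b -> a < t' < b -> h t = h t'.
Proof.
  intros H Ht Ht'. destruct (MVT_gen h t t' (fun _ => 0)) as (c & _ & E).
  - intros u Hu. apply H. unfold Rmin, Rmax in Hu. destruct (Rle_dec t t'); lra.
  - intros u Hu. eapply is_derive_continuity_pt. apply (H u).
    unfold Rmin, Rmax in Hu. destruct (Rle_dec t t'); lra.
  - simpl in E. lra.
Qed.

Lemma leaf_arc_derive (D : plane_set) (F : line_field) a b gx gy t :
  leaf_arc D F a b gx gy -> a < t < b ->
  D (gx t) (gy t) /\ exists vx vy : R, is_derive gx t vx /\ is_derive gy t vy /\
    (vx, vy) <> (0, 0) /\ F (gx t) (gy t) vx vy.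
Proof.
  intros [_ H] Ht. destruct (H t Ht) as (HD & X & Y & N & HF). split; [exact HD|].
  exists (Derive gx t), (Derive gy t). split; [now apply Derive_correct|].
  split; [now apply Derive_correct|]. split; assumption.
Qed.

Lemma dist2_euc x y x' y' : dist2 x y x' y' = dist_euc x y x' y'.
Proof. unfold dist2, dist_euc. now rewrite !Rsqr_pow2. Qed.

Lemma dist2_triangle x y x1 y1 x2 y2 :
  dist2 x1 y1 x2 y2 <= dist2 x y x1 y1 + dist2 x y x2 y2.
Proof.
  rewrite !dist2_euc, (distance_symm x y x1 y1). apply triangle.
Qed.

Lemma dist2_triangle_abs x y x1 y1 x2 y2 :
  Rabs (dist2 x y x1 y1 - dist2 x y x2 y2) <= dist2 x1 y1 x2 y2.
Proof.
  rewrite !dist2_euc. pose proof (triangle x y x1 y1 x2 y2) as T1.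
  pose proof (triangle x y x2 y2 x1 y1) as T2. rewrite (distance_symm x2 y2 x1 y1) in T1.
  apply Rabs_le. lra.
Qed.

Lemma dist2_sq x y x' y' : dist2 x y x' y' ^ 2 = (x - x') ^ 2 + (y - y') ^ 2.
Proof.
  unfold dist2. apply pow2_sqrt. pose proof (pow2_ge_0 (x - x')). pose proof (pow2_ge_0 (y - y')). lra.
Qed.

Lemma dist2_pos x y x' y' : (x - x') ^ 2 + (y - y') ^ 2 <> 0 -> 0 < dist2 x y x' y'.
Proof.
  intros N. apply sqrt_lt_R0. pose proof (pow2_ge_0 (x - x')). pose proof (pow2_ge_0 (y - y')). lra.
Qed.

Lemma is_derive_dist2 (gx gy : R -> R) t vx vy x1 y1 :
  is_derive gx t vx -> is_derive gy t vy -> (gx t - x1) ^ 2 + (gy t - y1) ^ 2 <> 0 ->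
  is_derive (fun u => dist2 (gx u) (gy u) x1 y1) t
    ((vx * (gx t - x1) + vy * (gy t - y1)) / dist2 (gx t) (gy t) x1 y1).
Proof.
  intros X Y N. pose proof (dist2_pos (gx t) (gy t) x1 y1 N) as P. unfold dist2 in *.
  der; [pose proof (pow2_ge_0 (gx t - x1)); pose proof (pow2_ge_0 (gy t - y1)); lra|].
  field. lra.
Qed.

Lemma product_nonzero a1 b1 a2 b2 :
  (a1 * a2 - b1 * b2, a1 * b2 + b1 * a2) <> (0, 0) ->
  a1 ^ 2 + b1 ^ 2 <> 0 /\ a2 ^ 2 + b2 ^ 2 <> 0.
Proof.
  intros N. split; intros Z; apply N.
  - assert (a1 = 0) by nra. assert (b1 = 0) by nra. subst. f_equal; ring.
  - assert (a2 = 0) by nra. assert (b2 = 0) by nra. subst. f_equal; ring.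
Qed.

(** It speaks of one foliation and leaves the sign free, so that each lemma on leaves applies to N1
    and to N2. *)
Definition bisects_foci (D : plane_set) (N : line_field) (X1 Y1 Z1 X2 Y2 Z2 sigma : R) : Prop :=
  forall x y, D x y ->
    let a1 := Z1 * x - X1 in let b1 := Z1 * y - Y1 in
    let a2 := Z2 * x - X2 in let b2 := Z2 * y - Y2 in
    (a1 * a2 - b1 * b2, a1 * b2 + b1 * a2) <> (0, 0) /\
    forall vx vy, N x y vx vy ->
       square_aligned (a1 * a2 - b1 * b2) (a1 * b2 + b1 * a2) sigma vx vy.

(** By the reflection law d1 - sigma d2 has zero derivative along a leaf: hyperbolas for sigma = 1,
    ellipses for sigma = - 1. The formulation by distances includes the degenerate leaves. *)
Lemma central_leaves (D : plane_set) (N : line_field) x1 y1 x2 y2 sigma :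
  sigma = 1 \/ sigma = -1 -> bisects_foci D N x1 y1 1 x2 y2 1 sigma ->
  leaves_in D N (central_confocal x1 y1 x2 y2).
Proof.
  intros Hs HB a b gx gy HA.
  set (h := fun t => dist2 (gx t) (gy t) x1 y1 - sigma * dist2 (gx t) (gy t) x2 y2).
  assert (Dh : forall t, a < t < b -> is_derive h t 0).
  { intros t Ht. destruct (leaf_arc_derive _ _ _ _ _ _ _ HA Ht) as (HD & vx & vy & X & Y & _ & HN).
    destruct (HB _ _ HD) as [NZ SQ]. specialize (SQ vx vy HN). rewrite !Rmult_1_l in NZ, SQ.
    destruct (product_nonzero _ _ _ _ NZ) as [P1 P2].
    pose proof (is_derive_dist2 gx gy t vx vy x1 y1 X Y P1) as D1.
    pose proof (is_derive_dist2 gx gy t vx vy x2 y2 X Y P2) as D2.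
    pose proof (reflection_law _ _ _ _ sigma vx vy _ _ Hs SQ (dist2_pos _ _ _ _ P1)
      (dist2_pos _ _ _ _ P2) (dist2_sq _ _ _ _) (dist2_sq _ _ _ _)) as E.
    unfold h. der. rewrite E. ring. }
  assert (Hab : a < b) by apply HA. set (t0 := (a + b) / 2).
  assert (Ht0 : a < t0 < b) by (unfold t0; lra).
  destruct Hs as [-> | ->].
  - exists (fun x y => Rabs (dist2 x y x1 y1 - dist2 x y x2 y2) = Rabs (h t0)). split.
    + right. exists (Rabs (h t0)). split; [|intros x y; reflexivity]. split; [apply Rabs_pos|].
      unfold h. rewrite Rmult_1_l. apply dist2_triangle_abs.
    + intros t Ht. rewrite <- (is_derive_zero_const h a b t t0 Dh Ht Ht0). unfold h.
      now rewrite Rmult_1_l.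
  - exists (fun x y => dist2 x y x1 y1 + dist2 x y x2 y2 = h t0). split.
    + left. exists (h t0). split; [|intros x y; reflexivity].
      unfold h. pose proof (dist2_triangle (gx t0) (gy t0) x1 y1 x2 y2). lra.
    + intros t Ht. rewrite <- (is_derive_zero_const h a b t t0 Dh Ht Ht0). unfold h. ring.
Qed.

Lemma dist2_projection x y x1 y1 ux uy : ux ^ 2 + uy ^ 2 = 1 ->
  Rabs ((x - x1) * ux + (y - y1) * uy) <= dist2 x y x1 y1.
Proof.
  intros U. apply Rabs_le.
  pose proof (dist2_sq x y x1 y1) as S. assert (P : 0 <= dist2 x y x1 y1) by apply sqrt_pos.
  set (d := dist2 x y x1 y1) in *. set (a := x - x1) in *. set (b := y - y1) in *.
  assert (Q : (a * ux + b * uy) ^ 2 <= d ^ 2).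
  { rewrite S. transitivity ((a ^ 2 + b ^ 2) * (ux ^ 2 + uy ^ 2)); [|rewrite U; lra].
    pose proof (pow2_ge_0 (a * uy - b * ux)). nra. }
  split; nra.
Qed.

(** The ideal focus contributes the constant unit vector - (ux, uy) to the reflection law, whence
    the plus sign in [h]. *)
Lemma parabolic_leaves (D : plane_set) (N : line_field) x1 y1 ux uy sigma :
  sigma = 1 \/ sigma = -1 -> ux ^ 2 + uy ^ 2 = 1 ->
  bisects_foci D N x1 y1 1 ux uy 0 sigma ->
  leaves_in D N (parabolic_confocal x1 y1 ux uy).
Proof.
  intros Hs U HB a b gx gy HA.
  set (h := fun t => dist2 (gx t) (gy t) x1 y1 + sigma * ((gx t - x1) * ux + (gy t - y1) * uy)).
  assert (Dh : forall t, a < t < b -> is_derive h t 0).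
  { intros t Ht. destruct (leaf_arc_derive _ _ _ _ _ _ _ HA Ht) as (HD & vx & vy & X & Y & _ & HN).
    destruct (HB _ _ HD) as [NZ SQ]. specialize (SQ vx vy HN). rewrite !Rmult_1_l in NZ, SQ.
    destruct (product_nonzero _ _ _ _ NZ) as [P1 P2].
    pose proof (is_derive_dist2 gx gy t vx vy x1 y1 X Y P1) as D1.
    assert (U1 : 1 ^ 2 = (0 * gx t - ux) ^ 2 + (0 * gy t - uy) ^ 2) by (transitivity (ux ^ 2 + uy ^ 2); [rewrite U|]; ring).
    pose proof (reflection_law _ _ _ _ sigma vx vy _ 1 Hs SQ (dist2_pos _ _ _ _ P1)
      Rlt_0_1 (dist2_sq _ _ _ _) U1) as E.
    unfold h. der. rewrite E. field. }
  assert (Hab : a < b) by apply HA. set (t0 := (a + b) / 2).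
  assert (Ht0 : a < t0 < b) by (unfold t0; lra).
  pose proof (dist2_projection (gx t0) (gy t0) x1 y1 ux uy U) as Pr. apply Rabs_le_between in Pr.
  destruct Hs as [-> | ->].
  - exists (fun x y => dist2 x y x1 y1 = h t0 - ((x - x1) * ux + (y - y1) * uy)). split.
    + exists (h t0). split; [unfold h; lra|]. right. intros x y; reflexivity.
    + intros t Ht. rewrite <- (is_derive_zero_const h a b t t0 Dh Ht Ht0). unfold h. ring.
  - exists (fun x y => dist2 x y x1 y1 = h t0 + ((x - x1) * ux + (y - y1) * uy)). split.
    + exists (h t0). split; [unfold h; lra|]. left. intros x y; reflexivity.
    + intros t Ht. rewrite <- (is_derive_zero_const h a b t t0 Dh Ht Ht0). unfold h. ring.
Qed.

(** When the foci coincide, c + i s has a real square with the sign of sigma, so it is itself real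
    or purely imaginary. *)
Lemma square_aligned_same a b sigma vx vy : sigma = 1 \/ sigma = -1 ->
  square_aligned (a * a - b * b) (a * b + b * a) sigma vx vy ->
  (sigma = 1 -> vx * b - vy * a = 0) /\ (sigma = -1 -> vx * a + vy * b = 0).
Proof.
  intros Hs [E1 E2]. set (c := vx * a + vy * b). set (s := vx * b - vy * a).
  assert (I : c * s = 0) by (unfold c, s; lra).
  assert (Re : (vx ^ 2 - vy ^ 2) * (a * a - b * b) + 2 * vx * vy * (a * b + b * a) = c ^ 2 - s ^ 2)
    by (unfold c, s; ring).
  rewrite Re in E2. split; intros ->; apply Rmult_integral in I; destruct I as [I|I]; try assumption;
    rewrite I in E2; nra.
Qed.

Lemma circle_leaves (D : plane_set) (N : line_field) x1 y1 :
  bisects_foci D N x1 y1 1 x1 y1 1 (-1) -> leaves_in D N (concentric_circle x1 y1).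
Proof.
  intros HB a b gx gy HA.
  set (h := fun t => (gx t - x1) ^ 2 + (gy t - y1) ^ 2).
  assert (Dh : forall t, a < t < b -> is_derive h t 0).
  { intros t Ht. destruct (leaf_arc_derive _ _ _ _ _ _ _ HA Ht) as (HD & vx & vy & X & Y & _ & HN).
    destruct (HB _ _ HD) as [NZ SQ]. specialize (SQ vx vy HN). rewrite !Rmult_1_l in SQ.
    destruct (square_aligned_same _ _ _ _ _ (or_intror eq_refl) SQ) as [_ E]. specialize (E eq_refl).
    unfold h. der. lra. }
  assert (Hab : a < b) by apply HA. set (t0 := (a + b) / 2).
  assert (Ht0 : a < t0 < b) by (unfold t0; lra).
  exists (fun x y => (x - x1) ^ 2 + (y - y1) ^ 2 = h t0). split.
  - assert (P : 0 < h t0).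
    { destruct (leaf_arc_derive _ _ _ _ _ _ _ HA Ht0) as (HD & _).
      destruct (HB _ _ HD) as [NZ _]. rewrite !Rmult_1_l in NZ.
      destruct (product_nonzero _ _ _ _ NZ) as [P1 _]. unfold h in *.
      pose proof (pow2_ge_0 (gx t0 - x1)). pose proof (pow2_ge_0 (gy t0 - y1)). lra. }
    exists (sqrt (h t0)). split; [now apply sqrt_lt_R0|]. intros x y.
    rewrite pow2_sqrt by lra. reflexivity.
  - intros t Ht. now apply (is_derive_zero_const h a b t t0 Dh Ht Ht0).
Qed.

(** The velocity is parallel to the radius vector, so the unit radius vector is constant along the
    leaf. *)
Lemma radial_leaves (D : plane_set) (N : line_field) x1 y1 :
  bisects_foci D N x1 y1 1 x1 y1 1 1 -> leaves_in D N (pencil x1 y1 1).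
Proof.
  intros HB a b gx gy HA.
  set (m := fun t => dist2 (gx t) (gy t) x1 y1).
  assert (F : forall t, a < t < b -> 0 < m t /\
     is_derive (fun t => (gx t - x1) / m t) t 0 /\ is_derive (fun t => (gy t - y1) / m t) t 0).
  { intros t Ht. destruct (leaf_arc_derive _ _ _ _ _ _ _ HA Ht) as (HD & vx & vy & X & Y & _ & HN).
    destruct (HB _ _ HD) as [NZ SQ]. specialize (SQ vx vy HN). rewrite !Rmult_1_l in SQ, NZ.
    destruct (product_nonzero _ _ _ _ NZ) as [P1 _].
    destruct (square_aligned_same _ _ _ _ _ (or_introl eq_refl) SQ) as [E _]. specialize (E eq_refl).
    pose proof (is_derive_dist2 gx gy t vx vy x1 y1 X Y P1) as D1. fold (m t) in D1.
    change (is_derive m t ((vx * (gx t - x1) + vy * (gy t - y1)) / m t)) in D1.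
    pose proof (dist2_pos _ _ _ _ P1) as P. fold (m t) in P.
    pose proof (dist2_sq (gx t) (gy t) x1 y1) as M. fold (m t) in M.
    split; [exact P|]. split.
    - der; [lra|]. apply Rmult_eq_reg_r with (m t ^ 3); [|apply pow_nonzero; lra].
      transitivity (vx * m t ^ 2 - (gx t - x1) * (vx * (gx t - x1) + vy * (gy t - y1))); [field; lra|].
      rewrite M. transitivity ((gy t - y1) * (vx * (gy t - y1) - vy * (gx t - x1))); [ring|].
      rewrite E. ring.
    - der; [lra|]. apply Rmult_eq_reg_r with (m t ^ 3); [|apply pow_nonzero; lra].
      transitivity (vy * m t ^ 2 - (gy t - y1) * (vx * (gx t - x1) + vy * (gy t - y1))); [field; lra|].
      rewrite M. transitivity (- (gx t - x1) * (vx * (gy t - y1) - vy * (gx t - x1))); [ring|].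
      rewrite E. ring. }
  assert (Hab : a < b) by apply HA. set (t0 := (a + b) / 2).
  assert (Ht0 : a < t0 < b) by (unfold t0; lra).
  set (p := (gx t0 - x1) / m t0). set (q := (gy t0 - y1) / m t0).
  exists (line (- q) p (q * x1 - p * y1)). split.
  - exists (- q), p, (q * x1 - p * y1). split; [ring|]. split; [|intros x y; reflexivity].
    intros Z. injection Z as Zq Zp. destruct (F t0 Ht0) as (P & _).
    assert (M : m t0 ^ 2 = (gx t0 - x1) ^ 2 + (gy t0 - y1) ^ 2) by apply dist2_sq.
    assert (p ^ 2 + q ^ 2 = 1).
    { unfold p, q. apply Rmult_eq_reg_r with (m t0 ^ 2); [|apply pow_nonzero; lra].
      rewrite M at 2. field. lra. }
    nra.
  - intros t Ht. unfold line. destruct (F t Ht) as (P & _).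
    assert (Ep : (gx t - x1) / m t = p).
    { apply (is_derive_zero_const (fun t => (gx t - x1) / m t) a b t t0); auto. intros u Hu. now apply F. }
    assert (Eq : (gy t - y1) / m t = q).
    { apply (is_derive_zero_const (fun t => (gy t - y1) / m t) a b t t0); auto. intros u Hu. now apply F. }
    rewrite <- Ep, <- Eq. field. lra.
Qed.

Lemma parallel_leaves (D : plane_set) (N : line_field) ux uy :
  (ux, uy) <> (0, 0) -> (forall x y vx vy, D x y -> N x y vx vy -> ux * vy - uy * vx = 0) ->
  leaves_in D N (pencil ux uy 0).
Proof.
  intros NZ HN a b gx gy HA.
  assert (Dh : forall t, a < t < b -> is_derive (fun t => ux * gy t - uy * gx t) t 0).
  { intros t Ht. destruct (leaf_arc_derive _ _ _ _ _ _ _ HA Ht) as (HD & vx & vy & X & Y & _ & Hv).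
    pose proof (HN _ _ _ _ HD Hv). der. lra. }
  assert (Hab : a < b) by apply HA. set (t0 := (a + b) / 2).
  assert (Ht0 : a < t0 < b) by (unfold t0; lra).
  exists (line (- uy) ux (uy * gx t0 - ux * gy t0)). split.
  - exists (- uy), ux, (uy * gx t0 - ux * gy t0). split; [ring|]. split; [|intros x y; reflexivity].
    intros Z. injection Z as Z1 Z2. apply NZ. f_equal; lra.
  - intros t Ht. unfold line.
    pose proof (is_derive_zero_const _ a b t t0 Dh Ht Ht0). cbv beta in H. lra.
Qed.

Lemma orthogonal_multiple p q vx vy : (vx, vy) <> (0, 0) -> p * vx + q * vy = 0 ->
  exists l, p = - l * vy /\ q = l * vx.
Proof.
  intros N E. assert (M : vx ^ 2 + vy ^ 2 <> 0) by (intros Z; apply N; f_equal; nra).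
  exists ((q * vx - p * vy) / (vx ^ 2 + vy ^ 2)).
  split; apply Rmult_eq_reg_r with (vx ^ 2 + vy ^ 2); try exact M; field_simplify; try exact M; nsz.
Qed.

(** A line is determined by one point and its direction there. Hence tangency to a conic or passage
    through a point can later be tested at the middle parameter alone. *)
Lemma straight_leaf_line (D : plane_set) (L : line_field) a b gx gy :
  leaves_in D L straight_line -> leaf_arc D L a b gx gy ->
  exists p q c x y vx vy, (p, q) <> (0, 0) /\ (forall t, a < t < b -> line p q c (gx t) (gy t)) /\
    D x y /\ L x y vx vy /\ (vx, vy) <> (0, 0) /\ p * x + q * y + c = 0 /\ p * vx + q * vy = 0.
Proof.
  intros HL HA. destruct (HL a b gx gy HA) as (Cv & (p & q & c & N & E) & HC).
  assert (Hab : a < b) by apply HA. set (t0 := (a + b) / 2).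
  assert (Ht0 : a < t0 < b) by (unfold t0; lra).
  destruct (leaf_arc_derive _ _ _ _ _ _ _ HA Ht0) as (HD & vx & vy & X & Y & Nv & Hv).
  exists p, q, c, (gx t0), (gy t0), vx, vy. split; [exact N|].
  assert (HI : forall t, a < t < b -> line p q c (gx t) (gy t)) by (intros t Ht; now apply E, HC).
  split; [exact HI|]. split; [exact HD|]. split; [exact Hv|]. split; [exact Nv|].
  split; [now apply HI|].
  assert (D0 : is_derive (fun u => p * gx u + q * gy u + c) t0 (p * vx + q * vy)) by (der; ring).
  apply is_derive_unique in D0. rewrite <- D0.
  rewrite (Derive_ext_loc _ (fun _ => 0)); [apply Derive_const|].
  apply (locally_interval _ t0 a b); simpl; [lra|lra|]. intros u Ha Hb. apply HI. lra.
Qed.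

Lemma pencil_leaves (D : plane_set) (L : line_field) X Y Z :
  leaves_in D L straight_line ->
  (forall x y vx vy, D x y -> L x y vx vy -> (Z * x - X) * vy - (Z * y - Y) * vx = 0) ->
  leaves_in D L (pencil X Y Z).
Proof.
  intros HS HL a b gx gy HA.
  destruct (straight_leaf_line D L a b gx gy HS HA)
    as (p & q & c & x & y & vx & vy & N & HI & HD & Hv & Nv & E1 & E2).
  exists (line p q c). split; [|exact HI]. exists p, q, c. split; [|split; [exact N|intros u v; reflexivity]].
  specialize (HL x y vx vy HD Hv).
  destruct (orthogonal_multiple p q vx vy Nv E2) as (l & -> & ->).
  replace c with (- (- l * vy * x + l * vx * y)) by lra.
  transitivity (l * ((Z * x - X) * vy - (Z * y - Y) * vx)); [ring|rewrite HL; ring].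
Qed.

(** * Conics with given foci *)

Lemma focal_product_homogeneous (D : plane_set) (L1 L2 N1 N2 : line_field) X1 Y1 Z1 X2 Y2 Z2 :
  planar_domain D -> locally_frame D L1 L2 N1 N2 ->
  focal_pair D L1 L2 X1 Y1 Z1 X2 Y2 Z2 ->
  exists b, forall x y vx vy, D x y -> (L1 x y vx vy \/ L2 x y vx vy) ->
    ((Z1 * x - X1) * vy - (Z1 * y - Y1) * vx) * ((Z2 * x - X2) * vy - (Z2 * y - Y2) * vx)
    = b * (vx ^ 2 + vy ^ 2).
Proof.
  intros HD HF HP.
  destruct (focal_product_const D L1 L2 N1 N2 _ _ _ _ _ _ HD HF HP) as (b & Hb).
  exists b. intros x y vx vy Hxy HL.
  destruct (HF x y Hxy) as (r & c1 & s1 & A & c2 & s2 & C & Hr & _ & F & _).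
  pose proof (open_disc_center x y r Hr) as HV.
  at_point F (open_disc_open x y r) x y HV.
  assert (T : forall c s, (L1 x y c s \/ L2 x y c s) -> c ^ 2 + s ^ 2 = 1 -> c * vy - s * vx = 0 ->
    ((Z1 * x - X1) * vy - (Z1 * y - Y1) * vx) * ((Z2 * x - X2) * vy - (Z2 * y - Y2) * vx)
    = b * (vx ^ 2 + vy ^ 2)).
  { intros c s HL' U E. destruct (span_unit c s vx vy U E) as (t & -> & ->).
    rewrite <- (Hb x y c s Hxy HL' U). 
    match goal with |- _ = ?P * _ => transitivity (P * (t ^ 2 * (c ^ 2 + s ^ 2))); [rewrite U|]; ring end. }
  destruct HL as [HL|HL].
  - apply (T (c1 x y) (s1 x y)); [left|exact U1|].
    + apply (lf_span (fr_1 F)); [exact HV|ring].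
    + now apply (lf_span (fr_1 F)).
  - apply (T (c2 x y) (s2 x y)); [right|exact U2|].
    + apply (lf_span (fr_2 F)); [exact HV|ring].
    + now apply (lf_span (fr_2 F)).
Qed.

(* The determinant and the adjugate of the matrix (F1 F2^T + F2 F1^T) / 2
   - b diag(1, 1, 0) of the dual conic (l . F1) (l . F2) = b (l_x^2 + l_y^2). *)
Definition focal_det (X1 Y1 Z1 X2 Y2 Z2 b : R) : R :=
  let A := X1 * X2 - b in let B := (X1 * Y2 + X2 * Y1) / 2 in let G := Y1 * Y2 - b in
  let E := (X1 * Z2 + X2 * Z1) / 2 in let F := (Y1 * Z2 + Y2 * Z1) / 2 in let H := Z1 * Z2 in
  A * (G * H - F ^ 2) - B * (B * H - E * F) + E * (B * F - G * E).

Definition focal_conic (X1 Y1 Z1 X2 Y2 Z2 b : R) : conic :=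
  let A := X1 * X2 - b in let B := (X1 * Y2 + X2 * Y1) / 2 in let G := Y1 * Y2 - b in
  let E := (X1 * Z2 + X2 * Z1) / 2 in let F := (Y1 * Z2 + Y2 * Z1) / 2 in let H := Z1 * Z2 in
  Conic (G * H - F ^ 2) (E * F - B * H) (A * H - E ^ 2) (B * F - G * E) (B * E - A * F) (A * G - B ^ 2).

(** The determinant of the adjugate of a matrix of order 3 is the square of the determinant. *)
Lemma focal_conic_smooth X1 Y1 Z1 X2 Y2 Z2 b :
  focal_det X1 Y1 Z1 X2 Y2 Z2 b <> 0 -> smooth_conic (focal_conic X1 Y1 Z1 X2 Y2 Z2 b).
Proof.
  intros N. unfold smooth_conic.
  match goal with |- ?p <> 0 => replace p with (focal_det X1 Y1 Z1 X2 Y2 Z2 b ^ 2) end.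
  - now apply pow_nonzero.
  - unfold focal_det, focal_conic. cbn [qa qb qc qd qe qf]. field.
Qed.

Lemma focal_conic_tangent X1 Y1 Z1 X2 Y2 Z2 b p q c :
  focal_det X1 Y1 Z1 X2 Y2 Z2 b <> 0 -> (p, q) <> (0, 0) ->
  (p * X1 + q * Y1 + c * Z1) * (p * X2 + q * Y2 + c * Z2) = b * (p ^ 2 + q ^ 2) ->
  tangent_line (focal_conic X1 Y1 Z1 X2 Y2 Z2 b) (line p q c).
Proof.
  intros N Npq E. set (d := focal_det X1 Y1 Z1 X2 Y2 Z2 b) in *.
  set (A := X1 * X2 - b). set (B := (X1 * Y2 + X2 * Y1) / 2). set (G := Y1 * Y2 - b).
  set (I := (X1 * Z2 + X2 * Z1) / 2). set (F := (Y1 * Z2 + Y2 * Z1) / 2). set (H := Z1 * Z2).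
  assert (Ed : d = A * (G * H - F ^ 2) - B * (B * H - I * F) + I * (B * F - G * I)) by reflexivity. clearbody d.
  (* The point of contact is the matrix of the dual conic applied to the line, divided by the
     determinant so that the adjugate gives back exactly (p, q, c). *)
  exists ((A * p + B * q + I * c) / d), ((B * p + G * q + F * c) / d), ((I * p + F * q + H * c) / d).
  change (focal_conic X1 Y1 Z1 X2 Y2 Z2 b) with
    (Conic (G * H - F ^ 2) (I * F - B * H) (A * H - I ^ 2) (B * F - G * I) (B * I - A * F) (A * G - B ^ 2)).
  cbn [qa qb qc qd qe qf]. cbv zeta.
  assert (E1 : (G * H - F ^ 2) * ((A * p + B * q + I * c) / d) + (I * F - B * H) * ((B * p + G * q + F * c) / d)
      + (B * F - G * I) * ((I * p + F * q + H * c) / d) = p).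
  { apply Rmult_eq_reg_r with d; [|exact N]. rewrite Ed at 5. field. exact N. }
  assert (E2 : (I * F - B * H) * ((A * p + B * q + I * c) / d) + (A * H - I ^ 2) * ((B * p + G * q + F * c) / d)
      + (B * I - A * F) * ((I * p + F * q + H * c) / d) = q).
  { apply Rmult_eq_reg_r with d; [|exact N]. rewrite Ed at 5. field. exact N. }
  assert (E3 : (B * F - G * I) * ((A * p + B * q + I * c) / d) + (B * I - A * F) * ((B * p + G * q + F * c) / d)
      + (A * G - B ^ 2) * ((I * p + F * q + H * c) / d) = c).
  { apply Rmult_eq_reg_r with d; [|exact N]. rewrite Ed at 5. field. exact N. }
  rewrite E1, E2, E3. split; [|split; [exact Npq|intros x y; reflexivity]].
  apply Rmult_eq_reg_r with d; [|exact N]. rewrite Rmult_0_l.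
  transitivity ((p * X1 + q * Y1 + c * Z1) * (p * X2 + q * Y2 + c * Z2) - b * (p ^ 2 + q ^ 2)).
  - unfold A, B, G, I, F, H. field. exact N.
  - rewrite E. ring.
Qed.

Lemma tangent_leaves (D : plane_set) (L : line_field) X1 Y1 Z1 X2 Y2 Z2 b :
  leaves_in D L straight_line -> focal_det X1 Y1 Z1 X2 Y2 Z2 b <> 0 ->
  (forall x y vx vy, D x y -> L x y vx vy ->
    ((Z1 * x - X1) * vy - (Z1 * y - Y1) * vx) * ((Z2 * x - X2) * vy - (Z2 * y - Y2) * vx)
    = b * (vx ^ 2 + vy ^ 2)) ->
  leaves_in D L (tangent_line (focal_conic X1 Y1 Z1 X2 Y2 Z2 b)).
Proof.
  intros HS Nd HL a0 b0 gx gy HA.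
  destruct (straight_leaf_line D L a0 b0 gx gy HS HA)
    as (p & q & c & x & y & vx & vy & N & HI & HD & Hv & Nv & E1 & E2).
  exists (line p q c). split; [|exact HI]. apply focal_conic_tangent; [exact Nd|exact N|].
  specialize (HL x y vx vy HD Hv).
  destruct (orthogonal_multiple p q vx vy Nv E2) as (l & -> & ->).
  replace c with (- (- l * vy * x + l * vx * y)) by lra.
  transitivity (l ^ 2 * (((Z1 * x - X1) * vy - (Z1 * y - Y1) * vx)
     * ((Z2 * x - X2) * vy - (Z2 * y - Y2) * vx))); [ring|rewrite HL; ring].
Qed.

Definition conic_value (Q : conic) (x y : R) : R :=
  qa Q * x ^ 2 + 2 * qb Q * x * y + qc Q * y ^ 2 + 2 * qd Q * x + 2 * qe Q * y + qf Q.

(** When [s] is positive it is the square of the semi-axis carrying the foci. The equation of the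
    conic is a polynomial in the squared focal distances, and it splits into a factor for hyperbolas
    and one for ellipses. *)
Lemma central_conic_distances x1 y1 x2 y2 b x y :
  let s := b + ((x1 - x2) ^ 2 + (y1 - y2) ^ 2) / 4 in
  16 * conic_value (focal_conic x1 y1 1 x2 y2 1 b) x y =
  ((dist2 x y x1 y1 - dist2 x y x2 y2) ^ 2 - 4 * s) * ((dist2 x y x1 y1 + dist2 x y x2 y2) ^ 2 - 4 * s).
Proof.
  intros s. pose proof (dist2_sq x y x1 y1) as M1. pose proof (dist2_sq x y x2 y2) as M2.
  set (d1 := dist2 x y x1 y1) in *. set (d2 := dist2 x y x2 y2) in *.
  transitivity ((4 * s + d1 ^ 2 - d2 ^ 2) ^ 2 - 16 * s * d1 ^ 2); [|ring].
  rewrite M1, M2. unfold conic_value, focal_conic, s. cbn [qa qb qc qd qe qf]. field.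
Qed.

(** With d the distance of the foci, k^2 = d^2 + 4 b. For b > 0 the bound |d1 - d2| <= d < k
    excludes the first factor, for b < 0 the bound k < d <= d1 + d2 excludes the second. *)
Lemma central_conic_confocal x1 y1 x2 y2 b :
  b <> 0 -> 0 < b + ((x1 - x2) ^ 2 + (y1 - y2) ^ 2) / 4 ->
  central_confocal x1 y1 x2 y2 (conic_locus (focal_conic x1 y1 1 x2 y2 1 b)).
Proof.
  intros Nb Hs. set (s := b + ((x1 - x2) ^ 2 + (y1 - y2) ^ 2) / 4) in *.
  set (k := 2 * sqrt s).
  assert (K0 : 0 < k) by (unfold k; pose proof (sqrt_lt_R0 s Hs); lra).
  assert (K2 : k ^ 2 = 4 * s).
  { unfold k. replace ((2 * sqrt s) ^ 2) with (4 * sqrt s ^ 2) by ring. rewrite pow2_sqrt; lra. }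
  set (d := dist2 x1 y1 x2 y2). assert (D0 : 0 <= d) by apply sqrt_pos.
  assert (D2 : d ^ 2 = (x1 - x2) ^ 2 + (y1 - y2) ^ 2) by apply dist2_sq.
  assert (KD : k ^ 2 = d ^ 2 + 4 * b) by (rewrite K2, D2; unfold s; field).
  assert (EQ : forall x y, conic_locus (focal_conic x1 y1 1 x2 y2 1 b) x y <->
     ((dist2 x y x1 y1 - dist2 x y x2 y2) ^ 2 - k ^ 2) * ((dist2 x y x1 y1 + dist2 x y x2 y2) ^ 2 - k ^ 2) = 0).
  { intros x y. change (conic_locus (focal_conic x1 y1 1 x2 y2 1 b) x y)
      with (conic_value (focal_conic x1 y1 1 x2 y2 1 b) x y = 0).
    pose proof (central_conic_distances x1 y1 x2 y2 b x y) as E. cbv zeta in E. fold s in E.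
    rewrite K2, <- E. split; intros; lra. }
  destruct (Rtotal_order b 0) as [L|[L|L]]; [|contradiction|].
  - right. exists k. split; [split; [lra|fold d; nra]|]. intros x y. rewrite EQ.
    pose proof (dist2_triangle x y x1 y1 x2 y2) as T. fold d in T.
    set (d1 := dist2 x y x1 y1) in *. set (d2 := dist2 x y x2 y2) in *. split.
    + intros Z. apply Rmult_integral in Z. destruct Z as [Z|Z]; [|nra].
      assert (T2 : (d1 - d2 - k) * (d1 - d2 + k) = 0) by lra.
      apply Rmult_integral in T2. destruct T2.
      * rewrite Rabs_pos_eq; lra.
      * rewrite Rabs_left; lra.
    + intros Z. replace ((d1 - d2) ^ 2) with (k ^ 2); [ring|]. rewrite <- Z. apply pow2_abs.
  - left. exists k. split; [fold d; nra|]. intros x y. rewrite EQ.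
    pose proof (dist2_triangle_abs x y x1 y1 x2 y2) as T. fold d in T.
    assert (P1 : 0 <= dist2 x y x1 y1) by apply sqrt_pos.
    assert (P2 : 0 <= dist2 x y x2 y2) by apply sqrt_pos.
    set (d1 := dist2 x y x1 y1) in *. set (d2 := dist2 x y x2 y2) in *. split.
    + intros Z. apply Rmult_integral in Z. destruct Z as [Z|Z].
      * exfalso. rewrite <- (pow2_abs (d1 - d2)) in Z. pose proof (Rabs_pos (d1 - d2)). nra.
      * nra.
    + intros Z. rewrite Z. ring.
Qed.

(* The center is (x1 + x2) / 2, the axes are spanned by h = (x1 - x2) / 2 and
   its rotation. *)
Lemma central_conic_axes x1 y1 x2 y2 b s t :
  let hx := (x1 - x2) / 2 in let hy := (y1 - y2) / 2 in
  let f := hx ^ 2 + hy ^ 2 in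
  conic_value (focal_conic x1 y1 1 x2 y2 1 b)
    ((x1 + x2) / 2 + s * hx - t * hy) ((y1 + y2) / 2 + s * hy + t * hx)
  = (b + f) * b - b * (s ^ 2 * f) - (b + f) * (t ^ 2 * f).
Proof.
  intros hx hy f. unfold conic_value, focal_conic, f, hx, hy. cbn [qa qb qc qd qe qf]. field.
Qed.

(** Adding the circle equation at two points of the conic symmetric about its center shows that all
    these pairs are equally far from that center. A vertex has squared distance b + f, another point
    of the conic b or b + 2 f. *)
Lemma central_conic_not_circle x1 y1 x2 y2 b :
  (x1, y1) <> (x2, y2) -> b <> 0 -> 0 < b + ((x1 - x2) ^ 2 + (y1 - y2) ^ 2) / 4 ->
  ~ is_circle (conic_locus (focal_conic x1 y1 1 x2 y2 1 b)).
Proof.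
  intros NF Nb Hs (x0 & y0 & r & Hr & HC).
  set (hx := (x1 - x2) / 2). set (hy := (y1 - y2) / 2). set (f := hx ^ 2 + hy ^ 2).
  assert (Hf : 0 < f).
  { unfold f. pose proof (pow2_ge_0 hx). pose proof (pow2_ge_0 hy).
    destruct (Rle_lt_or_eq_dec 0 (hx ^ 2 + hy ^ 2)) as [|E]; [lra|assumption|]. exfalso. apply NF.
    assert (hx = 0) by nra. assert (hy = 0) by nra. unfold hx, hy in *. f_equal; lra. }
  assert (Hs' : 0 < b + f) by (unfold f, hx, hy; lra).
  set (p := (x1 + x2) / 2 - x0). set (q := (y1 + y2) / 2 - y0).
  set (u := p * hx + q * hy). set (v := - p * hy + q * hx).
  assert (ON : forall s t, (b + f) * b - b * (s ^ 2 * f) - (b + f) * (t ^ 2 * f) = 0 ->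
     p ^ 2 + q ^ 2 + 2 * (s * u + t * v) + (s ^ 2 * f + t ^ 2 * f) = r ^ 2).
  { intros s t E.
    pose proof (proj1 (HC _ _) (eq_trans (central_conic_axes x1 y1 x2 y2 b s t) E)) as K.
    rewrite <- K. unfold u, v, p, q, f, hx, hy. field. }
  assert (SQ : forall w, 0 <= w -> exists z, z ^ 2 * f = w).
  { intros w Hw. exists (sqrt (w / f)). rewrite pow2_sqrt; [field; lra|].
    apply Rmult_le_pos; [exact Hw|]. left. now apply Rinv_0_lt_compat. }
  assert (ev : forall z w, z ^ 2 * f = w -> (- z) ^ 2 * f = w) by (intros z w E; rewrite <- E; ring).
  destruct (SQ (b + f)) as (s1 & Hs1); [lra|].
  pose proof (ON s1 0) as A1. pose proof (ON (- s1) 0) as A2. rewrite (ev _ _ Hs1) in A2. rewrite Hs1 in A1.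
  specialize (A1 ltac:(ring)). specialize (A2 ltac:(ring)).
  destruct (Rtotal_order b 0) as [L|[L|L]]; [|contradiction|].
  (* A hyperbola has no vertex on its second axis; another point is taken, at squared distance 2 (b
     + f) - b from the center. *)
  - destruct (SQ (2 * (b + f))) as (s2 & Hs2); [lra|]. destruct (SQ (- b)) as (t2 & Ht2); [lra|].
    pose proof (ON s2 t2) as A3. pose proof (ON (- s2) (- t2)) as A4.
    rewrite (ev _ _ Hs2), (ev _ _ Ht2) in A4. rewrite Hs2, Ht2 in A3.
    specialize (A3 ltac:(ring)). specialize (A4 ltac:(ring)). lra.
  - destruct (SQ b) as (t2 & Ht2); [lra|].
    pose proof (ON 0 t2) as A3. pose proof (ON 0 (- t2)) as A4.
    rewrite (ev _ _ Ht2) in A4. rewrite Ht2 in A3.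
    specialize (A3 ltac:(ring)). specialize (A4 ltac:(ring)). lra.
Qed.

Lemma circle_conic x1 y1 b : 0 < b ->
  concentric_circle x1 y1 (conic_locus (focal_conic x1 y1 1 x1 y1 1 b)).
Proof.
  intros Hb. exists (sqrt b). split; [now apply sqrt_lt_R0|]. intros x y.
  rewrite pow2_sqrt by lra.
  change (conic_locus (focal_conic x1 y1 1 x1 y1 1 b) x y)
    with (conic_value (focal_conic x1 y1 1 x1 y1 1 b) x y = 0).
  replace (conic_value (focal_conic x1 y1 1 x1 y1 1 b) x y)
    with (b * (b - ((x - x1) ^ 2 + (y - y1) ^ 2)))
    by (unfold conic_value, focal_conic; cbn [qa qb qc qd qe qf]; field).
  split; intros E; [|rewrite E; ring]. apply Rmult_integral in E. destruct E; lra.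
Qed.

Lemma parabolic_conic_value x1 y1 ux uy b x y : ux ^ 2 + uy ^ 2 = 1 ->
  4 * conic_value (focal_conic x1 y1 1 ux uy 0 b) x y =
  (2 * b + ((x - x1) * ux + (y - y1) * uy)) ^ 2 - ((x - x1) ^ 2 + (y - y1) ^ 2).
Proof.
  intros U.
  transitivity ((2 * b + ((x - x1) * ux + (y - y1) * uy)) ^ 2
                - (ux ^ 2 + uy ^ 2) * ((x - x1) ^ 2 + (y - y1) ^ 2)); [|rewrite U; ring].
  unfold conic_value, focal_conic. cbn [qa qb qc qd qe qf]. field.
Qed.

Lemma parabolic_conic_confocal x1 y1 ux uy b : ux ^ 2 + uy ^ 2 = 1 -> b <> 0 ->
  parabolic_confocal x1 y1 ux uy (conic_locus (focal_conic x1 y1 1 ux uy 0 b)).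
Proof.
  intros U Nb.
  assert (EQ : forall x y, conic_locus (focal_conic x1 y1 1 ux uy 0 b) x y <->
     (2 * b + ((x - x1) * ux + (y - y1) * uy)) ^ 2 = dist2 x y x1 y1 ^ 2).
  { intros x y. change (conic_locus (focal_conic x1 y1 1 ux uy 0 b) x y)
      with (conic_value (focal_conic x1 y1 1 ux uy 0 b) x y = 0).
    pose proof (parabolic_conic_value x1 y1 ux uy b x y U) as E. rewrite dist2_sq.
    split; intros; lra. }
  exists (2 * Rabs b). split; [pose proof (Rabs_pos b); lra|].
  destruct (Rtotal_order b 0) as [L|[L|L]]; [|contradiction|].
  - right. rewrite Rabs_left by exact L. intros x y. rewrite EQ.
    pose proof (dist2_projection x y x1 y1 ux uy U) as P. apply Rabs_le_between in P.
    set (d := dist2 x y x1 y1) in *. set (w := (x - x1) * ux + (y - y1) * uy) in *. split.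
    + intros E. assert (T : (2 * b + w - d) * (2 * b + w + d) = 0) by lra.
      apply Rmult_integral in T. destruct T; lra.
    + intros ->. ring.
  - left. rewrite Rabs_pos_eq by lra. intros x y. rewrite EQ.
    pose proof (dist2_projection x y x1 y1 ux uy U) as P. apply Rabs_le_between in P.
    set (d := dist2 x y x1 y1) in *. set (w := (x - x1) * ux + (y - y1) * uy) in *. split.
    + intros E. assert (T : (2 * b + w - d) * (2 * b + w + d) = 0) by lra.
      apply Rmult_integral in T. destruct T; lra.
    + intros ->. ring.
Qed.

(* On a circle a quartic polynomial without leading term would vanish along the
   parametrization by s, against its fourth difference 24 b^2. *)
Lemma parabolic_conic_not_circle x1 y1 ux uy b : ux ^ 2 + uy ^ 2 = 1 -> b <> 0 ->
  ~ is_circle (conic_locus (focal_conic x1 y1 1 ux uy 0 b)).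
Proof.
  intros U Nb (x0 & y0 & r & Hr & HC).
  set (p := (x1 - x0) * ux + (y1 - y0) * uy). set (q := - (x1 - x0) * uy + (y1 - y0) * ux).
  set (k := (x1 - x0) ^ 2 + (y1 - y0) ^ 2).
  assert (ON : forall s, b ^ 2 * (s ^ 2 + 1) ^ 2 + 2 * p * (b * (s ^ 2 - 1)) + 2 * q * (2 * b * s) + k = r ^ 2).
  { intros s. set (xi := b * (s ^ 2 - 1)). set (eta := 2 * b * s).
    assert (K : conic_locus (focal_conic x1 y1 1 ux uy 0 b) (x1 + xi * ux - eta * uy) (y1 + xi * uy + eta * ux)).
    { change (conic_value (focal_conic x1 y1 1 ux uy 0 b) (x1 + xi * ux - eta * uy) (y1 + xi * uy + eta * ux) = 0).
      apply Rmult_eq_reg_l with 4; [|lra]. rewrite (parabolic_conic_value _ _ _ _ _ _ _ U).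
      transitivity ((2 * b + xi * (ux ^ 2 + uy ^ 2)) ^ 2 - (xi ^ 2 + eta ^ 2) * (ux ^ 2 + uy ^ 2)); [ring|].
      rewrite U. unfold xi, eta. ring. }
    apply HC in K. rewrite <- K.
    transitivity (k + 2 * p * xi + 2 * q * eta + (xi ^ 2 + eta ^ 2) * 1); [unfold xi, eta; ring|].
    rewrite <- U. unfold p, q, k. ring. }
  pose proof (ON 0). pose proof (ON 1). pose proof (ON (-1)). pose proof (ON 2). pose proof (ON (-2)).
  assert (24 * b ^ 2 = 0) by lra. apply Nb. nra.
Qed.

Lemma focal_det_central x1 y1 x2 y2 b :
  focal_det x1 y1 1 x2 y2 1 b = b * (b + ((x1 - x2) ^ 2 + (y1 - y2) ^ 2) / 4).
Proof. unfold focal_det. field. Qed.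

Lemma focal_det_parabolic x1 y1 ux uy b : ux ^ 2 + uy ^ 2 = 1 ->
  focal_det x1 y1 1 ux uy 0 b = b / 4.
Proof.
  intros U. transitivity (b * (ux ^ 2 + uy ^ 2) / 4); [unfold focal_det; field|rewrite U; field].
Qed.

(** * The classification *)

Lemma at_right_0 (P : R -> Prop) (r : R) :
  0 < r -> (forall q, 0 < q -> q < r -> P q) -> at_right 0 P.
Proof.
  intros Hr H. exists (mkposreal r Hr). intros q Hq Hp. apply H; [exact Hp|].
  change (Rabs (q - 0) < r) in Hq. apply Rabs_def2 in Hq. lra.
Qed.

Lemma at_right_0_small (P : R -> Prop) (r : R) :
  0 < r -> at_right 0 P -> exists q, 0 < q < r /\ P q.
Proof.
  intros Hr [e H]. pose proof (cond_pos e) as He. set (q := Rmin (e / 2) (r / 2)).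
  assert (Hq : 0 < q) by (apply Rmin_glb_lt; lra).
  pose proof (Rmin_l (e / 2) (r / 2)). pose proof (Rmin_r (e / 2) (r / 2)). fold q in H0, H1.
  exists q. split; [lra|]. apply H; [|exact Hq].
  change (Rabs (q - 0) < e). rewrite Rabs_pos_eq; lra.
Qed.

(** * The two conditions and the webs *)

Lemma flat_locally_frame (D : plane_set) (L1 L2 N1 N2 : line_field) :
  planar_domain D -> linear_net D L1 L2 -> bisector_net D L1 L2 N1 N2 ->
  conformally_flat D N1 N2 -> locally_frame D L1 L2 N1 N2.
Proof.
  intros HD HL HB HC x0 y0 H0.
  destruct (frame_exists D L1 L2 N1 N2 x0 y0 HD HL HB H0) as (r & c1 & s1 & A & c2 & s2 & C & Hr & Hd & F).
  exists r, c1, s1, A, c2, s2, C. split; [exact Hr|]. split; [exact Hd|]. split; [exact F|].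
  intros x y HV. apply (flat_curvature D (open_disc x0 y0 r) L1 L2 N1 N2); auto using open_disc_open.
Qed.

(** If the curvature were nonzero at a point, it would be so on a small disc; there phi, and with it
    the basic Abelian relation, would vanish identically, against its independence. *)
Lemma hexagonal_locally_frame (D : plane_set) (L1 L2 N1 N2 N : line_field) :
  planar_domain D -> linear_net D L1 L2 -> bisector_net D L1 L2 N1 N2 ->
  N = N1 \/ N = N2 -> hexagonal D (web3 L1 L2 N) -> locally_frame D L1 L2 N1 N2.
Proof.
  intros HD HL HB HN [_ HR] x0 y0 H0.
  destruct (frame_exists D L1 L2 N1 N2 x0 y0 HD HL HB H0) as (r & c1 & s1 & A & c2 & s2 & C & Hr & Hd & F).
  exists r, c1, s1, A, c2, s2, C. split; [exact Hr|]. split; [exact Hd|]. split; [exact F|].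
  intros x y HV. set (V := open_disc x0 y0 r) in *.
  pose proof (open_disc_open x0 y0 r : open_set V) as HO.
  destruct (Req_dec (web_curvature c1 s1 A c2 s2 C x y) 0) as [|NZ]; [assumption|]. exfalso.
  destruct (frame_smooth F)
    as ((Sc1 & Ss1 & SA & Sc2 & Ss2 & SC) & (SAx & SAy & SCx & SCy)).
  assert (SK : smooth_on V (web_curvature c1 s1 A c2 s2 C)) by (unfold web_curvature; smooth).
  destruct (discs_and (fun u v => web_curvature c1 s1 A c2 s2 C u v <> 0) V x y) as (t & Ht & HT).
  { apply locally_2d_disc. apply continuity_2d_pt_neq_0; [|exact NZ]. now apply (smooth_on_continuity V). }
  { now apply open_set_disc. }
  destruct (at_right_0_small _ t Ht (HR x y (Hd x y HV))) as (q & Hq & B & HA & HI & _).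
  assert (sub : forall u v, open_disc x y q u v -> open_disc x y t u v) by (apply open_disc_mono; lra).
  assert (Fq : frame (open_disc x y q) L1 L2 N1 N2 c1 s1 A c2 s2 C).
  { apply (frame_sub V); [|exact F]. intros u v Huv. now apply HT, sub. }
  assert (He : exists e, e ^ 2 = 1 /\ forall u v, open_disc x y q u v ->
     N u v (c1 u v + e * c2 u v) (s1 u v + e * s2 u v)).
  { destruct HN as [-> | ->]; [exists 1|exists (-1)]; (split; [ring|]); intros u v Huv.
    - apply (fr_N1 Fq); [exact Huv|ring].
    - apply (fr_N2 Fq); [exact Huv|ring]. }
  destruct He as (e & He & HNe).
  destruct (hexagonal_curvature_at x y q L1 L2 N1 N2 c1 s1 A c2 s2 C e N (B 0%nat) Fq He HNe
    (HA 0%nat ltac:(lia))) as (phi & P1 & P2).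
  assert (Z : 1 = 0); [|lra].
  refine (HI (fun _ => 1) _ 0%nat ltac:(lia)). intros i u v Hi Huv. rewrite !sum_lt_1, !Rmult_1_l.
  apply P2; auto. destruct (Rmult_integral _ _ (P1 u v Huv)) as [|K]; [assumption|].
  exfalso. now apply (HT u v (sub u v Huv)).
Qed.

Lemma locally_frame_flat (D : plane_set) (L1 L2 N1 N2 : line_field) :
  locally_frame D L1 L2 N1 N2 -> conformally_flat D N1 N2.
Proof.
  intros HF x0 y0 H0. destruct (HF x0 y0 H0) as (r & c1 & s1 & A & c2 & s2 & C & Hr & Hd & F & HC).
  destruct (curvature_zero_flat x0 y0 r L1 L2 N1 N2 c1 s1 A c2 s2 C Hr F HC)
    as (q & u & v & Hq & HI & HU & HV).
  exists q, u, v. split; [apply Hq|]. split; [|split; [|split]; assumption].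
  intros x y Hxy. apply Hd. revert Hxy. now apply open_disc_mono.
Qed.

Lemma frame_transversal (D : plane_set) (L1 L2 N1 N2 : line_field) :
  locally_frame D L1 L2 N1 N2 ->
  (transversal D L1 N1 /\ transversal D L1 N2) /\ (transversal D L2 N1 /\ transversal D L2 N2).
Proof.
  intros HF.
  assert (K : forall x y vx vy, D x y -> exists c1 s1 c2 s2 : R, c1 * s2 - s1 * c2 <> 0 /\
    (L1 x y vx vy -> c1 * vy - s1 * vx = 0) /\ (L2 x y vx vy -> c2 * vy - s2 * vx = 0) /\
    (N1 x y vx vy -> (c1 + c2) * vy - (s1 + s2) * vx = 0) /\
    (N2 x y vx vy -> (c1 - c2) * vy - (s1 - s2) * vx = 0)).
  { intros x y vx vy Hxy. destruct (HF x y Hxy) as (r & c1 & s1 & A & c2 & s2 & C & Hr & _ & F & _).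
    pose proof (open_disc_center x y r Hr) as HV. destruct F as [K1 K2 HS HN1 HN2].
    exists (c1 x y), (s1 x y), (c2 x y), (s2 x y). split; [now apply HS|].
    split; [now apply (lf_span K1)|]. split; [now apply (lf_span K2)|].
    split; [now apply HN1|now apply HN2]. }
  assert (Z : forall c1 s1 c2 s2 vx vy : R, c1 * s2 - s1 * c2 <> 0 ->
     c1 * vy - s1 * vx = 0 -> c2 * vy - s2 * vx = 0 -> vx = 0 /\ vy = 0).
  { intros c1 s1 c2 s2 vx vy S E1 E2.
    apply (jacobian_independent (- s1) (- s2) c1 c2 vx vy); lra. }
  repeat split; (destruct (K x y vx vy H) as (c1 & s1 & c2 & s2 & S & K1 & K2 & K3 & K4));
    (apply (Z c1 s1 c2 s2 vx vy S); 
     [ try specialize (K1 H0); try specialize (K2 H0); try specialize (K3 H1); try specialize (K4 H1); lra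
     | try specialize (K1 H0); try specialize (K2 H0); try specialize (K3 H1); try specialize (K4 H1); lra ]).
Qed.

Lemma transversal_sym (D : plane_set) (F G : line_field) : transversal D F G -> transversal D G F.
Proof. intros H x y vx vy HD HG HF. now apply (H x y). Qed.

Lemma locally_frame_hexagonal (D : plane_set) (L1 L2 N1 N2 : line_field) :
  linear_net D L1 L2 -> bisector_net D L1 L2 N1 N2 -> locally_frame D L1 L2 N1 N2 ->
  hexagonal D (web3 L1 L2 N1).
Proof.
  intros [[HLf HLt] _] [[HNf _] _] HF.
  destruct (frame_transversal D L1 L2 N1 N2 HF) as [[T1 _] [T2 _]].
  split; [split|].
  - intros [|[|[|i]]] Hi; [exact (HLf 0%nat ltac:(lia))|exact (HLf 1%nat ltac:(lia))
      |exact (HNf 0%nat ltac:(lia))|lia].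
  - intros [|[|[|i]]] [|[|[|j]]] Hij; try lia; [exact (HLt 0%nat 1%nat ltac:(lia))|exact T1|exact T2].
  - intros x0 y0 H0. destruct (HF x0 y0 H0) as (r & c1 & s1 & A & c2 & s2 & C & Hr & Hd & F & HC).
    destruct (curvature_zero_parallel x0 y0 r L1 L2 N1 N2 c1 s1 A c2 s2 C Hr F HC)
      as (p & q & FP & FQ & FN & _ & J).
    apply (at_right_0 _ r Hr). intros t Ht Htr.
    assert (sub : forall u v, open_disc x0 y0 t u v -> open_disc x0 y0 r u v) by (apply open_disc_mono; lra).
    apply (parallel_3web_basis x0 y0 t L1 L2 N1 p q 1 Ht); try lra; eauto using first_integral_sub.
Qed.

Lemma locally_frame_web4 (D : plane_set) (L1 L2 N1 N2 : line_field) :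
  linear_net D L1 L2 -> bisector_net D L1 L2 N1 N2 -> locally_frame D L1 L2 N1 N2 ->
  web D 4 (web4 N1 N2 L1 L2).
Proof.
  intros [[HLf HLt] _] [[HNf HNt] _] HF.
  destruct (frame_transversal D L1 L2 N1 N2 HF) as [[T1 T2] [T3 T4]].
  split.
  - intros [|[|[|[|i]]]] Hi; [exact (HNf 0%nat ltac:(lia))|exact (HNf 1%nat ltac:(lia))
      |exact (HLf 0%nat ltac:(lia))|exact (HLf 1%nat ltac:(lia))|lia].
  - intros [|[|[|[|i]]]] [|[|[|[|j]]]] Hij; try lia;
      first [exact (HNt 0%nat 1%nat ltac:(lia)) | exact (HLt 0%nat 1%nat ltac:(lia))
            | apply transversal_sym; assumption].
Qed.

(** One pair p, q serves all smaller discs, as the quantifier [at_right] in the rank requires. *)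
Lemma locally_frame_parallel (D : plane_set) (L1 L2 N1 N2 : line_field) x0 y0 :
  locally_frame D L1 L2 N1 N2 -> D x0 y0 ->
  exists r p q, 0 < r /\ forall t, 0 < t -> t < r ->
    (forall i, (i < 4)%nat -> first_integral (open_disc x0 y0 t) (web4 N1 N2 L1 L2 i)
                                (parallel_first_integrals p q i)) /\
    (forall x y, open_disc x0 y0 t x y -> dx p x y * dy q x y - dy p x y * dx q x y <> 0).
Proof.
  intros HF H0. destruct (HF x0 y0 H0) as (r & c1 & s1 & A & c2 & s2 & C & Hr & Hd & F & HC).
  destruct (curvature_zero_parallel x0 y0 r L1 L2 N1 N2 c1 s1 A c2 s2 C Hr F HC)
      as (p & q & FP & FQ & FN1 & FN2 & J).
  exists r, p, q. split; [exact Hr|]. intros t Ht Htr.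
  assert (sub : forall u v, open_disc x0 y0 t u v -> open_disc x0 y0 r u v) by (apply open_disc_mono; lra).
  split; [|auto]. intros [|[|[|[|i]]]] Hi; [| | | |lia]; cbn [web4 parallel_first_integrals];
    eauto using first_integral_sub.
Qed.

Lemma focal_pair_point (D : plane_set) (L1 L2 N1 N2 : line_field) X1 Y1 Z1 X2 Y2 Z2 x y :
  locally_frame D L1 L2 N1 N2 -> focal_pair D L1 L2 X1 Y1 Z1 X2 Y2 Z2 -> D x y ->
  ((Z1 * x - X1) ^ 2 + (Z1 * y - Y1) ^ 2 <> 0 /\ (Z2 * x - X2) ^ 2 + (Z2 * y - Y2) ^ 2 <> 0) /\
  exists c1 s1 c2 s2 : R, c1 * s2 - s1 * c2 <> 0 /\
    (forall vx vy, L1 x y vx vy <-> c1 * vy - s1 * vx = 0) /\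
    (forall vx vy, L2 x y vx vy <-> c2 * vy - s2 * vx = 0).
Proof.
  intros HF HP Hxy. split.
  - apply product_nonzero. exact (proj1 (HP x y Hxy)).
  - destruct (HF x y Hxy) as (r & c1 & s1 & A & c2 & s2 & C & Hr & _ & F & _).
    pose proof (open_disc_center x y r Hr) as HV. destruct F as [K1 K2 HS _ _].
    exists (c1 x y), (s1 x y), (c2 x y), (s2 x y). split; [now apply HS|].
    split; intros; [now apply (lf_span K1)|now apply (lf_span K2)].
Qed.

Lemma cross_zero (a b c s c' s' : R) : c * s' - s * c' <> 0 ->
  a * s - b * c = 0 -> a * s' - b * c' = 0 -> a ^ 2 + b ^ 2 = 0.
Proof.
  intros S E1 E2.
  assert (S' : s * - c' - s' * - c <> 0) by lra.
  destruct (jacobian_independent s s' (- c) (- c') a b S') as [-> ->]; [lra|lra|ring].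
Qed.

(** Each line of L passes through a focus, and the two lines at a point cannot share one, since that
    point is not a focus. Which line takes which focus cannot change along D, by continuity. *)
Lemma zero_product_pencils (D : plane_set) (L1 L2 N1 N2 : line_field) X1 Y1 Z1 X2 Y2 Z2 :
  planar_domain D -> locally_frame D L1 L2 N1 N2 ->
  focal_pair D L1 L2 X1 Y1 Z1 X2 Y2 Z2 ->
  (forall x y vx vy, D x y -> (L1 x y vx vy \/ L2 x y vx vy) ->
    ((Z1 * x - X1) * vy - (Z1 * y - Y1) * vx) * ((Z2 * x - X2) * vy - (Z2 * y - Y2) * vx) = 0) ->
  let through X Y Z (L : line_field) :=
    forall x y vx vy, D x y -> L x y vx vy -> (Z * x - X) * vy - (Z * y - Y) * vx = 0 in
  (through X1 Y1 Z1 L1 /\ through X2 Y2 Z2 L2) \/ (through X2 Y2 Z2 L1 /\ through X1 Y1 Z1 L2).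
Proof.
  intros HD HF HP HZ through.
  (* at each point exactly one of the two alternatives holds *)
  assert (pt : forall x y, D x y ->
     let P := fun X Y Z (L : line_field) => forall vx vy, L x y vx vy -> (Z * x - X) * vy - (Z * y - Y) * vx = 0 in
     ((P X1 Y1 Z1 L1 /\ P X2 Y2 Z2 L2) \/ (P X2 Y2 Z2 L1 /\ P X1 Y1 Z1 L2)) /\
     ~ (P X1 Y1 Z1 L1 /\ P X2 Y2 Z2 L1)).
  { intros x y Hxy P. destruct (focal_pair_point D L1 L2 N1 N2 _ _ _ _ _ _ x y HF HP Hxy)
      as ((A1 & A2) & c1 & s1 & c2 & s2 & S & E1 & E2).
    assert (V1 : L1 x y c1 s1) by (apply E1; ring). assert (V2 : L2 x y c2 s2) by (apply E2; ring).
    assert (sp : forall (c s : R) (L : line_field) X Y Z, (c, s) <> (0, 0) ->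
       (forall vx vy, L x y vx vy <-> c * vy - s * vx = 0) ->
       (Z * x - X) * s - (Z * y - Y) * c = 0 -> P X Y Z L).
    { intros c s L X Y Z N E K vx vy Hv. apply E in Hv.
      apply (span_multiple _ _ _ _ N) in Hv. destruct Hv as (t & -> & ->).
      transitivity (t * ((Z * x - X) * s - (Z * y - Y) * c)); [ring|rewrite K; ring]. }
    assert (N1' : (c1, s1) <> (0, 0)) by (intros Z; injection Z as -> ->; apply S; ring).
    assert (N2' : (c2, s2) <> (0, 0)) by (intros Z; injection Z as -> ->; apply S; ring).
    pose proof (HZ x y c1 s1 Hxy (or_introl V1)) as T1. pose proof (HZ x y c2 s2 Hxy (or_intror V2)) as T2.
    assert (R1 : P X1 Y1 Z1 L1 -> P X1 Y1 Z1 L2 -> False).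
    { intros Q1 Q2. apply A1. apply (cross_zero _ _ c1 s1 c2 s2 S); [now apply Q1|now apply Q2]. }
    assert (R2 : P X2 Y2 Z2 L1 -> P X2 Y2 Z2 L2 -> False).
    { intros Q1 Q2. apply A2. apply (cross_zero _ _ c1 s1 c2 s2 S); [now apply Q1|now apply Q2]. }
    assert (T1' : P X1 Y1 Z1 L1 \/ P X2 Y2 Z2 L1)
      by (apply Rmult_integral in T1; destruct T1; [left|right]; now apply (sp c1 s1)).
    assert (T2' : P X1 Y1 Z1 L2 \/ P X2 Y2 Z2 L2)
      by (apply Rmult_integral in T2; destruct T2; [left|right]; now apply (sp c2 s2)).
    tauto. }
  assert (cn : forall X Y Z X' Y' Z',
    ((X, Y, Z, X', Y', Z') = (X1, Y1, Z1, X2, Y2, Z2) \/ (X, Y, Z, X', Y', Z') = (X2, Y2, Z2, X1, Y1, Z1)) ->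
    forall x0 y0, D x0 y0 ->
    (forall vx vy, L1 x0 y0 vx vy -> (Z * x0 - X) * vy - (Z * y0 - Y) * vx = 0) -> through X Y Z L1).
  { intros X Y Z X' Y' Z' Hc x0 y0 H0 HP0 x y vx vy Hxy. revert vx vy.
    apply (connected_const D (fun x y => forall vx vy, L1 x y vx vy -> (Z * x - X) * vy - (Z * y - Y) * vx = 0) HD)
      with (x0 := x0) (y0 := y0); [|assumption|assumption|assumption].
    clear x y Hxy. intros x y Hxy.
    destruct (HF x y Hxy) as (r & c1 & s1 & A & c2 & s2 & C & Hr & Hd & F & _).
    pose proof (open_disc_center x y r Hr) as HV. set (V := open_disc x y r) in *.
    pose proof (open_disc_open x y r : open_set V) as HO.
    destruct (frame_smooth F) as ((Sc1 & Ss1 & _) & _).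
    set (g := fun X Y Z u v => (Z * u - X) * s1 u v - (Z * v - Y) * c1 u v).
    assert (E1 : forall u v vx vy, V u v -> (L1 u v vx vy <-> c1 u v * vy - s1 u v * vx = 0))
      by (intros; now apply (lf_span (fr_1 F))).
    assert (EQ : forall X Y Z u v, V u v ->
      (forall vx vy, L1 u v vx vy -> (Z * u - X) * vy - (Z * v - Y) * vx = 0) <-> g X Y Z u v = 0).
    { intros X0 Y0 Z0 u v Huv. pose proof (lf_unit (fr_1 F) u v Huv) as U.
      split.
      - intros K. apply K. apply E1; [exact Huv|ring].
      - intros K vx vy Hv. apply E1 in Hv; [|exact Huv].
        destruct (span_unit _ _ _ _ U Hv) as (t & -> & ->).
        transitivity (t * g X0 Y0 Z0 u v); [unfold g; ring|rewrite K; ring]. }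
    assert (alt : forall u v, V u v -> (g X Y Z u v = 0 \/ g X' Y' Z' u v = 0) /\
              ~ (g X Y Z u v = 0 /\ g X' Y' Z' u v = 0)).
    { intros u v Huv. destruct (pt u v (Hd u v Huv)) as [P1 P2]. cbv zeta in P1, P2.
      rewrite <- !EQ by exact Huv.
      destruct Hc as [Hc|Hc]; injection Hc as -> -> -> -> -> ->; tauto. }
    assert (Cg : forall X Y Z u v, V u v -> continuity_2d_pt (g X Y Z) u v).
    { intros X0 Y0 Z0 u v Huv. assert (smooth_on V (g X0 Y0 Z0)) by (unfold g; smooth).
      now apply (smooth_on_continuity V). }
    assert (near : exists q, 0 < q /\ forall u v, open_disc x y q u v -> V u v /\
       (g X Y Z u v = 0 <-> g X Y Z x y = 0)).
    { destruct (alt x y HV) as [K1 K2].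
      destruct (Req_dec (g X Y Z x y) 0) as [Zg|Ng].
      - assert (Ng' : g X' Y' Z' x y <> 0) by tauto.
        destruct (discs_and (fun u v => g X' Y' Z' u v <> 0) V x y) as (q & Hq & HW).
        { apply locally_2d_disc, continuity_2d_pt_neq_0; auto. }
        { now apply open_set_disc. }
        exists q. split; [exact Hq|]. intros u v Huv. destruct (HW u v Huv) as [W1 W2].
        split; [exact W2|]. destruct (alt u v W2). tauto.
      - destruct (discs_and (fun u v => g X Y Z u v <> 0) V x y) as (q & Hq & HW).
        { apply locally_2d_disc, continuity_2d_pt_neq_0; auto. }
        { now apply open_set_disc. }
        exists q. split; [exact Hq|]. intros u v Huv. destruct (HW u v Huv) as [W1 W2].
        split; [exact W2|]. tauto. }
    destruct near as (q & Hq & HW). exists q. split; [exact Hq|].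
    intros u v u' v' Huv Huv' _ _. destruct (HW u v Huv) as [W1 W2]. destruct (HW u' v' Huv') as [W1' W2'].
    rewrite (EQ X Y Z u v W1), (EQ X Y Z u' v' W1'). tauto. }
  pose proof HD as ((x0 & y0 & H0) & _).
  destruct (pt x0 y0 H0) as [[[K _]|[K _]] _]; [left|right].
  - assert (T : through X1 Y1 Z1 L1) by (apply (cn X1 Y1 Z1 X2 Y2 Z2) with (x0 := x0) (y0 := y0); auto).
    split; [exact T|]. intros x y vx vy Hxy. destruct (pt x y Hxy) as [[[_ P]|[P _]] Q]; [apply P|].
    exfalso. apply Q. split; [intros; now apply T|exact P].
  - assert (T : through X2 Y2 Z2 L1) by (apply (cn X2 Y2 Z2 X1 Y1 Z1) with (x0 := x0) (y0 := y0); auto).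
    split; [exact T|]. intros x y vx vy Hxy. destruct (pt x y Hxy) as [[[P _]|[_ P]] Q]; [|apply P].
    exfalso. apply Q. split; [exact P|intros; now apply T].
Qed.

(** G is constant here, hence so is a + b locally. Its gradient A n1 + C n2 vanishes with n1, n2
    independent, so A = C = 0 and both direction fields are constant. *)
Lemma ideal_foci_parallel (D : plane_set) (L1 L2 N1 N2 : line_field) ux uy :
  planar_domain D -> locally_frame D L1 L2 N1 N2 -> focal_pair D L1 L2 ux uy 0 ux uy 0 ->
  exists p1 q1 p2 q2, ((p1, q1) <> (0, 0) /\ (p2, q2) <> (0, 0)) /\
    (forall x y vx vy, D x y -> L1 x y vx vy -> p1 * vy - q1 * vx = 0) /\
    (forall x y vx vy, D x y -> L2 x y vx vy -> p2 * vy - q2 * vx = 0).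
Proof.
  intros HD HF HP.
  assert (loc : forall x0 y0, D x0 y0 -> exists r p1 q1 p2 q2, 0 < r /\
     ((p1, q1) <> (0, 0) /\ (p2, q2) <> (0, 0)) /\
     forall x y, open_disc x0 y0 r x y ->
       (forall vx vy, L1 x y vx vy <-> p1 * vy - q1 * vx = 0) /\
       (forall vx vy, L2 x y vx vy <-> p2 * vy - q2 * vx = 0)).
  { intros x0 y0 H0. destruct (HF x0 y0 H0) as (r & c1 & s1 & A & c2 & s2 & C & Hr & Hd & F & _).
    set (V := open_disc x0 y0 r) in *.
    pose proof (open_disc_open x0 y0 r : open_set V) as HO.
    pose proof (open_disc_center x0 y0 r Hr : V x0 y0) as V0.
    set (g := ux ^ 2 - uy ^ 2). set (h := 2 * ux * uy).
    assert (AL : forall x y, V x y -> (g, h) <> (0, 0) /\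
      (c1 x y * c2 x y - s1 x y * s2 x y) * h - (c1 x y * s2 x y + s1 x y * c2 x y) * g = 0).
    { intros x y HV. destruct (proj1 (aligned_frame V _ _ _ _ _ _ _ _ _ _ _ _ x y F HV) (HP x y (Hd x y HV))) as [N E].
      replace ((0 * x - ux) * (0 * x - ux) - (0 * y - uy) * (0 * y - uy)) with g in * by (unfold g; ring).
      replace ((0 * x - ux) * (0 * y - uy) + (0 * y - uy) * (0 * x - ux)) with h in * by (unfold h; ring).
      split; [exact N|lra]. }
    assert (Z : forall x y, V x y -> A x y = 0 /\ C x y = 0).
    { intros x y HV. destruct (AL x y HV) as [N E].
      assert (G : grad_on V (fun x y => (c1 x y * c2 x y - s1 x y * s2 x y) * h - (c1 x y * s2 x y + s1 x y * c2 x y) * g)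
        (fun x y => (A x y * s1 x y + C x y * s2 x y)
          * ((c1 x y * s2 x y + s1 x y * c2 x y) * h + (c1 x y * c2 x y - s1 x y * s2 x y) * g))
        (fun x y => - (A x y * c1 x y + C x y * c2 x y)
          * ((c1 x y * s2 x y + s1 x y * c2 x y) * h + (c1 x y * c2 x y - s1 x y * s2 x y) * g))).
      { intros u v Huv. at_point F HO u v Huv. split; der; ring. }
      assert (G0 : grad_on V (fun _ _ => 0) (fun _ _ => 0) (fun _ _ => 0))
        by (intros u v _; split; apply is_derive_Rconst).
      destruct (grad_on_eq V _ _ _ _ _ _ HO G G0 (fun x y HV => proj2 (AL x y HV)) x y HV) as [X Y].
      at_point F HO x y HV.
      set (u := c1 x y * c2 x y - s1 x y * s2 x y) in *. set (v := c1 x y * s2 x y + s1 x y * c2 x y) in *.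
      assert (UV : u ^ 2 + v ^ 2 = 1) by (unfold u, v; clear - U1 U2; nsz).
      assert (T : v * h + u * g <> 0).
      { intros Z. apply N. clearbody u v g h. f_equal; clear - Z E UV; nsz. }
      apply Rmult_integral in X. destruct X as [X|X]; [|contradiction].
      apply Rmult_integral in Y. destruct Y as [Y|Y]; [|contradiction].
      split; apply Rmult_eq_reg_r with (c1 x y * s2 x y - s1 x y * c2 x y); try exact S0; rewrite Rmult_0_l.
      - transitivity (s2 x y * (A x y * c1 x y + C x y * c2 x y) - c2 x y * (A x y * s1 x y + C x y * s2 x y)); [ring|].
        rewrite X. replace (A x y * c1 x y + C x y * c2 x y) with 0 by lra. ring.
      - transitivity (c1 x y * (A x y * s1 x y + C x y * s2 x y) - s1 x y * (A x y * c1 x y + C x y * c2 x y)); [ring|].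
        rewrite X. replace (A x y * c1 x y + C x y * c2 x y) with 0 by lra. ring. }
    assert (CC : forall (L : line_field) c s B, line_frame V L c s B -> (forall x y, V x y -> B x y = 0) ->
       (c x0 y0, s x0 y0) <> (0, 0) /\
       forall x y, V x y -> forall vx vy, L x y vx vy <-> c x0 y0 * vy - s x0 y0 * vx = 0).
    { intros L c s B K HB. pose proof (lf_unit K x0 y0 V0) as U. split.
      - intros Z'. injection Z' as Z1 Z2. rewrite Z1, Z2 in U. lra.
      - assert (Gc : grad_on V c (fun _ _ => 0) (fun _ _ => 0)).
        { refine (grad_on_ext V _ _ _ _ _ _ (lf_gc K)). intros x y HV. rewrite (HB x y HV). split; ring. }
        assert (Gs : grad_on V s (fun _ _ => 0) (fun _ _ => 0)).
        { refine (grad_on_ext V _ _ _ _ _ _ (lf_gs K)). intros x y HV. rewrite (HB x y HV). split; ring. }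
        intros x y HV vx vy. rewrite <- (grad_zero_const x0 y0 r c Gc x y HV), <- (grad_zero_const x0 y0 r s Gs x y HV).
        now apply (lf_span K). }
    destruct (CC L1 c1 s1 A (fr_1 F)) as [M1 C1]; [intros; now apply Z|].
    destruct (CC L2 c2 s2 C (fr_2 F)) as [M2 C2]; [intros; now apply Z|].
    exists r, (c1 x0 y0), (s1 x0 y0), (c2 x0 y0), (s2 x0 y0). split; [exact Hr|]. split; [split; assumption|].
    intros x y HV. split; auto. }
  pose proof HD as ((x0 & y0 & H0) & _).
  destruct (loc x0 y0 H0) as (r & p1 & q1 & p2 & q2 & Hr & N & HL).
  exists p1, q1, p2, q2. split; [exact N|].
  destruct (HL x0 y0 (open_disc_center x0 y0 r Hr)) as [B1 B2].
  split.
  - intros x y vx vy Hxy. revert vx vy.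
    apply (connected_const D (fun x y => forall vx vy, L1 x y vx vy -> p1 * vy - q1 * vx = 0) HD)
      with (x0 := x0) (y0 := y0); [|assumption| |assumption].
    + clear x y Hxy. intros x y Hxy. destruct (loc x y Hxy) as (t & a1 & b1 & a2 & b2 & Ht & _ & HT).
      exists t. split; [exact Ht|]. intros u v u' v' Huv Huv' _ _ K vx vy Hv.
      apply K. apply (HT u v Huv). now apply (HT u' v' Huv').
    + intros vx vy Hv. now apply B1.
  - intros x y vx vy Hxy. revert vx vy.
    apply (connected_const D (fun x y => forall vx vy, L2 x y vx vy -> p2 * vy - q2 * vx = 0) HD)
      with (x0 := x0) (y0 := y0); [|assumption| |assumption].
    + clear x y Hxy. intros x y Hxy. destruct (loc x y Hxy) as (t & a1 & b1 & a2 & b2 & Ht & _ & HT).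
      exists t. split; [exact Ht|]. intros u v u' v' Huv Huv' _ _ K vx vy Hv.
      apply K. apply (HT u v Huv). now apply (HT u' v' Huv').
    + intros vx vy Hv. now apply B2.
Qed.

(** For v along a line of L, (4 b + |F1 F2|^2) |v|^2 is the square of the sum of the signed focal
    distances plus the square of the scalar product of F1 F2 with v. Were it zero, F1 F2 would be
    orthogonal to two independent directions, so that the foci coincide and b = 0. *)
Lemma central_product_bound (D : plane_set) (L1 L2 N1 N2 : line_field) x1 y1 x2 y2 b :
  planar_domain D -> locally_frame D L1 L2 N1 N2 -> focal_pair D L1 L2 x1 y1 1 x2 y2 1 ->
  (forall x y vx vy, D x y -> (L1 x y vx vy \/ L2 x y vx vy) ->
    ((1 * x - x1) * vy - (1 * y - y1) * vx) * ((1 * x - x2) * vy - (1 * y - y2) * vx)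
    = b * (vx ^ 2 + vy ^ 2)) ->
  b <> 0 -> 0 < b + ((x1 - x2) ^ 2 + (y1 - y2) ^ 2) / 4.
Proof.
  intros HD HF HP Hb Nb. pose proof HD as ((x & y & Hxy) & _).
  destruct (focal_pair_point D L1 L2 N1 N2 _ _ _ _ _ _ x y HF HP Hxy)
      as (_ & c1 & s1 & c2 & s2 & S & E1 & E2).
  assert (V1 : L1 x y c1 s1) by (apply E1; ring). assert (V2 : L2 x y c2 s2) by (apply E2; ring).
  set (p := x1 - x2). set (q := y1 - y2).
  assert (T : forall c s, L1 x y c s \/ L2 x y c s -> 
     (4 * b + (p ^ 2 + q ^ 2)) * (c ^ 2 + s ^ 2) =
     (((x - x1) * s - (y - y1) * c) + ((x - x2) * s - (y - y2) * c)) ^ 2 + (p * c + q * s) ^ 2).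
  { intros c s HL. pose proof (Hb x y c s Hxy HL) as E. rewrite !Rmult_1_l in E.
    transitivity (4 * (b * (c ^ 2 + s ^ 2)) + (p ^ 2 + q ^ 2) * (c ^ 2 + s ^ 2)); [ring|].
    rewrite <- E. unfold p, q. ring. }
  pose proof (T c1 s1 (or_introl V1)) as T1. pose proof (T c2 s2 (or_intror V2)) as T2.
  assert (P1 : 0 < c1 ^ 2 + s1 ^ 2).
  { pose proof (pow2_ge_0 c1). pose proof (pow2_ge_0 s1).
    destruct (Rle_lt_or_eq_dec 0 (c1 ^ 2 + s1 ^ 2)) as [|Z]; [lra|assumption|]. exfalso.
    apply S. destruct (sum_squares_zero c1 s1 (eq_sym Z)) as [-> ->]. ring. }
  assert (G : 0 <= 4 * b + (p ^ 2 + q ^ 2)).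
  { apply Rmult_le_reg_r with (c1 ^ 2 + s1 ^ 2); [exact P1|]. rewrite T1, Rmult_0_l.
    apply Rplus_le_le_0_compat; apply pow2_ge_0. }
  destruct (Rle_lt_or_eq_dec _ _ G) as [G'|G']; [fold p q; lra|]. exfalso.
  rewrite <- G', Rmult_0_l in T1, T2.
  assert (Z : forall a b : R, 0 = a ^ 2 + b ^ 2 -> b = 0).
  { intros a b' E. now apply (sum_squares_zero a b'). }
  apply Z in T1. apply Z in T2.
  assert (S' : c1 * s2 - c2 * s1 <> 0) by lra.
  destruct (jacobian_independent c1 c2 s1 s2 p q S') as [Zp Zq]; [lra|lra|].
  rewrite Zp, Zq in G'. lra.
Qed.

Lemma bisects_foci_pair (D : plane_set) (L1 L2 N1 N2 : line_field) X1 Y1 Z1 X2 Y2 Z2 :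
  planar_domain D -> locally_frame D L1 L2 N1 N2 ->
  focal_pair D L1 L2 X1 Y1 Z1 X2 Y2 Z2 ->
  exists sigma, (sigma = 1 \/ sigma = -1) /\
    bisects_foci D N1 X1 Y1 Z1 X2 Y2 Z2 sigma /\ bisects_foci D N2 X1 Y1 Z1 X2 Y2 Z2 (- sigma).
Proof.
  intros HD HF HP. destruct (bisector_squares D L1 L2 N1 N2 _ _ _ _ _ _ HD HF HP) as (sigma & Hs & H).
  exists sigma. split; [exact Hs|].
  split; intros x y Hxy; (split; [exact (proj1 (HP x y Hxy))|now apply H]).
Qed.

Lemma sign_opp (sigma : R) : sigma = 1 \/ sigma = -1 -> - sigma = 1 \/ - sigma = -1.
Proof. intros [-> | ->]; [right|left]; ring. Qed.

(** The last clause of the theorem, named so that each position of the foci can be treated in a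
    lemma of its own. *)
Definition net_description (D : plane_set) (L1 L2 N1 N2 : line_field) : Prop :=
  (exists Q : conic,
     smooth_conic Q /\
     leaves_in D L1 (tangent_line Q) /\ leaves_in D L2 (tangent_line Q) /\
     (~ is_circle (conic_locus Q) ->
        exists family, confocal_family family /\
          family (conic_locus Q) /\
          leaves_in D N1 family /\ leaves_in D N2 family) /\
     (is_circle (conic_locus Q) ->
        exists cx cy, polar_net D N1 N2 cx cy /\
          concentric_circle cx cy (conic_locus Q))) \/
  (exists X1 Y1 Z1 X2 Y2 Z2 : R,
     (X1, Y1, Z1) <> (0, 0, 0) /\ (X2, Y2, Z2) <> (0, 0, 0) /\
     leaves_in D L1 (pencil X1 Y1 Z1) /\ leaves_in D L2 (pencil X2 Y2 Z2) /\
     (~ (Z1 = 0 /\ Z2 = 0) ->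
        exists family, confocal_family family /\
          leaves_in D N1 family /\ leaves_in D N2 family) /\
     (Z1 = 0 /\ Z2 = 0 -> cartesian_net D N1 N2)).

Lemma pencils_description (D : plane_set) (L1 L2 N1 N2 : line_field) X1 Y1 Z1 X2 Y2 Z2 family :
  planar_domain D -> locally_frame D L1 L2 N1 N2 -> focal_pair D L1 L2 X1 Y1 Z1 X2 Y2 Z2 ->
  leaves_in D L1 straight_line -> leaves_in D L2 straight_line ->
  (forall x y vx vy, D x y -> (L1 x y vx vy \/ L2 x y vx vy) ->
    ((Z1 * x - X1) * vy - (Z1 * y - Y1) * vx) * ((Z2 * x - X2) * vy - (Z2 * y - Y2) * vx) = 0) ->
  ~ (Z1 = 0 /\ Z2 = 0) -> (X1, Y1, Z1) <> (0, 0, 0) -> (X2, Y2, Z2) <> (0, 0, 0) ->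
  confocal_family family -> leaves_in D N1 family -> leaves_in D N2 family ->
  net_description D L1 L2 N1 N2.
Proof.
  intros HD HF HP S1 S2 HZ NZ F1 F2 HC HN1 HN2. right.
  destruct (zero_product_pencils D L1 L2 N1 N2 _ _ _ _ _ _ HD HF HP HZ) as [[T1 T2]|[T1 T2]].
  - exists X1, Y1, Z1, X2, Y2, Z2. split; [exact F1|]. split; [exact F2|].
    split; [now apply pencil_leaves|]. split; [now apply pencil_leaves|].
    split; [intros _; exists family; auto|tauto].
  - exists X2, Y2, Z2, X1, Y1, Z1. split; [exact F2|]. split; [exact F1|].
    split; [now apply pencil_leaves|]. split; [now apply pencil_leaves|].
    split; [intros _; exists family; auto|tauto].
Qed.

(** With b = 0 both lines at each point would pass through the common focus, so the point would be
    that focus, where G vanishes. *)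
Lemma coincident_foci (D : plane_set) (L1 L2 N1 N2 : line_field) x1 y1 b :
  planar_domain D -> locally_frame D L1 L2 N1 N2 -> focal_pair D L1 L2 x1 y1 1 x1 y1 1 ->
  (forall x y vx vy, D x y -> (L1 x y vx vy \/ L2 x y vx vy) ->
    ((1 * x - x1) * vy - (1 * y - y1) * vx) * ((1 * x - x1) * vy - (1 * y - y1) * vx)
    = b * (vx ^ 2 + vy ^ 2)) -> b <> 0.
Proof.
  intros HD HF HP Hb Zb. pose proof HD as ((x & y & Hxy) & _).
  destruct (focal_pair_point D L1 L2 N1 N2 _ _ _ _ _ _ x y HF HP Hxy)
      as ((NZ & _) & c1 & s1 & c2 & s2 & S & E1 & E2).
  assert (V1 : L1 x y c1 s1) by (apply E1; ring). assert (V2 : L2 x y c2 s2) by (apply E2; ring).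
  pose proof (Hb x y c1 s1 Hxy (or_introl V1)) as T1. pose proof (Hb x y c2 s2 Hxy (or_intror V2)) as T2.
  rewrite Zb, Rmult_0_l in T1, T2. apply NZ.
  apply (cross_zero _ _ c1 s1 c2 s2 S).
  - apply Rmult_integral in T1. tauto.
  - apply Rmult_integral in T2. tauto.
Qed.

Lemma central_description (D : plane_set) (L1 L2 N1 N2 : line_field) x1 y1 x2 y2 :
  planar_domain D -> locally_frame D L1 L2 N1 N2 -> focal_pair D L1 L2 x1 y1 1 x2 y2 1 ->
  leaves_in D L1 straight_line -> leaves_in D L2 straight_line ->
  net_description D L1 L2 N1 N2.
Proof.
  intros HD HF HP S1 S2.
  destruct (bisects_foci_pair D L1 L2 N1 N2 _ _ _ _ _ _ HD HF HP) as (sigma & Hs & B1 & B2).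
  destruct (focal_product_homogeneous D L1 L2 N1 N2 _ _ _ _ _ _ HD HF HP) as (b & Hb).
  pose proof (central_leaves D N1 _ _ _ _ _ Hs B1) as C1.
  pose proof (central_leaves D N2 _ _ _ _ _ (sign_opp _ Hs) B2) as C2.
  destruct (Req_dec b 0) as [Zb|Nb].
  - apply (pencils_description D L1 L2 N1 N2 x1 y1 1 x2 y2 1 (central_confocal x1 y1 x2 y2)); auto.
    + intros x y vx vy Hxy HL. rewrite (Hb x y vx vy Hxy HL), Zb. ring.
    + lra.
    + intros E. injection E. lra.
    + intros E. injection E. lra.
    + apply confocal_central. intros E. injection E as -> ->.
      exact (coincident_foci D L1 L2 N1 N2 x2 y2 b HD HF HP Hb Zb).
  - left. pose proof (central_product_bound D L1 L2 N1 N2 _ _ _ _ b HD HF HP Hb Nb) as Hpos.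
    assert (Nd : focal_det x1 y1 1 x2 y2 1 b <> 0).
    { rewrite focal_det_central. apply Rmult_integral_contrapositive_currified; lra. }
    exists (focal_conic x1 y1 1 x2 y2 1 b). split; [now apply focal_conic_smooth|].
    split; [apply tangent_leaves; auto|]. split; [apply tangent_leaves; auto|].
    destruct (Classical_Prop.classic ((x1, y1) = (x2, y2))) as [E|NE].
    + injection E as -> ->.
      assert (Pb : 0 < b) by (replace ((x2 - x2) ^ 2 + (y2 - y2) ^ 2) with 0 in Hpos by ring; lra).
      pose proof (circle_conic x2 y2 b Pb) as CC. split.
      * intros K. exfalso. apply K. now exists x2, y2.
      * intros _. exists x2, y2. split; [|exact CC].
        destruct Hs as [-> | ->].
        -- right. split; [now apply circle_leaves|now apply radial_leaves].
        -- left. replace (- -1) with 1 in B2 by ring. split; [now apply circle_leaves|now apply radial_leaves].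
    + split.
      * intros _. exists (central_confocal x1 y1 x2 y2). split; [now apply confocal_central|].
        split; [now apply central_conic_confocal|]. split; assumption.
      * intros K. exfalso. revert K. now apply central_conic_not_circle.
Qed.

Lemma parabolic_description (D : plane_set) (L1 L2 N1 N2 : line_field) x1 y1 ux uy :
  planar_domain D -> locally_frame D L1 L2 N1 N2 -> ux ^ 2 + uy ^ 2 = 1 ->
  focal_pair D L1 L2 x1 y1 1 ux uy 0 ->
  leaves_in D L1 straight_line -> leaves_in D L2 straight_line ->
  net_description D L1 L2 N1 N2.
Proof.
  intros HD HF U HP S1 S2.
  destruct (bisects_foci_pair D L1 L2 N1 N2 _ _ _ _ _ _ HD HF HP) as (sigma & Hs & B1 & B2).
  destruct (focal_product_homogeneous D L1 L2 N1 N2 _ _ _ _ _ _ HD HF HP) as (b & Hb).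
  pose proof (parabolic_leaves D N1 _ _ _ _ _ Hs U B1) as C1.
  pose proof (parabolic_leaves D N2 _ _ _ _ _ (sign_opp _ Hs) U B2) as C2.
  destruct (Req_dec b 0) as [Zb|Nb].
  - apply (pencils_description D L1 L2 N1 N2 x1 y1 1 ux uy 0 (parabolic_confocal x1 y1 ux uy)); auto.
    + intros x y vx vy Hxy HL. rewrite (Hb x y vx vy Hxy HL), Zb. ring.
    + lra.
    + intros E. injection E. lra.
    + intros E. injection E as -> ->. lra.
    + now apply confocal_parabolic.
  - left.
    assert (Nd : focal_det x1 y1 1 ux uy 0 b <> 0) by (rewrite focal_det_parabolic; lra).
    exists (focal_conic x1 y1 1 ux uy 0 b). split; [now apply focal_conic_smooth|].
    split; [apply tangent_leaves; auto|]. split; [apply tangent_leaves; auto|]. split.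
    + intros _. exists (parabolic_confocal x1 y1 ux uy). split; [now apply confocal_parabolic|].
      split; [now apply parabolic_conic_confocal|]. split; assumption.
    + intros K. exfalso. revert K. now apply parabolic_conic_not_circle.
Qed.

Lemma ideal_description (D : plane_set) (L1 L2 N1 N2 : line_field) ux uy :
  planar_domain D -> locally_frame D L1 L2 N1 N2 -> focal_pair D L1 L2 ux uy 0 ux uy 0 ->
  net_description D L1 L2 N1 N2.
Proof.
  intros HD HF HP. right.
  destruct (bisects_foci_pair D L1 L2 N1 N2 _ _ _ _ _ _ HD HF HP) as (sigma & Hs & B1 & B2).
  destruct (ideal_foci_parallel D L1 L2 N1 N2 ux uy HD HF HP)
    as (p1 & q1 & p2 & q2 & (N1' & N2') & T1 & T2).
  assert (NU : (ux, uy) <> (0, 0)).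
  { pose proof HD as ((x & y & Hxy) & _). intros E. injection E as -> ->.
    apply (proj1 (B1 x y Hxy)). f_equal; ring. }
  exists p1, q1, 0, p2, q2, 0.
  split; [intros E; injection E as -> ->; now apply N1'|].
  split; [intros E; injection E as -> ->; now apply N2'|].
  split; [now apply parallel_leaves|]. split; [now apply parallel_leaves|].
  split; [tauto|]. intros _.
  assert (par : forall N, bisects_foci D N ux uy 0 ux uy 0 1 ->
     forall x y vx vy, D x y -> N x y vx vy -> ux * vy - uy * vx = 0).
  { intros N B x y vx vy Hxy Hv. destruct (B x y Hxy) as [_ SQ]. specialize (SQ vx vy Hv).
    pose proof (proj1 (square_aligned_same _ _ _ _ _ (or_introl eq_refl) SQ) eq_refl). lra. }
  assert (ort : forall N, bisects_foci D N ux uy 0 ux uy 0 (-1) ->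
     forall x y vx vy, D x y -> N x y vx vy -> ux * vx + uy * vy = 0).
  { intros N B x y vx vy Hxy Hv. destruct (B x y Hxy) as [_ SQ]. specialize (SQ vx vy Hv).
    pose proof (proj2 (square_aligned_same _ _ _ _ _ (or_intror eq_refl) SQ) eq_refl). lra. }
  assert (NU' : (- uy, ux) <> (0, 0)) by (intros E; injection E as E1 E2; apply NU; f_equal; lra).
  (* [cartesian_net] names the direction of N1: it is the ideal focus when sigma = 1, and this
     direction turned by a right angle otherwise. *)
  destruct Hs as [-> | ->].
  - exists ux, uy. split; [exact NU|]. split; apply parallel_leaves; auto.
    + exact (par N1 B1).
    + intros x y vx vy Hxy Hv. pose proof (ort N2 B2 x y vx vy Hxy Hv). lra.
  - replace (- -1) with 1 in B2 by ring.
    exists (- uy), ux. split; [exact NU'|]. split; apply parallel_leaves; auto.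
    + intros x y vx vy Hxy Hv. pose proof (ort N1 B1 x y vx vy Hxy Hv). lra.
    + intros E. injection E as E1 E2. apply NU. f_equal; lra.
    + intros x y vx vy Hxy Hv. pose proof (par N2 B2 x y vx vy Hxy Hv). lra.
Qed.

Theorem theorem3 :
  forall (D : plane_set) (L1 L2 N1 N2 : line_field),
    planar_domain D ->
    linear_net D L1 L2 ->
    bisector_net D L1 L2 N1 N2 ->
    ((hexagonal D (web3 L1 L2 N1) \/ hexagonal D (web3 L1 L2 N2)) <->
     conformally_flat D N1 N2) /\
    (conformally_flat D N1 N2 ->
     (web D 4 (web4 N1 N2 L1 L2) /\ web_rank D 4 (web4 N1 N2 L1 L2) 3) /\
     (forall x0 y0, D x0 y0 ->
        at_right 0 (fun r =>
          (exists P, rank_quartic (open_disc x0 y0 r) (web4 N1 N2 L1 L2) P) /\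
          (forall P, rank_quartic (open_disc x0 y0 r) (web4 N1 N2 L1 L2) P ->
             four_harmonic_lines P))) /\
     ((exists Q : conic,
         smooth_conic Q /\
         leaves_in D L1 (tangent_line Q) /\ leaves_in D L2 (tangent_line Q) /\
         (~ is_circle (conic_locus Q) ->
            exists family, confocal_family family /\
              family (conic_locus Q) /\
              leaves_in D N1 family /\ leaves_in D N2 family) /\
         (is_circle (conic_locus Q) ->
            exists cx cy, polar_net D N1 N2 cx cy /\
              concentric_circle cx cy (conic_locus Q))) \/
      (exists X1 Y1 Z1 X2 Y2 Z2 : R,
         (X1, Y1, Z1) <> (0, 0, 0) /\ (X2, Y2, Z2) <> (0, 0, 0) /\
         leaves_in D L1 (pencil X1 Y1 Z1) /\ leaves_in D L2 (pencil X2 Y2 Z2) /\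
         (~ (Z1 = 0 /\ Z2 = 0) ->
            exists family, confocal_family family /\
              leaves_in D N1 family /\ leaves_in D N2 family) /\
         (Z1 = 0 /\ Z2 = 0 -> cartesian_net D N1 N2)))).
Proof.
  intros D L1 L2 N1 N2 HD HL HB. split; [split|].
  - intros [H|H]; apply (locally_frame_flat D L1 L2);
      [apply (hexagonal_locally_frame D L1 L2 N1 N2 N1)|apply (hexagonal_locally_frame D L1 L2 N1 N2 N2)];
      auto.
  - intros H. left. apply (locally_frame_hexagonal D L1 L2 N1 N2); auto.
    now apply flat_locally_frame.
  - intros H. pose proof (flat_locally_frame D L1 L2 N1 N2 HD HL HB H) as HF.
    split; [split|split].
    + now apply locally_frame_web4.
    + intros x0 y0 H0. destruct (locally_frame_parallel D L1 L2 N1 N2 x0 y0 HF H0) as (r & p & q & Hr & K).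
      apply (at_right_0 _ r Hr). intros t Ht Htr. destruct (K t Ht Htr) as [FI J].
      exists (parallel_relations p q). now apply parallel_4web_basis.
    + intros x0 y0 H0. destruct (locally_frame_parallel D L1 L2 N1 N2 x0 y0 HF H0) as (r & p & q & Hr & K).
      apply (at_right_0 _ r Hr). intros t Ht Htr. destruct (K t Ht Htr) as [FI J].
      now apply (parallel_rank_quartic x0 y0 t _ p q).
    + change (net_description D L1 L2 N1 N2). destruct HL as (_ & S1 & S2).
      destruct (focal_pair_exists D L1 L2 N1 N2 HD HF)
        as [(x1 & y1 & x2 & y2 & HP)|[(x1 & y1 & ux & uy & U & HP)|(ux & uy & HP)]].
      * now apply (central_description D L1 L2 N1 N2 x1 y1 x2 y2).
      * now apply (parabolic_description D L1 L2 N1 N2 x1 y1 ux uy).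
      * now apply (ideal_description D L1 L2 N1 N2 ux uy).
Qed.
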